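(* Let $\alpha>0$ and $\beta\in\mathbb{R}$. Then there are infinitely many integers $\ell>0$ such that $$|\zeta(\tfrac12+i(\alpha\ell+\beta))|\ge\exp\Big((1+o(1))\sqrt{\frac{\log\ell}{6\log\log\ell}}\Big),$$ and infinitely many integers $\ell>0$ such that $$|\zeta(\tfrac12+i(\alpha\ell+\beta))|\le\exp\Big(-(1+o(1))\sqrt{\frac{\log\ell}{6\log\log\ell}}\Big),$$ where $o(1)$ denotes a quantity tending to $0$ as $\ell\to\infty$. *)

(* Defs.v *)
From Stdlib Require Import Reals Lra ClassicalEpsilon.
Open Scope R_scope.

(* The Riemann zeta function on the critical line s = 1/2 + i t, defined via
   the Dirichlet eta function (valid for Re s > 0, s <> 1):
     eta(s) = sum_{n>=1} (-1)^(n-1) n^(-s),  zeta(s) = eta(s) / (1 - 2^(1-s)).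
   On Re s = 1/2 the denominator never vanishes.
   Complex numbers are represented by their real and imaginary parts. *)

(* n = k+1 ;  n^(-1/2 - i t) = n^(-1/2) (cos (t ln n) - i sin (t ln n)) *)
Definition eta_re_partial (t : R) (N : nat) : R :=
  sum_f_R0 (fun k => (-1) ^ k * / sqrt (INR (S k)) * cos (t * ln (INR (S k)))) N.
Definition eta_im_partial (t : R) (N : nat) : R :=
  sum_f_R0 (fun k => - ((-1) ^ k * / sqrt (INR (S k)) * sin (t * ln (INR (S k))))) N.

Definition eta_re (t : R) : R :=
  epsilon (inhabits 0) (fun l => Un_cv (eta_re_partial t) l).
Definition eta_im (t : R) : R :=
  epsilon (inhabits 0) (fun l => Un_cv (eta_im_partial t) l).

(* 1 - 2^(1-s) = 1 - sqrt 2 * (cos (t ln 2) - i sin (t ln 2)) *)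
Definition den_re (t : R) : R := 1 - sqrt 2 * cos (t * ln 2).
Definition den_im (t : R) : R := sqrt 2 * sin (t * ln 2).

Definition zeta_re (t : R) : R :=
  (eta_re t * den_re t + eta_im t * den_im t) / (den_re t ^ 2 + den_im t ^ 2).
Definition zeta_im (t : R) : R :=
  (eta_im t * den_re t - eta_re t * den_im t) / (den_re t ^ 2 + den_im t ^ 2).

Definition zeta_abs_crit (t : R) : R := sqrt (zeta_re t ^ 2 + zeta_im t ^ 2).

Definition rate (l : nat) : R := sqrt (ln (INR l) / (6 * ln (ln (INR l)))).

(* Main.v *)
(** We work with the alternating series [eta = (1 - 2^(1-s)) zeta], which has the size of [zeta] up to a
    factor [3] on the critical line, and use the resonance method along the progression [t = alpha l + beta].
    Put [N = z^(2q-1)] and [w = ln N].  The resonator [R(t) = sum_(n <= N) r(n) n^(-it)] runs over the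
    squarefree products of the primes in [(v^q, v^(q^2)]], with [v^q] about [w^(1+1/q)] and
    [|r(p)| = L / (sqrt p ln p)], and the mean over [l] is a [24]-fold iterated average over blocks of length
    [M = z^(12q)], so that phases [cis (l th)] with [th] not very close to [2 PI Z] disappear.

    Large values ([r > 0]): the average of [|R|^2] is its diagonal, because the remaining coincidences
    [m / n ~ exp (2 PI j / alpha)] force a fixed reduced fraction [A / B] with [A B] large.  In the average of
    [eta |R|^2] these coincidences are harmless once the primes up to a constant [P0] are sieved out of
    [eta], so it is at least [exp ((1 - 2/q) sum_p f(p) p^(-1/2))] times that of [|R|^2].

    Small values ([r(n) = (-1)^omega(n) f(n)]): a large sieve bounds the mean of [|eta R|^2] by sums of squares of
    partial sums of its coefficients over short multiplicative intervals.  These are combinations of square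
    waves [(-1)^(floor (k/m))], whose correlations are explicit; averaging against convex weights turns them
    into an Euler product of size [exp (- 2 (1 - 2/q) sum_p f(p) p^(-1/2))].

    Mertens' theorem evaluates [sum_p f(p) p^(-1/2)], whose square is asymptotically [w / ln w] with
    [w ~ ln l / 6]; finally [q] tends to infinity. *)

(* As [alpha] is arbitrary, coincidences [m / n ~ exp (2 PI j / alpha)] cannot be excluded; they can
   only be traced back to one fraction for each [j]. That takes a tolerance [d] below [N^(-2) / G],
   where [G = z^(7q)] separates the [j] treated by uniqueness from those treated by counting; hence
   [d = z^(-11q)]. Then [M d = z^q], and 24 averages gain [z^(24q)], more than the [z^(19q)] lost by
   trivial bounds for a polynomial of length about [z^(17q+1)] and a resonator of length [z^(2q-1)].
   The length [X = z^(17q+1)] makes the truncation error [M^2 / X^(3/2)] of the smoothed [eta] tend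
   to 0. As [M] is about [N^6], [ln N] is about [ln l / 6]: this is the 6 of the statement.

   For small values the polynomial is longer than the range of [l], so the squares of its
   coefficients bound too little. The signs must be used inside each short interval, where the
   alternating multiples of [m] collapse to -1, 0 or 1. The convex weights are made so that the sum
   over interval lengths leaves quadratic forms which are Euler products. *)
Require Import Defs.
From Stdlib Require Import Reals ClassicalEpsilon.
From mathcomp Require Import all_boot all_order all_algebra.
From mathcomp Require Import complex Rstruct.
From mathcomp Require Import zify ring lra.
Set Implicit Arguments. Unset Strict Implicit. Unset Printing Implicit Defensive.
Import Order.TTheory GRing.Theory Num.Theory.
Local Open Scope ring_scope.

(* Restrict [lia] and [nia] to the arithmetic hypotheses on [nat]. *)
Ltac nat_bool b := lazymatch b with
  | leq _ _ => idtac
  | andb ?x ?y => nat_bool x; nat_bool y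
  | orb ?x ?y => nat_bool x; nat_bool y
  | negb ?x => nat_bool x
  | dvdn _ _ => idtac
  | eq_op ?x _ => let t := type of x in unify t nat
  | true => idtac
  | false => idtac
  end.
Ltac nat_prop T := lazymatch T with
  | is_true ?b => nat_bool b
  | @eq nat _ _ => idtac
  | @eq bool ?x _ => nat_bool x
  | ~ ?P => nat_prop P
  | ?A -> ?B => nat_prop A; nat_prop B
  end.
Ltac clear_non_nat := repeat match goal with
  | H : ?T |- _ => first [ nat_prop T; fail 1 | clear H ] end.
Ltac nlia := clear_non_nat; lia.
Ltac nnia := clear_non_nat; nia.

Bind Scope ring_scope with R.
Arguments exp _%_ring_scope.
Arguments ln _%_ring_scope.
Arguments cos _%_ring_scope.
Arguments sin _%_ring_scope.

(** * Exponential and logarithm *)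

Lemma expD (x y : R) : exp (x + y) = exp x * exp y.
Proof. exact: exp_plus. Qed.

Lemma exp_gt0 (x : R) : 0 < exp x.
Proof. by apply/RltP; exact: exp_pos. Qed.

Lemma exp_ge0 (x : R) : 0 <= exp x.
Proof. exact/ltW/exp_gt0. Qed.

Lemma expN (x : R) : exp (- x) = (exp x)^-1.
Proof. by rewrite exp_Ropp. Qed.

Lemma exp00 : exp 0 = 1 :> R.
Proof. exact: exp_0. Qed.

Lemma exp_ge1D (x : R) : 1 + x <= exp x.
Proof. by apply/RleP; exact: exp_ineq1_le. Qed.

Lemma ler_exp (x y : R) : (exp x <= exp y) = (x <= y).
Proof.
apply/idP/idP => [|h].
  by apply: contraTT; rewrite -!ltNge => /RltP h; apply/RltP/exp_increasing.
by move: h; rewrite le_eqVlt => /orP[/eqP->//|/RltP h]; apply/ltW/RltP/exp_increasing.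
Qed.

Lemma ltr_exp (x y : R) : (exp x < exp y) = (x < y).
Proof. by rewrite !ltNge ler_exp. Qed.

Lemma exp_le1 (x : R) : x <= 0 -> exp x <= 1.
Proof. by move=> h; rewrite -exp00 ler_exp. Qed.

Lemma exp_ge1 (x : R) : 0 <= x -> 1 <= exp x.
Proof. by move=> h; rewrite -exp00 ler_exp. Qed.

Lemma expMn (x : R) (n : nat) : exp (n%:R * x) = exp x ^+ n.
Proof.
elim: n => [|n IH]; first by rewrite mulr0n mul0r exp00.
by rewrite -natr1 mulrDl mul1r expD IH exprSr.
Qed.

Lemma exp_sum (I : finType) (P : pred I) (F : I -> R) :
  exp (\sum_(i | P i) F i) = \prod_(i | P i) exp (F i).
Proof. by apply: (big_morph _ expD exp00). Qed.

(** From [exp (- x) >= 1 - x] follows [exp x <= 1 / (1 - x)], which is below the line [1 + 2 x] up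
    to [x = 1/2]. *)
Lemma exp_le1D2 (x : R) : 0 <= x -> x <= 2^-1 -> exp x <= 1 + 2 * x.
Proof.
move=> h0 h1; have := exp_ge1D (- x); rewrite expN => he.
have h2 : 0 < 1 - x by lra.
have h3 : exp x <= (1 - x)^-1.
  by rewrite -[exp x]invrK lef_pV2 ?posrE ?invr_gt0 ?exp_gt0.
apply: le_trans h3 _; rewrite -div1r ler_pdivrMr//; nra.
Qed.

Lemma exp_ln0 (x : R) : 0 < x -> exp (ln x) = x.
Proof. by move/RltP; exact: exp_ln. Qed.

Lemma ln_exp0 (x : R) : ln (exp x) = x.
Proof. exact: ln_exp. Qed.

Lemma lnM (x y : R) : 0 < x -> 0 < y -> ln (x * y) = ln x + ln y.
Proof. by move=> /RltP hx /RltP hy; exact: ln_mult. Qed.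

Lemma lnV (x : R) : 0 < x -> ln (x^-1) = - ln x.
Proof. by move=> /RltP hx; exact: ln_Rinv. Qed.

Lemma ln10 : ln 1 = 0 :> R.
Proof. exact: ln_1. Qed.

Lemma lndiv (x y : R) : 0 < x -> 0 < y -> ln (x / y) = ln x - ln y.
Proof. by move=> hx hy; rewrite lnM ?invr_gt0// lnV. Qed.

Lemma lnXn (x : R) (n : nat) : 0 < x -> ln (x ^+ n) = n%:R * ln x.
Proof.
move=> hx; elim: n => [|n IH]; first by rewrite expr0 ln10 mulr0n mul0r.
by rewrite exprSr lnM ?exprn_gt0// IH -natr1 mulrDl mul1r.
Qed.

Lemma ler_ln (x y : R) : 0 < x -> 0 < y -> (ln x <= ln y) = (x <= y).
Proof. by move=> hx hy; rewrite -ler_exp !exp_ln0. Qed.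

Lemma ltr_ln (x y : R) : 0 < x -> 0 < y -> (ln x < ln y) = (x < y).
Proof. by move=> hx hy; rewrite -ltr_exp !exp_ln0. Qed.

Lemma ln_ge0 (x : R) : 1 <= x -> 0 <= ln x.
Proof. by move=> h; rewrite -ln10 ler_ln// (lt_le_trans ltr01). Qed.

Lemma ln_gt0 (x : R) : 1 < x -> 0 < ln x.
Proof. by move=> h; rewrite -ln10 ltr_ln// (lt_trans ltr01). Qed.

Lemma ln_leB1 (x : R) : 0 < x -> ln x <= x - 1.
Proof. by move=> hx; have := exp_ge1D (ln x); rewrite exp_ln0//; lra. Qed.

Lemma ln_geB (x : R) : 0 < x -> 1 - x^-1 <= ln x.
Proof.
by move=> hx; have := @ln_leB1 x^-1; rewrite invr_gt0 lnV// => /(_ hx); lra.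
Qed.

Lemma ln_succ_le (a : R) : 0 < a -> ln (a + 1) - ln a <= a^-1.
Proof.
move=> ha; rewrite -lndiv//; last lra.
apply: le_trans (ln_leB1 _) _; first by rewrite divr_gt0//; lra.
by rewrite mulrDl mulfV ?gt_eqF// mul1r; lra.
Qed.

(** Includes [n = 0], since [ln] is 0 outside the positive reals. *)
Lemma lnn_ge0 (n : nat) : 0 <= ln n%:R :> R.
Proof.
case: n => [|n]; last by apply: ln_ge0; rewrite ler1n.
by rewrite /ln; case: Rlt_dec => // h; exfalso; exact: (Rlt_irrefl 0).
Qed.

(** * Real powers *)

(** As [ln 0 = 0], the base 0 gives 1 for every exponent; sums of negative powers are therefore
    restricted to positive indices. *)
Definition pw (x a : R) : R := exp (a * ln x).

Lemma pw_gt0 x a : 0 < pw x a. Proof. exact: exp_gt0. Qed.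
Lemma pw_ge0 x a : 0 <= pw x a. Proof. exact: exp_ge0. Qed.
Lemma pwD x a b : pw x (a + b) = pw x a * pw x b.
Proof. by rewrite /pw mulrDl expD. Qed.
Lemma pwN x a : pw x (- a) = (pw x a)^-1.
Proof. by rewrite /pw mulNr expN. Qed.
Lemma pw0 x : pw x 0 = 1.
Proof. by rewrite /pw mul0r exp00. Qed.
Lemma pw1 x : 0 < x -> pw x 1 = x.
Proof. by move=> h; rewrite /pw mul1r exp_ln0. Qed.
Lemma pw1x a : pw 1 a = 1.
Proof. by rewrite /pw ln10 mulr0 exp00. Qed.
Lemma pwM x y a : 0 < x -> 0 < y -> pw (x * y) a = pw x a * pw y a.
Proof. by move=> hx hy; rewrite /pw lnM// mulrDr expD. Qed.
Lemma pwV x a : 0 < x -> pw x^-1 a = (pw x a)^-1.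
Proof. by move=> hx; rewrite /pw lnV// mulrN expN. Qed.

Lemma ln_pw x a : ln (pw x a) = a * ln x.
Proof. by rewrite /pw ln_exp0. Qed.

Lemma ler_pw x y a : 0 <= a -> 0 < x -> x <= y -> pw x a <= pw y a.
Proof.
by move=> ha hx hxy; rewrite /pw ler_exp ler_wpM2l// ler_ln// (lt_le_trans hx).
Qed.

Lemma ler_pwN x y a : a <= 0 -> 0 < x -> x <= y -> pw y a <= pw x a.
Proof.
by move=> ha hx hxy; rewrite /pw ler_exp ler_wnM2l// ler_ln// (lt_le_trans hx).
Qed.

Lemma ler_pwe x a b : 1 <= x -> a <= b -> pw x a <= pw x b.
Proof. by move=> hx hab; rewrite /pw ler_exp ler_wpM2r// ln_ge0. Qed.

Lemma pw_le1 x a : 1 <= x -> a <= 0 -> pw x a <= 1.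
Proof. by move=> hx ha; rewrite -(pw0 x) ler_pwe. Qed.

Lemma pw_ge1 x a : 1 <= x -> 0 <= a -> 1 <= pw x a.
Proof. by move=> hx ha; rewrite -[X in X <= _](pw0 x) ler_pwe. Qed.

Lemma pw_sqr x a : pw x a ^+ 2 = pw x (a *+ 2).
Proof. by rewrite expr2 -pwD mulr2n. Qed.

Lemma pw_prod (I : finType) (P : pred I) (F : I -> R) a :
  (forall i, P i -> 0 < F i) ->
  pw (\prod_(i | P i) F i) a = \prod_(i | P i) pw (F i) a.
Proof.
move=> h.
suff [_ ->] : 0 < \prod_(i | P i) F i /\
   pw (\prod_(i | P i) F i) a = \prod_(i | P i) pw (F i) a by [].
apply: (big_ind2 (fun x y => 0 < x /\ pw x a = y)).
- by rewrite pw1x.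
- by move=> x1 x2 y1 y2 [hx <-] [hy <-]; rewrite mulr_gt0// pwM.
- by move=> i hi; rewrite h.
Qed.

Lemma sqrt_pw x : 0 < x -> Num.sqrt x = pw x (2^-1).
Proof.
move=> hx; have h : (pw x 2^-1) ^+ 2 = x.
  by rewrite pw_sqr (_ : 2^-1 *+ 2 = 1) ?pw1//; lra.
by rewrite -[in LHS]h sqrtr_sqr ger0_norm// pw_ge0.
Qed.

(* Bernoulli in the form (1 - u)^-q >= 1 + q u. *)
Lemma bernoulli_pwN (u q : R) : 0 <= q -> u < 1 -> 1 + q * u <= pw (1 - u) (- q).
Proof.
move=> hq hu; rewrite /pw; apply: le_trans (exp_ge1D _).
have h : 0 < 1 - u by lra.
have := ln_leB1 h; nra.
Qed.

(** * Complex exponentials *)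

Local Notation C := R[i].
Local Open Scope complex_scope.

(** A modulus with values in [R]; the generic norm of [R[i]] takes its values in [R[i]]. *)
Definition nrm (z : C) : R := Normc.normc z.
Arguments nrm : simpl never.

Lemma nrmM z w : nrm (z * w) = nrm z * nrm w. Proof. exact: Normc.normcM. Qed.
Lemma nrm0 : nrm 0 = 0. Proof. exact: Normc.normc0. Qed.
Lemma nrm1 : nrm 1 = 1. Proof. exact: Normc.normc1. Qed.
Lemma nrmD z w : nrm (z + w) <= nrm z + nrm w. Proof. exact: le_normcD. Qed.
Lemma nrm_ge0 z : 0 <= nrm z.
Proof. by case: z => a b; rewrite /nrm /= sqrtr_ge0. Qed.
Lemma nrmN z : nrm (- z) = nrm z.
Proof. by case: z => a b; rewrite /nrm /= !sqrrN. Qed.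
Lemma nrmB z w : nrm (z - w) <= nrm z + nrm w.
Proof. by apply: le_trans (nrmD _ _) _; rewrite nrmN. Qed.
Lemma nrmBC z w : nrm (z - w) = nrm (w - z).
Proof. by rewrite -nrmN opprB. Qed.
Lemma nrm_real (x : R) : nrm x%:C = `|x|.
Proof. by rewrite /nrm /= expr0n /= addr0 sqrtr_sqr. Qed.
Definition cj (z : C) : C := complex.Re z +i* - complex.Im z.

Lemma cjD (z w : C) : cj (z + w) = cj z + cj w.
Proof. by case: z w => a b [c d]; rewrite /cj /= opprD. Qed.
Lemma cjM (z w : C) : cj (z * w) = cj z * cj w.
Proof.
case: z w => a b [c d]; apply/eqP; rewrite eq_complex /=.
by apply/andP; split; apply/eqP; ring.
Qed.
Lemma cj0 : cj 0 = 0. Proof. by rewrite /cj /= oppr0. Qed.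
Lemma cj1 : cj 1 = 1. Proof. by rewrite /cj /= oppr0. Qed.
Lemma cjN (z : C) : cj (- z) = - cj z.
Proof. by case: z. Qed.
Lemma cjB (z w : C) : cj (z - w) = cj z - cj w.
Proof. by rewrite cjD cjN. Qed.
Lemma cj_real (x : R) : cj x%:C = x%:C.
Proof. by rewrite /cj /= oppr0. Qed.
Lemma cj_sum (I : Type) (r : seq I) (P : pred I) (F : I -> C) :
  cj (\sum_(i <- r | P i) F i) = \sum_(i <- r | P i) cj (F i).
Proof. exact: (big_morph _ cjD cj0). Qed.
Lemma nrm_cj z : nrm (cj z) = nrm z.
Proof. by case: z => a b; rewrite /nrm /= sqrrN. Qed.
Lemma nrmX z n : nrm (z ^+ n) = nrm z ^+ n.
Proof. by elim: n => [|n IH]; rewrite ?expr0 ?nrm1// !exprS nrmM IH. Qed.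
Lemma nrm_sub_ge z w : nrm z - nrm w <= nrm (z - w).
Proof. by rewrite lerBlDr; apply: le_trans (nrmD _ _); rewrite subrK. Qed.
Lemma nrm_add_ge z w : nrm z - nrm w <= nrm (z + w).
Proof. by rewrite -[w]opprK -nrmN nrmN; have := nrm_sub_ge z (- w); rewrite nrmN opprK. Qed.

Lemma nrm_sum (I : Type) (r : seq I) (P : pred I) (F : I -> C) :
  nrm (\sum_(i <- r | P i) F i) <= \sum_(i <- r | P i) nrm (F i).
Proof.
apply: (big_ind2 (fun x y => nrm x <= y)) => //; first by rewrite nrm0.
by move=> x1 x2 y1 y2 h1 h2; apply: le_trans (nrmD _ _) _; exact: lerD.
Qed.

Lemma nrm_sqr z : nrm z ^+ 2 = complex.Re z ^+ 2 + complex.Im z ^+ 2.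
Proof.
by case: z => a b; rewrite /nrm /= sqr_sqrtr// addr_ge0// sqr_ge0.
Qed.

Lemma nrm_sqrC z : (nrm z ^+ 2)%:C = z * cj z.
Proof.
by rewrite nrm_sqr; case: z => a b; apply/eqP; rewrite eq_complex /=; apply/andP; split; apply/eqP; ring.
Qed.

Lemma Re_le_nrm z : complex.Re z <= nrm z.
Proof.
case: z => a b; rewrite /nrm /=; apply: le_trans (ler_norm _) _.
by rewrite -sqrtr_sqr ler_sqrt ?lerDl ?addr_ge0 ?sqr_ge0.
Qed.

Ltac pos := repeat (first [ done | by apply: ltW | lazymatch goal with
  | |- is_true (0 <= _ * _) => apply: mulr_ge0
  | |- is_true (0 <= _ + _) => apply: addr_ge0
  | |- is_true (0 <= _ ^-1) => rewrite invr_ge0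
  | |- is_true (0 <= _ ^+ 2) => apply: sqr_ge0
  | |- is_true (0 <= _ ^+ _) => apply: exprn_ge0
  | |- is_true (0 <= _%:R) => apply: ler0n
  | |- is_true (0 <= nrm _) => apply: nrm_ge0
  | |- is_true (0 <= exp _) => apply: exp_ge0
  | |- is_true (0 <= pw _ _) => apply: pw_ge0
  | |- is_true (0 <= `|_|) => apply: normr_ge0
  | |- is_true (0 <= Num.sqrt _) => apply: sqrtr_ge0
  | |- is_true (0 <= ln _%:R) => apply: lnn_ge0
  | |- is_true (0 <= bigop.body _ _ _) => first [apply: sumr_ge0 => ? ? | apply: prodr_ge0 => ? ?]
  end ]).

Definition cis (x : R) : C := (cos x +i* sin x).

Lemma cisD x y : cis (x + y) = cis x * cis y.
Proof.
rewrite /cis; apply/eqP; rewrite eq_complex /=; apply/andP; split; apply/eqP.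
- by rewrite cosD.
- by rewrite sinD; ring.
Qed.

Lemma cis0 : cis 0 = 1.
Proof. by rewrite /cis cos_0 sin_0. Qed.

Lemma cisN x : cis (- x) = cj (cis x).
Proof. by rewrite /cis /cj /= cos_neg sin_neg. Qed.

Lemma nrm_cis x : nrm (cis x) = 1.
Proof.
rewrite /nrm /=; have := sin2_cos2 x; rewrite /Rsqr !RealsE -!expr2 addrC => ->.
by rewrite sqrtr1.
Qed.

Lemma cisMn x n : cis (n%:R * x) = cis x ^+ n.
Proof.
elim: n => [|n IH]; first by rewrite mulr0n mul0r cis0.
by rewrite -natr1 mulrDl mul1r cisD IH exprSr.
Qed.

Lemma cis_2PIn (n : nat) : cis (n%:R * (2 * PI)) = 1.
Proof.
by rewrite cisMn (_ : cis (2 * PI) = 1) ?expr1n// /cis cos_2PI sin_2PI.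
Qed.

(** A chord is no longer than its arc: after a rotation by [cis (- y)] the chord is
    [2 |sin (t / 2)|] with [t = x - y]. *)
Lemma nrm_cisB x y : nrm (cis x - cis y) <= `|x - y|.
Proof.
have -> : cis x = cis (x - y) * cis y by rewrite -cisD subrK.
rewrite -{2}(mul1r (cis y)) -mulrBl nrmM nrm_cis mulr1.
move: (x - y) => t {x y}.
rewrite -ler_sqr ?nnegrE ?nrm_ge0 ?normr_ge0// nrm_sqr /= real_normK ?num_real//.
have -> : (cos t - 1) ^+ 2 + (sin t - 0) ^+ 2 = 4 * sin (t / 2) ^+ 2.
  have e : cos t = 1 - 2 * sin (t / 2) * sin (t / 2).
    by rewrite -[in LHS](_ : 2 * (t / 2) = t); [exact: cos_2a_sin | lra].
  have h : sin t * sin t + cos t * cos t = 1 := sin2_cos2 t.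
  have h2 : sin t * sin t = 1 - cos t * cos t by lra.
  by rewrite subr0 !expr2 h2 e; ring.
have hs : `|sin (t / 2)| <= `|t / 2|.
  wlog: t / 0 <= t => [H|ht].
    case: (lerP 0 t) => ht; first exact: H.
    have := H (- t); rewrite mulNr sin_neg !RealsE !normrN; apply; lra.
  have h2 : 0 <= t / 2 by lra.
  rewrite (ger0_norm h2).
  case: (ltrP 1 (t / 2)) => h1.
    by apply: le_trans (ltW h1); rewrite ler_norml; have [/RleP h3 /RleP h4] := SIN_bound (t / 2); rewrite h4 andbT.
  have hp : 0 <= sin (t / 2).
    apply/RleP/sin_ge_0; first exact/RleP.
    apply/RleP; have h5 : 1 < PI / 2 by apply/RltP; exact: PI2_1.
    lra.
  rewrite ger0_norm//; move: h2; rewrite le_eqVlt => /orP[/eqP <-|h2].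
    by rewrite sin_0.
  by apply/ltW/RltP/sin_lt_x/RltP.
rewrite -(ler_pXn2r (n:=2)) ?nnegrE// in hs.
by move: hs; rewrite !real_normK ?num_real//; lra.
Qed.

(** * Iterated averages over blocks of integers *)

(** The mean of [g (c + i_1 + ... + i_K)] over all [i_j < M]. Iteration raises the mean of a phase
    over one block to the power [K], so that a modest saving in each block becomes as large as
    required. *)
Fixpoint Av (F : fieldType) (M K : nat) (g : nat -> F) (c : nat) : F :=
  if K is K'.+1 then M%:R^-1 * \sum_(i < M) Av M K' g (c + i) else g c.

Lemma eq_Av (F : fieldType) M K (g h : nat -> F) c :
  g =1 h -> Av M K g c = Av M K h c.
Proof.
move=> e; elim: K c => [|K IH] c /=; first exact: e.
by congr (_ * _); apply: eq_bigr => i _; exact: IH.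
Qed.

Lemma Av_scale (F : fieldType) M K (a : F) (g : nat -> F) c :
  Av M K (fun l => a * g l) c = a * Av M K g c.
Proof.
elim: K c => [|K IH] c //=; rewrite mulrCA; congr (_ * _).
by rewrite mulr_sumr; apply: eq_bigr => i _; exact: IH.
Qed.

Lemma Av_sum (F : fieldType) M K (I : Type) (r : seq I) (P : pred I)
    (G : I -> nat -> F) c :
  Av M K (fun l => \sum_(i <- r | P i) G i l) c = \sum_(i <- r | P i) Av M K (G i) c.
Proof.
elim: K c => [|K IH] c //=.
rewrite -mulr_sumr; congr (_ * _); rewrite exchange_big /=.
by apply: eq_bigr => i _; exact: IH.
Qed.

Lemma Av_add (F : fieldType) M K (g h : nat -> F) c :
  Av M K (fun l => g l + h l) c = Av M K g c + Av M K h c.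
Proof.
elim: K c => [|K IH] c //=; rewrite -mulrDr; congr (_ * _).
by rewrite -big_split /=; apply: eq_bigr => i _; exact: IH.
Qed.

Lemma Av_const (F : fieldType) M K (a : F) c : (M%:R != 0 :> F) ->
  Av M K (fun=> a) c = a.
Proof.
move=> hM; elim: K c => [|K IH] c //=.
under eq_bigr do rewrite IH.
by rewrite sumr_const card_ord -[a *+ M]mulr_natl mulrA mulVf// mul1r.
Qed.

Lemma Av_real M K (g : nat -> R) c : Av M K (fun l => (g l)%:C) c = (Av M K g c)%:C.
Proof.
elim: K c => [|K IH] c //=; rewrite rmorphM /= fmorphV rmorph_nat rmorph_sum.
by congr (_ * _); apply: eq_bigr => i _; exact: IH.
Qed.

Lemma ler_Av M K (g h : nat -> R) c :
  (forall l, (c <= l <= c + K * M)%N -> g l <= h l) -> Av M K g c <= Av M K h c.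
Proof.
elim: K c => [|K IH] c hgh /=; first by apply: hgh; rewrite mul0n addn0 !leqnn.
rewrite ler_wpM2l ?invr_ge0 ?ler0n//; apply: ler_sum => i _; apply: IH => l hl.
by apply: hgh; have := ltn_ord i; lia.
Qed.

Lemma nrm_natV (M : nat) : nrm (M%:R^-1) = M%:R^-1.
Proof.
have -> : (M%:R^-1 : C) = (M%:R^-1)%:C by rewrite fmorphV rmorph_nat.
by rewrite nrm_real ger0_norm// invr_ge0 ler0n.
Qed.

Lemma nrm_Av M K (g : nat -> C) c : nrm (Av M K g c) <= Av M K (fun l => nrm (g l)) c.
Proof.
elim: K c => [|K IH] c //=; rewrite nrmM nrm_natV ler_wpM2l ?invr_ge0 ?ler0n//.
by apply: le_trans (nrm_sum _ _ _) _; apply: ler_sum => i _; exact: IH.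
Qed.

Lemma Av_exists_ge M K (g : nat -> R) c x : (0 < M)%N ->
  x <= Av M K g c -> exists l, (c <= l <= c + K * M)%N /\ x <= g l.
Proof.
move=> hM; elim: K c => [|K IH] c /= hx; first by exists c; rewrite mul0n addn0 !leqnn.
have [i hi] : exists i : 'I_M, x <= Av M K g (c + i).
  apply/existsP; apply: contraLR hx => /existsPn /= h; rewrite -ltNge.
  have hM' : 0 < M%:R :> R by rewrite ltr0n.
  rewrite mulrC ltr_pdivrMr// -[M in x * M%:R]card_ord mulr_natr -sumr_const.
  apply: ltr_sum; last by move=> i _; rewrite ltNge h.
  by apply/hasP; exists (Ordinal hM); rewrite // mem_index_enum.
have [l [hl hxl]] := IH _ hi; exists l; split => //.
by have := ltn_ord i; lia.
Qed.

(** For nonnegative [g] one of the averages suffices: every innermost mean is at most [1 / M] times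
    the whole sum, and further averaging keeps that bound. It passes from iterated means to the
    plain sum bounded by the large sieve. *)
Lemma Av_le_sum M K (g : nat -> R) c : (0 < M)%N -> (forall l, 0 <= g l) ->
  Av M K.+1 g c <= M%:R^-1 * \sum_(l < c + K.+1 * M) g l.
Proof.
move=> hM hg; elim: K c => [|K IH] c.
  rewrite /= ler_wpM2l ?invr_ge0 ?ler0n// mul1n.
  rewrite -[X in _ <= X](big_mkord xpredT) (big_cat_nat (n := c)) ?leq_addr//=.
  rewrite -{3}[c]add0n big_addn addKn big_mkord.
  under [X in _ <= _ + X]eq_bigr do rewrite addnC.
  by rewrite [X in _ <= _ + X]big_mkord lerDr sumr_ge0.
rewrite [Av _ _ _ _]/=.
have hM' : 0 < M%:R :> R by rewrite ltr0n.
have hle (i : 'I_M) : Av M K.+1 g (c + i) <= M%:R^-1 * \sum_(l < c + K.+2 * M) g l.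
  apply: le_trans (IH _) _; rewrite ler_wpM2l ?invr_ge0 ?ler0n//.
  have h : (c + i + K.+1 * M <= c + K.+2 * M)%N by have := ltn_ord i; lia.
  rewrite (big_ord_widen _ g h) big_mkcond /=; apply: ler_sum => l _.
  by case: ifP.
rewrite mulrC ler_pdivrMr//.
apply: le_trans (ler_sum _ (fun i _ => hle i)) _.
by rewrite sumr_const card_ord mulr_natr.
Qed.

Lemma Av_cis M K (th : R) c :
  Av M K (fun l => cis (- (l%:R * th))) c =
  cis (- (c%:R * th)) * (M%:R^-1 * \sum_(i < M) cis (- (i%:R * th))) ^+ K.
Proof.
elim: K c => [|K IH] c /=; first by rewrite expr0 mulr1.
rewrite exprS; set G := (_ * _) ^+ K in IH *.
transitivity (M%:R^-1 * \sum_(i < M) (cis (- (c%:R * th)) * G) * cis (- (i%:R * th))).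
  congr (_ * _); apply: eq_bigr => i _.
  by rewrite IH natrD mulrDl opprD cisD; ring.
by rewrite -mulr_sumr; ring.
Qed.

Lemma nrm_geosum_le (M : nat) (th : R) :
  nrm (\sum_(i < M) cis (- (i%:R * th))) * nrm (1 - cis th) <= 2.
Proof.
have -> : nrm (1 - cis th) = nrm (1 - cis (- th)).
  by rewrite cisN -nrm_cj cjB cj1.
rewrite -nrmM.
under eq_bigr do rewrite -mulrN cisMn.
rewrite mulrC -subrX1 || rewrite mulrC -(opprB _ 1) mulNr -subrX1.
rewrite nrmN; apply: le_trans (nrmB _ _) _.
by rewrite nrmX nrm_cis expr1n nrm1.
Qed.

Lemma nrm_geosum_leM (M : nat) (th : R) :
  nrm (\sum_(i < M) cis (- (i%:R * th))) <= M%:R.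
Proof.
apply: le_trans (nrm_sum _ _ _) _; under eq_bigr do rewrite nrm_cis.
by rewrite sumr_const card_ord.
Qed.

Lemma nrm_Av_cis_le1 M K (th : R) c : (0 < M)%N ->
  nrm (Av M K (fun l => cis (- (l%:R * th))) c) <= 1.
Proof.
move=> hM; rewrite Av_cis nrmM nrm_cis mul1r nrmX exprn_ile1 ?nrm_ge0//.
by rewrite nrmM nrm_natV mulrC ler_pdivrMr ?ltr0n// mul1r nrm_geosum_leM.
Qed.

Lemma nrm_Av_cis_far M K (th : R) c (d : R) : (0 < M)%N -> 0 < d ->
  d <= nrm (1 - cis th) ->
  nrm (Av M K (fun l => cis (- (l%:R * th))) c) <= (2 / (M%:R * d)) ^+ K.
Proof.
move=> hM hd hth; rewrite Av_cis nrmM nrm_cis mul1r nrmX.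
have hM' : 0 < M%:R :> R by rewrite ltr0n.
have hMd : 0 <= 2 / (M%:R * d) by rewrite divr_ge0// mulr_ge0// ltW.
rewrite lerXn2r ?nnegrE ?nrm_ge0//.
rewrite nrmM nrm_natV invfM mulrCA ler_wpM2l ?invr_ge0 ?ler0n//.
rewrite ler_pdivlMr//; apply: le_trans (nrm_geosum_le M th).
by rewrite ler_wpM2l ?nrm_ge0.
Qed.

Lemma sum_nat_blocks (V : nmodType) (J Q : nat) (F : nat -> V) :
  \sum_(X < J * Q) F X = \sum_(x < Q) \sum_(j < J) F (x + j * Q)%N.
Proof.
rewrite exchange_big /=; elim: J => [|J IH]; first by rewrite !big_ord0.
rewrite big_ord_recr /= -IH mulSnr.
rewrite -(big_mkord xpredT) (big_cat_nat (n := (J * Q)%N)) ?leq_addr//= big_mkord.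
by congr (_ + _); rewrite -{1}[(J * Q)%N]add0n big_addn addKn big_mkord.
Qed.

Lemma sum_indicator_itv (U a b : nat) :
  \sum_(X < U) ((a <= X < b)%N%:R : R) <= (b - a)%:R.
Proof.
rewrite -(big_mkord xpredT (fun X => ((a <= X < b)%N%:R : R))).
rewrite -natr_sum ler_nat.
elim: U => [|U IH]; first by rewrite big_nil.
rewrite big_nat_recr //=.
case hb : (a <= U < b)%N; last by rewrite addn0.
have : (\sum_(0 <= i < U) (a <= i < b) <= U - a)%N.
  move: hb => /andP[_]; elim: U {IH} => [|U IH] hb; first by rewrite big_nil.
  rewrite big_nat_recr //=; have := IH (ltnW hb).
  by rewrite (ltnW hb) andbT; case: (leqP a U) => ha /=; lia.
by lia.
Qed.

(** * Angles close to a multiple of [2 * PI] *)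

Lemma PI_gt0 : 0 < PI :> R.
Proof. by apply/RltP; exact: PI_RGT_0. Qed.

Lemma PI_le4 : PI <= 4 :> R.
Proof. by apply/RleP; have := PI_4; rewrite IZRposE INRE. Qed.

Lemma PI_ge3 : 3 <= PI :> R.
Proof.
have /RltP := PI2_3_2; have e3 : IZR 3 = 3 by rewrite IZRposE INRE.
have e2 : IZR 2 = 2 by rewrite IZRposE INRE.
rewrite e3 e2 !RealsE; lra.
Qed.

Lemma cis_2PIz (j : int) : cis (j%:~R * (2 * PI)) = 1.
Proof.
case: j => n; first exact: cis_2PIn.
by rewrite NegzE mulrNz mulNr cisN cis_2PIn cj1.
Qed.

Lemma sin_ge_half (u : R) : 0 <= u -> u <= 1 -> u / 2 <= sin u.
Proof.
rewrite le_eqVlt => /orP[/eqP<- _|h0 h1]; first by rewrite sin_0 mul0r.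
have [||c [hc [/RltP hc1 /RltP hc2]]] := @MVT_cor2 sin cos 0 u.
- exact/RltP.
- by move=> c _; exact: derivable_pt_lim_sin.
have : nrm (cis c - cis 0) ^+ 2 <= `|c - 0| ^+ 2.
  by rewrite lerXn2r ?nnegrE ?nrm_ge0// nrm_cisB.
rewrite cis0 nrm_sqr /= subr0 subr0 real_normK ?num_real// => h.
have h2 : sin c * sin c + cos c * cos c = 1 := sin2_cos2 c.
move: hc; rewrite sin_0 !RealsE !subr0 => ->.
have : 1 / 2 <= cos c by nra.
nra.
Qed.

(** On [[0, PI]] the chord is [2 sin (x / 2)], and [sin u >= u / 2] up to [u = 1]. Beyond that the
    chord is at least [2 sin 1 >= 1], which [d <= 1/2] excludes. *)
Lemma near_2PI (th d : R) : d <= 2^-1 -> nrm (1 - cis th) < d ->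
  exists j : int, `|th - j%:~R * (2 * PI)| <= 2 * d.
Proof.
move=> hd hth; have hPI := PI_gt0.
(* The shift by [PI] selects the nearest multiple and leaves a remainder in [[- PI, PI]]. *)
pose j := Num.floor ((th + PI) / (2 * PI)); exists j.
have /andP[h1 h2] : (j%:~R <= (th + PI) / (2 * PI) < (j + 1)%:~R).
  exact: floor_itv.
have h2PI : 0 < 2 * PI by lra.
rewrite ler_pdivlMr// in h1; rewrite ltr_pdivrMr// in h2.
set x := th - _.
have hx1 : - PI <= x by rewrite /x; lra.
have hx2 : x <= PI by move: h2; rewrite intrD rmorph1 mulrDl mul1r /x; lra.
have e : cis th = cis x by rewrite /x cisD -mulNr -mulrNz cis_2PIz mulr1.
rewrite e in hth.
wlog h0 : x {hx1 hx2 e h1 h2 hth} hx1 hx2 hth / 0 <= x => [H|].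
  case: (lerP 0 x) => h0; first by apply: H => //; rewrite -e.
  rewrite -normrN; apply: H; try lra.
  suff <- : nrm (1 - cis x) = nrm (1 - cis (- x)) by [].
  by rewrite cisN -[in LHS]nrm_cj cjB cj1.
rewrite ger0_norm//.
have hs : nrm (1 - cis x) ^+ 2 = (2 * sin (x / 2)) ^+ 2.
  rewrite nrm_sqr /=.
  have ex : cos x = 1 - 2 * sin (x / 2) * sin (x / 2).
    by rewrite -[in LHS](_ : 2 * (x / 2) = x); [exact: cos_2a_sin | lra].
  have h : sin x * sin x + cos x * cos x = 1 := sin2_cos2 x.
  have h3 : sin x * sin x = 1 - cos x * cos x by lra.
  rewrite sub0r sqrrN -[sin x ^+ 2]/(sin x * sin x) h3 ex; ring.
have hsp : 0 <= sin (x / 2).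
  have hx20 : 0 <= x / 2 by lra.
  have hx2P : x / 2 <= PI by lra.
  by apply/RleP/sin_ge_0; exact/RleP.
have hs2 : nrm (1 - cis x) = 2 * sin (x / 2).
  apply/eqP; rewrite -(@eqrXn2 _ 2) ?nrm_ge0//; first by rewrite hs.
  by rewrite mulr_ge0.
rewrite hs2 in hth.
case: (lerP (x / 2) 1) => hx.
  by have := sin_ge_half (divr_ge0 h0 (ler0n _ 2)) hx; lra.
have hs1 : 1 / 2 <= sin 1 by apply: sin_ge_half; lra.
have h3 : sin 1 <= sin (x / 2).
  have h5 : 1 < PI / 2 by apply/RltP; exact: PI2_1.
  have a1 : - (PI / 2) <= 1 by lra.
  have a2 : 1 <= PI / 2 by lra.
  have a3 : - (PI / 2) <= x / 2 by lra.
  have a4 : x / 2 <= PI / 2 by lra.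
  have a5 := ltW hx.
  by apply/RleP/sin_incr_1; exact/RleP.
lra.
Qed.

(** * A large sieve inequality along an arithmetic progression *)

Lemma cauchy_schwarz_nrm (J : nat) (a : 'I_J -> C) :
  nrm (\sum_j a j) ^+ 2 <= J%:R * \sum_j nrm (a j) ^+ 2.
Proof.
have h : nrm (\sum_j a j) <= \sum_j nrm (a j) by exact: nrm_sum.
apply: le_trans (_ : (\sum_j nrm (a j)) ^+ 2 <= _).
  by rewrite lerXn2r ?nnegrE ?nrm_ge0// sumr_ge0// => i _; exact: nrm_ge0.
pose b j := nrm (a j).
rewrite -/(\sum_j b j) expr2 mulr_suml.
have -> : \sum_i b i * (\sum_j b j) = \sum_i \sum_j b i * b j.
  by apply: eq_bigr => i _; rewrite mulr_sumr.
have hb : \sum_(i < J) \sum_(j < J) b i * b j <=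
    \sum_(i < J) \sum_(j < J) (b i ^+ 2 / 2 + b j ^+ 2 / 2).
  apply: ler_sum => i _; apply: ler_sum => j _.
  by have := sqr_ge0 (b i - b j); rewrite sqrrB mulr2n; lra.
apply: le_trans hb _.
under eq_bigr do rewrite big_split /= sumr_const card_ord.
rewrite big_split /= sumr_const card_ord !sumrMnl -mulr_suml.
rewrite -[(_ / 2) *+ J]mulr_natl; move: (\sum_(i < J) b i ^+ 2) => S.
by rewrite /b -/b; lra.
Qed.

Lemma cis_period (Q l x j : nat) : (0 < Q)%N ->
  cis (- (2 * PI * l%:R * (x + j * Q)%:R / Q%:R)) = cis (- (2 * PI * l%:R * x%:R / Q%:R)).
Proof.
move=> hQ; have hQ' : Q%:R != 0 :> R by rewrite pnatr_eq0 -lt0n.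
have -> : - (2 * PI * l%:R * (x + j * Q)%:R / Q%:R) =
   - (2 * PI * l%:R * x%:R / Q%:R) - (l * j)%N%:R * (2 * PI).
  by rewrite natrD !natrM; field.
by rewrite cisD [cis (- ((l * j)%N%:R * _))]cisN cis_2PIn cj1 mulr1.
Qed.

Lemma geosum_root_of_unity (Q : nat) (d : nat) : (0 < d < Q)%N ->
  \sum_(l < Q) cis (2 * PI * l%:R * d%:R / Q%:R) = 0.
Proof.
move=> /andP[d0 dQ].
have hQ' : Q%:R != 0 :> R by rewrite pnatr_eq0 -lt0n; lia.
set z := cis (2 * PI * d%:R / Q%:R).
have hz : z ^+ Q = 1.
  by rewrite /z -cisMn (_ : _ * _ = d%:R * (2 * PI)) ?cis_2PIn//; field.
have hz1 : z != 1.
  (* If the root were 1, [near_2PI] would put [d / Q] at distance less than [1 / Q] from an integer,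
     impossible for [0 < d < Q]. *)
  apply/eqP => h1; have hPI := PI_gt0.
  have [||j hj] := @near_2PI (2 * PI * d%:R / Q%:R) (8^-1 * Q%:R^-1).
  - clear hz h1 z; have : Q%:R^-1 <= 1 :> R by rewrite invf_le1 ?ltr0n ?ler1n; lia.
    lra.
  - by rewrite -/z h1 subrr nrm0 mulr_gt0// ?invr_gt0 ?ltr0n; lia.
  clear hz h1 z.
  have hPI0 : PI != 0 by rewrite gt_eqF.
  have hQ0 : 0 < Q%:R :> R by rewrite ltr0n; lia.
  have hPI1 : 1 < PI / 2 by apply/RltP; exact: PI2_1.
  have : `|(d%:Z - j * Q%:Z)%:~R| < 1 :> R.
    have -> : (d%:Z - j * Q%:Z)%:~R =
       (2 * PI * d%:R / Q%:R - j%:~R * (2 * PI)) * (Q%:R / (2 * PI)) :> R.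
      by rewrite intrB intrM -!pmulrn; field; rewrite ?hQ' ?hPI0.
    rewrite normrM [`|_ / (2 * PI)|]ger0_norm ?divr_ge0 ?ler0n//; last lra.
    apply: le_lt_trans (ler_wpM2r _ hj) _; first by rewrite divr_ge0 ?ler0n//; lra.
    rewrite [X in X < _](_ : _ = 8^-1 / PI); last by field; rewrite ?hQ' ?hPI0.
    rewrite ltr_pdivrMr//; lra.
  rewrite -intr_norm (_ : 1 = 1%:~R)// ltr_int => h.
  have h0 : (d%:Z - j * Q%:Z = 0)%R by lia.
  have : (d = `|j| * Q)%N by lia.
  move=> hd; move: d0 dQ; rewrite hd; case: `|j|%N => [|n] //; rewrite mulSn; lia.
have : (z - 1) * \sum_(l < Q) z ^+ l = 0 by rewrite -subrX1 hz subrr.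
move/eqP; rewrite mulf_eq0 subr_eq0 (negPf hz1) /= => /eqP h0.
rewrite -[RHS]h0; apply: eq_bigr => l _; rewrite /z -cisMn; congr cis; ring.
Qed.

Lemma dft_parseval (Q : nat) (w : nat -> C) : (0 < Q)%N ->
  \sum_(l < Q) nrm (\sum_(x < Q) w x * cis (- (2 * PI * l%:R * x%:R / Q%:R))) ^+ 2
  = Q%:R * \sum_(x < Q) nrm (w x) ^+ 2.
Proof.
move=> hQ.
apply: (can_inj (g := @complex.Re R) (f := @real_complex_def R (Phant R))) => //.
rewrite !rmorphM rmorph_nat !rmorph_sum /=.
transitivity (\sum_(l < Q) \sum_(x < Q) \sum_(y < Q)
   w x * cj (w y) * cis (2 * PI * l%:R * (y%:R - x%:R) / Q%:R)).
  apply: eq_bigr => l _; rewrite nrm_sqrC cj_sum mulr_suml.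
  apply: eq_bigr => x _; rewrite mulr_sumr; apply: eq_bigr => y _.
  rewrite cjM -cisN opprK -!mulrA [X in _ * X = _]mulrCA; congr (_ * (_ * _)).
  by rewrite -cisD; congr cis; ring.
rewrite exchange_big mulr_sumr /=; apply: eq_bigr => x _.
rewrite exchange_big (bigD1 x) //= [X in _ + X]big1 ?addr0; last first.
  move=> y hy; rewrite -mulr_sumr.
  suff -> : \sum_(l < Q) cis (2 * PI * l%:R * (y%:R - x%:R) / Q%:R) = 0 by rewrite mulr0.
  have hyx : (y != x :> nat) by [].
  case: (ltngtP x y) => hxy; last by rewrite hxy eqxx in hyx.
  - rewrite -[RHS](@geosum_root_of_unity Q (y - x)); last by have := ltn_ord y; lia.
    by apply: eq_bigr => l _; rewrite natrB// ltnW.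
  - have := @geosum_root_of_unity Q (x - y).
    have -> : (0 < x - y < Q)%N by have := ltn_ord x; lia.
    move=> /(_ isT) /(congr1 cj); rewrite cj0 cj_sum => h0.
    rewrite -[RHS]h0; apply: eq_bigr => l _; rewrite -cisN; congr cis; rewrite natrB; last exact: ltnW.
    ring.
rewrite nrm_sqrC.
under eq_bigr do rewrite subrr mulr0 mul0r cis0 mulr1.
by rewrite sumr_const card_ord -[in LHS]mulr_natl.
Qed.

(** The [n] with [q n <= Y] form an initial segment of [1 .. U]; its end [K] turns a condition on
    [q n] into one on [n]. *)
Lemma monotone_cut (q : nat -> nat) (Y U : nat) :
  {homo q : m n / (m <= n)%N} ->
  exists K, (K <= U)%N /\ forall n, (0 < n <= U)%N -> (q n <= Y)%N = (n <= K)%N.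
Proof.
move=> hq; elim: U => [|U [K [hK IH]]]; first by exists 0%N; split => // n; lia.
case: (leqP (q U.+1) Y) => h.
  exists U.+1; split => // n /andP[n0 hn].
  by rewrite hn; apply: leq_trans (hq _ _ hn) h.
exists K; split; first exact: leqW.
move=> n /andP[n0]; rewrite leq_eqVlt => /orP[/eqP->|hn]; last by apply: IH; lia.
by rewrite leqNgt h /=; apply/esym/negbTE; rewrite -ltnNge ltnS.
Qed.

Section Bessel.
Variables (I : finType) (c : I -> C) (n : I -> nat) (U : nat).
Hypothesis n_gt0 : forall i, (0 < n i)%N.
Hypothesis n_leU : forall i, (n i <= U)%N.

Definition window (k k' : nat) : C := \sum_(i | (k < n i <= k')%N) c i.

Variables (alpha : R) (L1 V J : nat).
Hypothesis alpha_gt0 : 0 < alpha.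
Hypothesis L1_gt0 : (0 < L1)%N.
Hypothesis V_ge8 : (8 <= V)%N.
Hypothesis V_big : alpha * L1%:R <= V%:R.
Hypothesis J_big : alpha * ln U%:R / (2 * PI) + 2 <= J%:R.

(** Windows starting at [k] have length about [k / V]. For [k < V / 4] such a window contains at
    most one integer, so unit windows suffice. *)
Definition S1 : R := \sum_(k < U | (4 * k < V)%N) nrm (window k k.+1) ^+ 2.
(** The weight [1 / k] is the logarithmic length of [[k, k + 1)]; the conditions on [s] say that
    [s V] differs from [k] by at most a few [V]. *)
Definition S2 : R := \sum_(k < U | (V <= 4 * k)%N) k%:R^-1 *
  \sum_(s < (4 * U).+1 | (k < (s + 2) * V)%N && (s * V < k + 3 * V)%N)
     nrm (window k (k + s)) ^+ 2.

Section Grid.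
Variable Q : nat.
Let lam : R := alpha * Q%:R / (2 * PI).
Hypothesis lam_big : (16 * V * U.+1)%:R <= lam.

(** The phases [alpha ln n / (2 PI)] are rounded down to multiples of [1 / Q], which turns the
    polynomial into a discrete Fourier transform modulo [Q]. Convolution with a box of [h] points
    replaces coefficients by window sums, to which Parseval applies, while the transform of the box
    stays above [h / 2] for [l < L1]. *)
Let q (m : nat) : nat := Num.truncn (lam * ln m%:R).
Let h : nat := Num.truncn (lam * ln (1 + V%:R^-1)).

Let lam_gt0 : 0 < lam.
Proof. by apply: lt_le_trans lam_big; rewrite ltr0n; nlia. Qed.

Let V_gt0 : 0 < V%:R :> R.
Proof. by rewrite ltr0n; nlia. Qed.

Let Q_gt0 : (0 < Q)%N.
Proof.
rewrite lt0n; apply/eqP => Q0; move: lam_gt0.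
by rewrite /lam Q0 mulr0 mul0r ltxx.
Qed.

Let q_itv m : (q m)%:R <= lam * ln m%:R < (q m)%:R + 1.
Proof.
have h0 : 0 <= lam * ln m%:R by rewrite mulr_ge0 ?lnn_ge0// ltW.
by have := truncn_itv h0; rewrite -natr1.
Qed.

Let lnV_ge0 : 0 <= ln (1 + V%:R^-1) :> R.
Proof. by apply: ln_ge0; rewrite lerDl invr_ge0 ltW. Qed.

Let h_itv : h%:R <= lam * ln (1 + V%:R^-1) < h%:R + 1.
Proof.
have h0 : 0 <= lam * ln (1 + V%:R^-1) by rewrite mulr_ge0// ltW.
by have := truncn_itv h0; rewrite -natr1.
Qed.

Let q_homo : {homo q : m m' / (m <= m')%N}.
Proof.
move=> m m' hm; rewrite /q; apply: le_truncn; rewrite ler_wpM2l ?(ltW lam_gt0)//.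
case: m hm => [|m] hm.
  have -> : ln 0%:R = 0 :> R.
    by rewrite /ln; case: Rlt_dec => // h0; exfalso; exact: (Rlt_irrefl 0).
  exact: lnn_ge0.
by rewrite ler_ln ?ltr0n ?ler_nat//; nlia.
Qed.

Let q1 : q 1 = 0%N.
Proof. by rewrite /q ln10 mulr0 truncn0. Qed.

Let ln1V_le : ln (1 + V%:R^-1) <= V%:R^-1.
Proof.
have hV := V_gt0; have : 0 < 1 + V%:R^-1 :> R by rewrite ltr_wpDr ?invr_ge0// ltW.
by move/ln_leB1; lra.
Qed.

Let ln1V_ge : (2 * V%:R)^-1 <= ln (1 + V%:R^-1).
Proof.
have hV := V_gt0; have h1 : 0 < 1 + V%:R^-1 :> R by rewrite ltr_wpDr ?invr_ge0// ltW.
apply: le_trans (ln_geB h1).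
have hV1 : 1 <= V%:R :> R by rewrite ler1n; nlia.
have -> : 1 - (1 + V%:R^-1)^-1 = (V%:R + 1)^-1 :> R.
  by field; rewrite !gt_eqF//; lra.
rewrite lef_pV2 ?posrE; lra.
Qed.

Let h_ge : lam / (4 * V%:R) <= h%:R.
Proof.
have hV := V_gt0; have /andP[_ hh] := h_itv.
have h1 : lam / (2 * V%:R) <= lam * ln (1 + V%:R^-1) by rewrite ler_wpM2l// (ltW lam_gt0).
have h2 : 1 <= lam / (4 * V%:R).
  rewrite ler_pdivlMr ?mul1r; last lra.
  apply: le_trans lam_big; rewrite -natrM ler_nat; nlia.
have e : lam / (2 * V%:R) = lam / (4 * V%:R) * 2 by field; rewrite gt_eqF.
lra.
Qed.

Let h_le : h%:R <= lam / V%:R.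
Proof.
have /andP[hh _] := h_itv; apply: le_trans hh _.
by rewrite ler_wpM2l// (ltW lam_gt0).
Qed.

(** The positions [X] at which the box sees exactly the integers of [(k, k + s]]: those up to [k]
    have left it, and [k + s] is the last to have entered. At index 0 there is no such integer,
    hence the first disjuncts. *)
Let ok (k s X : nat) : bool :=
  [&& (k == 0%N) || (q k + h <= X)%N, (X < q k.+1 + h)%N,
      (k + s == 0)%N || (q (k + s) <= X)%N & (X < q (k + s).+1)%N].

Let AX (X : nat) : C := \sum_(i | (q (n i) <= X < q (n i) + h)%N) c i.

Let U_gt0 (i : I) : (0 < U)%N.
Proof. exact: leq_trans (n_gt0 i) (n_leU i). Qed.

(** While the box still contains an integer [n <= U], its position is below [q (4 U)]; so the right
    end of the window can be sought below [4 U]. *)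
Let q4U : (0 < U)%N -> (q U + h <= q (4 * U))%N.
Proof.
move=> U0.
have /andP[a1 a2] := q_itv U; have /andP[b1 b2] := q_itv (4 * U).
have hU : 0 < U%:R :> R by rewrite ltr0n.
have e : ln (4 * U)%:R = ln 4 + ln U%:R :> R by rewrite natrM lnM.
have h4 : 3 / 4 <= ln 4 :> R.
  by have := @ln_geB 4 (ltr0n _ 4); lra.
have hl := h_le.
have hV8 : lam / V%:R <= lam / 8.
  rewrite ler_wpM2l ?(ltW lam_gt0)// lef_pV2 ?posrE//.
  by rewrite (ler_nat _ 8).
have h16 : 16 <= lam.
  by apply: le_trans lam_big; rewrite (ler_nat _ 16); nlia.
rewrite e in b2.
have : (q U + h)%:R < (q (4 * U)).+1%:R :> R.
  rewrite natrD -natr1.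
  have h5 : lam * (3 / 4) <= lam * ln 4 by rewrite ler_wpM2l// (ltW lam_gt0).
  rewrite mulrDr in b2; lra.
by rewrite ltr_nat.
Qed.

(** Either the box has passed [U] and the sum is empty, or its position yields an admissible pair
    [(k, s)] whose window is [AX X]; the other terms are nonnegative. *)
Let AX_window X : nrm (AX X) ^+ 2 <= \sum_(k < U) \sum_(s < (4 * U).+1)
  (ok k s X)%:R * nrm (window k (k + s)) ^+ 2.
Proof.
have RHS0 : 0 <= \sum_(k < U) \sum_(s < (4 * U).+1)
    (ok k s X)%:R * nrm (window k (k + s)) ^+ 2 :> R.
  by apply: sumr_ge0 => k _; apply: sumr_ge0 => s _; rewrite mulr_ge0 ?ler0n// sqr_ge0.
have [K [hK cutK]] := @monotone_cut (fun m => q m + h)%N X (4 * U)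
   (fun m m' hm => leq_add (q_homo hm) (leqnn h)).
have [K' [hK' cutK']] := @monotone_cut q X (4 * U) q_homo.
have n4U i : (0 < n i <= 4 * U)%N by rewrite n_gt0 /=; have := n_leU i; nlia.
case: (leqP U K) => hUK.
  suff -> : AX X = 0 by rewrite nrm0 expr0n.
  rewrite /AX big1 // => i /andP[_]; have := cutK _ (n4U i).
  by rewrite ltnNge => ->; rewrite (leq_trans (n_leU i) hUK).
have U0 : (0 < U)%N by nlia.
have KK' : (K <= K')%N.
  case: (posnP K) => [->//|K0].
  rewrite -cutK'; last by rewrite K0.
  by apply: leq_trans (leq_addr h _) _; rewrite cutK ?leqnn// K0.
have XK : (X < q K.+1 + h)%N by rewrite ltnNge cutK ?ltnn//; nlia.
have K'U : (K' < 4 * U)%N.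
  rewrite ltnNge; apply/negP => hc.
  have : (q (4 * U) <= X)%N by rewrite cutK'; nlia.
  have : (q K.+1 <= q U)%N by apply: q_homo.
  have := q4U U0; nlia.
have XK' : (X < q K'.+1)%N by rewrite ltnNge cutK' ?ltnn//; nlia.
have es : (K + (K' - K) = K')%N by nlia.
have hs : (K' - K < (4 * U).+1)%N by nlia.
have okK : ok K (K' - K) X.
  rewrite /ok es XK XK' andbT /=; apply/andP; split.
    by case: (posnP K) => [->//|K0]; rewrite cutK ?leqnn ?orbT// K0.
  by case: (posnP K') => [->//|K0]; rewrite cutK' ?leqnn ?orbT// K0.
rewrite (bigD1 (Ordinal hUK)) //= (bigD1 (Ordinal hs)) //= okK mul1r es.
have -> : AX X = window K K'.
  rewrite /AX /window; apply: eq_bigl => i.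
  by rewrite ltnNge (cutK _ (n4U i)) (cutK' _ (n4U i)) ltnNge andbC.
rewrite -addrA lerDl addr_ge0//.
  by apply: sumr_ge0 => s _; rewrite mulr_ge0 ?ler0n// sqr_ge0.
by apply: sumr_ge0 => k _; apply: sumr_ge0 => s _; rewrite mulr_ge0 ?ler0n// sqr_ge0.
Qed.

(** Both [k + 1] and [k + s] fit into the box, so [ln (k + s) - ln (k + 1)] is below its length
    [ln (1 + 1 / V)]. *)
Let ok_upper k s X : ok k s X -> (k + s != 0)%N -> (s * V < V + k.+1)%N.
Proof.
move=> /and4P[_ h1 h2 _] hks; move: h2; rewrite (negPf hks) /= => h2.
have /andP[_ a2] := q_itv (k + s); have /andP[b1 _] := q_itv k.+1.
have /andP[c1 _] := h_itv.
have hle : (q (k + s))%:R + 1 <= (q k.+1)%:R + h%:R :> R.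
  by rewrite natr1 -natrD ler_nat; apply: leq_ltn_trans h2 h1.
have hks0 : 0 < (k + s)%:R :> R by rewrite ltr0n lt0n.
have hk0 : 0 < k.+1%:R :> R by rewrite ltr0n.
have hV1 : 0 < 1 + V%:R^-1 :> R by rewrite ltr_wpDr ?invr_ge0 ?(ltW V_gt0).
have : ln (k + s)%:R < ln (k.+1%:R * (1 + V%:R^-1)) :> R.
  rewrite lnM// -(ltr_pM2l lam_gt0); lra.
rewrite ltr_ln ?mulr_gt0// mulrDr mulr1 -(ltr_pM2r V_gt0) mulrDl mulfVK ?gt_eqF//.
rewrite -!natrM -natrD ltr_nat; nnia.
Qed.

(** The box fits between [k] and [k + s + 1]. Rounding costs [1 / lam] in the logarithm, at most one
    unit in the integers because of [lam_big]. *)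
Let ok_lower k s X : (k < U)%N -> (s <= 4 * U)%N -> ok k s X -> (k < (s + 2) * V)%N.
Proof.
move=> kU sU /and4P[h1 _ _ h2].
case: (posnP k) => [->|k0]; first by rewrite muln_gt0; nlia.
move: h1; rewrite (gtn_eqF k0) /= => h1.
have /andP[a1 _] := q_itv (k + s).+1; have /andP[_ b2] := q_itv k.
have /andP[_ c2] := h_itv.
have hle : (q k)%:R + h%:R + 1 <= (q (k + s).+1)%:R :> R.
  by rewrite -natrD natr1 ler_nat; apply: leq_ltn_trans h1 h2.
have hk0 : 0 < k%:R :> R by rewrite ltr0n.
have hks0 : 0 < (k + s).+1%:R :> R by rewrite ltr0n.
have hV1 : 0 < 1 + V%:R^-1 :> R by rewrite ltr_wpDr ?invr_ge0 ?(ltW V_gt0).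
have hl0 := lam_gt0.
have hlt : ln (k%:R * (1 + V%:R^-1)) < ln (k + s).+1%:R + lam^-1 :> R.
  rewrite lnM// -(ltr_pM2l hl0) [lam * (_ + lam^-1)]mulrDr mulfV ?gt_eqF//; lra.
have hU : (k + s).+1%:R <= 5 * U.+1%:R :> R by rewrite -natrM ler_nat; nlia.
have hlam : 128 * U.+1%:R <= lam.
  apply: le_trans lam_big; rewrite -natrM ler_nat; nnia.
have hU0 : 0 < U.+1%:R :> R by rewrite ltr0n.
have hU1 : 1 <= U.+1%:R :> R by rewrite ler1n.
have hli : lam^-1 <= 2^-1 by rewrite lef_pV2 ?posrE//; lra.
have hli0 : 0 < lam^-1 by rewrite invr_gt0.
have hexp : exp lam^-1 <= 1 + 2 * lam^-1 by apply: exp_le1D2; [exact: ltW | ].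
rewrite -(ltr_exp) expD !exp_ln0 ?mulr_gt0// in hlt.
have h3 : k%:R * (1 + V%:R^-1) < (k + s).+1%:R + 1 :> R.
  apply: lt_le_trans hlt _; apply: le_trans (ler_wpM2l (ltW hks0) hexp) _.
  rewrite mulrDr mulr1 lerD2l.
  have : (k + s).+1%:R / lam <= 2^-1 by rewrite ler_pdivrMr//; lra.
  lra.
move: h3; rewrite mulrDr mulr1 -(ltr_pM2r V_gt0) mulrDl mulfVK ?gt_eqF//.
rewrite natr1 -!natrM -natrD ltr_nat; nnia.
Qed.

Let cnt k s : R := \sum_(X < J * Q) (ok k s X)%:R.

Let cnt_ge0 k s : 0 <= cnt k s.
Proof. by apply: sumr_ge0 => X _; rewrite ler0n. Qed.

Let cnt_small k : cnt k 1 <= h%:R.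
Proof.
apply: le_trans (_ : \sum_(X < J * Q) ((q k.+1 <= X < q k.+1 + h)%N%:R : R) <= _).
  apply: ler_sum => X _; rewrite ler_nat; case E : (ok k 1 X) => //.
  by move: E => /and4P[_ -> + _]; rewrite addn1 /= => ->.
by apply: le_trans (sum_indicator_itv _ _ _) _; rewrite addKn.
Qed.

(** The positions lie in a range of length about [lam ln ((k + 1) / k) <= lam / k]; the rounding
    error 1 is also at most [lam / k]. *)
Let cnt_large k s : (0 < k < U)%N -> cnt k s <= 2 * lam / k%:R.
Proof.
move=> /andP[k0 kU].
apply: le_trans (_ : \sum_(X < J * Q) ((q k + h <= X < q k.+1 + h)%N%:R : R) <= _).
  apply: ler_sum => X _; rewrite ler_nat; case E : (ok k s X) => //.
  by move: E => /and4P[+ -> _ _]; rewrite (gtn_eqF k0) /= => ->.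
apply: le_trans (sum_indicator_itv _ _ _) _; rewrite subnDr natrB; last exact: q_homo.
have /andP[_ a2] := q_itv k; have /andP[b1 _] := q_itv k.+1.
have hk0 : 0 < k%:R :> R by rewrite ltr0n.
have hl0 := lam_gt0.
have : ln k.+1%:R - ln k%:R <= k%:R^-1 :> R.
  rewrite -lndiv ?ltr0n//; apply: le_trans (ln_leB1 _) _; first by rewrite divr_gt0// ltr0n.
  by rewrite -natr1 mulrDl mulfV ?gt_eqF// mul1r addrC addKr.
rewrite -(ler_pM2l hl0) mulrBr => h1.
have h2 : 1 <= lam / k%:R.
  rewrite ler_pdivlMr// mul1r; apply: le_trans lam_big; rewrite ler_nat; nnia.
lra.
Qed.

Let sum_AX : \sum_(X < J * Q) nrm (AX X) ^+ 2 <= h%:R * S1 + 2 * lam * S2.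
Proof.
apply: le_trans (_ : \sum_(X < J * Q) \sum_(k < U) \sum_(s < (4 * U).+1)
  (ok k s X)%:R * nrm (window k (k + s)) ^+ 2 <= _).
  by apply: ler_sum => X _; exact: AX_window.
rewrite exchange_big /=.
under eq_bigr => k _ do rewrite exchange_big /=.
under eq_bigr => k _ do under eq_bigr => s _ do rewrite -mulr_suml -/(cnt k s).
rewrite (bigID (fun k : 'I_U => (4 * k < V)%N)) /= lerD//.
  rewrite /S1 mulr_sumr; apply: ler_sum => k hk.
  apply: le_trans (_ : \sum_(s < (4 * U).+1) (s == 1 :> nat)%:R * (h%:R * nrm (window k k.+1) ^+ 2) <= _).
    apply: ler_sum => s _; case: (altP (s =P 1 :> nat)) => [->|s1].
      by rewrite mul1r addn1 ler_wpM2r ?sqr_ge0// cnt_small.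
    rewrite mul0r; case: (posnP s) => [->|s0].
      by rewrite addn0 /window big1 ?nrm0 ?expr0n ?mulr0// => i; nlia.
    suff -> : cnt k s = 0 by rewrite mul0r.
    rewrite /cnt big1 // => X _; case hok : (ok k s X) => //.
    have := ok_upper hok; nnia.
  rewrite -mulr_suml -[X in _ <= X]mul1r ler_wpM2r//.
    by rewrite mulr_ge0 ?ler0n ?sqr_ge0.
  apply: le_trans (sum_indicator_itv (4 * U).+1 1 2); apply: ler_sum => s _.
  by case: (nat_of_ord s) => [|[|]].
rewrite /S2 mulr_sumr.
under eq_bigl do rewrite -leqNgt.
apply: ler_sum => k hk.
have k0 : (0 < k)%N by nlia.
rewrite mulrA mulr_sumr [X in _ <= X]big_mkcond /=; apply: ler_sum => s _.
case: ifP => hs; first by rewrite ler_wpM2r ?sqr_ge0// cnt_large// k0 ltn_ord.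
suff -> : cnt k s = 0 by rewrite mul0r.
rewrite /cnt big1 // => X _; case hok : (ok k s X) => //.
have h1 := ok_upper hok; have h2 := ok_lower (ltn_ord k) _ hok.
move/negbT: hs; rewrite h2 /=; last by have := ltn_ord s; nlia.
rewrite -leqNgt => h3; have := h1; nnia.
Qed.

Let Dt (l : nat) : C := \sum_i c i * cis (- (2 * PI * l%:R * (q (n i))%:R / Q%:R)).
Let Hh (l : nat) : C := \sum_(u < h) cis (- (2 * PI * l%:R * u%:R / Q%:R)).

Let lamQ : lam * (2 * PI) = alpha * Q%:R.
Proof. by rewrite /lam mulfVK// gt_eqF// mulr_gt0// PI_gt0. Qed.

Let Hh_ge l : (l < L1)%N -> h%:R / 2 <= nrm (Hh l).
Proof.
move=> hl; apply: le_trans (Re_le_nrm _); rewrite /Hh raddf_sum /=.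
rewrite -[X in X / 2](mulr1 h%:R) -mulrA -{1}[h]card_ord mulr_natl -sumr_const.
apply: ler_sum => u _; rewrite mul1r.
set x := - _.
have hPI := PI_gt0.
have hQ : 0 < Q%:R :> R by rewrite ltr0n.
have hx : `|x| <= 1.
  rewrite /x normrN ger0_norm; last by pos.
  rewrite ler_pdivrMr// mul1r.
  have hu : u%:R <= lam / V%:R by apply: le_trans h_le; rewrite ler_nat ltnW.
  have hl1 : l%:R <= L1%:R :> R by rewrite ler_nat ltnW.
  apply: le_trans (_ : 2 * PI * L1%:R * (lam / V%:R) <= _).
    rewrite ler_pM ?ler0n//; first by pos.
    by rewrite ler_wpM2l// mulr_ge0// (ltW hPI).
  have -> : 2 * PI * L1%:R * (lam / V%:R) = (lam * (2 * PI)) * L1%:R / V%:R by ring.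
  rewrite lamQ ler_pdivrMr// mulrAC -[X in _ <= X]mulrC ler_wpM2r//.
have : nrm (cis x - cis 0) ^+ 2 <= 1.
  apply: le_trans (_ : `|x - 0| ^+ 2 <= _).
    by rewrite lerXn2r ?nnegrE ?nrm_ge0// nrm_cisB.
  by rewrite subr0 exprn_ile1.
rewrite cis0 nrm_sqr /= subr0.
have h2 : sin x * sin x + cos x * cos x = 1 := sin2_cos2 x.
nra.
Qed.

(** By [J_big] every box lies inside the [J] periods, so the convolution is complete. *)
Let conv l : \sum_(X < J * Q) AX X * cis (- (2 * PI * l%:R * X%:R / Q%:R)) = Dt l * Hh l.
Proof.
have hPI := PI_gt0.
have hQ : 0 < Q%:R :> R by rewrite ltr0n.
have fit i : (q (n i) + h <= J * Q)%N.
  rewrite -(ler_nat R) natrD natrM.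
  have /andP[a1 _] := q_itv (n i).
  have hn : ln (n i)%:R <= ln U%:R :> R.
    by rewrite ler_ln ?ltr0n ?ler_nat ?n_gt0 ?n_leU//; exact: U_gt0 i.
  have h1 : h%:R <= Q%:R :> R.
    apply: le_trans h_le _; rewrite ler_pdivrMr// /lam ler_pdivrMr; last lra.
    have hL : 1 <= L1%:R :> R by rewrite ler1n.
    have ha : alpha <= V%:R by apply: le_trans V_big; have := alpha_gt0; nra.
    have hP1 : 1 < PI / 2 by apply/RltP; exact: PI2_1.
    rewrite mulrC -mulrA ler_wpM2l ?ler0n//; apply: le_trans ha _.
    have := ler_wpM2l (ltW V_gt0) (_ : 1 <= 2 * PI).
    by rewrite mulr1; apply; lra.
  have hq : (q (n i))%:R <= lam * ln U%:R.
    by apply: le_trans a1 _; rewrite ler_wpM2l// (ltW lam_gt0).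
  have e : lam * ln U%:R = alpha * ln U%:R / (2 * PI) * Q%:R.
    by rewrite /lam; field; rewrite gt_eqF.
  have := ler_wpM2r (ltW hQ) J_big; rewrite mulrDl -e; lra.
rewrite /Dt mulr_suml.
under eq_bigr => X _ do rewrite /AX mulr_suml.
rewrite (exchange_big_dep xpredT) //=; apply: eq_bigr => i _.
rewrite -mulr_sumr -[RHS]mulrA; congr (_ * _).
rewrite -(big_mkord (fun X => (q (n i) <= X < q (n i) + h)%N)
   (fun X => cis (- (2 * PI * l%:R * X%:R / Q%:R)))).
rewrite (big_cat_nat (n := q (n i))) //=; last by have := fit i; nlia.
rewrite big_nat_cond big1 ?add0r; last by move=> X; nlia.
rewrite (big_cat_nat (n := (q (n i) + h)%N)) ?leq_addr//=.
rewrite [X in _ + X]big_nat_cond [X in _ + X]big1 ?addr0; last by move=> X; nlia.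
rewrite big_nat_cond.
under eq_bigl => X do rewrite andbb.
rewrite -big_nat -{1}[q (n i)]add0n big_addn addKn big_mkord /Hh mulr_sumr.
apply: eq_bigr => u _; rewrite -cisD; congr cis.
by rewrite natrD; ring.
Qed.

(** Folding [J Q] positions into [Q] residues costs a factor [J] by Cauchy-Schwarz. Parseval then
    bounds the transform, [(h / 2)^2] is divided out, and [h >= lam / (4 V)] makes [Q] disappear. *)
Let grid_bound : \sum_(l < L1) nrm (Dt l) ^+ 2 <=
  128 * J%:R * V%:R / alpha * (S1 + 8 * V%:R * S2).
Proof.
have hPI := PI_gt0; have hQ : 0 < Q%:R :> R by rewrite ltr0n.
have hl0 := lam_gt0; have hV := V_gt0.
have hh0 : 0 < h%:R :> R by apply: lt_le_trans h_ge; rewrite divr_gt0// mulr_gt0.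
have L1Q : (L1 <= Q)%N.
  rewrite -(ler_nat R); have : alpha * L1%:R <= alpha * Q%:R.
    rewrite -lamQ; apply: le_trans V_big _.
    have : V%:R <= lam by apply: le_trans lam_big; rewrite ler_nat; nnia.
    have : 1 < PI / 2 by apply/RltP; exact: PI2_1.
    nra.
  by rewrite ler_pM2l.
have key : (h%:R / 2) ^+ 2 * \sum_(l < L1) nrm (Dt l) ^+ 2 <=
    Q%:R * (J%:R * (h%:R * S1 + 2 * lam * S2)).
  pose w (x : nat) := \sum_(j < J) AX (x + j * Q).
  have hw l : \sum_(x < Q) w x * cis (- (2 * PI * l%:R * x%:R / Q%:R)) = Dt l * Hh l.
    rewrite -conv (sum_nat_blocks J Q (fun X => AX X * cis (- (2 * PI * l%:R * X%:R / Q%:R)))).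
    apply: eq_bigr => x _; rewrite /w mulr_suml.
    by apply: eq_bigr => j _; rewrite cis_period.
  rewrite mulr_sumr.
  apply: le_trans (_ : \sum_(l < L1) nrm (Dt l * Hh l) ^+ 2 <= _).
    apply: ler_sum => l _; rewrite nrmM [X in _ <= X]exprMn [X in _ <= X]mulrC ler_wpM2r ?sqr_ge0//.
    by rewrite lerXn2r ?nnegrE ?nrm_ge0 ?divr_ge0 ?ler0n// Hh_ge.
  apply: le_trans (_ : \sum_(l < Q) nrm (Dt l * Hh l) ^+ 2 <= _).
    rewrite (big_ord_widen _ (fun l => nrm (Dt l * Hh l) ^+ 2) L1Q) big_mkcond /=.
    by apply: ler_sum => l _; case: ifP => // _; rewrite sqr_ge0.
  under eq_bigr do rewrite -hw.
  rewrite dft_parseval// ler_wpM2l ?ler0n//.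
  apply: le_trans (_ : \sum_(x < Q) J%:R * \sum_(j < J) nrm (AX (x + j * Q)) ^+ 2 <= _).
    by apply: ler_sum => x _; exact: cauchy_schwarz_nrm.
  rewrite -mulr_sumr ler_wpM2l ?ler0n//.
  by rewrite -(sum_nat_blocks J Q (fun X => nrm (AX X) ^+ 2)); exact: sum_AX.
have S1p : 0 <= S1 by apply: sumr_ge0 => k _; rewrite sqr_ge0.
have S2p : 0 <= S2.
  apply: sumr_ge0 => k _; rewrite mulr_ge0 ?invr_ge0 ?ler0n//.
  by apply: sumr_ge0 => s _; rewrite sqr_ge0.
have hQe : Q%:R = lam * (2 * PI) / alpha by rewrite lamQ mulrAC mulfV ?mul1r// gt_eqF.
have hPI4 : PI <= 4 by exact: PI_le4.
have h2p : 0 < (h%:R / 2) ^+ 2 :> R by rewrite exprn_gt0// divr_gt0.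
rewrite -(ler_pM2l h2p); apply: le_trans key _; rewrite hQe.
have hg : lam <= 4 * V%:R * h%:R.
  by have := h_ge; rewrite ler_pdivrMr; [rewrite mulrC | rewrite mulr_gt0].
have J0 : 0 <= J%:R :> R by rewrite ler0n.
rewrite (_ : lam * (2 * PI) / alpha * (J%:R * (h%:R * S1 + 2 * lam * S2)) =
  J%:R / alpha * ((2 * PI * lam * h%:R) * S1 + (4 * PI * lam * lam) * S2)); last first.
  by field; rewrite gt_eqF.
rewrite (_ : (h%:R / 2) ^+ 2 * (128 * J%:R * V%:R / alpha * (S1 + 8 * V%:R * S2)) =
  J%:R / alpha * ((32 * V%:R * h%:R * h%:R) * S1 + (256 * V%:R * V%:R * h%:R * h%:R) * S2)); last first.
  by field; rewrite gt_eqF.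
rewrite ler_wpM2l ?divr_ge0 ?(ltW alpha_gt0)//; apply: lerD; rewrite ler_wpM2r//.
  apply: le_trans (_ : 2 * 4 * (4 * V%:R * h%:R) * h%:R <= _); last lra.
  rewrite ler_wpM2r ?ler0n// ler_pM//; [by pos | exact: ltW | lra].
apply: le_trans (_ : 4 * 4 * (4 * V%:R * h%:R) * (4 * V%:R * h%:R) <= _); last lra.
have hvh : 0 <= 4 * V%:R * h%:R :> R by pos.
by rewrite ler_pM//; [pos | exact: ltW | rewrite ler_pM//; [pos | exact: ltW | lra]].
Qed.

Lemma bessel_grid :
  \sum_(l < L1) nrm (\sum_i c i * cis (- (l%:R * (alpha * ln (n i)%:R)))) ^+ 2 <=
  256 * J%:R * V%:R / alpha * (S1 + 8 * V%:R * S2) +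
  2 * L1%:R * (L1%:R * (2 * PI) / Q%:R * \sum_i nrm (c i)) ^+ 2.
Proof.
have hPI := PI_gt0; have hQ : 0 < Q%:R :> R by rewrite ltr0n.
set D := fun l : nat => \sum_i c i * cis (- (l%:R * (alpha * ln (n i)%:R))).
set e := L1%:R * _ / _ * _.
have hD l : (l < L1)%N -> nrm (D l - Dt l) <= e.
  move=> hl; rewrite /D /Dt -sumrB /e mulr_sumr.
  apply: le_trans (nrm_sum _ _ _) _; apply: ler_sum => i _.
  rewrite -mulrBr nrmM mulrC ler_wpM2r ?nrm_ge0//.
  apply: le_trans (nrm_cisB _ _) _.
  have -> : - (l%:R * (alpha * ln (n i)%:R)) - - (2 * PI * l%:R * (q (n i))%:R / Q%:R)
     = - (l%:R * (2 * PI) / Q%:R * (lam * ln (n i)%:R - (q (n i))%:R)).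
    by rewrite /lam; field; rewrite !gt_eqF.
  rewrite normrN normrM ger0_norm; last by rewrite divr_ge0 ?ler0n// mulr_ge0 ?ler0n//; lra.
  have /andP[a1 a2] := q_itv (n i).
  rewrite ger0_norm ?subr_ge0//.
  rewrite -[X in _ <= X]mulr1 ler_pM ?subr_ge0//.
  - by rewrite divr_ge0 ?ler0n// mulr_ge0 ?ler0n//; lra.
  - rewrite ler_wpM2r ?invr_ge0 ?ler0n// ler_wpM2r//; first lra.
    by rewrite ler_nat ltnW.
  - lra.
apply: le_trans (_ : \sum_(l < L1) (2 * nrm (Dt l) ^+ 2 + 2 * e ^+ 2) <= _).
  apply: ler_sum => l _; rewrite -/(D l).
  have h1 : nrm (D l) <= nrm (Dt l) + e.
    rewrite -[D l](subrK (Dt l)) addrC; apply: le_trans (nrmD _ _) _.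
    by rewrite lerD2l hD.
  have : nrm (D l) ^+ 2 <= (nrm (Dt l) + e) ^+ 2.
    by rewrite lerXn2r ?nnegrE ?nrm_ge0// (le_trans (nrm_ge0 _) h1).
  move=> h2; apply: le_trans h2 _.
  have := sqr_ge0 (nrm (Dt l) - e); rewrite sqrrB sqrrD mulr2n; lra.
rewrite big_split /= sumr_const card_ord -mulr_sumr lerD//.
  by have := grid_bound; lra.
by rewrite -[_ *+ L1]mulr_natl; lra.
Qed.

End Grid.

Lemma bessel_progression :
  \sum_(l < L1) nrm (\sum_i c i * cis (- (l%:R * (alpha * ln (n i)%:R)))) ^+ 2 <=
  256 * J%:R * V%:R / alpha * (S1 + 8 * V%:R * S2).
Proof.
(* Neither side involves [Q], so the rounding error is removed by taking [Q] large in terms of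
   [e]. *)
apply/ler_addgt0Pr => e he.
have hPI := PI_gt0.
set N1 := \sum_i nrm (c i).
have N1p : 0 <= N1 by apply: sumr_ge0 => i _; exact: nrm_ge0.
have L1p : 1 <= L1%:R :> R by rewrite ler1n.
set B := (16 * V * U.+1)%:R * (2 * PI) / alpha + 2 * L1%:R * (1 + (L1%:R * (2 * PI) * N1) ^+ 2) / e + 1.
have [Q hQ] : exists Q : nat, B <= Q%:R.
  by exists (Num.truncn B).+1; apply/ltW/truncnS_gt.
have p1 : 0 <= (16 * V * U.+1)%:R * (2 * PI) / alpha.
  by rewrite divr_ge0 ?(ltW alpha_gt0)// mulr_ge0 ?ler0n//; lra.
set G := L1%:R * (2 * PI) * N1.
have G0 : 0 <= G by rewrite /G; pos.
have p2 : 0 <= 2 * L1%:R * (1 + G ^+ 2) / e.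
  by rewrite divr_ge0 ?(ltW he)// mulr_ge0//; [lra | have := sqr_ge0 G; lra].
have Qp : 0 < Q%:R :> R by apply: lt_le_trans hQ; rewrite /B -/G; lra.
apply: le_trans (@bessel_grid Q _) _.
  rewrite ler_pdivlMr; last lra.
  rewrite mulrC -ler_pdivrMl// [alpha^-1 * _]mulrC [2 * PI * _]mulrC.
  by apply: le_trans hQ; rewrite /B -/G; lra.
rewrite lerD2l -/N1 (_ : L1%:R * (2 * PI) / Q%:R * N1 = G / Q%:R); last by rewrite /G; ring.
have hQ1 : 1 <= Q%:R :> R by apply: le_trans hQ; rewrite /B -/G; lra.
have hQe : 2 * L1%:R * (1 + G ^+ 2) <= e * Q%:R.
  rewrite [e * _]mulrC -ler_pdivrMr//; apply: le_trans hQ; rewrite /B -/G; lra.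
rewrite expr_div_n mulrA ler_pdivrMr ?exprn_gt0//.
have : e * Q%:R <= e * Q%:R ^+ 2.
  by rewrite ler_wpM2l ?(ltW he)// expr2 ler_peMr// ltW.
have := sqr_ge0 G; nra.
Qed.

End Bessel.

(** * Mertens' first theorem *)

Lemma coprime_prodr_seq (p : nat) (s : seq nat) :
  {in s, forall x, coprime p x} -> coprime p (\prod_(x <- s) x).
Proof.
elim: s => [|x s IH] h; first by rewrite big_nil coprimen1.
rewrite big_cons coprimeMr h ?mem_head// IH // => z zs.
by apply: h; rewrite inE zs orbT.
Qed.

Lemma prod_primes_dvd (s : seq nat) (d : nat) :
  uniq s -> {in s, forall p, prime p && (p %| d)%N} -> (\prod_(p <- s) p %| d)%N.
Proof.
elim: s => [|p s IH] /=; first by rewrite big_nil dvd1n.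
move=> /andP[ps us] h; have /andP[pp pd] := h p (mem_head _ _).
have h' : {in s, forall p, prime p && (p %| d)%N} by move=> x xs; apply: h; rewrite inE xs orbT.
rewrite big_cons Gauss_dvd ?pd ?IH//.
apply: coprime_prodr_seq => x xs; have /andP[px _] := h' x xs.
rewrite prime_coprime// dvdn_prime2//; apply: contraNneq ps => -> //.
Qed.

Lemma prime_dvd_fact (p n : nat) : prime p -> (p %| n`!)%N = (p <= n)%N.
Proof.
move=> pp; apply/idP/idP => [|h]; last by apply: dvdn_fact; rewrite prime_gt0.
elim: n => [|n IH]; first by rewrite fact0 dvdn1 => /eqP h; move: pp; rewrite h.
rewrite factS Euclid_dvdM// => /orP[/dvdn_leq->//|/IH h]; exact: leqW.
Qed.

Definition primorial (n : nat) : nat := \prod_(p <- index_iota 0 n.+1 | prime p) p.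

Lemma central_bin_le n : ('C(2 * n, n) <= 4 ^ n)%N.
Proof.
have -> : (4 ^ n = (1 + 1) ^ (2 * n))%N by rewrite expnM.
rewrite expnDn.
rewrite -(big_mkord xpredT (fun i => 'C(2 * n, i) * (1 ^ (2 * n - i) * 1 ^ i))%N).
rewrite (big_cat_nat (n := n)) //=; last by lia.
rewrite [X in (_ + X)%N]big_ltn; last by lia.
by rewrite !exp1n !muln1; lia.
Qed.

(** Doubling: the primes in [(n, 2 n]] divide the central binomial coefficient, which is at most
    [4^n]. *)
Lemma primorial_pow2 k : (primorial (2 ^ k) <= 4 ^ (2 ^ k))%N.
Proof.
elim: k => [|k IH]; first by rewrite /primorial /index_iota /= unlock.
set n := (2 ^ k)%N in IH *.
have n0 : (0 < n)%N by rewrite expn_gt0.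
rewrite expnS -/n /primorial /index_iota subn0.
rewrite -[iota 0 _]/(iota 0 (2 * n).+1) (_ : (2 * n).+1 = n.+1 + n)%N; last by lia.
rewrite iotaD big_cat /= (_ : 2 * n = n + n)%N; last by lia.
rewrite expnD leq_mul//.
apply: leq_trans (central_bin_le n).
rewrite -big_filter; apply: dvdn_leq; first by rewrite bin_gt0; lia.
apply: prod_primes_dvd; first by rewrite filter_uniq// iota_uniq.
move=> p; rewrite mem_filter mem_iota => /andP[pp hp]; rewrite pp /=.
have := bin_fact (leq_pmull n (isT : 0 < 2)%N).
rewrite (_ : (2 * n - n)%N = n); last by lia.
move=> e; have : (p %| (2 * n)`!)%N by rewrite prime_dvd_fact//; lia.
rewrite -e !Euclid_dvdM// prime_dvd_fact//.
by case: (leqP p n) hp => //; lia.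
Qed.

Definition theta (n : nat) : R := \sum_(p < n.+1 | prime p) ln p%:R.

Lemma ln_prod_nat (r : seq nat) (P : pred nat) (F : nat -> nat) :
  (forall i, P i -> (0 < F i)%N) ->
  ln (\prod_(i <- r | P i) F i)%:R = \sum_(i <- r | P i) ln (F i)%:R :> R.
Proof.
move=> hF; suff [_ ->] : (0 < \prod_(i <- r | P i) F i)%N /\
   ln (\prod_(i <- r | P i) F i)%:R = \sum_(i <- r | P i) ln (F i)%:R :> R by [].
apply: (big_ind2 (fun x y => (0 < x)%N /\ ln x%:R = y)).
- by rewrite ln10.
- by move=> x1 x2 y1 y2 [hx <-] [hy <-]; rewrite muln_gt0 hx hy natrM lnM ?ltr0n.
- by move=> i hi; rewrite hF.
Qed.

(** The factor 2 comes from rounding [n] up to a power of 2. *)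
Lemma theta_le n : (0 < n)%N -> theta n <= 2 * n%:R * ln 4.
Proof.
move=> n0.
have [k [hk1 hk2]] : exists k, (n <= 2 ^ k)%N /\ (2 ^ k <= 2 * n)%N.
  case: (leqP n 1) => n1; first by exists 0%N; lia.
  have /andP[a b] := @up_log_bounds 2 n isT n1.
  exists (up_log 2 n); split => //.
  have up0 : (0 < up_log 2 n)%N.
    by rewrite lt0n; apply: contraTneq b => ->; rewrite expn0 -ltnNge.
  by move: a; case: (up_log 2 n) up0 => // u _ /= a; rewrite expnS leq_pmul2l// ltnW.
have h4 : 0 <= ln 4 :> R by apply: ln_ge0; lra.
apply: le_trans (_ : (2 ^ k)%:R * ln 4 <= _); last first.
  by rewrite ler_wpM2r// -natrM ler_nat.
apply: le_trans (_ : ln (primorial (2 ^ k))%:R <= _); last first.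
  rewrite -lnXn// -natrX ler_ln ?ltr0n ?expn_gt0 ?ler_nat ?primorial_pow2//.
  by rewrite /primorial prodn_cond_gt0 // => i /prime_gt0.
rewrite /primorial ln_prod_nat; last by move=> i /prime_gt0.
rewrite /theta -(big_mkord (fun p => prime p) (fun p => ln p%:R)).
rewrite [X in _ <= X](big_cat_nat (n := n.+1)) //= lerDl.
by apply: sumr_ge0 => i _; exact: lnn_ge0.
Qed.

Definition mert (n : nat) : R := \sum_(p < n.+1 | prime p) ln p%:R / p%:R.

Lemma ln_fact_ge n : n%:R * ln n%:R - n%:R <= ln n`!%:R :> R.
Proof.
elim: n => [|n IH]; first by rewrite mul0r subr0 fact0 ln10.
rewrite factS natrM lnM ?ltr0n ?fact_gt0//.
case: n IH => [|n] IH; first by rewrite fact0 !ln10 mulr0 addr0 sub0r oppr_le0.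
set a := n.+1%:R in IH *; have ha : 0 < a :> R by rewrite /a ltr0n.
have ea : n.+2%:R = a + 1 :> R by rewrite /a natr1.
rewrite ea.
have h := ln_succ_le ha; clearbody a.
have h2 : a * (ln (a + 1) - ln a) <= 1.
  have a0 : a != 0 by rewrite gt_eqF.
  by rewrite -[X in _ <= X](mulfV a0) ler_wpM2l// ltW.
rewrite mulrDl mul1r; lra.
Qed.

Lemma fact_le_exp n : (n`! <= n ^ n)%N.
Proof.
elim: n => // n IH; rewrite factS expnS leq_mul//.
by apply: leq_trans IH _; case: n => // n; rewrite leq_exp2r.
Qed.

Lemma ln_fact_le n : ln n`!%:R <= n%:R * ln n%:R :> R.
Proof.
case: n => [|n]; first by rewrite mul0r fact0 ln10.
rewrite -lnXn ?ltr0n// ler_ln ?exprn_gt0 ?ltr0n ?fact_gt0// -natrX ler_nat.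
exact: fact_le_exp.
Qed.

Lemma fact_prime_prod (M n : nat) : (n <= M)%N ->
  n`! = (\prod_(0 <= p < M.+1) p ^ logn p n`!)%N.
Proof.
elim: n => [|n IH] h.
  by rewrite fact0 big1 // => i _; rewrite logn1 expn0.
rewrite factS {1}IH ?(ltnW h)//.
rewrite -{1}(@partnT n.+1)// (widen_partn _ h) -big_split /=.
by apply: eq_bigr => p _; rewrite lognM ?fact_gt0// expnD.
Qed.

Lemma ln_fact_primes n :
  ln n`!%:R = \sum_(p < n.+1 | prime p) (logn p n`!)%:R * ln p%:R :> R.
Proof.
rewrite {1}(fact_prime_prod (leqnn n)).
rewrite (bigID (fun p => prime p)) /= [X in (_ * X)%N]big1 ?muln1; last first.
  by move=> i /negPf h; rewrite lognE h expn0.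
rewrite ln_prod_nat; last by move=> i /prime_gt0 h; rewrite expn_gt0 h.
rewrite big_mkord; apply: eq_bigr => p pp.
by rewrite natrX lnXn// ltr0n prime_gt0.
Qed.

(** Each prime occurs at least [n / p - 1] times in the factorial of [n]; the total loss is
    [theta n], of order [n]. *)
Lemma mert_le n : (0 < n)%N -> mert n <= ln n%:R + 2 * ln 4.
Proof.
move=> n0; have hn : 0 < n%:R :> R by rewrite ltr0n.
have h1 : n%:R * mert n - theta n <= ln n`!%:R.
  rewrite ln_fact_primes /mert /theta mulr_sumr -sumrB; apply: ler_sum => p pp.
  have p0 : 0 < p%:R :> R by rewrite ltr0n prime_gt0.
  have hl : (n %/ p <= logn p n`!)%N.
    by rewrite logn_fact// big_ltn// expn1 leq_addr.
  have h2 : n%:R / p%:R - 1 <= (n %/ p)%:R :> R.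
    rewrite lerBlDr natr1 ler_pdivrMr// -natrM ler_nat.
    by rewrite ltnW// ltn_ceil// prime_gt0.
  have h3 : n%:R / p%:R - 1 <= (logn p n`!)%:R :> R.
    by apply: le_trans h2 _; rewrite ler_nat.
  apply: le_trans (ler_wpM2r (lnn_ge0 p) h3).
  by rewrite mulrBl mul1r lerD2r mulrA mulrAC.
have := ln_fact_le n; have := theta_le n0 => h2 h3.
rewrite -(ler_pM2l hn); lra.
Qed.

Lemma sum_ln_le n : \sum_(m < n.+1 | (1 < m)%N) ln m%:R / (m%:R * (m%:R - 1)) <= 2 :> R.
Proof.
(* The bound is strengthened by [(ln n + 2) / n], whose decrease from [n] to [n + 1] covers the new
   term and which equals 2 at [n = 1]. *)
suff h : \sum_(m < n.+1 | (1 < m)%N) ln m%:R / (m%:R * (m%:R - 1)) <=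
    2 - (if (n == 0)%N then 0 else (ln n%:R + 2) / n%:R) :> R.
  apply: le_trans h _; case: ifP => _; first lra.
  by rewrite lerBlDr lerDl divr_ge0 ?addr_ge0 ?lnn_ge0// ler0n.
elim: n => [|n IH]; first by rewrite big_mkcond big_ord_recl big_ord0 /=; lra.
rewrite big_mkcond big_ord_recr -big_mkcond /=.
case: n IH => [|n] IH.
  by rewrite big_mkcond big_ord_recl big_ord0 /= ln10; lra.
rewrite /= in IH *.
set a := n.+1%:R in IH *; have ha : 1 <= a :> R by rewrite /a ler1n.
have ea : n.+2%:R = a + 1 :> R by rewrite /a natr1.
rewrite ea addrK.
have ha0 : 0 < a by lra.
have h := ln_succ_le ha0; clearbody a.
have hV : a^-1 <= 1 by rewrite invf_le1//; lra.
have h2 : a * (ln (a + 1) - ln a) <= 1.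
  have a0 : a != 0 by rewrite gt_eqF//; lra.
  by rewrite -[X in _ <= X](mulfV a0) ler_wpM2l//; lra.
suff key : ln (a + 1) / ((a + 1) * a) + (ln (a + 1) + 2) / (a + 1) <= (ln a + 2) / a by lra.
have a1p : 0 < (a + 1) * a by rewrite mulr_gt0//; lra.
rewrite -(ler_pM2r a1p).
rewrite (_ : (ln a + 2) / a * ((a + 1) * a) = (ln a + 2) * (a + 1)); last by field; lra.
rewrite (_ : _ * ((a + 1) * a) = ln (a + 1) + (ln (a + 1) + 2) * a); last by field; apply/andP; split; lra.
lra.
Qed.

(** The multiplicity of [p] in the factorial is at most [n / (p - 1) = n / p + n / (p (p - 1))], and
    the second part gives the convergent series of [sum_ln_le]. *)
Lemma mert_ge n : (0 < n)%N -> ln n%:R - 3 <= mert n.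
Proof.
move=> n0; have hn : 0 < n%:R :> R by rewrite ltr0n.
have h1 : ln n`!%:R <= n%:R * mert n + n%:R * 2.
  apply: le_trans (_ : n%:R * mert n + n%:R * \sum_(m < n.+1 | (1 < m)%N) ln m%:R / (m%:R * (m%:R - 1)) <= _); last first.
    by rewrite lerD2l ler_wpM2l ?ler0n// sum_ln_le.
  apply: le_trans (_ : n%:R * mert n + n%:R * \sum_(m < n.+1 | prime m) ln m%:R / (m%:R * (m%:R - 1)) <= _); last first.
    rewrite lerD2l ler_wpM2l ?ler0n// [X in X <= _]big_mkcond [X in _ <= X]big_mkcond /=.
    apply: ler_sum => p _; case: ifP => pp; first by rewrite prime_gt1.
    case: ifP => // p1; rewrite divr_ge0 ?lnn_ge0// mulr_ge0 ?ler0n//.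
    by rewrite subr_ge0 ler1n ltnW.
  rewrite ln_fact_primes /mert !mulr_sumr -big_split /=; apply: ler_sum => p pp.
  have p1 := prime_gt1 pp; have p0 : 0 < p%:R :> R by rewrite ltr0n ltnW.
  have p1' : 0 < p%:R - 1 :> R by rewrite subr_gt0 ltr1n.
  have hl : (logn p n`!)%:R <= n%:R / (p%:R - 1) :> R.
    rewrite logn_fact// natr_sum.
    suff hs m : \sum_(1 <= k < m.+1) (n %/ p ^ k)%:R <=
        n%:R / (p%:R - 1) * (1 - p%:R ^- m) :> R.
      apply: le_trans (hs n) _; rewrite -[X in _ <= X]mulr1 ler_wpM2l//.
        by rewrite divr_ge0 ?ler0n// ltW.
      by rewrite lerBlDr lerDl invr_ge0 exprn_ge0// ltW.
    elim: m => [|m IH]; first by rewrite big_geq// expr0 invr1 subrr mulr0.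
    have hd : (n %/ p ^ m.+1)%:R <= n%:R / p%:R ^+ m.+1 :> R.
      by rewrite ler_pdivlMr ?exprn_gt0// -natrX -natrM ler_nat leq_trunc_div.
    rewrite big_nat_recr//=; apply: le_trans (lerD IH hd) _.
    rewrite le_eqVlt; apply/orP; left; apply/eqP; rewrite exprS; field.
    by rewrite !gt_eqF ?exprn_gt0.
  apply: le_trans (ler_wpM2r (lnn_ge0 p) hl) _.
  rewrite le_eqVlt; apply/orP; left; apply/eqP; field.
  by rewrite !gt_eqF.
have := ln_fact_ge n => h2.
rewrite -(ler_pM2l hn); lra.
Qed.

(** * The eta function on the critical line *)

Definition ut (t : R) (a : nat) : C := ((Num.sqrt a%:R)^-1)%:C * cis (- (t * ln a%:R)).

Definition etaP (t : R) (n : nat) : C := \sum_(k < n) (-1) ^+ k * ut t k.+1.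

(** Partial sums averaged twice: consecutive values differ by a second difference of the terms, of
    order [(1 + |t|)^2 n^(-5/2)]. This gives absolute convergence and an explicit error for [t] as
    large as a power of [n]. *)
Definition etaV (t : R) (n : nat) : C :=
  (4^-1)%:C * (etaP t n + 2 * etaP t n.+1 + etaP t n.+2).

Lemma nrm_ut t a : nrm (ut t a) = (Num.sqrt a%:R)^-1.
Proof. by rewrite nrmM nrm_cis mulr1 nrm_real ger0_norm// invr_ge0 sqrtr_ge0. Qed.

Lemma nrm_sign k : nrm ((-1) ^+ k) = 1.
Proof. by rewrite nrmX nrmN nrm1 expr1n. Qed.

Lemma etaPS t n : etaP t n.+1 = etaP t n + (-1) ^+ n * ut t n.+1.
Proof. by rewrite /etaP big_ord_recr. Qed.

(** The ratio [exp (- (1/2 + i t) v)] of the terms at [a exp v] and [a]. *)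
Definition Erot (t v : R) : C := (exp (- (v / 2)))%:C * cis (- (t * v)).

Lemma ut_mul t a b : 0 < a%:R :> R -> 0 < b%:R :> R ->
  ut t b = ut t a * Erot t (ln b%:R - ln a%:R).
Proof.
move=> ha hb; rewrite /ut /Erot !sqrt_pw// /pw -!expN.
rewrite mulrACA -rmorphM -expD -cisD; congr (_ * _); last by congr cis; ring.
by congr (_%:C); congr exp; lra.
Qed.

Lemma expB_le (x y : R) : x <= 0 -> y <= 0 -> `|exp x - exp y| <= `|x - y|.
Proof.
wlog hxy : x y / x <= y => [H hx hy|hx hy].
  case/orP: (le_total x y) => h; first exact: H.
  by rewrite distrC [`|x - y|]distrC; apply: H.
rewrite distrC [`|x - y|]distrC !ger0_norm ?subr_ge0 ?ler_exp//.
have := exp_ge1D (x - y); rewrite (_ : exp x = exp (x - y) * exp y); last by rewrite -expD subrK.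
have := exp_le1 hy; have := exp_ge0 y; have : exp (x - y) <= 1 by apply: exp_le1; lra.
nra.
Qed.

Lemma Erot_lip t v w : 0 <= v -> 0 <= w ->
  nrm (Erot t v - Erot t w) <= (1 + `|t|) * `|v - w|.
Proof.
move=> hv hw; rewrite /Erot.
set a := exp _; set b := exp _.
have -> : a%:C * cis (- (t * v)) - b%:C * cis (- (t * w)) =
    (a - b)%:C * cis (- (t * v)) + b%:C * (cis (- (t * v)) - cis (- (t * w))).
  by rewrite rmorphB /=; ring.
apply: le_trans (nrmD _ _) _; rewrite !nrmM nrm_cis mulr1 !nrm_real mulrDl mul1r lerD//.
  apply: le_trans (expB_le _ _) _; try lra.
  by rewrite -opprB -mulrBl opprK || idtac; rewrite (_ : - (v / 2) - - (w / 2) = - ((v - w) / 2)); [rewrite normrN normrM [`|2^-1|]ger0_norm; have := normr_ge0 (v - w); lra | ring].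
rewrite [`|b|]ger0_norm ?exp_ge0//.
have b1 : b <= 1 by apply: exp_le1; lra.
apply: le_trans (_ : 1 * nrm (cis (- (t * v)) - cis (- (t * w))) <= _).
  by rewrite ler_wpM2r ?nrm_ge0.
rewrite mul1r; apply: le_trans (nrm_cisB _ _) _.
by rewrite -opprB opprK addrC -mulrBr normrM distrC || (rewrite (_ : - (t * v) - - (t * w) = - (t * (v - w))); [rewrite normrN normrM | ring]).
Qed.

Lemma Erot0 t : Erot t 0 = 1.
Proof. by rewrite /Erot mul0r mulr0 oppr0 exp00 cis0 mulr1. Qed.

Lemma nrm_Erot_le1 t v : 0 <= v -> nrm (Erot t v) <= 1.
Proof.
move=> hv; rewrite nrmM nrm_cis mulr1 nrm_real ger0_norm ?exp_ge0//.
by apply: exp_le1; lra.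
Qed.

(** With [E v] and [E w] the two successive ratios, the second difference is [ut t a] times
    [(1 - E v)^2 + E v (E w - E v)]. Both parts are of order [a^(-2)], since [v <= 1 / a] and
    [|w - v| <= 1 / a^2]. *)
Lemma ut_diff2 t a : (0 < a)%N ->
  nrm (ut t a - 2 * ut t a.+1 + ut t a.+2) <=
  2 * (1 + `|t|) ^+ 2 * (Num.sqrt a%:R)^-1 / a%:R ^+ 2.
Proof.
move=> a0; set T := 1 + `|t|.
have T1 : 1 <= T by rewrite lerDl.
set x : R := a%:R; have hx : 1 <= x by rewrite /x ler1n.
have e1 : a.+1%:R = x + 1 :> R by rewrite natr1.
have e2 : a.+2%:R = x + 2 :> R by rewrite -natr1 e1; lra.
set v := ln (x + 1) - ln x; set w := ln (x + 2) - ln (x + 1).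
have hv : 0 <= v by rewrite /v subr_ge0 ler_ln; lra.
have hw : 0 <= w by rewrite /w subr_ge0 ler_ln; lra.
have xV : 0 < x^-1 by rewrite invr_gt0; lra.
have hv1 : v <= x^-1.
  by apply: ln_succ_le; lra.
have hvw : `|w - v| <= (x ^+ 2)^-1.
  have -> : w - v = - ln ((x + 1) ^+ 2 / (x * (x + 2))).
    rewrite lndiv ?exprn_gt0 ?mulr_gt0; try lra.
    by rewrite lnXn ?lnM /v /w; try lra.
  have hx2 : 0 < x * (x + 2) by rewrite mulr_gt0; lra.
  have ge1 : 1 <= (x + 1) ^+ 2 / (x * (x + 2)) by rewrite ler_pdivlMr// mul1r; nra.
  rewrite normrN ger0_norm; last exact: ln_ge0.
  apply: le_trans (ln_leB1 _) _; first by lra.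
  have -> : (x + 1) ^+ 2 / (x * (x + 2)) - 1 = (x * (x + 2))^-1.
    by field; apply/andP; split; rewrite gt_eqF//; lra.
  by rewrite lef_pV2 ?posrE ?exprn_gt0; nra.
have ha : 0 < a%:R :> R by rewrite ltr0n.
have eu1 : ut t a.+1 = ut t a * Erot t v by rewrite (ut_mul t ha) ?ltr0n// e1.
have eu2 : ut t a.+2 = ut t a * Erot t v * Erot t w.
  by rewrite -eu1 (@ut_mul t a.+1) ?ltr0n// e1 e2.
rewrite eu2 eu1.
have -> : ut t a - 2 * (ut t a * Erot t v) + ut t a * Erot t v * Erot t w =
   ut t a * ((1 - Erot t v) ^+ 2 + Erot t v * (Erot t w - Erot t v)) by ring.
rewrite nrmM nrm_ut -/x (_ : 2 * T ^+ 2 / Num.sqrt x / x ^+ 2 = (Num.sqrt x)^-1 * (2 * T ^+ 2 / x ^+ 2)); last by ring.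
rewrite ler_wpM2l ?invr_ge0 ?sqrtr_ge0//.
have b1 : nrm (1 - Erot t v) <= T * x^-1.
  rewrite -(Erot0 t); apply: le_trans (Erot_lip _ _ _) _ => //.
  by rewrite sub0r normrN (ger0_norm hv) ler_wpM2l//; pos.
have b2 : nrm (Erot t w - Erot t v) <= T * (x ^+ 2)^-1.
  by apply: le_trans (Erot_lip _ _ _) _ => //; rewrite ler_wpM2l//; pos.
apply: le_trans (nrmD _ _) _; rewrite nrmX nrmM.
have c1 : nrm (1 - Erot t v) ^+ 2 <= T ^+ 2 / x ^+ 2.
  by rewrite -expr_div_n lerXn2r ?nnegrE ?nrm_ge0// divr_ge0; lra.
have c2 : nrm (Erot t v) * nrm (Erot t w - Erot t v) <= T ^+ 2 / x ^+ 2.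
  apply: le_trans (_ : 1 * (T * (x ^+ 2)^-1) <= _).
    by rewrite ler_pM ?nrm_ge0 ?nrm_Erot_le1.
  rewrite mul1r ler_wpM2r ?invr_ge0 ?sqr_ge0// expr2; nra.
lra.
Qed.

Lemma etaV_step t n :
  nrm (etaV t n.+1 - etaV t n) <= (1 + `|t|) ^+ 2 * (Num.sqrt n.+1%:R)^-1 / n.+1%:R ^+ 2.
Proof.
have -> : etaV t n.+1 - etaV t n =
   (4^-1)%:C * ((-1) ^+ n * (ut t n.+1 - 2 * ut t n.+2 + ut t n.+3)).
  rewrite /etaV -mulrBr; congr (_ * _); rewrite !etaPS !exprS; ring.
rewrite !nrmM nrm_real nrm_sign mul1r ger0_norm ?invr_ge0//.
have := @ut_diff2 t n.+1 isT; set A := nrm _.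
set B := (_ ^+ 2)%R; set D := (Num.sqrt _)^-1; set E := (_ ^+ 2)^-1.
have : 0 <= B * D * E by rewrite /B /D /E; pos.
lra.
Qed.

Lemma sum_invsq_le (n m : nat) : (0 < n)%N -> (n <= m)%N ->
  \sum_(n <= i < m) (i.+1%:R ^+ 2)^-1 <= n%:R^-1 - m%:R^-1 :> R.
Proof.
move=> n0; elim: m => [|m IH]; first by lia.
rewrite leq_eqVlt => /orP[/eqP<-|]; first by rewrite big_geq// subrr.
rewrite ltnS => hnm; rewrite big_nat_recr//=.
apply: le_trans (lerD (IH hnm) (lexx _)) _.
have hm : 1 <= m%:R :> R by rewrite ler1n; lia.
rewrite -natr1; move: (m%:R : R) hm => x hx.
suff : ((x + 1) ^+ 2)^-1 <= x^-1 - (x + 1)^-1 by lra.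
have -> : x^-1 - (x + 1)^-1 = (x * (x + 1))^-1.
  by field; rewrite !gt_eqF//; lra.
by rewrite lef_pV2 ?posrE ?mulr_gt0 ?exprn_gt0//; nra.
Qed.

Lemma etaV_cauchy t n m : (0 < n)%N -> (n <= m)%N ->
  nrm (etaV t m - etaV t n) <= (1 + `|t|) ^+ 2 / (Num.sqrt n%:R * n%:R).
Proof.
move=> n0 hnm.
have -> : etaV t m - etaV t n = \sum_(n <= i < m) (etaV t i.+1 - etaV t i).
  by rewrite telescope_sumr.
apply: le_trans (nrm_sum _ _ _) _.
apply: le_trans (_ : \sum_(n <= i < m) (1 + `|t|) ^+ 2 / Num.sqrt n%:R * (i.+1%:R ^+ 2)^-1 <= _).
  rewrite !big_nat; apply: ler_sum => i /andP[hi _].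
  apply: le_trans (etaV_step t i) _; rewrite ler_wpM2r ?invr_ge0 ?sqr_ge0//.
  rewrite ler_wpM2l ?sqr_ge0// lef_pV2 ?posrE ?sqrtr_gt0 ?ltr0n//.
  by rewrite ler_wsqrtr// ler_nat; lia.
rewrite -mulr_sumr invfM mulrA ler_wpM2l//; first by pos.
apply: le_trans (sum_invsq_le n0 hnm) _.
by rewrite lerBlDr lerDl invr_ge0 ler0n.
Qed.

Lemma etaP_etaV t n : nrm (etaP t n - etaV t n) <= (Num.sqrt n.+1%:R)^-1.
Proof.
have -> : etaP t n - etaV t n =
  (4^-1)%:C * ((-1) ^+ n * (ut t n.+2 - 3 * ut t n.+1)).
  have hq : ((4 : R)^-1)%:C * 4%:R = 1 :> C.
    by rewrite -(rmorph_nat (real_complex R) 4) -(rmorphM (real_complex R)) mulVf ?rmorph1// pnatr_eq0.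
  have e : etaP t n = ((4 : R)^-1)%:C * 4%:R * etaP t n by rewrite hq mul1r.
  rewrite /etaV !etaPS !exprS [X in X - _ = _]e; ring.
rewrite !nrmM nrm_real nrm_sign mul1r ger0_norm ?invr_ge0//.
apply: le_trans (_ : 4^-1 * ((Num.sqrt n.+1%:R)^-1 + 3 * (Num.sqrt n.+1%:R)^-1) <= _); last by lra.
rewrite ler_wpM2l ?invr_ge0//; apply: le_trans (nrmB _ _) _; rewrite nrmM !nrm_ut.
have -> : nrm 3%:R = 3 by rewrite -(rmorph_nat (real_complex R) 3) nrm_real ger0_norm ?ler0n.
rewrite lerD2r lef_pV2 ?posrE ?sqrtr_gt0 ?ltr0n//.
by rewrite ler_wsqrtr// ler_nat.
Qed.

Lemma inv_small (e : R) : 0 < e -> exists N : nat, forall n, (N <= n)%N ->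
  (0 < n)%N /\ n%:R^-1 <= e.
Proof.
move=> he; exists (Num.truncn e^-1).+1 => n hn; split; first by lia.
rewrite -[e]invrK lef_pV2 ?posrE ?invr_gt0 ?ltr0n; try lia; last by [].
by apply: ltW; apply: lt_le_trans (truncnS_gt _) _; rewrite ler_nat.
Qed.

Lemma inv_sqrt_small (e : R) : 0 < e -> exists N : nat, forall n, (N <= n)%N ->
  (0 < n)%N /\ (Num.sqrt n%:R)^-1 <= e.
Proof.
move=> he; have [N hN] := inv_small (exprn_gt0 2 he); exists N => n /hN [n0 h].
split => //; rewrite -sqrtrV ?ler0n//.
by rewrite -[e](ger0_norm (ltW he)) -sqrtr_sqr ler_wsqrtr.
Qed.

Lemma etaP_cauchy t (e : R) : 0 < e -> exists N : nat, forall n m, (N <= n)%N -> (N <= m)%N ->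
  nrm (etaP t n - etaP t m) <= e.
Proof.
move=> he; set T := (1 + `|t|) ^+ 2.
have T1 : 1 <= T by rewrite expr_ge1// ?addr_ge0// lerDl.
have he' : 0 < e / (4 * T) by rewrite divr_gt0// mulr_gt0//; lra.
have [N hN] := inv_sqrt_small he'.
exists N => n m hn hm.
wlog hnm : n m hn hm / (n <= m)%N => [H|].
  by case/orP: (leq_total n m) => h; [|rewrite nrmBC]; apply: H.
have eT : e / (4 * T) <= e / 4.
  by rewrite ler_wpM2l ?(ltW he)// lef_pV2 ?posrE//; lra.
have [n0 hn'] := hN n hn.
have b k : (N <= k)%N -> nrm (etaP t k - etaV t k) <= e / 4.
  move=> hk; apply: le_trans (etaP_etaV t k) _; apply: le_trans (proj2 (hN k.+1 _)) eT.
  exact: leqW.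
have b2 : nrm (etaV t m - etaV t n) <= e / 4.
  apply: le_trans (etaV_cauchy t n0 hnm) _; rewrite -/T invfM.
  have h1 : n%:R^-1 <= 1 :> R by rewrite invf_le1 ?ltr0n ?ler1n.
  have h2 : (Num.sqrt n%:R)^-1 * n%:R^-1 <= e / (4 * T) * 1 :> R by rewrite ler_pM//; pos.
  apply: le_trans (ler_wpM2l _ h2) _; first by lra.
  by rewrite mulr1 le_eqVlt; apply/orP; left; apply/eqP; field; lra.
have -> : etaP t n - etaP t m = (etaP t n - etaV t n) - (etaV t m - etaV t n) - (etaP t m - etaV t m) by ring.
apply: le_trans (nrmB _ _) _; have := nrmB (etaP t n - etaV t n) (etaV t m - etaV t n).
have := b n hn; have := b m hm; lra.
Qed.

Lemma Re_scale (x : R) (z : C) : complex.Re (x%:C * z) = x * complex.Re z.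
Proof. by case: z => a b /=; rewrite mul0r subr0. Qed.

Lemma Im_scale (x : R) (z : C) : complex.Im (x%:C * z) = x * complex.Im z.
Proof. by case: z => a b /=; rewrite mul0r addr0. Qed.

Lemma sign_real k : (-1) ^+ k = ((-1) ^+ k : R)%:C.
Proof. by rewrite (rmorphXn (real_complex R)) rmorphN1. Qed.

(** [sum_f_R0] includes its last index, so the partial sum of index [n] has [n + 1] terms. *)
Lemma Re_etaP t n : eta_re_partial t n = complex.Re (etaP t n.+1).
Proof.
rewrite /eta_re_partial sum_f_R0E /etaP raddf_sum big_mkord; apply: eq_bigr => k _.
rewrite INRE RsqrtE [RHS](_ : _ = complex.Re ((-1) ^+ k * ut t k.+1))//.
rewrite sign_real !Re_scale /= cos_neg mulrA.
by rewrite !RealsE.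
Qed.

Lemma Im_etaP t n : eta_im_partial t n = complex.Im (etaP t n.+1).
Proof.
rewrite /eta_im_partial sum_f_R0E /etaP raddf_sum big_mkord; apply: eq_bigr => k _.
rewrite INRE RsqrtE [RHS](_ : _ = complex.Im ((-1) ^+ k * ut t k.+1))//.
rewrite sign_real !Im_scale /= sin_neg mulrA.
by rewrite !RealsE mulrN.
Qed.

Definition eta (t : R) : C := eta_re t +i* eta_im t.

Lemma norm_Re_le z : `|complex.Re z| <= nrm z.
Proof.
rewrite ler_norml Re_le_nrm andbT lerNl; apply: le_trans (_ : complex.Re (- z) <= _).
  by rewrite raddfN.
by rewrite -(nrmN z); exact: Re_le_nrm.
Qed.

Lemma norm_Im_le z : `|complex.Im z| <= nrm z.
Proof.
by case: z => a b; rewrite /nrm /= -[`|b|]sqrtr_sqr ler_wsqrtr// lerDr sqr_ge0.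
Qed.

Lemma nrm_le_ReIm z : nrm z <= `|complex.Re z| + `|complex.Im z|.
Proof.
rewrite -ler_sqr ?nnegrE ?nrm_ge0 ?addr_ge0// nrm_sqr sqrrD !real_normK ?num_real//.
by rewrite lerD2r lerDl mulrn_wge0// mulr_ge0.
Qed.

Lemma eta_re_cv t : Un_cv (eta_re_partial t) (eta_re t).
Proof.
rewrite /eta_re; apply: epsilon_spec.
have [|l hl] := R_complete (eta_re_partial t); last by exists l.
move=> e /RltP he0; have he : 0 < e := he0; clear he0; have [N hN] := etaP_cauchy t (divr_gt0 he (ltr0n R 2)).
exists N => n m hn hm; apply/RltP; rewrite RdistE !Re_etaP -raddfB.
apply: le_lt_trans (norm_Re_le _) _; apply: le_lt_trans (hN _ _ _ _) _; try lia.
lra.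
Qed.

Lemma eta_im_cv t : Un_cv (eta_im_partial t) (eta_im t).
Proof.
rewrite /eta_im; apply: epsilon_spec.
have [|l hl] := R_complete (eta_im_partial t); last by exists l.
move=> e /RltP he0; have he : 0 < e := he0; clear he0; have [N hN] := etaP_cauchy t (divr_gt0 he (ltr0n R 2)).
exists N => n m hn hm; apply/RltP; rewrite RdistE !Im_etaP -raddfB.
apply: le_lt_trans (norm_Im_le _) _; apply: le_lt_trans (hN _ _ _ _) _; try lia.
lra.
Qed.

Lemma eta_approx t n : (0 < n)%N ->
  nrm (eta t - etaV t n) <= (1 + `|t|) ^+ 2 / (Num.sqrt n%:R * n%:R).
Proof.
move=> n0; apply/ler_addgt0Pr => e he.
have he4 : 0 < e / 4 by lra.
have /RltP hp := he4.
have [N1 h1] := @eta_re_cv t (e / 4) hp.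
have [N2 h2] := @eta_im_cv t (e / 4) hp.
have [N3 h3] := inv_sqrt_small he4.
set m := (n + N1 + N2 + N3)%N.
have hr : `|complex.Re (etaP t m.+1) - eta_re t| <= e / 4.
  by have /RltP := h1 m ltac:(rewrite /m; lia); rewrite RdistE Re_etaP => /ltW.
have hi : `|complex.Im (etaP t m.+1) - eta_im t| <= e / 4.
  by have /RltP := h2 m ltac:(rewrite /m; lia); rewrite RdistE Im_etaP => /ltW.
have hP : nrm (eta t - etaP t m.+1) <= e / 2.
  rewrite nrmBC; apply: le_trans (nrm_le_ReIm _) _; rewrite !raddfB /=; lra.
have hV : nrm (etaP t m.+1 - etaV t m.+1) <= e / 4.
  apply: le_trans (etaP_etaV _ _) _; apply: (proj2 (h3 _ _)); rewrite /m; lia.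
have hC := etaV_cauchy t n0 (_ : n <= m.+1)%N.
have -> : eta t - etaV t n = (eta t - etaP t m.+1) + (etaP t m.+1 - etaV t m.+1) + (etaV t m.+1 - etaV t n) by ring.
apply: le_trans (nrmD _ _) _; have := nrmD (eta t - etaP t m.+1) (etaP t m.+1 - etaV t m.+1).
have := hC ltac:(rewrite /m; lia); lra.
Qed.

Definition den (t : R) : C := den_re t +i* den_im t.

Lemma denE t : den t = 1 - (Num.sqrt 2)%:C * cis (- (t * ln 2)).
Proof.
have e2 : IZR 2 = 2 by rewrite IZRposE INRE.
apply/eqP; rewrite eq_complex /= /den_re /den_im RsqrtE e2 !RealsE cos_neg sin_neg !RealsE.
by apply/andP; split; apply/eqP; ring.
Qed.

Lemma zeta_abs_critE t : zeta_abs_crit t = nrm (eta t) / nrm (den t).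
Proof.
rewrite /zeta_abs_crit RsqrtE !RealsE.
have hd : nrm (den t) != 0.
  apply/eqP => h0; have := nrm_sub_ge ((Num.sqrt 2)%:C * cis (- (t * ln 2))) 1.
  rewrite nrmBC -denE h0 nrmM nrm_cis mulr1 nrm1 nrm_real ger0_norm ?sqrtr_ge0// subr_le0 => h.
  have := sqr_sqrtr (ler0n R 2); have := sqrtr_ge0 (2 : R); nra.
have hd2 : den_re t ^+ 2 + den_im t ^+ 2 != 0.
  by have := nrm_sqr (den t); rewrite /den /= => <-; rewrite expf_neq0.
have -> : zeta_re t ^+ 2 + zeta_im t ^+ 2 = (nrm (eta t) / nrm (den t)) ^+ 2.
  rewrite [RHS]expr_div_n !nrm_sqr /= /zeta_re /zeta_im !RealsE; field.
  by rewrite hd2.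
by rewrite sqrtr_sqr ger0_norm// divr_ge0 ?nrm_ge0.
Qed.

(** The modulus of [1 - 2^(1-s)] lies between [sqrt 2 - 1] and [sqrt 2 + 1], hence in [[1/3, 3]]. *)
Lemma zeta_eta t : nrm (eta t) / 3 <= zeta_abs_crit t /\ zeta_abs_crit t <= 3 * nrm (eta t).
Proof.
rewrite zeta_abs_critE.
have s0 := sqrtr_ge0 (2 : R); have s2 := sqr_sqrtr (ler0n R 2).
have h1 : 3^-1 <= nrm (den t).
  apply: le_trans (_ : Num.sqrt 2 - 1 <= _); first nra.
  rewrite denE nrmBC; apply: le_trans (nrm_sub_ge _ _).
  by rewrite nrmM nrm_cis mulr1 nrm1 nrm_real ger0_norm.
have h2 : nrm (den t) <= 3.
  rewrite denE; apply: le_trans (nrmB _ _) _.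
  rewrite nrmM nrm_cis mulr1 nrm1 nrm_real ger0_norm//; nra.
have d0 : 0 < nrm (den t) by lra.
have e0 := nrm_ge0 (eta t); split.
  by rewrite ler_wpM2l// lef_pV2 ?posrE.
by rewrite ler_pdivrMr//; nra.
Qed.

(** * Squarefree numbers as sets of primes *)

Section Squarefree.
Variables (I : finType) (pr : I -> nat).
Hypothesis pr_prime : forall i, prime (pr i).
Hypothesis pr_inj : injective pr.

Definition nS (S : {set I}) : nat := \prod_(i in S) pr i.

Lemma nS_gt0 S : (0 < nS S)%N.
Proof. by rewrite prodn_cond_gt0// => i _; exact: prime_gt0. Qed.

Lemma pr_dvd_nS i S : (pr i %| nS S)%N = (i \in S).
Proof.
apply/idP/idP => [|iS]; last by rewrite /nS (bigD1 i)//= dvdn_mulr.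
rewrite /nS; elim/big_rec: _ => [|j x jS IH].
  by rewrite dvdn1 => /eqP h; have := pr_prime i; rewrite h.
rewrite Euclid_dvdM// => /orP[|//]; rewrite dvdn_prime2// => /eqP /pr_inj -> //.
Qed.

Lemma nS_inj : injective nS.
Proof. by move=> S T e; apply/setP => i; rewrite -!pr_dvd_nS e. Qed.

Lemma nSID (S T : {set I}) : nS S = (nS (S :&: T) * nS (S :\: T))%N.
Proof. by rewrite /nS (big_setID T). Qed.

Lemma coprime_nS (S T : {set I}) : [disjoint S & T] -> coprime (nS S) (nS T).
Proof.
move=> dST; rewrite /nS; elim/big_rec: _ => [|i x iS IH]; first by rewrite coprime1n.
rewrite coprimeMl IH andbT prime_coprime// pr_dvd_nS.
by rewrite (disjointFr dST iS).
Qed.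

Lemma coprime_nSD S T : coprime (nS (S :\: T)) (nS (T :\: S)).
Proof.
apply: coprime_nS; rewrite -setI_eq0; apply/eqP/setP => i; rewrite !inE.
by case: (i \in S); case: (i \in T).
Qed.

Lemma gcd_nS S T : gcdn (nS S) (nS T) = nS (S :&: T).
Proof.
rewrite (nSID S T) (nSID T S) setIC -muln_gcdr.
by have := coprime_nSD S T; rewrite /coprime => /eqP ->; rewrite muln1.
Qed.

Lemma nS_dvd (S : {set I}) d : {in S, forall i, (pr i %| d)%N} -> (nS S %| d)%N.
Proof.
move=> h; suff hs : forall s : seq I, uniq s -> {subset s <= S} -> (\prod_(i <- s) pr i %| d)%N.
  by rewrite /nS -big_enum; apply: hs; [exact: enum_uniq | move=> i; rewrite mem_enum].
elim=> [|i s IH] /=; first by rewrite big_nil dvd1n.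
move=> /andP[iNs us] ss; rewrite big_cons Gauss_dvd; last first.
  rewrite prime_coprime//; apply/negP => hd; move/negP: iNs; apply.
  move: hd; elim: s {IH us ss} => [|j s IH].
    by rewrite big_nil dvdn1 => /eqP e; have := pr_prime i; rewrite e.
  rewrite big_cons Euclid_dvdM// inE => /orP[|/IH->]; last by rewrite orbT.
  by rewrite dvdn_prime2// => /eqP/pr_inj->; rewrite eqxx.
rewrite h ?ss ?mem_head//= IH// => j js; apply: ss; by rewrite inE js orbT.
Qed.

Lemma dvd_nS (S : {set I}) d : (d %| nS S)%N -> d = nS [set i in S | (pr i %| d)%N].
Proof.
move=> dS; set T := [set i in S | _].
have hT : (nS T %| d)%N by apply: nS_dvd => i; rewrite inE => /andP[].
apply/eqP; rewrite eqn_dvd hT andbT.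
have : coprime d (nS (S :\: T)).
  rewrite coprime_sym /nS; elim/big_rec: _ => [|i x iD IH]; first by rewrite coprime1n.
  rewrite coprimeMl IH andbT prime_coprime//.
  by move: iD; rewrite !inE => /andP[+ iS]; rewrite iS.
move: dS; rewrite (nSID S T) => + hc; rewrite Gauss_dvdl//.
by rewrite (setIidPr _)//; apply/subsetP => i; rewrite inE => /andP[].
Qed.

Lemma nS_odd S : (forall i, odd (pr i)) -> odd (nS S).
Proof.
move=> ho; rewrite /nS; elim/big_rec: _ => // i x _ hx.
by rewrite oddM ho.
Qed.

Lemma natr_nS S : (nS S)%:R = \prod_(i in S) (pr i)%:R :> R.
Proof. by rewrite /nS natr_prod. Qed.

Lemma pr_gt0 i : 0 < (pr i)%:R :> R.
Proof. by rewrite ltr0n prime_gt0. Qed.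

Lemma pw_nS S a : pw (nS S)%:R a = \prod_(i in S) pw (pr i)%:R a.
Proof. by rewrite natr_nS pw_prod// => i _; exact: pr_gt0. Qed.

Lemma sum_sets (h : I -> bool -> R) :
  \sum_(S : {set I}) \prod_i h i (i \in S) = \prod_i (h i true + h i false).
Proof.
transitivity (\prod_i \sum_(b : bool) h i b); last first.
  by apply: eq_bigr => i _; rewrite big_bool.
rewrite bigA_distr_bigA (reindex (fun S : {set I} => [ffun i => i \in S])) /=.
  by apply: eq_bigr => S _; apply: eq_bigr => i _; rewrite ffunE.
exists (fun f : {ffun I -> bool} => [set i | f i]) => x _.
  by apply/setP => i; rewrite inE ffunE.
by apply/ffunP => i; rewrite ffunE inE.
Qed.

Lemma sum_sets2 (h : I -> bool -> bool -> R) :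
  \sum_(S : {set I}) \sum_(T : {set I}) \prod_i h i (i \in S) (i \in T) =
  \prod_i (h i true true + h i true false + h i false true + h i false false).
Proof.
transitivity (\sum_(S : {set I}) \prod_i (h i (i \in S) true + h i (i \in S) false)).
  by apply: eq_bigr => S _; rewrite (sum_sets (fun i b => h i (i \in S) b)).
rewrite (sum_sets (fun i b => h i b true + h i b false)).
by apply: eq_bigr => i _; rewrite !addrA.
Qed.

(** A multiplicative function of the pair [(nS S, nS T)]: [a] at the common primes, [b] and [b'] at
    the primes of one number only. The quadratic forms of the resonator have this shape, so their
    complete sums are Euler products. *)
Definition ker (a b b' : I -> R) (S T : {set I}) : R :=
  (\prod_(i in S :&: T) a i) * (\prod_(i in S :\: T) b i) * (\prod_(i in T :\: S) b' i).

Lemma kerE a b b' S T : ker a b b' S T = \prod_i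
  (if i \in S then (if i \in T then a i else b i) else (if i \in T then b' i else 1)).
Proof.
rewrite /ker [X in X * _ * _]big_mkcond [X in _ * X * _]big_mkcond [X in _ * _ * X]big_mkcond.
rewrite -!big_split /=; apply: eq_bigr => i _; rewrite !inE.
by case: (i \in S); case: (i \in T) => /=; rewrite ?mulr1 ?mul1r.
Qed.

Lemma sum_ker a b b' : \sum_S \sum_T ker a b b' S T = \prod_i (1 + a i + b i + b' i).
Proof.
transitivity (\sum_(S : {set I}) \sum_(T : {set I}) \prod_i
  (if i \in S then (if i \in T then a i else b i) else (if i \in T then b' i else 1))).
  by apply: eq_bigr => S _; apply: eq_bigr => T _; rewrite kerE.
rewrite (sum_sets2 (fun i s t => if s then (if t then a i else b i) else (if t then b' i else 1))).
by apply: eq_bigr => i _; ring.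
Qed.

Variable N : nat.
Hypothesis N_gt0 : (0 < N)%N.

Definition trunc_ker a b b' : R :=
  \sum_(S | (nS S <= N)%N) \sum_(T | (nS T <= N)%N) ker a b b' S T.

Variable rho : R.
Hypothesis rho_ge0 : 0 <= rho.

Lemma rankin_weight S : (N < nS S)%N -> 1 <= pw N%:R (- rho) * pw (nS S)%:R rho.
Proof.
move=> h; rewrite pwN -ler_pdivrMl ?invr_gt0 ?pw_gt0// invrK mulr1.
by rewrite ler_pw ?ltr0n ?ler_nat// ltnW.
Qed.

(** Rankin's trick: a pair leaves the truncation when one of its numbers exceeds [N] and is then
    weighted by [(n / N)^rho]. There is one product for each of the two numbers; the common primes
    carry the weight in both. *)
Definition rk_bound (a b b' : I -> R) : R := pw N%:R (- rho) *
  (\prod_i (1 + a i * pw (pr i)%:R rho + b i * pw (pr i)%:R rho + b' i) +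
   \prod_i (1 + a i * pw (pr i)%:R rho + b i + b' i * pw (pr i)%:R rho)).

Lemma rankin_ker a b b' (A B B' : I -> R) :
  (forall i, `|a i| <= A i) -> (forall i, `|b i| <= B i) -> (forall i, `|b' i| <= B' i) ->
  `|trunc_ker a b b' - \prod_i (1 + a i + b i + b' i)| <= rk_bound A B B'.
Proof.
move=> ha hb hb'.
have hker S T : `|ker a b b' S T| <= ker A B B' S T.
  rewrite /ker !normrM !normr_prod !ler_pM ?mulr_ge0 ?prodr_ge0//;
    try (by move=> i _; exact: normr_ge0); apply: ler_prod => i _; rewrite normr_ge0 /=;
    by [exact: ha | exact: hb | exact: hb'].
have kA0 S T : 0 <= ker A B B' S T by apply: le_trans (hker S T); exact: normr_ge0.
rewrite -sum_ker distrC.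
have -> : \sum_S \sum_T ker a b b' S T - trunc_ker a b b' =
   \sum_S \sum_T (~~ ((nS S <= N) && (nS T <= N))%N)%:R * ker a b b' S T.
  rewrite /trunc_ker [X in _ - X]big_mkcond -sumrB; apply: eq_bigr => S _.
  case: ifP => hS; last by rewrite subr0; apply: eq_bigr => T _; rewrite mul1r.
  rewrite [X in _ - X]big_mkcond -sumrB; apply: eq_bigr => T _ /=.
  by case: ifP => hT; rewrite ?subrr ?subr0 ?mul0r ?mul1r.
apply: le_trans (ler_norm_sum _ _ _) _.
apply: le_trans (_ : \sum_S \sum_T pw N%:R (- rho) *
   (pw (nS S)%:R rho * ker A B B' S T + pw (nS T)%:R rho * ker A B B' S T) <= _).
  apply: ler_sum => S _; apply: le_trans (ler_norm_sum _ _ _) _; apply: ler_sum => T _.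
  have w0 U : 0 <= pw N%:R (- rho) * pw (nS U)%:R rho by pos.
  have w : (~~ ((nS S <= N) && (nS T <= N))%N)%:R <=
      pw N%:R (- rho) * pw (nS S)%:R rho + pw N%:R (- rho) * pw (nS T)%:R rho.
    case: (leqP (nS S) N) => hS; case: (leqP (nS T) N) => hT /=.
    - exact: addr_ge0.
    - by apply: le_trans (rankin_weight hT) _; rewrite lerDr.
    - by apply: le_trans (rankin_weight hS) _; rewrite lerDl.
    - by apply: le_trans (rankin_weight hS) _; rewrite lerDl.
  rewrite normrM normr_nat.
  apply: le_trans (ler_pM (ler0n _ _) (normr_ge0 _) w (hker S T)) _.
  by rewrite le_eqVlt; apply/orP; left; apply/eqP; ring.
under eq_bigr => S _ do rewrite -mulr_sumr big_split /=.
rewrite -mulr_sumr big_split /= /rk_bound le_eqVlt; apply/orP; left; apply/eqP.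
congr (_ * (_ + _)).
  transitivity (\sum_S \sum_T ker (fun i => A i * pw (pr i)%:R rho) (fun i => B i * pw (pr i)%:R rho) B' S T).
    apply: eq_bigr => S _; apply: eq_bigr => T _.
    by rewrite /ker !big_split /= pw_nS (big_setID T) /=; ring.
  by rewrite sum_ker.
transitivity (\sum_S \sum_T ker (fun i => A i * pw (pr i)%:R rho) B (fun i => B' i * pw (pr i)%:R rho) S T).
  apply: eq_bigr => S _; apply: eq_bigr => T _.
  by rewrite /ker !big_split /= pw_nS (big_setID S) /= setIC; ring.
by rewrite sum_ker.
Qed.

Lemma sum_le_card : \sum_(S | (nS S <= N)%N) (1 : R) <= N%:R.
Proof.
rewrite sumr_const ler_nat.
pose h (S : {set I}) : 'I_N.+1 := inord (nS S).
have : (#|[pred S : {set I} | (nS S <= N)%N]| <= #|[pred x : 'I_N.+1 | (0 < x)%N]|)%N.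
  rewrite -(@card_in_imset _ _ h); last first.
    move=> S T; rewrite !inE => hS hT /(congr1 val) /=; rewrite !inordK//.
    exact: nS_inj.
  apply/subset_leq_card/subsetP => x /imsetP[S]; rewrite inE => hS ->.
  by rewrite inE inordK// nS_gt0.
move/leq_trans; apply.
rewrite -ltnS -[X in (_ < X)%N](card_ord N.+1) -(cardC [pred x : 'I_N.+1 | (0 < x)%N]).
rewrite -[X in (X < _)%N]addn0 ltn_add2l; apply/card_gt0P; exists ord0.
by rewrite !inE.
Qed.

Variable f : I -> R.
Hypothesis f_ge0 : forall i, 0 <= f i.
Definition fS (S : {set I}) : R := \prod_(i in S) f i.
(** The diagonal of the mean square of the resonator. *)
Definition FN : R := \sum_(S | (nS S <= N)%N) fS S ^+ 2.

Lemma fS_ge0 S : 0 <= fS S.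
Proof. by apply: prodr_ge0 => i _. Qed.

Lemma fSID (S T : {set I}) : fS S = fS (S :&: T) * fS (S :\: T).
Proof. by rewrite /fS (big_setID T). Qed.

Lemma FN_ge0 : 0 <= FN.
Proof. by apply: sumr_ge0 => S _; exact: sqr_ge0. Qed.

(** Cauchy-Schwarz, with at most [N] sets because [nS] is injective. *)
Lemma sum_fS_sqr : (\sum_(S | (nS S <= N)%N) fS S) ^+ 2 <= N%:R * FN.
Proof.
set s := \sum_(S | _) fS S; set c := \sum_(S | (nS S <= N)%N) (1 : R).
have c0 : 0 <= c by apply: sumr_ge0.
(* [sum_(S,T) (f_S - f_T)^2 >= 0] *)
have h : 0 <= \sum_(S | (nS S <= N)%N) \sum_(T | (nS T <= N)%N) (fS S - fS T) ^+ 2.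
  by apply: sumr_ge0 => S _; apply: sumr_ge0 => T _; exact: sqr_ge0.
have e : \sum_(S | (nS S <= N)%N) \sum_(T | (nS T <= N)%N) (fS S - fS T) ^+ 2 =
    2 * (c * FN - s ^+ 2).
  transitivity (\sum_(S | (nS S <= N)%N) (fS S ^+ 2 * c + FN - 2 * fS S * s)).
    apply: eq_bigr => S _; rewrite /c /FN /s !mulr_sumr -big_split -sumrB /=.
    by apply: eq_bigr => T _; ring.
  rewrite sumrB big_split /= -mulr_suml -mulr_suml -/FN -mulr_sumr -/s.
  have -> : \sum_(S | (nS S <= N)%N) FN = c * FN.
    by rewrite /c mulr_suml; apply: eq_bigr => S _; rewrite mul1r.
  ring.
have := sum_le_card; rewrite -/c => hc; have := FN_ge0; rewrite e in h; nra.
Qed.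

Definition F0 : R := \prod_i (1 + f i ^+ 2).

Lemma FN_le : FN <= F0.
Proof.
rewrite /F0.
have -> : \prod_i (1 + f i ^+ 2) = \sum_(S : {set I}) fS S ^+ 2.
  under eq_bigr do rewrite addrC.
  rewrite -(sum_sets (fun i b => if b then f i ^+ 2 else 1)); apply: eq_bigr => S _.
  by rewrite /fS -prodrXl [RHS]big_mkcond.
rewrite /FN big_mkcond; apply: ler_sum => S _; case: ifP => // _; exact: sqr_ge0.
Qed.

Lemma FN_ge : F0 - pw N%:R (- rho) * \prod_i (1 + f i ^+ 2 * pw (pr i)%:R rho) <= FN.
Proof.
have eS (h : I -> R) : \prod_i (1 + h i) = \sum_(S : {set I}) \prod_(i in S) h i.
  under eq_bigr do rewrite addrC.
  rewrite -(sum_sets (fun i b => if b then h i else 1)); apply: eq_bigr => S _.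
  by rewrite [RHS]big_mkcond.
rewrite /F0 !eS mulr_sumr -sumrB /FN [X in _ <= X]big_mkcond; apply: ler_sum => S _.
have e2 : \prod_(i in S) f i ^+ 2 = fS S ^+ 2 by rewrite /fS prodrXl.
have -> : \prod_(i in S) (f i ^+ 2 * pw (pr i)%:R rho) = fS S ^+ 2 * pw (nS S)%:R rho.
  by rewrite pw_nS -e2 -big_split.
rewrite e2.
have h0 : 0 <= fS S ^+ 2 by exact: sqr_ge0.
case: (leqP (nS S) N) => h.
  rewrite lerBlDr lerDl; pos.
have := rankin_weight h; rewrite subr_le0; nra.
Qed.

End Squarefree.

(** * Correlation of square waves *)

Section Periodic.
Variables (L : nat) (F : nat -> R).
Hypothesis F_per : forall k, F (k + L)%N = F k.

Lemma period_mul q k : F (k + q * L)%N = F k.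
Proof. by elim: q => [|q IH]; rewrite ?addn0// mulSn addnCA addnC F_per. Qed.

Lemma sum_period_shift c : \sum_(k < L) F (k + c)%N = \sum_(k < L) F k.
Proof.
elim: c => [|c IH]; first by apply: eq_bigr => k _; rewrite addn0.
rewrite -IH; case: L F_per => [|l] hp; first by rewrite !big_ord0.
rewrite big_ord_recr big_ord_recl /= addrC; congr (_ + _).
  by rewrite add0n -(hp c); congr F; lia.
by apply: eq_bigr => k _; congr F; rewrite /bump /=; lia.
Qed.

Lemma sum_period_mul q : \sum_(k < q * L) F k = q%:R * \sum_(k < L) F k.
Proof.
rewrite sum_nat_blocks exchange_big /=.
under eq_bigr => j _ do under eq_bigr => x _ do rewrite period_mul.
by rewrite sumr_const card_ord mulr_natl.
Qed.

Lemma period_mod k : F (k %% L)%N = F k.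
Proof. by rewrite {2}(divn_eq k L) addnC period_mul. Qed.

End Periodic.

Lemma norm_sum_le1 (r : nat) (G : nat -> R) : (forall k, `|G k| <= 1) ->
  `|\sum_(k < r) G k| <= r%:R.
Proof.
move=> G1; apply: le_trans (ler_norm_sum _ _ _) _.
apply: le_trans (_ : \sum_(k < r) 1 <= _); first by apply: ler_sum => k _.
by rewrite sumr_const card_ord.
Qed.

Lemma period_interval_mean (L : nat) (F : nat -> R) a n :
  (forall k, F (k + L)%N = F k) -> (0 < L)%N -> (forall k, `|F k| <= 1) ->
  `|\sum_(k < n) F (a + k)%N - n%:R / L%:R * \sum_(k < L) F k| <= 2 * L%:R.
Proof.
move=> Fp L0 F1; have hL : 0 < L%:R :> R by rewrite ltr0n.
pose G k := F (a + k)%N.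
have Gp k : G (k + L)%N = G k by rewrite /G addnA Fp.
have -> : \sum_(k < L) F k = \sum_(k < L) G k.
  by rewrite -(sum_period_shift Fp a); apply: eq_bigr => k _; rewrite /G addnC.
have G1 k : `|G k| <= 1 by exact: F1.
rewrite -[\sum_(k < n) _]/(\sum_(k < n) G k).
set S := \sum_(k < L) G k.
have hS : `|S| <= L%:R by exact: norm_sum_le1.
have hn := divn_eq n L; set q := (n %/ L)%N in hn; set r := (n %% L)%N in hn.
have rL : (r < L)%N by rewrite ltn_mod.
have -> : \sum_(k < n) G k = q%:R * S + \sum_(k < r) G k.
  rewrite hn -(big_mkord xpredT G) (big_cat_nat (n := (q * L)%N)) ?leq_addr//=.
  rewrite big_mkord sum_period_mul//; congr (_ + _).
  rewrite -{1}[(q * L)%N]add0n big_addn addKn big_mkord.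
  by apply: eq_bigr => k _; rewrite period_mul.
have -> : n%:R / L%:R * S = q%:R * S + r%:R / L%:R * S.
  by rewrite hn natrD natrM mulrDl mulfK ?gt_eqF// mulrDl.
rewrite opprD addrACA subrr add0r; apply: le_trans (ler_normB _ _) _.
have h1 : `|\sum_(k < r) G k| <= L%:R.
  by apply: le_trans (norm_sum_le1 _ G1) _; rewrite ler_nat ltnW.
have h2 : `|r%:R / L%:R * S| <= L%:R.
  rewrite normrM ger0_norm ?divr_ge0 ?ler0n// -[X in _ <= X]mul1r ler_pM ?divr_ge0 ?ler0n//.
  by rewrite ler_pdivrMr// mul1r ler_nat ltnW.
lra.
Qed.

(** A square wave of period [2 m]. Alternating sums over the multiples of [m] in an interval are
    half differences of its values. *)
Definition chi (m k : nat) : R := (-1) ^+ (k %/ m).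

Lemma chi_period m q k : (0 < m)%N -> chi m (k + q * (2 * m))%N = chi m k.
Proof.
move=> m0; rewrite /chi (_ : k + q * (2 * m) = (2 * q) * m + k)%N; last by lia.
by rewrite divnMDl// exprD exprM sqrr_sign || rewrite divnMDl// exprD exprM expr2 mulrNN mulr1 expr1n mul1r.
Qed.

Lemma chi_norm m k : `|chi m k| = 1.
Proof. by rewrite /chi normrX normrN normr1 expr1n. Qed.

Lemma chi_jumps (m J : nat) (G : nat -> R) : (0 < m)%N ->
  \sum_(k < J * m) (chi m k.+1 - chi m k) * G k =
  \sum_(i < J) -2 * (-1) ^+ i * G (m.-1 + i * m)%N.
Proof.
case: m => // m _.
rewrite (sum_nat_blocks J m.+1 (fun k => (chi m.+1 k.+1 - chi m.+1 k) * G k)).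
rewrite big_ord_recr /= [X in X + _]big1 ?add0r.
  apply: eq_bigr => i _; congr (_ * _).
  have e1 : ((m + i * m.+1).+1 = i.+1 * m.+1 + 0)%N by lia.
  rewrite /chi e1 divnMDl// div0n addn0 addnC divnMDl// divn_small// addn0.
  by rewrite exprS; ring.
move=> x _; apply: big1 => i _.
have hx := ltn_ord x.
rewrite /chi -addSn [(x.+1 + _)%N]addnC [(x + _)%N]addnC !divnMDl//.
by rewrite !divn_small ?subrr ?mul0r//; lia.
Qed.

Lemma sum_sign n : \sum_(x < n) (-1) ^+ x = (odd n)%:R :> R.
Proof.
elim: n => [|n IH]; first by rewrite big_ord0.
rewrite big_ord_recr /= IH -signr_odd; case: (odd n) => /=; rewrite ?expr0 ?expr1; lra.
Qed.

Lemma sum_sign_chi n : odd n -> \sum_(x < 2 * n) (-1) ^+ x * chi n x = 2.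
Proof.
move=> on; have n0 : (0 < n)%N by case: n on.
rewrite mul2n -addnn -(big_mkord xpredT (fun x => (-1) ^+ x * chi n x)).
rewrite (big_cat_nat (n := n)) ?leq_addr//=.
have -> : \sum_(0 <= i < n) (-1) ^+ i * chi n i = 1.
  rewrite big_mkord -[RHS](_ : (odd n)%:R = _); last by rewrite on.
  rewrite -sum_sign; apply: eq_bigr => i _.
  by rewrite /chi divn_small ?ltn_ord// expr0 mulr1.
have -> : \sum_(n <= i < n + n) (-1) ^+ i * chi n i = 1.
  rewrite -{1}[n]add0n big_addn addKn big_mkord -[RHS](_ : (odd n)%:R = _); last by rewrite on.
  rewrite -sum_sign; apply: eq_bigr => i _.
  rewrite /chi (_ : i + n = 1 * n + i)%N; last by lia.
  rewrite divnMDl// divn_small ?ltn_ord// addn0 expr1 mul1n.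
  by rewrite exprD -[(-1) ^+ n]signr_odd on expr1; ring.
lra.
Qed.

Definition corr (m n s : nat) : R := \sum_(k < 2 * m * n) chi m (k + s) * chi n k.

Definition wave (g s : nat) : R := \sum_(i < s) chi g i.

(** A step in [s] samples [chi n] at the [2 n] jumps of [chi m]. Divided by [g], the sample points
    run [g] times through all residues modulo [2 n'], since [m'] is odd and prime to [n']. With the
    sign of the jump the summand becomes [(-1)^x chi n' x], whose sum over a period is 2. *)
Lemma corrS m n s : odd m -> odd n ->
  corr m n s.+1 - corr m n s = - 4 * (gcdn m n)%:R * chi (gcdn m n) s.
Proof.
move=> om on; have m0 : (0 < m)%N by case: m om.
have n0 : (0 < n)%N by case: n on.
set g := gcdn m n; have g0 : (0 < g)%N by rewrite gcdn_gt0 m0.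
have [m' em] := dvdnP (dvdn_gcdl m n); have [n' en] := dvdnP (dvdn_gcdr m n).
rewrite -/g in em en.
have om' : odd m' by move: om; rewrite em oddM => /andP[].
have on' : odd n' by move: on; rewrite en oddM => /andP[].
have n'0 : (0 < n')%N by case: n' on' {en}.
have cop : coprime m' (2 * n').
  rewrite coprimeMr coprimen2 om' /= /coprime -(eqn_pmul2r g0) muln_gcdl -em -en mul1n.
  by [].
set L := (2 * m * n)%N; have L0 : (0 < L)%N by rewrite !muln_gt0 m0 n0.
pose F k := (chi m (k + s.+1) - chi m (k + s)) * chi n k.
have chiL k q : chi m (k + q * L) = chi m k.
  by rewrite (_ : q * L = (q * n) * (2 * m))%N ?chi_period//; rewrite /L; lia.
have chiL' k q : chi n (k + q * L) = chi n k.
  by rewrite (_ : q * L = (q * m) * (2 * n))%N ?chi_period//; rewrite /L; lia.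
have Fp k : F (k + L)%N = F k.
  rewrite /F; congr ((_ - _) * _); last by rewrite -[L]mul1n chiL'.
    by rewrite addnAC -[L]mul1n chiL.
  by rewrite addnAC -[L]mul1n chiL.
have -> : corr m n s.+1 - corr m n s = \sum_(k < L) F k.
  by rewrite /corr -sumrB; apply: eq_bigr => k _; rewrite /F mulrBl.
(* [c] is [- s] modulo the period: shifting by it fixes the places of the jumps and moves the
   dependence on [s] into the factor [chi n]. *)
pose c := (L * s.+1 - s)%N.
have hc : (c + s = s.+1 * L)%N.
  by rewrite /c mulnC subnK//; apply: leq_trans (leqnSn s) _; exact: leq_pmulr.
have c1 : (0 < c)%N.
  by rewrite -(ltn_add2r s) hc add0n; apply: leq_trans (leq_pmulr _ L0).
rewrite -(sum_period_shift Fp c).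
have -> : \sum_(k < L) F (k + c)%N =
   \sum_(k < (2 * n) * m) (chi m k.+1 - chi m k) * chi n (k + c).
  rewrite (_ : 2 * n * m = L)%N; last by rewrite /L; lia.
  apply: eq_bigr => k _; rewrite /F; congr ((_ - _) * _).
    by rewrite (_ : k + c + s.+1 = k.+1 + s.+1 * L)%N ?chiL// -hc; nlia.
  by rewrite (_ : k + c + s = k + s.+1 * L)%N ?chiL// -hc; nlia.
rewrite (chi_jumps _ (fun k => chi n (k + c)))//.
pose d := ((c - 1) %/ g)%N.
have chin i : chi n (m.-1 + i * m + c) = chi n' (m' * i.+1 + d).
  rewrite /chi {1}en [(n' * g)%N]mulnC divnMA; congr ((-1) ^+ (_ %/ _)).
  rewrite /d (_ : m.-1 + i * m + c = (m' * i.+1) * g + (c - 1))%N; last first.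
    by rewrite mulnAC -em mulnS; move: m0 c1; clear; nlia.
  by rewrite divnMDl.
pose G x := (-1) ^+ x * chi n' x.
have Gp k : G (k + 2 * n')%N = G k.
  by rewrite /G -{2}[(2 * n')%N]mul1n chi_period// exprD exprM sqrrN expr1n expr1n mulr1.
have step i : -2 * (-1) ^+ i * chi n (m.-1 + i * m + c) =
    2 * (-1) ^+ d * G (m' * i.+1 + d)%N.
  rewrite chin /G -[(-1) ^+ (m' * _ + d)]signr_odd oddD oddM om' /=.
  rewrite -[(-1) ^+ i]signr_odd -[(-1) ^+ d]signr_odd.
  by case: (odd i); case: (odd d); rewrite /= ?expr0 ?expr1; ring.
under eq_bigr => i _ do rewrite step.
rewrite -mulr_sumr.
have -> : \sum_(i < 2 * n) G (m' * i.+1 + d)%N = g%:R * 2.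
  rewrite (_ : 2 * n = g * (2 * n'))%N; last by rewrite en; lia.
  rewrite (@sum_period_mul (2 * n') (fun i => G (m' * i.+1 + d)%N)); last first.
    move=> k; rewrite (_ : m' * (k + 2 * n').+1 + d = m' * k.+1 + d + m' * (2 * n'))%N; last by lia.
    by rewrite (period_mul Gp).
  congr (_ * _); rewrite -(sum_sign_chi on').
  have N0 : (0 < 2 * n')%N by lia.
  pose h (i : 'I_(2 * n')) : 'I_(2 * n') := Ordinal (ltn_pmod (m' * i.+1 + d) N0).
  have hinj : injective h.
    move=> i j /(congr1 val) /= /eqP; rewrite eqn_modDr => hij; apply: val_inj => /=.
    wlog hle : i j hij / (i <= j)%N => [H|].
      by case/orP: (leq_total i j) => hl; [exact: H | apply/esym/H; rewrite // eq_sym].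
    move: hij; rewrite eq_sym eqn_mod_dvd ?leq_mul// -mulnBr Gauss_dvdr; last by rewrite coprime_sym.
    rewrite subSS; case: (posnP (j - i)) => [h0 _|hp /(dvdn_leq hp)]; first by lia.
    by have := ltn_ord j; lia.
  rewrite [RHS](reindex_inj hinj) /=; apply: eq_bigr => i _.
  by rewrite -[RHS]/(G _) (period_mod Gp).
(* [c - 1] is an even multiple of [g] minus [s + 1], so its quotient by [g] has the parity opposite
   to that of [s / g]. *)
have dE : (-1) ^+ d = - chi g s.
  pose E := (2 * (m * n'))%N.
  have eL : (L = E * g)%N by rewrite /L /E en !mulnA.
  have E0 : (0 < E)%N by rewrite /E !muln_gt0 m0 n'0.
  have hle : ((s %/ g).+1 <= E * s.+1)%N.
    by apply: leq_trans (leq_pmull _ E0); rewrite ltnS leq_div.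
  have ed : d = (E * s.+1 - (s %/ g).+1)%N.
    have hs := divn_eq s g; have hr := ltn_pmod s g0.
    rewrite /d /c; set a := (s %/ g)%N in hs hle *; set r := (s %% g)%N in hs hr.
    have hx := subnK hle; set x := (E * s.+1 - a.+1)%N in hx *.
    have e1 : (L * s.+1 = x * g + a * g + g)%N.
      by rewrite eL mulnAC -hx mulnDl mulSn; move: (x * g)%N (a * g)%N; clear; nlia.
    have e2 : (L * s.+1 - s - 1 = x * g + (g - 1 - r))%N.
      have aux X A s' r' g' : s' = (A + r')%N -> (r' < g')%N ->
        (X + A + g' - s' - 1 = X + (g' - 1 - r'))%N by clear; nlia.
      by rewrite e1; exact: aux hs hr.
    by rewrite e2 divnMDl// [((g - 1 - r) %/ g)%N]divn_small ?addn0//; move: g0; clear; nlia.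
  have oE : ~~ odd (E * s.+1) by rewrite oddM negb_and oddM.
  rewrite /chi -[LHS]signr_odd ed oddB// (negPf oE) /= -[(-1) ^+ (s %/ g)]signr_odd.
  by case: (odd (s %/ g)); rewrite /= ?expr0 ?expr1; ring.
rewrite dE; ring.
Qed.

Lemma corrE m n s : odd m -> odd n ->
  corr m n s = corr m n 0 - 4 * (gcdn m n)%:R * wave (gcdn m n) s.
Proof.
move=> om on; elim: s => [|s IH]; first by rewrite /wave big_ord0 mulr0 subr0.
have := corrS s om on; rewrite /wave big_ord_recr /= -/(wave _ s) IH => h.
lra.
Qed.

(** The sum of [(-1)^a] over the multiples [(a + 1) m] in [(k, k + s]]; it is -1, 0 or 1. *)
Definition dB (m s k : nat) : R := (chi m k - chi m (k + s)) / 2.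

(** Expanding the product gives two unshifted correlations, which agree, and two shifted ones given
    by [corrE]; [corr m n 0] cancels. *)
Lemma dB_corr m n s : odd m -> odd n ->
  \sum_(k < 2 * m * n) dB m s k * dB n s k =
  2 * (gcdn m n)%:R * wave (gcdn m n) s.
Proof.
move=> om on; have m0 : (0 < m)%N by case: m om.
have n0 : (0 < n)%N by case: n on.
pose F k := chi m k * chi n k.
have Fp k : F (k + 2 * m * n)%N = F k.
  rewrite /F; congr (_ * _); last by rewrite (mulnC 2) -mulnA chi_period.
  by rewrite (_ : 2 * m * n = n * (2 * m))%N ?chi_period//; lia.
have e0 : \sum_(k < 2 * m * n) F (k + s)%N = corr m n 0.
  by rewrite (sum_period_shift Fp); apply: eq_bigr => k _; rewrite addn0.
have e1 : corr n m s = \sum_(k < 2 * m * n) chi m k * chi n (k + s).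
  rewrite /corr (_ : 2 * n * m = 2 * m * n)%N; last by lia.
  by apply: eq_bigr => k _; rewrite mulrC.
have e2 : corr n m 0 = corr m n 0.
  rewrite /corr (_ : 2 * n * m = 2 * m * n)%N; last by lia.
  by apply: eq_bigr => k _; rewrite addn0 mulrC.
have h1 := corrE s om on; have h2 := corrE s on om; rewrite gcdnC e2 in h2.
transitivity ((corr m n 0 + \sum_(k < 2 * m * n) F (k + s)%N - corr m n s - corr n m s) / 4).
  rewrite e1 /corr -big_split -!sumrB /= mulr_suml; apply: eq_bigr => k _.
  by rewrite /dB /F addn0; lra.
rewrite e0 h1 h2; lra.
Qed.

(** * Convex weights *)

Lemma alt_sum_bound (a : nat -> R) (n m : nat) :
  (forall k, (n <= k)%N -> a k.+1 <= a k) -> (forall k, (n <= k)%N -> 0 <= a k) -> (n <= m)%N ->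
  0 <= (-1) ^+ n * \sum_(n <= k < m) (-1) ^+ k * a k <= a n.
Proof.
move=> dec pos0 hnm; rewrite -(subnK hnm).
move: (m - n)%N => d {hnm}; elim: d n dec pos0 => [|d IH] n dec pos0.
  by rewrite add0n big_geq// mulr0 lexx pos0.
rewrite big_ltn; last by lia.
rewrite addSnnS; have /andP[h1 h2] := IH n.+1 (fun k hk => dec k (ltnW hk)) (fun k hk => pos0 k (ltnW hk)).
set S := \sum_(_ <= _ < _) _ in h1 h2 *.
have sq : (-1) ^+ n * (-1) ^+ n = 1 :> R by rewrite -expr2 sqrr_sign.
rewrite exprS in h1 h2.
have -> : (-1) ^+ n * ((-1) ^+ n * a n + S) = a n + (-1) ^+ n * S.
  by rewrite mulrDr mulrA sq mul1r.
have := dec n (leqnn n); lra.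
Qed.

Section Weights.
Variable kap : R.
Hypothesis kap_gt0 : 0 < kap.
Hypothesis kap_le : kap <= 2^-1.

(** The power [k^(-kap)], with the value at 0 raised to 2 so that the second difference [om] is
    positive at 1 as well. *)
Definition phi (k : nat) : R := if k is 0 then 2 else pw k%:R (- kap).
Definition psi (k : nat) : R := phi k - phi k.+1.
Definition om (s : nat) : R := psi s.-1 - psi s.

Lemma phiS k : phi k.+1 = pw k.+1%:R (- kap). Proof. by []. Qed.

(** It allows [1 / s^2], which the large sieve produces, to be replaced by [om s] at the cost of
    [s^kap / kap]. *)
Lemma om_ge s : (0 < s)%N -> kap * pw s%:R (- kap) / s%:R ^+ 2 <= om s.
Proof.
case: s => // s _; rewrite /om /psi /=.
case: s => [|s].
  rewrite /phi pw1x mulr1 expr1n divr1.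
  have h : 1 - kap * ln 2 <= pw 2 (- kap).
    by apply: le_trans (exp_ge1D _); lra.
  have h2 : ln 2 <= 1 :> R by have := @ln_leB1 2 (ltr0n _ 2); lra.
  have := ler_wpM2l (ltW kap_gt0) h2; rewrite mulr1.
  set p := pw 2 (- kap) in h *; have := kap_le; move: h; set l := kap * ln 2; lra.
rewrite /phi; set x : R := s.+2%:R.
have e1 : s.+1%:R = x - 1 by rewrite /x -[s.+2%:R]natr1 addrK.
have e3 : s.+3%:R = x + 1 by rewrite /x natr1.
rewrite e1 e3; have hx : 2 <= x by rewrite /x (ler_nat _ 2).
clearbody x; clear e1 e3 s.
set p := pw (x - 1) (- kap); set q := pw (x + 1) (- kap); set r := pw x (- kap).
have p0 : 0 < p := pw_gt0 _ _; have q0 : 0 < q := pw_gt0 _ _; have r0 : 0 < r := pw_gt0 _ _.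
have x0 : 0 < x by lra.
have x2 : 0 < x ^+ 2 by rewrite exprn_gt0.
have xi : (x ^+ 2)^-1 < 1 by rewrite invf_lt1//; nra.
(* AM-GM: [p + q >= 2 sqrt (p q)] and [p q = r^2 (1 - x^-2)^-kap]. *)
have hpq : p * q = r ^+ 2 * pw (1 - (x ^+ 2)^-1) (- kap).
  rewrite /p /q /r -pwM; try lra.
  rewrite pw_sqr mulr2n pwD -!pwM ?mulr_gt0 ?subr_gt0//.
  by congr pw; field; rewrite gt_eqF.
pose u := pw (1 - (x ^+ 2)^-1) (- (kap / 2)).
have hu : 1 + kap / 2 * (x ^+ 2)^-1 <= u by apply: bernoulli_pwN => //; apply: divr_ge0 => //; exact: ltW.
have hu2 : pw (1 - (x ^+ 2)^-1) (- kap) = u ^+ 2.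
  by rewrite /u pw_sqr; congr pw; lra.
have hi0 : 0 < (x ^+ 2)^-1 by rewrite invr_gt0.
have ku : 0 <= kap / 2 * (x ^+ 2)^-1 by pos.
have amgm : 2 * (r * u) <= p + q.
  rewrite -(ler_pXn2r (n:=2)) ?nnegrE//; try (rewrite ?mulr_ge0//; lra).
  have : (2 * (r * u)) ^+ 2 = 4 * (p * q) by rewrite hpq hu2; ring.
  move=> ->; have := sqr_ge0 (p - q); rewrite sqrrB sqrrD mulr2n; lra.
have : r * (1 + kap / 2 * (x ^+ 2)^-1) <= r * u by rewrite ler_wpM2l// ltW.
rewrite -mulrA [pw x _ * _]mulrC -/r; lra.
Qed.

Lemma om_ge0 s : (0 < s)%N -> 0 <= om s.
Proof. by move=> s0; apply: le_trans (om_ge s0); pos. Qed.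

Lemma psi_dec k : psi k.+1 <= psi k.
Proof. by have := om_ge0 (ltn0Sn k); rewrite /om /= subr_ge0. Qed.

Lemma psi_ge0 k : 0 <= psi k.
Proof.
rewrite /psi subr_ge0; case: k => [|k].
  by rewrite /phi pw1x; lra.
rewrite !phiS ler_pwN ?ler_nat ?ltr0n//; have := kap_gt0; lra.
Qed.

Lemma psi_le k : (0 < k)%N -> psi k <= k%:R^-1.
Proof.
case: k => // k _; rewrite /psi !phiS.
set x : R := k.+1%:R; have hx : 1 <= x by rewrite /x ler1n.
have e : k.+2%:R = x + 1 by rewrite /x natr1.
rewrite e; clearbody x; clear e k.
have x0 : 0 < x by lra.
have -> : pw (x + 1) (- kap) = pw x (- kap) * pw (1 + x^-1) (- kap).
  by rewrite -pwM ?ltr_wpDr ?invr_ge0 ?(ltW x0)//; congr pw; rewrite mulrDr mulr1 mulfV ?gt_eqF.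
have h1 : 1 - kap * x^-1 <= pw (1 + x^-1) (- kap).
  apply: le_trans (exp_ge1D _); rewrite mulNr lerD2l lerN2 ler_wpM2l ?(ltW kap_gt0)//.
  have hp : 0 < 1 + x^-1 by rewrite ltr_wpDr ?invr_ge0 ?(ltW x0).
  by have := ln_leB1 hp; lra.
have h2 : pw x (- kap) <= 1 by apply: pw_le1 => //; have := kap_gt0; lra.
have h3 := pw_gt0 x (- kap).
have hi : 0 < x^-1 by rewrite invr_gt0.
rewrite -[X in X - _]mulr1 -mulrBr.
apply: le_trans (_ : 1 * (kap * x^-1) <= _); last by have := kap_gt0; have := kap_le; nra.
by rewrite ler_pM ?(ltW h3)//; [rewrite subr_ge0; apply: pw_le1; have := kap_gt0; lra | lra].
Qed.

Definition tau (K : nat) : R := \sum_(1 <= k < K) (-1) ^+ k.-1 * psi k.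

Lemma tau_ge0 K : 0 <= tau K.
Proof.
case: K => [|K]; first by rewrite /tau big_geq.
have /andP[h _] := @alt_sum_bound psi 1 K.+1 (fun k _ => psi_dec k) (fun k _ => psi_ge0 k) isT.
rewrite expr1 mulr_sumr in h; apply: le_trans h _; rewrite /tau le_eqVlt; apply/orP; left; apply/eqP.
rewrite !big_nat; apply: eq_bigr => -[|k] // _ /=; rewrite exprS; ring.
Qed.

Lemma tau_diff K K' : (0 < K)%N -> (K <= K')%N -> `|tau K' - tau K| <= K%:R^-1.
Proof.
move=> K0 hK.
have -> : tau K' = tau K + \sum_(K <= k < K') (-1) ^+ k.-1 * psi k.
  by rewrite /tau [LHS](big_cat_nat (n := K)).
rewrite addrAC subrr add0r.
have /andP[h1 h2] := @alt_sum_bound psi K K' (fun k _ => psi_dec k) (fun k _ => psi_ge0 k) hK.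
apply: le_trans (psi_le K0); apply: le_trans h2.
rewrite -[X in _ <= X]ger0_norm// normrM normrX normrN normr1 expr1n mul1r.
rewrite (_ : \sum_(K <= i < K') _ = - \sum_(K <= k < K') (-1) ^+ k * psi k) ?normrN//.
rewrite -sumrN !big_nat; apply: eq_bigr => -[|k] /=; first by lia.
by move=> _; rewrite exprS; ring.
Qed.

Lemma wave_even g K : (0 < g)%N -> wave g (2 * K * g) = 0.
Proof.
move=> g0; rewrite /wave (sum_nat_blocks (2 * K) g (chi g)).
rewrite big1 // => x _.
have -> : \sum_(j < 2 * K) chi g (x + j * g) = \sum_(j < 2 * K) (-1) ^+ j.
  apply: eq_bigr => j _; rewrite /chi addnC divnMDl// divn_small ?ltn_ord// addn0.
  by [].
by rewrite sum_sign oddM.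
Qed.

(** Summation by parts turns [om] and [wave] into [psi] and [chi]; the boundary term vanishes at
    multiples of [2 g], and blocks of length [g] telescope to [phi] at multiples of [g]. As [phi] is
    a power there, [g] enters only through [g^(-kap)] and the length of [tau]: this is the reason
    for these weights. *)
Lemma sum_om_wave g K : (0 < g)%N ->
  \sum_(1 <= s < (2 * K.+1 * g).+1) om s * wave g s = 2 - (1 + tau (2 * K.+1)) * pw g%:R (- kap).
Proof.
move=> g0; set S := (2 * K.+1 * g)%N.
have abel T : \sum_(1 <= s < T.+1) om s * wave g s =
    \sum_(i < T) chi g i * psi i - psi T * wave g T.
  elim: T => [|T IH]; first by rewrite big_geq// /wave !big_ord0 mulr0 subr0.
  rewrite big_nat_recr//= IH [in RHS]big_ord_recr /= /om /= /wave [in RHS]big_ord_recr /= [in LHS]big_ord_recr /=.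
  ring.
rewrite abel wave_even// mulr0 subr0.
rewrite (sum_nat_blocks (2 * K.+1) g (fun i => chi g i * psi i)) exchange_big /=.
have -> : \sum_(j < 2 * K.+1) \sum_(i < g) chi g (i + j * g) * psi (i + j * g) =
   \sum_(j < 2 * K.+1) (-1) ^+ j * (phi (j * g) - phi (j.+1 * g)).
  apply: eq_bigr => j _.
  have -> : phi (j * g) - phi (j.+1 * g) = \sum_(i < g) psi (i + j * g).
    rewrite -(big_mkord xpredT (fun i => psi (i + j * g))) -opprB.
    rewrite mulSn -{2}[(j * g)%N]add0n -(telescope_sumr (fun i => phi (i + j * g)%N)) // -sumrN.
    by apply: eq_bigr => i _; rewrite opprB /psi addSn.
  rewrite mulr_sumr; apply: eq_bigr => i _; congr (_ * _).
  by rewrite /chi addnC divnMDl// divn_small ?ltn_ord// addn0.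
have -> : (2 * K.+1 = (2 * K).+2)%N by lia.
rewrite big_ord_recl /= ?mul0n ?mul1n expr0 mul1r.
have phig j : phi (j.+1 * g) = pw g%:R (- kap) * phi j.+1.
  have phiP k : (0 < k)%N -> phi k = pw k%:R (- kap) by case: k.
  by rewrite !phiP ?muln_gt0// natrM pwM ?ltr0n// mulrC.
have -> : \sum_(i < (2 * K).+1) (-1) ^+ (bump 0 i) * (phi (bump 0 i * g) - phi ((bump 0 i).+1 * g)) =
   - pw g%:R (- kap) * tau (2 * K).+2.
  rewrite /tau big_add1 /= big_mkord mulr_sumr; apply: eq_bigr => i _.
  rewrite /bump /= !add1n phig (phig i.+1) /psi exprS; ring.
have := phig 0%N; rewrite mul1n phiS pw1x mulr1 => ->.
ring.
Qed.

End Weights.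

(** * Near coincidences in the progression *)

Lemma ler_sum_inj (X Y : finType) (P : pred X) (Q : pred Y) (h : X -> Y) (w : X -> R) (v : Y -> R) :
  {in P &, injective h} -> (forall x, P x -> Q (h x)) -> (forall x, P x -> w x <= v (h x)) ->
  (forall y, Q y -> 0 <= v y) ->
  \sum_(x | P x) w x <= \sum_(y | Q y) v y.
Proof.
move=> hinj hPQ hw v0.
apply: le_trans (ler_sum _ hw) _.
have -> : \sum_(x | P x) v (h x) = \sum_(y in [set h x | x in P]) v y by rewrite big_imset.
rewrite big_mkcond [X in _ <= X]big_mkcond /=; apply: ler_sum => y _.
case: ifP => [/imsetP[x Px ->]|_]; first by rewrite hPQ.
by case: ifP => // /v0.
Qed.

Lemma union_bound (X Y : finType) (P : pred X) (Q : Y -> pred X) (w : X -> R) :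
  (forall x, P x -> exists y, Q y x) -> (forall x, P x -> 0 <= w x) ->
  \sum_(x | P x) w x <= \sum_y \sum_(x | P x && Q y x) w x.
Proof.
move=> hP w0; rewrite (exchange_big_dep P) /=; last by move=> y x _ /andP[].
apply: ler_sum => x Px; have [y Qy] := hP x Px.
rewrite (bigD1 y) /=; last by rewrite Px.
by rewrite lerDl; apply: sumr_ge0 => z _; exact: w0.
Qed.

Section Near.
Variables (alpha d : R).
Hypothesis alpha_gt0 : 0 < alpha.
Hypothesis d_gt0 : 0 < d.

(* [th] is within [2 d / alpha] of [2 PI j / alpha], where [j = n] or [j = - n]. *)
Definition near (s : bool) (n : nat) (th : R) : bool :=
  `|alpha * th - (-1) ^+ s * n%:R * (2 * PI)| <= 2 * d.

Lemma norm_sign_2PI (s : bool) (n : nat) :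
  `|(-1) ^+ s * n%:R * (2 * PI)| = n%:R * (2 * PI).
Proof.
have h : 0 <= 2 * PI by rewrite mulr_ge0// (ltW PI_gt0).
by rewrite -mulrA normrM normrX normrN normr1 expr1n mul1r ger0_norm// mulr_ge0 ?ler0n.
Qed.

Lemma near_cases th (J : nat) : d <= 2^-1 -> alpha * `|th| + 1 <= 6 * J%:R ->
  d <= nrm (1 - cis (alpha * th)) \/ exists s (n : 'I_J.+1), near s n th.
Proof.
move=> hd hJ; case: (lerP d (nrm (1 - cis (alpha * th)))) => h; [by left | right].
have [j hj] := near_2PI hd h.
have [s [n e]] : exists s n, j%:~R = (-1) ^+ (s : bool) * n%:R :> R.
  case: j {hj} => n; first by exists false, n; rewrite mul1r.
  by exists true, n.+1; rewrite NegzE mulrNz expr1 mulN1r.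
rewrite e in hj.
have hn : (n < J.+1)%N.
  rewrite ltnS -(ler_nat R).
  have h1 : n%:R * (2 * PI) <= alpha * `|th| + 2 * d.
    rewrite -(norm_sign_2PI s).
    rewrite -[alpha * `|th|](_ : `|alpha * th| = _); last by rewrite normrM gtr0_norm.
    rewrite -[X in `|X|](subKr (alpha * th)); apply: le_trans (ler_normB _ _) _.
    by rewrite lerD2l.
  (* The 6 in the hypothesis on [J] is a lower bound for [2 PI]. *)
  have hP := PI_ge3; have n0 : 0 <= n%:R :> R by rewrite ler0n.
  have : n%:R * 6 <= n%:R * (2 * PI) by rewrite ler_wpM2l//; lra.
  lra.
by exists s, (Ordinal hn).
Qed.

Lemma near_exp_lower s n (A B : R) : 1 <= A -> 1 <= B -> near s n (ln A - ln B) ->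
  (2 * PI * n%:R - 2 * d) / alpha <= ln (A * B).
Proof.
move=> hA hB hn; have la := ln_ge0 hA; have lb := ln_ge0 hB.
rewrite lnM; try lra.
apply: le_trans (_ : `|ln A - ln B| <= _); last by rewrite ler_norml; lra.
rewrite ler_pdivrMr// mulrC lerBlDr.
have -> : `|ln A - ln B| * alpha = `|alpha * (ln A - ln B)|.
  by rewrite normrM (gtr0_norm alpha_gt0) mulrC.
rewrite -(norm_sign_2PI s).
rewrite -[X in `|X| <= _](subKr (alpha * (ln A - ln B))).
by apply: le_trans (ler_normB _ _) _; rewrite lerD2l.
Qed.

(** A fraction [A / B] near [exp (2 PI j / alpha)] has [A B] at least about
    [exp (2 PI |j| / alpha)]. Half of the exponent is spent on this, giving a factor geometric in
    [n = |j|], and half on [A B >= P]. *)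
Lemma near_decay s n (A B P kap : R) : 0 <= kap -> d <= 2^-1 ->
  1 <= A -> 1 <= B -> 1 <= P -> P <= A * B -> near s n (ln A - ln B) ->
  pw (A * B) (- kap) <=
  pw P (- (kap / 2)) * exp (kap / (2 * alpha)) * exp (- (kap * PI / alpha)) ^+ n.
Proof.
move=> hk hd hA hB hP hPAB hn.
have AB0 : 0 < A * B by rewrite mulr_gt0//; lra.
have -> : pw (A * B) (- kap) = pw (A * B) (- (kap / 2)) * pw (A * B) (- (kap / 2)).
  by rewrite -pwD; congr pw; lra.
rewrite -mulrA ler_pM ?pw_ge0//; first by apply: ler_pwN => //; lra.
rewrite -expMn -expD /pw ler_exp.
have h := near_exp_lower hA hB hn.
have h2 : kap / 2 * ((2 * PI * n%:R - 2 * d) / alpha) <= kap / 2 * ln (A * B).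
  by rewrite ler_wpM2l//; lra.
have e : kap / 2 * ((2 * PI * n%:R - 2 * d) / alpha) =
   n%:R * (kap * PI / alpha) - kap * d / alpha by field; rewrite gt_eqF.
have h3 : kap * d / alpha <= kap / (2 * alpha).
  rewrite (_ : kap / (2 * alpha) = kap * 2^-1 / alpha); last by field; rewrite gt_eqF.
  by rewrite ler_wpM2r ?invr_ge0 ?(ltW alpha_gt0)// ler_wpM2l.
rewrite e in h2; lra.
Qed.

(** Both ratios agree up to a factor [exp (4 d / alpha)], so [A B'] and [A' B] differ by less than
    1. *)
Lemma near_unique s n (A B A' B' Nn : nat) (G : R) :
  (0 < A)%N -> (0 < B)%N -> (0 < A')%N -> (0 < B')%N -> (B <= Nn)%N -> (B' <= Nn)%N ->
  A%:R <= G * B%:R -> A'%:R <= G * B'%:R ->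
  4 * d / alpha <= 2^-1 -> 8 * d / alpha * G * Nn%:R ^+ 2 < 1 ->
  near s n (ln A%:R - ln B%:R) -> near s n (ln A'%:R - ln B'%:R) -> (A * B' = A' * B)%N.
Proof.
move=> A0 B0 A'0 B'0 hB hB' hAG hA'G hd hsmall h1 h2.
wlog hlt : A B A' B' A0 B0 A'0 B'0 hB hB' hAG hA'G h1 h2 / (A' * B < A * B')%N => [H|].
  case: (ltngtP (A' * B) (A * B')) => [h|h|->//].
    exact: (H A B A' B').
  by apply/esym; apply: (H A' B' A B).
exfalso.
have pA : 0 < A%:R :> R by rewrite ltr0n.
have pB : 0 < B%:R :> R by rewrite ltr0n.
have pA' : 0 < A'%:R :> R by rewrite ltr0n.
have pB' : 0 < B'%:R :> R by rewrite ltr0n.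
have hx : ln (A * B')%:R - ln (A' * B)%:R <= 4 * d / alpha :> R.
  rewrite !natrM !lnM// ler_pdivlMr//.
  move: h1 h2; rewrite /near !ler_norml => /andP[_ h1] /andP[h2 _]; lra.
have hm0 : 0 < (A' * B)%:R :> R by rewrite ltr0n muln_gt0 A'0.
have he : (A * B')%:R <= (A' * B)%:R * (1 + 2 * (4 * d / alpha)) :> R.
  have hd0 : 0 <= 4 * d / alpha by pos.
  apply: le_trans (_ : (A' * B)%:R * exp (4 * d / alpha) <= _).
    rewrite -ler_ln ?mulr_gt0 ?exp_gt0 ?ltr0n ?muln_gt0 ?A0 ?A'0//.
    rewrite lnM ?exp_gt0// ln_exp0; lra.
  by rewrite ler_wpM2l ?(ltW hm0)// exp_le1D2.
have h1' : (A' * B)%:R + 1 <= (A * B')%:R :> R by rewrite natr1 ler_nat.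
have G0 : 0 <= G by rewrite -(pmulr_lge0 _ pB'); apply: le_trans (hA'G); exact: ltW.
have : (A' * B)%:R * (2 * (4 * d / alpha)) < 1.
  apply: le_lt_trans hsmall.
  have -> : 8 * d / alpha * G * Nn%:R ^+ 2 = (G * Nn%:R) * Nn%:R * (2 * (4 * d / alpha)) by ring.
  rewrite ler_wpM2r//; first by pos.
  rewrite natrM ler_pM ?ler0n ?ler_nat//; apply: le_trans hA'G _.
  by rewrite ler_wpM2l// ler_nat.
lra.
Qed.

Lemma geo_sum_le (q : R) (J : nat) : 0 <= q -> q < 1 -> \sum_(n < J) q ^+ n <= (1 - q)^-1.
Proof.
move=> q0 q1; rewrite -[X in _ <= X]mul1r ler_pdivlMr ?subr_gt0// mulrC.
have -> : (1 - q) * \sum_(n < J) q ^+ n = 1 - q ^+ J.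
  by rewrite -opprB mulNr -subrX1 opprB.
by rewrite lerBlDr lerDl exprn_ge0.
Qed.

End Near.

Lemma muln_cancel_aux (a a0 b v u w : nat) :
  (a * b * (a0 * v) = a0 * u * (a * w) -> a0 * (a * (b * v)) = a0 * (a * (u * w)))%N.
Proof.
move=> h; transitivity (a * b * (a0 * v))%N; first by ring.
by rewrite h; ring.
Qed.

(** * The mean square of the resonator *)

Section ResonatorMean.
Variables (I : finType) (pr : I -> nat).
Hypothesis pr_prime : forall i, prime (pr i).
Hypothesis pr_inj : injective pr.
Variable N : nat.
Hypothesis N_gt0 : (0 < N)%N.
Variables f : I -> R.
Hypothesis f_ge0 : forall i, 0 <= f i.
Variables (alpha beta d : R).
Hypothesis alpha_gt0 : 0 < alpha.
Hypothesis d_gt0 : 0 < d.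
Variables (y kap : R).
Hypothesis y_ge1 : 1 <= y.
Hypothesis y_le : forall i, y <= (pr i)%:R.
Hypothesis kap_gt0 : 0 < kap.
Hypothesis f_le : forall i, f i <= pw (pr i)%:R (- kap).

Local Notation nS := (nS pr).
Local Notation fS := (fS f).
Local Notation FN := (FN pr N f).

Lemma fS_le S : fS S <= pw (nS S)%:R (- kap).
Proof. by rewrite pw_nS//; apply: ler_prod => i _; rewrite f_ge0 f_le. Qed.

Lemma nS_ge1 S : 1 <= (nS S)%:R :> R.
Proof. by rewrite ler1n nS_gt0. Qed.

Lemma nS_ge_y S : S != set0 -> y <= (nS S)%:R.
Proof.
move=> /set0Pn[i iS]; apply: le_trans (y_le i) _; rewrite ler_nat.
by apply: dvdn_leq; [exact: nS_gt0 | rewrite pr_dvd_nS].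
Qed.

Definition resonator (r : {set I} -> R) (t : R) : C :=
  \sum_(S | (nS S <= N)%N) (r S)%:C * cis (- (t * ln (nS S)%:R)).

Lemma nrm_resonator_sqr r t : ((nrm (resonator r t)) ^+ 2)%:C =
  \sum_(S | (nS S <= N)%N) \sum_(T | (nS T <= N)%N)
    (r S * r T)%:C * cis (- (t * (ln (nS S)%:R - ln (nS T)%:R))).
Proof.
rewrite nrm_sqrC /resonator cj_sum mulr_suml; apply: eq_bigr => S _.
rewrite mulr_sumr; apply: eq_bigr => T _.
rewrite cjM cj_real -cisN opprK mulrACA -rmorphM -cisD; congr (_ * cis _); ring.
Qed.

Lemma nrm_sum_sub_diag (X : finType) (P : pred X) (k : X -> X -> C) :
  nrm (\sum_(S | P S) \sum_(T | P T) k S T - \sum_(S | P S) k S S) <=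
  \sum_(x : X * X | [&& P x.1, P x.2 & x.1 != x.2]) nrm (k x.1 x.2).
Proof.
rewrite -sumrB.
have -> : \sum_(S | P S) (\sum_(T | P T) k S T - k S S) =
   \sum_(S | P S) \sum_(T | P T && (S != T)) k S T.
  apply: eq_bigr => S PS; rewrite (bigD1 S) //= addrAC subrr add0r.
  by apply: eq_bigl => T; rewrite eq_sym.
rewrite pair_big_dep /=; apply: le_trans (nrm_sum _ _ _) _.
by rewrite le_eqVlt; apply/orP; left; apply/eqP; apply: eq_bigl => -[S T].
Qed.

Variables (M K J : nat).
Hypothesis M_gt0 : (0 < M)%N.
Hypothesis d_le : d <= 2^-1.
Hypothesis J_big : alpha * ln N%:R + 1 <= 6 * J%:R.
Hypothesis d_small : 4 * d / alpha <= 2^-1.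
Hypothesis dN_small : 8 * d / alpha * N%:R * N%:R ^+ 2 < 1.

Let q := exp (- (kap * PI / alpha)).
Let C1 := exp (kap / (2 * alpha)).

(** Off the diagonal, pairs with phase far from [2 PI Z] gain from the averages. For each [(s, n)]
    the near pairs share one reduced fraction, hence the sets [S :\: T] and [T :\: S]; such a pair
    is determined by [S :&: T], so together they give at most one small product times [FN]. *)
Lemma resonator_mean (r : {set I} -> R) (c : nat) : (forall S, `|r S| = fS S) ->
  `|Av M K (fun l => nrm (resonator r (alpha * l%:R + beta)) ^+ 2) c - FN| <=
  ((2 / (M%:R * d)) ^+ K * N%:R + pw y (- (kap / 2)) * C1 * (2 / (1 - q))) * FN.
Proof.
move=> hr.
have C10 : 0 <= C1 by exact: exp_ge0.
have q0 : 0 <= q by exact: exp_ge0.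
have FN0 : 0 <= FN by exact: FN_ge0.
pose th (x : {set I} * {set I}) : R := ln (nS x.1)%:R - ln (nS x.2)%:R.
pose kn (x : {set I} * {set I}) : C := Av M K (fun l => cis (- (l%:R * (alpha * th x)))) c.
pose k S T : C := (r S * r T)%:C * (cis (- (beta * th (S, T))) * kn (S, T)).
have eAv : (Av M K (fun l => nrm (resonator r (alpha * l%:R + beta)) ^+ 2) c)%:C =
   \sum_(S | (nS S <= N)%N) \sum_(T | (nS T <= N)%N) k S T.
  rewrite -Av_real; under eq_Av do rewrite nrm_resonator_sqr.
  rewrite Av_sum; apply: eq_bigr => S _; rewrite Av_sum; apply: eq_bigr => T _.
  rewrite Av_scale /k; congr (_ * _); rewrite /kn -Av_scale; apply: eq_Av => l.
  by rewrite -cisD; congr cis; rewrite /th /=; ring.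
have eFN : FN%:C = \sum_(S | (nS S <= N)%N) k S S.
  rewrite /FN rmorph_sum; apply: eq_bigr => S _.
  rewrite /k /kn /th /= subrr mulr0 oppr0 cis0 mul1r.
  under eq_Av do rewrite mulr0 mulr0 oppr0 cis0.
  rewrite Av_const ?mulr1; last by rewrite pnatr_eq0 -lt0n.
  by rewrite -hr -expr2 real_normK ?num_real.
rewrite -nrm_real (rmorphB (real_complex R)) [X in X - _]eAv [X in _ - X]eFN.
apply: le_trans (nrm_sum_sub_diag _ _) _.
set P := fun x : {set I} * {set I} => [&& (nS x.1 <= N)%N, (nS x.2 <= N)%N & x.1 != x.2].
have hk x : nrm (k x.1 x.2) = fS x.1 * fS x.2 * nrm (kn x).
  by case: x => S T; rewrite /k !nrmM nrm_cis mul1r nrm_real normrM !hr.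
have lnb S : (nS S <= N)%N -> (0 : R) <= ln (nS S)%:R <= ln N%:R.
  by move=> hS; rewrite lnn_ge0 ler_ln ?ltr0n ?nS_gt0// ler_nat.
have dich x : P x -> d <= nrm (1 - cis (alpha * th x)) \/ exists (s : bool) (n : 'I_J.+1), near alpha d s n (th x).
  move=> /and3P[h1 h2 _]; apply: near_cases => //.
  apply: le_trans J_big; rewrite lerD2r ler_wpM2l ?(ltW alpha_gt0)// ler_norml /th.
  have := lnb _ h1; have := lnb _ h2; lra.
have hfar0 : 0 <= (2 / (M%:R * d)) ^+ K by pos.
rewrite (bigID (fun x => d <= nrm (1 - cis (alpha * th x)))) /= mulrDl lerD//.
  apply: le_trans (_ : \sum_(x | P x) (2 / (M%:R * d)) ^+ K * (fS x.1 * fS x.2) <= _).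
    rewrite [X in _ <= X](bigID (fun x => d <= nrm (1 - cis (alpha * th x)))) /= -[X in X <= _]addr0 lerD//.
      apply: ler_sum => x /andP[_ hx]; rewrite hk mulrC ler_wpM2r ?mulr_ge0 ?fS_ge0//.
      exact: nrm_Av_cis_far.
    by apply: sumr_ge0 => x _; rewrite !mulr_ge0 ?fS_ge0.
  rewrite -mulr_sumr -mulrA ler_wpM2l//.
  apply: le_trans (sum_fS_sqr pr_prime pr_inj N f).
  rewrite expr2 mulr_suml; under [X in _ <= X]eq_bigr do rewrite mulr_sumr.
  rewrite pair_big /= [X in X <= _]big_mkcond [X in _ <= X]big_mkcond /=.
  apply: ler_sum => -[S T] _ /=; rewrite /P /=.
  case: (nS S <= N)%N; case: (nS T <= N)%N => //=; case: ifP => // _.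
  by rewrite mulr_ge0 ?fS_ge0.
set Pn := fun x => P x && ~~ (d <= nrm (1 - cis (alpha * th x))).
apply: le_trans (_ : \sum_(x | Pn x) fS x.1 * fS x.2 <= _).
  apply: ler_sum => x _; rewrite hk -[X in _ <= X]mulr1 ler_wpM2l ?mulr_ge0 ?fS_ge0//.
  exact: nrm_Av_cis_le1.
apply: le_trans (@union_bound _ (bool * 'I_J.+1)%type Pn (fun z x => near alpha d z.1 z.2 (th x)) _ _ _) _.
- move=> x /andP[/dich [->//|[s [n hn]]] _]; by exists (s, n).
- by move=> x _; rewrite mulr_ge0 ?fS_ge0.
apply: le_trans (_ : \sum_(z : bool * 'I_J.+1) pw y (- (kap / 2)) * C1 * q ^+ z.2 * FN <= _); last first.
  rewrite -mulr_suml -mulr_sumr ler_wpM2r ?FN_ge0// ler_wpM2l//; first by pos.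
  rewrite -(pair_big xpredT xpredT (fun (s : bool) (n : 'I_J.+1) => q ^+ n)) /=.
  have q1 : q < 1.
    by rewrite -exp00 ltr_exp oppr_lt0 divr_gt0// mulr_gt0// PI_gt0.
  by rewrite big_bool /=; have := geo_sum_le J.+1 q0 q1; lra.
apply: ler_sum => -[s n] _ /=.
case: (pickP (fun x => Pn x && near alpha d s n (th x))) => [x0 /andP[/andP[/and3P[a1 a2 a3] _] nx0]|no]; last first.
  by rewrite big_pred0 //; pos.
set U := x0.1 :\: x0.2; set V := x0.2 :\: x0.1.
have uniqUV x : Pn x -> near alpha d s n (th x) -> x.1 :\: x.2 = U /\ x.2 :\: x.1 = V.
  move=> /andP[/and3P[b1 b2 b3] _] nx.
  have bN S T : (nS S <= N)%N -> (nS S)%:R <= N%:R * (nS T)%:R :> R.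
    by move=> hS; rewrite -natrM ler_nat; apply: leq_trans hS _; rewrite leq_pmulr// nS_gt0.
  have := @near_unique alpha d alpha_gt0 d_gt0 s n (nS x.1) (nS x.2) (nS x0.1) (nS x0.2) N N%:R.
  rewrite !nS_gt0// !bN// => /(_ isT isT isT isT b2 a2 isT isT d_small dN_small nx nx0) e.
  rewrite (nSID pr x.1 x.2) (nSID pr x.2 x.1) (nSID pr x0.1 x0.2) (nSID pr x0.2 x0.1) in e.
  rewrite [x.2 :&: x.1]setIC [x0.2 :&: x0.1]setIC in e.
  have e' : (nS (x.1 :\: x.2) * nS V = nS U * nS (x.2 :\: x.1))%N.
    have p1 := nS_gt0 pr_prime (x.1 :&: x.2); have p2 := nS_gt0 pr_prime (x0.1 :&: x0.2).
    apply/eqP; rewrite -(eqn_pmul2l p1) -(eqn_pmul2l p2); apply/eqP.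
    exact: muln_cancel_aux.
  have c1 := coprime_nSD pr_prime pr_inj x.1 x.2; have c2 := coprime_nSD pr_prime pr_inj x0.1 x0.2.
  have eU : nS (x.1 :\: x.2) = nS U.
    apply/eqP; rewrite eqn_dvd; apply/andP; split.
      by rewrite -(@Gauss_dvdl _ _ (nS (x.2 :\: x.1)))// -e' dvdn_mulr.
    by rewrite -(@Gauss_dvdl _ _ (nS V))// e' dvdn_mulr.
  split; first exact: (nS_inj pr_prime pr_inj eU).
  apply: (nS_inj pr_prime pr_inj); move: e'; rewrite eU => /eqP.
  by rewrite eqn_pmul2l ?nS_gt0// => /eqP.
have UV0 : y <= (nS U)%:R * (nS V)%:R.
  case: (boolP (U == set0)) => [/eqP U0|/nS_ge_y hU]; last first.
    by apply: le_trans hU _; rewrite ler_peMr ?ler0n// nS_ge1.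
  have V0 : V != set0.
    by apply: contra a3 => /eqP V0; rewrite eqEsubset -!setD_eq0 -/U -/V U0 V0 eqxx.
  by apply: le_trans (nS_ge_y V0) _; rewrite ler_peMl ?ler0n// nS_ge1.
have nUV : near alpha d s n (ln (nS U)%:R - ln (nS V)%:R).
  move: nx0; rewrite /th (nSID pr x0.1 x0.2) (nSID pr x0.2 x0.1) setIC !natrM.
  by rewrite !lnM ?ltr0n ?nS_gt0// opprD addrACA subrr add0r.
have hdec : fS U * fS V <= pw y (- (kap / 2)) * C1 * q ^+ n.
  apply: le_trans (near_decay alpha_gt0 (ltW kap_gt0) d_le (nS_ge1 U) (nS_ge1 V) y_ge1 UV0 nUV).
  by rewrite pwM ?ltr0n ?nS_gt0// ler_pM ?fS_ge0// fS_le.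
apply: le_trans (ler_wpM2r (FN_ge0 _ _ _) hdec).
rewrite /FN mulr_sumr.
apply: (@ler_sum_inj _ _ _ _ (fun x => x.1 :&: x.2)).
- move=> x x'; rewrite !unfold_in => /andP[px nx] /andP[px' nx'] e.
  have [e1 e2] := uniqUV x px nx; have [e3 e4] := uniqUV x' px' nx'.
  case: x x' px nx px' nx' e e1 e2 e3 e4 => [S T] [S' T'] /= _ _ _ _ e e1 e2 e3 e4.
  congr (_, _); first by rewrite -(setID S T) -(setID S' T') e e1 e3.
  by rewrite -(setID T S) -(setID T' S') setIC e setIC e2 e4.
- move=> x /andP[/andP[/and3P[b1 _ _] _] _]; apply: leq_trans b1.
  by apply: dvdn_leq; [exact: nS_gt0 | rewrite [X in (_ %| X)%N](nSID pr x.1 x.2) dvdn_mulr].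
- move=> x /andP[px nx]; have [e1 e2] := uniqUV x px nx.
  rewrite (fSID f x.1 x.2) (fSID f x.2 x.1) setIC e1 e2 le_eqVlt; apply/orP; left; apply/eqP; ring.
- by move=> S _; rewrite !mulr_ge0 ?fS_ge0 ?sqr_ge0.
Qed.

End ResonatorMean.

(** * The first moment against the resonator *)

Section FirstMoment.
Variables (I : finType) (pr : I -> nat).
Hypothesis pr_prime : forall i, prime (pr i).
Hypothesis pr_inj : injective pr.
Variable N : nat.
Hypothesis N_gt0 : (0 < N)%N.
Variables f : I -> R.
Hypothesis f_ge0 : forall i, 0 <= f i.
Variables (alpha beta d : R).
Hypothesis alpha_gt0 : 0 < alpha.
Hypothesis d_gt0 : 0 < d.
Variables (P0 : nat) (kap : R).
Hypothesis P0_ge2 : (2 <= P0)%N.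
Hypothesis pr_gtP0 : forall i, (P0 < pr i)%N.
Hypothesis kap_gt0 : 0 < kap.
Hypothesis kap_le : kap <= 2^-1.
Hypothesis f_le : forall i, f i <= pw (pr i)%:R (- kap).
Hypothesis pr_kap : forall i, 2 <= pw (pr i)%:R (kap / 2).

Local Notation nS := (nS pr).
Local Notation fS := (fS f).
Local Notation FN := (FN pr N f).

Variables (c : nat -> R) (W : nat) (CH Cc X0 : R).
Hypothesis N_W : (2 * N <= W)%N.
Hypothesis c_one : forall S, (nS S <= N)%N -> c (nS S) = 1.
Hypothesis c_two : forall S, (nS S <= N)%N -> c (2 * nS S)%N = -2.
Hypothesis c_zero : forall A S, (3 <= A <= P0)%N -> (nS S <= N)%N -> c (A * nS S)%N = 0.
Hypothesis c_le2 : forall b, b%:R <= X0 -> `|c b| <= 2.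
Hypothesis c_leCH : forall b, `|c b| <= CH.
Hypothesis CH_ge0 : 0 <= CH.
Hypothesis c_sum : \sum_(b < W.+1 | (0 < b)%N) `|c b| * pw b%:R (- 2^-1) <= Cc.

Variables (M K J : nat) (G : R).
Hypothesis M_gt0 : (0 < M)%N.
Hypothesis d_le : d <= 2^-1.
Hypothesis J_big : alpha * (ln W%:R + ln N%:R) + 1 <= 6 * J%:R.
Hypothesis d_small : 4 * d / alpha <= 2^-1.
Hypothesis G_ge1 : 1 <= G.
Hypothesis dG_small : 8 * d / alpha * (2 * G) * N%:R ^+ 2 < 1.
Hypothesis G_X0 : 2 * G * N%:R <= X0.

(** The solutions of [b nS S = nS T]: [S] is contained in [T], and the quotient [b] has weight
    [b^(-1/2)]. *)
Definition diag1 : R := \sum_(x : {set I} * {set I} | (x.1 \subset x.2) && (nS x.2 <= N)%N)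
  fS x.1 * fS x.2 * pw (nS (x.2 :\: x.1))%:R (- 2^-1).

Lemma diag1_ge0 : 0 <= diag1.
Proof. by apply: sumr_ge0 => x _; rewrite !mulr_ge0 ?fS_ge0 ?pw_ge0. Qed.

Definition dirpoly (t : R) : C :=
  \sum_(b < W.+1 | (0 < b)%N) (c b * pw b%:R (- 2^-1))%:C * cis (- (t * ln b%:R)).

(** The primes of the resonator exceed [P0 >= A], so none of them divides [A]. *)
Lemma smooth_ratio (A b : nat) (S T : {set I}) : (0 < A <= P0)%N ->
  (b * nS S = A * nS T)%N -> S \subset T /\ b = (A * nS (T :\: S))%N.
Proof.
move=> /andP[A0 AP] e.
have sub : S \subset T.
  apply/subsetP => i iS; rewrite -(pr_dvd_nS pr_prime pr_inj).
  have : (pr i %| A * nS T)%N by rewrite -e dvdn_mull// pr_dvd_nS.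
  rewrite Euclid_dvdM// => /orP[/(dvdn_leq A0) h|//].
  by have := leq_trans (leq_ltn_trans h (leq_ltn_trans AP (pr_gtP0 i))) (leqnn _); rewrite ltnn.
split=> //; apply/eqP; rewrite -(eqn_pmul2r (nS_gt0 pr_prime S)) e.
by rewrite (nSID pr T S) (setIidPr sub) -mulnA eqn_pmul2l// mulnC.
Qed.

Let Tr := ('I_W.+1 * ({set I} * {set I}))%type.
Let PT (x : Tr) : bool := [&& (0 < x.1)%N, (nS x.2.1 <= N)%N & (nS x.2.2 <= N)%N].
Let th (x : Tr) : R := ln (x.1)%:R + ln (nS x.2.1)%:R - ln (nS x.2.2)%:R.
Let w (x : Tr) : R := c x.1 * pw (x.1)%:R (- 2^-1) * (fS x.2.1 * fS x.2.2).
Variable c0 : nat.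
Let kn (u : R) : C := Av M K (fun l => cis (- (l%:R * (alpha * u)))) c0.
Let term (x : Tr) : C := (w x)%:C * (cis (- (beta * th x)) * kn (th x)).
Let ratio (A : nat) (x : Tr) : bool := (x.1 * nS x.2.1 == A * nS x.2.2)%N.

Lemma sum_ratio A (cA : R) : (0 < A <= 2)%N -> (forall S, (nS S <= N)%N -> c (A * nS S)%N = cA) ->
  \sum_(x | PT x && ratio A x) w x = cA * pw A%:R (- 2^-1) * diag1.
Proof.
move=> hA hc; have A0 : (0 < A)%N by case/andP: hA.
have hAP : (0 < A <= P0)%N by rewrite A0 (leq_trans _ P0_ge2)//; case/andP: hA.
rewrite /diag1 mulr_sumr.
transitivity (\sum_(b : 'I_W.+1) \sum_(y : {set I} * {set I} | PT (b, y) && ratio A (b, y)) w (b, y)).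
  by rewrite pair_big_dep /=; apply: eq_big => -[b y].
rewrite (exchange_big_dep xpredT) //= [RHS]big_mkcond /=; apply: eq_bigr => -[S T] _ /=.
case: ifP => [/andP[sub hT]|hno].
  have hb : (A * nS (T :\: S) < W.+1)%N.
    rewrite ltnS; apply: leq_trans N_W; apply: leq_mul; first by case/andP: hA.
    apply: leq_trans hT; apply: dvdn_leq; first exact: nS_gt0.
    by rewrite [X in (_ %| X)%N](nSID pr T S) dvdn_mull.
  have hTS : (nS (T :\: S) <= N)%N.
    apply: leq_trans hT; apply: dvdn_leq; first exact: nS_gt0.
    by rewrite [X in (_ %| X)%N](nSID pr T S) dvdn_mull.
  have hSN : (nS S <= N)%N.
    apply: leq_trans hT; apply: dvdn_leq; first exact: nS_gt0.
    by rewrite [X in (_ %| X)%N](nSID pr T S) (setIidPr sub) dvdn_mulr.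
  rewrite (big_pred1 (Ordinal hb)) /=.
    rewrite /w /= hc// natrM pwM ?ltr0n ?nS_gt0//; ring.
  move=> b; rewrite /PT /ratio /= hT hSN andbT -val_eqE /=.
  apply/idP/idP => [/andP[_ /eqP e]|/eqP ->]; first by have [_ ->] := smooth_ratio hAP e.
  rewrite muln_gt0 A0 nS_gt0//= (nSID pr T S) (setIidPr sub) -mulnA eqn_pmul2l// mulnC.
  by [].
rewrite big_pred0 // => b; apply/negbTE/negP => /andP[/and3P[_ _ h2] /eqP e].
by have [sub _] := smooth_ratio hAP e; rewrite sub h2 in hno.
Qed.

Lemma Av_moment_eq :
  Av M K (fun l => dirpoly (alpha * l%:R + beta) *
     (nrm (resonator pr N fS (alpha * l%:R + beta)) ^+ 2)%:C) c0 = \sum_(x | PT x) term x.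
Proof.
transitivity (Av M K (fun l => \sum_(x | PT x) (w x)%:C * (cis (- (beta * th x)) * cis (- (l%:R * (alpha * th x))))) c0).
  apply: eq_Av => l; rewrite nrm_resonator_sqr /dirpoly mulr_suml.
  transitivity (\sum_(b < W.+1 | (0 < b)%N) \sum_(y : {set I} * {set I} | (nS y.1 <= N)%N && (nS y.2 <= N)%N)
     (w (b, y))%:C * (cis (- (beta * th (b, y))) * cis (- (l%:R * (alpha * th (b, y)))))).
    apply: eq_bigr => b b0; rewrite mulr_sumr.
    under eq_bigr => S _ do rewrite mulr_sumr.
    rewrite pair_big /=; apply: eq_bigr => -[S T] _ /=.
    rewrite mulrACA -(rmorphM (real_complex R)) -!cisD; congr (_ * cis _).
    by rewrite /th /=; ring.
  by rewrite pair_big_dep /=; apply: eq_big => -[b y].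
by rewrite Av_sum; apply: eq_bigr => x _; rewrite Av_scale; congr (_ * _); rewrite Av_scale.
Qed.

Let far := (2 / (M%:R * d)) ^+ K.
Let q := exp (- (kap / 2 * PI / alpha)).
Let Bj := pw P0%:R (- (kap / 2 / 2)) * exp (kap / 2 / (2 * alpha)).
Let Big := 8 * d / alpha * pw W%:R 2^-1 + pw (2 * N%:R / G) 2^-1.

Let FN0 : 0 <= FN. Proof. exact: FN_ge0. Qed.
Let far0 : 0 <= far. Proof. by rewrite /far; pos. Qed.
Let q0 : 0 <= q. Proof. exact: exp_ge0. Qed.
Let Bj0 : 0 <= Bj. Proof. by rewrite /Bj; pos. Qed.
Let Big0 : 0 <= Big. Proof. by rewrite /Big; pos. Qed.

Lemma thE x : PT x -> th x = ln (x.1 * nS x.2.1)%:R - ln (nS x.2.2)%:R.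
Proof. by move=> /and3P[b0 _ _]; rewrite natrM lnM ?ltr0n ?nS_gt0. Qed.

(** By [pr_kap] the factor [1 + p^(1/2 - kap)], at most [2 p^(1/2 - kap)], is bounded by
    [p^(1/2 - kap/2)]. *)
Lemma prodA_bound (A : nat) : (0 < A)%N ->
  pw A%:R (- 2^-1) * \prod_(i | (pr i %| A)%N) (1 + f i * pw (pr i)%:R 2^-1) <= pw A%:R (- (kap / 2)).
Proof.
move=> A0; have pA : 0 < A%:R :> R by rewrite ltr0n.
set PA := [set i | (pr i %| A)%N].
apply: le_trans (_ : pw A%:R (- 2^-1) * pw A%:R (2^-1 - kap / 2) <= _); last first.
  by rewrite -pwD le_eqVlt; apply/orP; left; apply/eqP; congr pw; lra.
rewrite ler_wpM2l ?pw_ge0//.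
apply: le_trans (_ : pw (nS PA)%:R (2^-1 - kap / 2) <= _); last first.
  apply: ler_pw; [have := kap_le; lra | by rewrite ltr0n nS_gt0 |].
  rewrite ler_nat; apply: dvdn_leq => //; apply: nS_dvd => // i; by rewrite inE.
rewrite pw_nS// [X in _ <= X](eq_bigl (fun i => (pr i %| A)%N)); last by move=> i; rewrite inE.
apply: ler_prod => i _; apply/andP; split; first by rewrite addr_ge0// mulr_ge0 ?pw_ge0.
have p1 : 1 <= (pr i)%:R :> R by rewrite ler1n prime_gt0.
have hk := kap_le; have hk0 := kap_gt0.
have h1 : f i * pw (pr i)%:R 2^-1 <= pw (pr i)%:R (2^-1 - kap).
  by rewrite pwD mulrC ler_wpM2l ?pw_ge0// f_le.
have h2 : 1 <= pw (pr i)%:R (2^-1 - kap) by apply: pw_ge1 => //; lra.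
have h3 : 2 * pw (pr i)%:R (2^-1 - kap) <= pw (pr i)%:R (2^-1 - kap / 2).
  rewrite (_ : 2^-1 - kap / 2 = kap / 2 + (2^-1 - kap)); last by lra.
  by rewrite [X in _ <= X]pwD ler_wpM2r ?pw_ge0// pr_kap.
lra.
Qed.

(** All triples near the same [j] have one ratio [A / B]. Here [A B >= P0]: a prime of [B] exceeds
    [P0], and for [B = 1] the coefficient vanishes unless [A > P0], the ratios 1 and 2 being
    excluded. Splitting off the primes dividing [A] from [S] and those of [B] from [T] leaves a term
    of [diag1]. *)
Lemma near_small s n : exp ((-1) ^+ (s : bool) * n%:R * (2 * PI) / alpha) <= G ->
  \sum_(x | [&& PT x, ~~ ratio 1 x, ~~ ratio 2 x & near alpha d s n (th x)]) `|w x| <=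
  2 * (Bj * q ^+ n) * diag1.
Proof.
move=> hE; have D0 := diag1_ge0.
set Pn := fun x => [&& PT x, ~~ ratio 1 x, ~~ ratio 2 x & near alpha d s n (th x)].
have hrat x : Pn x -> (x.1 * nS x.2.1)%:R <= 2 * G * (nS x.2.2)%:R.
  move=> /and4P[px _ _ nx]; have /and3P[b0 _ _] := px.
  have p1 : 0 < (x.1 * nS x.2.1)%:R :> R by rewrite ltr0n muln_gt0 b0 nS_gt0.
  have p2 : 0 < (nS x.2.2)%:R :> R by rewrite ltr0n nS_gt0.
  set j := (-1) ^+ s * n%:R * (2 * PI) / alpha in hE.
  have : ln (x.1 * nS x.2.1)%:R <= j + 4 * d / alpha + ln (nS x.2.2)%:R :> R.
    move: nx; rewrite thE// /near ler_norml => /andP[_ h].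
    have : alpha * (ln (x.1 * nS x.2.1)%:R - ln (nS x.2.2)%:R) <= alpha * (j + 4 * d / alpha) :> R.
      have -> : alpha * (j + 4 * d / alpha) = (-1) ^+ s * n%:R * (2 * PI) + 4 * d by rewrite /j; field; rewrite gt_eqF.
      by have := d_gt0; lra.
    by rewrite ler_pM2l//; lra.
  rewrite -ler_exp exp_ln0// !expD exp_ln0// => h; apply: le_trans h _.
  rewrite ler_wpM2r ?(ltW p2)// mulrC ler_pM ?exp_ge0//.
  apply: le_trans (exp_le1D2 _ d_small) _; first by pos.
  by have := d_small; lra.
(* A triple with nonzero coefficient is needed to bound [A B] from below; without one the sum is
   0. *)
case: (pickP (fun x => Pn x && (c x.1 != 0))) => [x0 /andP[px0 cx0]|no]; last first.
  rewrite big1; first by pos.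
  move=> x px; have := no x; rewrite /= (_ : Pn x) //= => /negbFE/eqP e.
  by rewrite /w e !mul0r normr0.
have /and4P[pt0 r1 r2 n0] := px0; have /and3P[b0 hS0 hT0] := pt0.
set num := (x0.1 * nS x0.2.1)%N; set dn := nS x0.2.2; set g := gcdn num dn.
have num0 : (0 < num)%N by rewrite muln_gt0 b0 nS_gt0.
have dn0 : (0 < dn)%N by exact: nS_gt0.
have g0 : (0 < g)%N by rewrite gcdn_gt0 num0.
have [A eA] := dvdnP (dvdn_gcdl num dn); have [B eB] := dvdnP (dvdn_gcdr num dn).
rewrite -/g in eA eB.
have A0 : (0 < A)%N by move: num0; rewrite eA muln_gt0 => /andP[].
have B0 : (0 < B)%N by move: dn0; rewrite eB muln_gt0 => /andP[].
have cAB : coprime A B.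
  by rewrite /coprime -(eqn_pmul2r g0) muln_gcdl -eA -eB mul1n.
have allx x : Pn x -> (x.1 * nS x.2.1 * B = A * nS x.2.2)%N.
  move=> px; have /and4P[pt _ _ nx] := px; have /and3P[xb0 hS hT] := pt.
  have xn0 : (0 < x.1 * nS x.2.1)%N by rewrite muln_gt0 xb0 nS_gt0.
  have nx' : near alpha d s n (ln (x.1 * nS x.2.1)%:R - ln (nS x.2.2)%:R) by rewrite -thE.
  have n0' : near alpha d s n (ln num%:R - ln dn%:R) by rewrite -thE.
  have := near_unique alpha_gt0 d_gt0 xn0 (nS_gt0 pr_prime x.2.2) num0 dn0 hT hT0 (hrat x px) (hrat x0 px0) d_small dG_small nx' n0'.
  rewrite eA eB => e; apply/eqP; rewrite -(eqn_pmul2r g0); apply/eqP.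
  by rewrite -mulnA e mulnAC.
have eAB0 := allx x0 px0.
have AB : P0%:R <= A%:R * B%:R :> R.
  rewrite -natrM ler_nat.
  case: (ltngtP B 1) => hB; first by rewrite ltnNge B0 in hB.
    have [p pp pB] := pdivP hB.
    have : (p %| nS x0.2.2)%N by apply: dvdn_trans pB _; rewrite -/dn eB dvdn_mulr.
    rewrite /nS; elim/big_rec: _ => [|i z _ IH]; first by rewrite dvdn1 => /eqP e; rewrite e in pp.
    rewrite Euclid_dvdM// => /orP[|/IH//]; rewrite dvdn_prime2// => /eqP ep.
    apply: leq_trans (ltnW (pr_gtP0 i)) _; rewrite -ep.
    by apply: leq_trans (dvdn_leq B0 pB) _; rewrite leq_pmull.
  rewrite hB muln1 leqNgt; apply/negP => hAP.
  rewrite hB muln1 in eAB0.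
  have hA : (0 < A <= P0)%N by rewrite A0 ltnW.
  have [sub eb] := smooth_ratio hA eAB0.
  have A3 : (3 <= A)%N.
    by move: r1 r2 A0; rewrite /ratio eAB0 !eqn_pmul2r ?nS_gt0//; clear; case: A => [|[|[|A]]].
  have hTS : (nS (x0.2.2 :\: x0.2.1) <= N)%N.
    apply: leq_trans hT0; apply: dvdn_leq; first exact: nS_gt0.
    by rewrite [X in (_ %| X)%N](nSID pr x0.2.2 x0.2.1) dvdn_mull.
  by move/eqP: cx0; apply; rewrite eb c_zero// A3 ltnW.
have nAB : near alpha d s n (ln A%:R - ln B%:R).
  move: n0; rewrite thE// -/num -/dn eA eB !natrM !lnM ?ltr0n//.
  by rewrite opprD addrACA subrr addr0.
have A1 : 1 <= A%:R :> R by rewrite ler1n.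
have B1 : 1 <= B%:R :> R by rewrite ler1n.
have P1 : 1 <= P0%:R :> R by rewrite ler1n (leq_trans _ P0_ge2).
have kh : 0 <= kap / 2 by pos.
have hdec := near_decay alpha_gt0 kh d_le A1 B1 P1 AB nAB.
set SB := [set i | (pr i %| B)%N].
have SBsub (T : {set I}) : (B %| nS T)%N -> B = nS SB /\ SB \subset T.
  move=> BT; have e := dvd_nS pr_prime pr_inj BT.
  have sub : SB \subset T.
    apply/subsetP => i; rewrite inE => hi.
    by rewrite -(pr_dvd_nS pr_prime pr_inj) (dvdn_trans hi BT).
  split=> //; rewrite {1}e; congr nS; apply/setP => i; rewrite !inE.
  by case: (boolP (pr i %| B)%N) => hi; rewrite ?andbF// andbT; apply: (subsetP sub); rewrite inE.
have BdvT x : Pn x -> (B %| nS x.2.2)%N.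
  have cBA : coprime B A by rewrite coprime_sym.
  by move=> px; rewrite -(Gauss_dvdr _ cBA) -(allx x px) dvdn_mull.
(* The image keeps the primes of [S] dividing [A], the rest of [S], and [T] without the primes of
   [B]; [b] is recovered from the fixed ratio. *)
pose h (x : Tr) : {set I} * ({set I} * {set I}) :=
  ([set i in x.2.1 | (pr i %| A)%N], (x.2.1 :\: [set i in x.2.1 | (pr i %| A)%N], x.2.2 :\: SB)).
pose Q (y : {set I} * ({set I} * {set I})) := [forall i in y.1, (pr i %| A)%N] &&
  ((y.2.1 \subset y.2.2) && (nS y.2.2 <= N)%N).
pose v (y : {set I} * ({set I} * {set I})) : R := 2 * (pw A%:R (- 2^-1) * fS SB) *
  ((fS y.1 * pw (nS y.1)%:R 2^-1) *
   (fS y.2.1 * fS y.2.2 * pw (nS (y.2.2 :\: y.2.1))%:R (- 2^-1))).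
have fact x : Pn x -> let U := [set i in x.2.1 | (pr i %| A)%N] in
   let S1 := x.2.1 :\: U in let T1 := x.2.2 :\: SB in
   [/\ nS x.2.1 = (nS U * nS S1)%N, nS x.2.2 = (B * nS T1)%N, S1 \subset T1 &
       (x.1 * nS x.2.1 = A * nS T1)%N].
  move=> px U S1 T1; have [eB' subT] := SBsub _ (BdvT x px).
  have e1 : nS x.2.1 = (nS U * nS S1)%N.
    rewrite [LHS](nSID pr _ U) (setIidPr _)//; apply/subsetP => i; by rewrite inE => /andP[].
  have e2 : nS x.2.2 = (B * nS T1)%N.
    by rewrite [LHS](nSID pr _ SB) (setIidPr subT) -eB'.
  have e3 : (x.1 * nS x.2.1 = A * nS T1)%N.
    apply/eqP; rewrite -(eqn_pmul2r B0) (allx x px) e2 mulnA mulnAC -mulnA.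
    by rewrite mulnA mulnAC.
  split=> //; apply/subsetP => i; rewrite !inE => /andP[iNU iS].
  have iA : ~~ (pr i %| A)%N by move: iNU; rewrite iS.
  have : (pr i %| A * nS T1)%N by rewrite -e3 dvdn_mull// pr_dvd_nS.
  by rewrite Euclid_dvdM// (negPf iA) /= pr_dvd_nS// !inE.
have bnd : \sum_(x | Pn x) `|w x| <= \sum_(y | Q y) v y.
  apply: (@ler_sum_inj _ _ _ _ h).
  - move=> [b [S T]] [b' [S' T']]; rewrite !unfold_in => px px' [e1 e2 e3].
    have eS : S = S'.
      rewrite -(setID S [set i in S | (pr i %| A)%N]) -(setID S' [set i in S' | (pr i %| A)%N]).
      have sub0 (S0 : {set I}) : S0 :&: [set i in S0 | (pr i %| A)%N] = [set i in S0 | (pr i %| A)%N].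
        by apply/setIidPr/subsetP => i; rewrite inE => /andP[].
      by rewrite !sub0 e2 e1.
    have [_ sT] := SBsub _ (BdvT _ px); have [_ sT'] := SBsub _ (BdvT _ px').
    have eT : T = T' by rewrite -(setID T SB) -(setID T' SB) (setIidPr sT) (setIidPr sT') e3.
    have := allx _ px; have := allx _ px'; rewrite /= eS eT => <- /eqP.
    rewrite eqn_pmul2r// eqn_pmul2r ?nS_gt0// => /eqP eb.
    by congr (_, _); apply: val_inj.
  - move=> x px; have [e1 e2 e3 e4] := fact x px.
    have /and4P[/and3P[_ _ hT] _ _ _] := px.
    rewrite /Q /h /= e3 /=.
    apply/andP; split; first by apply/forall_inP => i; rewrite inE => /andP[].
    by apply: leq_trans hT; rewrite e2 leq_pmull.
  - move=> x px; have [e1 e2 e3 e4] := fact x px; have /and4P[pt _ _ _] := px.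
    have /and3P[xb0 _ _] := pt.
    set U := [set i in x.2.1 | (pr i %| A)%N] in e1 e3.
    set S1 := x.2.1 :\: U in e1 e3; set T1 := x.2.2 :\: SB in e2 e3 e4.
    have [eB' subT] := SBsub _ (BdvT x px).
    have fSe : fS x.2.1 = fS U * fS S1.
      rewrite [LHS](fSID f _ U) (setIidPr _)//; apply/subsetP => i; by rewrite inE => /andP[].
    have fTe : fS x.2.2 = fS SB * fS T1 by rewrite [LHS](fSID f _ SB) (setIidPr subT).
    have pb : 0 < (x.1)%:R :> R by rewrite ltr0n.
    have ppos S : 0 < (nS S)%:R :> R by rewrite ltr0n nS_gt0.
    have pA : 0 < A%:R :> R by rewrite ltr0n.
    have eT1 : nS T1 = (nS S1 * nS (T1 :\: S1))%N by rewrite [LHS](nSID pr _ S1) (setIidPr e3).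
    have eb : pw (x.1)%:R (- 2^-1) = pw A%:R (- 2^-1) * pw (nS U)%:R 2^-1 * pw (nS (T1 :\: S1))%:R (- 2^-1).
      have e5 : (x.1)%:R * (nS U)%:R = A%:R * (nS (T1 :\: S1))%:R :> R.
        move: e4; rewrite e1 eT1 => e4; rewrite -!natrM; congr (_%:R).
        apply/eqP; rewrite -(eqn_pmul2r (nS_gt0 pr_prime S1)); apply/eqP.
        by rewrite -mulnA e4 [(nS S1 * _)%N]mulnC mulnA.
      have e6 := congr1 (pw^~ (- 2^-1)) e5; rewrite /= !pwM// in e6.
      have uu : pw (nS U)%:R (- 2^-1) * pw (nS U)%:R 2^-1 = 1 by rewrite -pwD addNr pw0.
      by rewrite mulrAC -e6 -mulrA uu mulr1.
    rewrite /w normrM normrM [`|pw _ _|]ger0_norm ?pw_ge0// [`|_ * _|]ger0_norm ?mulr_ge0 ?fS_ge0//.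
    have c2 : `|c x.1| <= 2.
      apply: c_le2; apply: le_trans G_X0; apply: le_trans (_ : (x.1 * nS x.2.1)%:R <= _).
        by rewrite ler_nat leq_pmulr// nS_gt0.
      apply: le_trans (hrat x px) _; rewrite ler_wpM2l//; first by have := G_ge1; lra.
      by rewrite ler_nat; have /and3P[] := pt.
    rewrite -mulrA; apply: le_trans (ler_wpM2r _ c2) _.
      by rewrite mulr_ge0 ?pw_ge0// mulr_ge0 ?fS_ge0.
    rewrite /v /h /= -/U -/S1 -/T1 eb fSe fTe le_eqVlt; apply/orP; left; apply/eqP; ring.
  - by move=> y _; rewrite /v; pos; exact: fS_ge0.
apply: le_trans bnd _.
have -> : \sum_(y | Q y) v y = 2 * (pw A%:R (- 2^-1) * fS SB) *
   ((\sum_(U : {set I} | [forall i in U, (pr i %| A)%N]) fS U * pw (nS U)%:R 2^-1) * diag1).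
  rewrite /diag1 mulr_suml; under [X in _ = _ * X]eq_bigr do rewrite mulr_sumr.
  by rewrite pair_big /= mulr_sumr; apply: eq_big => -[U [S T]].
rewrite -[X in _ <= X]mulrA -[X in X <= _]mulrA ler_wpM2l// mulrA ler_wpM2r//.
apply: le_trans (_ : pw A%:R (- (kap / 2)) * pw B%:R (- (kap / 2)) <= _); last first.
  by apply: le_trans hdec; rewrite pwM ?ltr0n.
rewrite mulrAC ler_pM ?mulr_ge0 ?pw_ge0 ?fS_ge0//.
- by apply: sumr_ge0 => U _; rewrite mulr_ge0 ?fS_ge0 ?pw_ge0.
- apply: le_trans (prodA_bound A0); rewrite ler_wpM2l ?pw_ge0//.
  pose hh i := if (pr i %| A)%N then f i * pw (pr i)%:R 2^-1 else 0.
  have hh0 i : 0 <= hh i by rewrite /hh; case: ifP => // _; rewrite mulr_ge0 ?pw_ge0.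
  have -> : \prod_(i | (pr i %| A)%N) (1 + f i * pw (pr i)%:R 2^-1) = \prod_i (1 + hh i).
    by rewrite big_mkcond; apply: eq_bigr => i _; rewrite /hh; case: ifP => // _; rewrite addr0.
  under [X in _ <= X]eq_bigr do rewrite addrC.
  have := @sum_sets I (fun i b => if b then hh i else 1); rewrite /= => <-.
  rewrite big_mkcond; apply: ler_sum => U _; case: ifP => [/forall_inP hU|_]; last first.
    by apply: prodr_ge0 => i _; case: ifP.
  rewrite pw_nS// /fS -big_split [X in X <= _]big_mkcond le_eqVlt; apply/orP; left; apply/eqP.
  by apply: eq_bigr => i _; rewrite /hh; case: ifP => // iU; rewrite hU.
- have [eB' _] := SBsub _ (BdvT x0 px0).
  apply: le_trans (fS_le pr_prime f_ge0 f_le SB) _; rewrite -eB'.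
  by apply: ler_pwe => //; have := kap_gt0; lra.
Qed.

(** From its minimum [b0] the set extends to at most [b0 (1 + g)]; these are at most [1 + g b0]
    integers, each of weight at most [b0^(-1/2)]. *)
Lemma ord_run_sum (g lo : R) (P : pred 'I_W.+1) : 0 <= g -> 0 < lo ->
  (forall b, P b -> (0 < b)%N /\ lo <= b%:R) ->
  (forall b b', P b -> P b' -> b'%:R <= b%:R * (1 + g)) ->
  \sum_(b | P b) pw b%:R (- 2^-1) <= g * pw W%:R 2^-1 + pw lo^-1 2^-1.
Proof.
move=> g0 lo0 hlo hrun.
have R0 : 0 <= g * pw W%:R 2^-1 + pw lo^-1 2^-1 by pos.
case: (pickP P) => [b1 Pb1|no]; last by rewrite big_pred0.
pose b0 := [arg min_(b < b1 | P b) (b : nat)].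
have [Pb0 min0] : P b0 /\ (forall b, P b -> (b0 <= b)%N).
  by rewrite /b0; case: arg_minnP => // i Pi hi; split.
have [b00 hb0] := hlo _ Pb0.
have p0 : 0 < b0%:R :> R by rewrite ltr0n.
pose top := Num.Def.truncn (b0%:R * (1 + g) : R).
have htop0 : 0 <= b0%:R * (1 + g) by pos.
have htop b : P b -> (b <= top)%N.
  by move=> Pb; rewrite /top truncn_ge_nat// hrun.
apply: le_trans (_ : \sum_(b < W.+1) ((b0 <= b < top.+1)%N%:R * pw b0%:R (- 2^-1)) <= _).
  rewrite big_mkcond; apply: ler_sum => b _; case: ifP => [Pb|_]; last by rewrite mulr_ge0 ?ler0n ?pw_ge0.
  rewrite min0//= ltnS htop// mul1r; apply: ler_pwN; rewrite ?ler_nat ?min0//; lra.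
rewrite -mulr_suml; apply: le_trans (ler_wpM2r (pw_ge0 _ _) (sum_indicator_itv _ _ _)) _.
have h1 : (top.+1 - b0)%:R <= 1 + g * b0%:R :> R.
  rewrite natrB ?(leq_trans (htop _ Pb0))// -natr1.
  have : top%:R <= b0%:R * (1 + g) :> R by rewrite /top truncn_le.
  lra.
apply: le_trans (ler_wpM2r (pw_ge0 _ _) h1) _.
rewrite mulrDl mul1r addrC lerD//.
  have -> : g * b0%:R * pw b0%:R (- 2^-1) = g * pw b0%:R 2^-1.
    rewrite -mulrA -[X in X * pw _ _](pw1 p0) -pwD; congr (_ * pw _ _); lra.
  rewrite ler_wpM2l//; apply: ler_pw; [lra | done | by rewrite ler_nat -ltnS].
by rewrite pwV// -pwN; apply: ler_pwN => //; lra.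
Qed.

(** Now [b] is at least [G / (2 N)] and, for fixed [S] and [T], confined to a short run, so the size
    of the coefficients is enough. *)
Lemma near_big s n : G <= exp ((-1) ^+ (s : bool) * n%:R * (2 * PI) / alpha) ->
  \sum_(x | PT x && near alpha d s n (th x)) `|w x| <= CH * Big * (N%:R * FN).
Proof.
move=> hE; set j := (-1) ^+ s * n%:R * (2 * PI) / alpha in hE.
have nearE x : near alpha d s n (th x) -> j - 2 * d / alpha <= th x <= j + 2 * d / alpha.
  rewrite /near ler_norml => /andP[h1 h2].
  have e1 : alpha * (j + 2 * d / alpha) = (-1) ^+ s * n%:R * (2 * PI) + 2 * d by rewrite /j; field; rewrite gt_eqF.
  have e2 : alpha * (j - 2 * d / alpha) = (-1) ^+ s * n%:R * (2 * PI) - 2 * d by rewrite /j; field; rewrite gt_eqF.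
  by apply/andP; split; rewrite -(ler_pM2l alpha_gt0) ?e1 ?e2; lra.
have ds := d_small; have d0 := d_gt0.
have dl : 2 * d / alpha <= 4^-1 by lra.
have dl0 : 0 <= 2 * d / alpha by pos.
have G0 : 0 < G by have := G_ge1; lra.
have N0 : 0 < N%:R :> R by rewrite ltr0n.
have run S T : (nS S <= N)%N -> (nS T <= N)%N ->
   \sum_(b < W.+1 | (0 < b)%N && near alpha d s n (th (b, (S, T)))) pw b%:R (- 2^-1) <= Big.
  move=> hS hT.
  have pS : 0 < (nS S)%:R :> R by rewrite ltr0n nS_gt0.
  have pT : 1 <= (nS T)%:R :> R by rewrite ler1n nS_gt0.
  have SN : (nS S)%:R <= N%:R :> R by rewrite ler_nat.
  have -> : Big = 8 * d / alpha * pw W%:R 2^-1 + pw ((G / (2 * N%:R)))^-1 2^-1.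
    by rewrite /Big; congr (_ + pw _ _); field; rewrite !gt_eqF.
  apply: ord_run_sum; first by pos.
  - by rewrite divr_gt0// mulr_gt0.
  - move=> b /andP[b0 nb]; split=> //.
    have pb : 0 < b%:R :> R by rewrite ltr0n.
    have /andP[h1 _] := nearE _ nb; rewrite /th /= in h1.
    have lT := ln_ge0 pT.
    have h2 : j - 2 * d / alpha <= ln (b%:R * (nS S)%:R) by rewrite lnM//; lra.
    have h3 : exp (j - 2 * d / alpha) <= b%:R * N%:R.
      apply: le_trans (_ : b%:R * (nS S)%:R <= _); last by rewrite ler_wpM2l// ltW.
      by rewrite -[X in _ <= X]exp_ln0 ?mulr_gt0// ler_exp.
    rewrite ler_pdivrMr ?mulr_gt0//.
    have h4 : G / 2 <= exp (j - 2 * d / alpha).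
      rewrite expD; apply: le_trans (_ : G * 2^-1 <= _) => //.
      apply: ler_pM => //; [exact: ltW | lra |].
      by have := exp_ge1D (- (2 * d / alpha)); lra.
    lra.
  - move=> b b' /andP[b0 nb] /andP[b0' nb'].
    have pb : 0 < b%:R :> R by rewrite ltr0n.
    have pb' : 0 < b'%:R :> R by rewrite ltr0n.
    have /andP[h1 _] := nearE _ nb; have /andP[_ h2] := nearE _ nb'; rewrite /th /= in h1 h2.
    have h3 : ln b'%:R <= ln b%:R + 4 * d / alpha :> R by lra.
    have h40 : 0 <= 4 * d / alpha by pos.
    have h4 : 1 + 8 * d / alpha = 1 + 2 * (4 * d / alpha) by ring.
    rewrite h4; apply: le_trans (ler_wpM2l (ltW pb) (exp_le1D2 h40 ds)).
    by rewrite -[X in X <= _](exp_ln0 pb') -[X in X * _](exp_ln0 pb) -expD ler_exp.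
have F0 S : 0 <= fS S by exact: fS_ge0.
apply: le_trans (_ : \sum_(y : {set I} * {set I} | (nS y.1 <= N)%N && (nS y.2 <= N)%N)
   CH * Big * (fS y.1 * fS y.2) <= _); last first.
  rewrite -mulr_sumr ler_wpM2l ?mulr_ge0//.
  apply: le_trans (sum_fS_sqr pr_prime pr_inj N f).
  rewrite expr2 mulr_suml; under [X in _ <= X]eq_bigr do rewrite mulr_sumr.
  by rewrite pair_big.
have -> : \sum_(x | PT x && near alpha d s n (th x)) `|w x| =
  \sum_(y : {set I} * {set I} | (nS y.1 <= N)%N && (nS y.2 <= N)%N)
    \sum_(b < W.+1 | (0 < b)%N && near alpha d s n (th (b, y))) `|w (b, y)|.
  rewrite (exchange_big_dep xpredT) //= pair_big_dep /=; apply: eq_big => -[b [S T]] //=.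
  by rewrite /PT /=; case: (0 < b)%N; case: (nS S <= N)%N; case: (nS T <= N)%N.
apply: ler_sum => -[S T] /= /andP[hS hT].
apply: le_trans (_ : \sum_(b < W.+1 | (0 < b)%N && near alpha d s n (th (b, (S, T))))
   CH * (fS S * fS T) * pw b%:R (- 2^-1) <= _).
  apply: ler_sum => b _; rewrite /w /= normrM normrM [`|pw _ _|]ger0_norm ?pw_ge0//.
  rewrite [`|fS S * _|]ger0_norm ?mulr_ge0// mulrAC ler_wpM2r ?pw_ge0// ler_wpM2r ?mulr_ge0//.
by rewrite -mulr_sumr mulrAC ler_wpM2r ?mulr_ge0// ler_wpM2l// run.
Qed.

Hypothesis two_case : cis (alpha * ln 2) = 1 \/ nrm (kn (ln 2)) <= 4^-1.

(** The ratios 1 and 2 give [diag1] times [|1 - sqrt 2 z|], where [z] has the modulus of the mean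
    phase of 2. This cannot be small: if the phase of 2 along the progression is trivial then
    [|z| = 1], otherwise averaging gives [|z| <= 1/4]. Hence the dichotomy [two_case]. *)
Lemma first_moment_lower :
  (2 / 5 - 4 * Bj / (1 - q)) * diag1 -
    (far * Cc + 2 * J.+1%:R * (CH * Big)) * (N%:R * FN) <=
  nrm (Av M K (fun l => dirpoly (alpha * l%:R + beta) *
     (nrm (resonator pr N fS (alpha * l%:R + beta)) ^+ 2)%:C) c0).
Proof.
rewrite Av_moment_eq.
have D0 := diag1_ge0; have NF0 : 0 <= N%:R * FN by rewrite mulr_ge0.
have M0 : M%:R != 0 :> C by rewrite pnatr_eq0 -lt0n.
have kn0 : kn 0 = 1.
  rewrite /kn; under eq_Av do rewrite !mulr0 oppr0 cis0.
  by rewrite Av_const.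
have thA A x : (0 < A)%N -> PT x -> ratio A x -> th x = ln A%:R.
  by move=> A0 px /eqP e; rewrite thE// e natrM lnM ?ltr0n ?nS_gt0// addrK.
have r12 x : PT x -> ratio 2 x -> ~~ ratio 1 x.
  move=> px /eqP e; apply/negP => /eqP; rewrite e => /eqP.
  by rewrite eqn_pmul2r ?nS_gt0.
have s1 : \sum_(x | PT x && ratio 1 x) term x = diag1%:C.
  transitivity (\sum_(x | PT x && ratio 1 x) (w x)%:C).
    apply: eq_bigr => x /andP[px rx]; rewrite /term (thA 1%N)// ln10 mulr0 oppr0 cis0 mul1r kn0 mulr1 //.
  rewrite -(rmorph_sum (real_complex R)) (@sum_ratio 1 1)//.
    by rewrite pw1x !mul1r.
  by move=> S hS; rewrite mul1n c_one.
have s2 : \sum_(x | (PT x && ~~ ratio 1 x) && ratio 2 x) term x =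
    (- 2 * pw 2 (- 2^-1) * diag1)%:C * (cis (- (beta * ln 2)) * kn (ln 2)).
  transitivity (\sum_(x | PT x && ratio 2 x) (w x)%:C * (cis (- (beta * ln 2)) * kn (ln 2))).
    apply: eq_big => [x|x /andP[/andP[px _] rx]]; last by rewrite /term (thA 2%N).
    by rewrite -andbA; case: (boolP (PT x)) => //= px; case: (boolP (ratio 2 x)) => rx; rewrite ?andbF// r12.
  by rewrite -mulr_suml -(rmorph_sum (real_complex R)) (@sum_ratio 2 (- 2)).
rewrite (bigID (ratio 1)) /= s1 [X in nrm (_ + X)](bigID (ratio 2)) /= s2 addrA.
set rest := \sum_(x | _) term x.
have hrest : nrm rest <= far * Cc * (N%:R * FN) + (4 * Bj / (1 - q) * diag1 + 2 * J.+1%:R * (CH * Big) * (N%:R * FN)).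
  apply: le_trans (nrm_sum _ _ _) _.
  have ht x : nrm (term x) = `|w x| * nrm (kn (th x)) by rewrite /term !nrmM nrm_cis mul1r nrm_real.
  set P := fun x => (PT x && ~~ ratio 1 x) && ~~ ratio 2 x.
  rewrite (bigID (fun x => d <= nrm (1 - cis (alpha * th x)))) /= lerD//.
    apply: le_trans (_ : \sum_(x | PT x) far * `|w x| <= _).
      rewrite [X in X <= _]big_mkcond [X in _ <= X]big_mkcond /=; apply: ler_sum => x _.
      case: ifP => [/andP[/andP[/andP[-> _] _] hx]|_]; last by case: ifP => // _; rewrite mulr_ge0.
      rewrite ht mulrC ler_wpM2r//; exact: nrm_Av_cis_far.
    rewrite -mulr_sumr -mulrA ler_wpM2l//.
    have -> : \sum_(x | PT x) `|w x| = (\sum_(b < W.+1 | (0 < b)%N) `|c b| * pw b%:R (- 2^-1)) *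
       (\sum_(S | (nS S <= N)%N) fS S) ^+ 2.
      rewrite expr2 mulr_suml [in RHS]mulr_suml.
      transitivity (\sum_(b < W.+1 | (0 < b)%N) \sum_(y : {set I} * {set I} | (nS y.1 <= N)%N && (nS y.2 <= N)%N)
         `|c b| * pw b%:R (- 2^-1) * (fS y.1 * fS y.2)).
        rewrite pair_big_dep /=; apply: eq_big => -[b [S T]] //= _.
        by rewrite /w /= normrM normrM [`|pw _ _|]ger0_norm ?pw_ge0// [`|fS S * _|]ger0_norm// mulr_ge0 ?fS_ge0.
      apply: eq_bigr => b _; rewrite -mulr_sumr; congr (_ * _).
      by under [RHS]eq_bigr do rewrite mulr_sumr; rewrite pair_big.
    apply: ler_pM; rewrite ?sqr_ge0//; first by apply: sumr_ge0 => b _; rewrite mulr_ge0 ?pw_ge0.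
    exact: sum_fS_sqr.
  set Pn := fun x => P x && ~~ (d <= nrm (1 - cis (alpha * th x))).
  apply: le_trans (_ : \sum_(x | Pn x) `|w x| <= _).
    apply: ler_sum => x _; rewrite ht -[X in _ <= X]mulr1 ler_wpM2l//; exact: nrm_Av_cis_le1.
  apply: le_trans (@union_bound _ (bool * 'I_J.+1)%type Pn (fun z x => near alpha d z.1 z.2 (th x)) _ _ _) _.
  - move=> x /andP[/andP[/andP[px _] _] hx].
    have hJ : alpha * `|th x| + 1 <= 6 * J%:R.
      apply: le_trans J_big; rewrite lerD2r ler_wpM2l ?(ltW alpha_gt0)// ler_norml /th.
      have /and3P[b0 hS hT] := px.
      have l1 : 0 <= ln (x.1)%:R :> R by rewrite lnn_ge0.
      have l2 : ln (x.1)%:R <= ln W%:R :> R by rewrite ler_ln ?ltr0n ?(leq_trans b0) ?ler_nat// -ltnS.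
      have l3 : 0 <= ln (nS x.2.1)%:R :> R by rewrite lnn_ge0.
      have l4 : ln (nS x.2.1)%:R <= ln N%:R :> R by rewrite ler_ln ?ltr0n ?nS_gt0// ler_nat.
      have l5 : 0 <= ln (nS x.2.2)%:R :> R by rewrite lnn_ge0.
      have l6 : ln (nS x.2.2)%:R <= ln N%:R :> R by rewrite ler_ln ?ltr0n ?nS_gt0// ler_nat.
      apply/andP; split; lra.
    by have [h|[s [n hn]]] := near_cases alpha_gt0 d_le hJ; [rewrite h in hx | exists (s, n)].
  - by move=> x _.
  apply: le_trans (_ : \sum_(z : bool * 'I_J.+1) (2 * (Bj * q ^+ z.2) * diag1 + CH * Big * (N%:R * FN)) <= _).
    apply: ler_sum => -[s n] _ /=.
    have CB0 : 0 <= CH * Big * (N%:R * FN) by rewrite !mulr_ge0.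
    have qn0 : 0 <= q ^+ n by exact: exprn_ge0.
    have BD0 : 0 <= 2 * (Bj * q ^+ n) * diag1 := mulr_ge0 (mulr_ge0 (ler0n _ 2) (mulr_ge0 Bj0 qn0)) D0.
    case/orP: (le_total (exp ((-1) ^+ (s : bool) * n%:R * (2 * PI) / alpha)) G) => hG.
      apply: le_trans (_ : 2 * (Bj * q ^+ n) * diag1 <= _); last by rewrite lerDl.
      apply: le_trans (near_small hG); rewrite [X in X <= _]big_mkcond [X in _ <= X]big_mkcond /=.
      apply: ler_sum => x _; case: ifP => [/andP[/andP[/andP[/andP[-> ->] ->] _] ->] //|_].
      by case: ifP.
    apply: le_trans (_ : CH * Big * (N%:R * FN) <= _); last by rewrite lerDr.
    apply: le_trans (near_big hG); rewrite [X in X <= _]big_mkcond [X in _ <= X]big_mkcond /=.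
    apply: ler_sum => x _; case: ifP => [/andP[/andP[/andP[/andP[-> _] _] _] ->] //|_].
    by case: ifP.
  rewrite big_split /= lerD//; last first.
    rewrite sumr_const card_prod card_bool card_ord -[_ *+ _]mulr_natl natrM.
    by rewrite le_eqVlt; apply/orP; left; apply/eqP; ring.
  rewrite -mulr_suml ler_wpM2r// -mulr_sumr -mulr_sumr.
  rewrite -(pair_big xpredT xpredT (fun (s : bool) (n : 'I_J.+1) => q ^+ n)) /= big_bool /=.
  have q1 : q < 1.
    have k0 := kap_gt0; have hp := PI_gt0.
    by rewrite -exp00 ltr_exp oppr_lt0 divr_gt0// mulr_gt0//; lra.
  have hg := geo_sum_le J.+1 q0 q1; set gs := \sum_(i < J.+1) q ^+ i in hg *.
  have -> : 4 * Bj / (1 - q) = 2 * (Bj * ((1 - q)^-1 + (1 - q)^-1)) by ring.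
  by rewrite ler_wpM2l// ler_wpM2l// lerD.
apply: le_trans (nrm_add_ge _ _).
suff hm : 2 / 5 * diag1 <= nrm (diag1%:C + (- 2 * pw 2 (- 2^-1) * diag1)%:C * (cis (- (beta * ln 2)) * kn (ln 2))) by lra.
have -> : diag1%:C + (- 2 * pw 2 (- 2^-1) * diag1)%:C * (cis (- (beta * ln 2)) * kn (ln 2)) =
   diag1%:C * (1 - (2 * pw 2 (- 2^-1))%:C * (cis (- (beta * ln 2)) * kn (ln 2))).
  by rewrite !mulNr (rmorphN (real_complex R)) (rmorphM (real_complex R) _ diag1); ring.
rewrite nrmM nrm_real (ger0_norm D0) mulrC ler_wpM2l//.
set u := 2 * pw 2 (- 2^-1).
have u2 : u ^+ 2 = 2.
  rewrite /u exprMn pw_sqr (_ : - 2^-1 *+ 2 = - 1); last by lra.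
  by rewrite pwN pw1//; lra.
have u0 : 0 <= u by rewrite /u; pos.
(* Rational bounds for [sqrt 2]: the first case leaves [7/5 - 1], the second [1 - 2/5], both at
   least [2/5]. *)
have u1 : 7 / 5 <= u by rewrite leNgt; apply/negP => h; nra.
have u3 : u <= 8 / 5 by rewrite leNgt; apply/negP => h; nra.
have nz : nrm (u%:C * (cis (- (beta * ln 2)) * kn (ln 2))) = u * nrm (kn (ln 2)).
  by rewrite !nrmM nrm_cis mul1r nrm_real ger0_norm.
have n1 : nrm (1 : C) = 1 by rewrite -[1](rmorph1 (real_complex R)) nrm_real normr1.
case: two_case => h2.
  have k1 : nrm (kn (ln 2)) = 1.
    rewrite /kn -[RHS]n1; congr nrm; under eq_Av => l do rewrite -mulrN cisMn cisN h2.
    rewrite -[RHS](@Av_const _ M K 1 c0 M0); apply: eq_Av => l.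
    by rewrite -[1](rmorph1 (real_complex R)) cj_real rmorph1 expr1n.
  rewrite nrmBC; apply: le_trans (nrm_sub_ge _ _); rewrite nz k1 n1; lra.
apply: le_trans (nrm_sub_ge _ _); rewrite nz n1.
have := ler_wpM2l u0 h2; lra.
Qed.

End FirstMoment.

(** * Removing the small primes from the alternating series *)

(** Multiplication of a Dirichlet series by [1 - p^(-s)]; the weights [b^(-1/2)] are kept apart from
    the coefficients. *)
Definition sieve (p : nat) (e : nat -> R) (b : nat) : R :=
  e b - (if (p %| b)%N then e (b %/ p)%N else 0).

Definition rough (ps : seq nat) (b : nat) : bool := all (fun p => ~~ (p %| b)%N) ps.

Definition pwt (t : R) (b : nat) : C := (pw b%:R (- 2^-1))%:C * cis (- (t * ln b%:R)).

Lemma pwtM t a b : (0 < a)%N -> (0 < b)%N -> pwt t (a * b) = pwt t a * pwt t b.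
Proof.
move=> a0 b0; rewrite /pwt natrM pwM ?ltr0n// lnM ?ltr0n// mulrDr opprD cisD.
by rewrite (rmorphM (real_complex R)) mulrACA.
Qed.

Lemma nrm_pwt t b : nrm (pwt t b) = pw b%:R (- 2^-1).
Proof. by rewrite /pwt nrmM nrm_cis mulr1 nrm_real ger0_norm// pw_ge0. Qed.

Lemma dirpolyE c W t : dirpoly c W t = \sum_(b < W.+1 | (0 < b)%N) (c b)%:C * pwt t b.
Proof. by apply: eq_bigr => b _; rewrite (rmorphM (real_complex R)) -mulrA. Qed.

Lemma dirpoly_widen c W W' t : (W <= W')%N -> (forall b, (W < b)%N -> c b = 0) ->
  dirpoly c W' t = dirpoly c W t.
Proof.
move=> h hc; rewrite /dirpoly.
rewrite -(big_mkord (fun b => (0 < b)%N) (fun b => (c b * pw b%:R (- 2^-1))%:C * cis (- (t * ln b%:R)))).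
rewrite (@big_cat_nat _ _ _ W.+1) //= big_mkord [X in _ + X]big_nat_cond [X in _ + X]big1 ?addr0//.
by move=> b /andP[/andP[hb _] _]; rewrite hc// mul0r mul0r.
Qed.

Lemma sum_multiples (T : nmodType) (p W : nat) (F : nat -> T) : (0 < p)%N ->
  \sum_(b < (p * W).+1 | (0 < b)%N && (p %| b)%N) F b = \sum_(a < W.+1 | (0 < a)%N) F (p * a)%N.
Proof.
move=> p0.
have h1 (a : 'I_W.+1) : (p * a < (p * W).+1)%N by rewrite ltnS leq_pmul2l// -ltnS.
have h2 (b : 'I_(p * W).+1) : (b %/ p < W.+1)%N.
  have hb : (b <= p * W)%N by rewrite -ltnS.
  by rewrite ltn_divLR// mulSn [(W * p)%N]mulnC (leq_ltn_trans hb)// -[X in (X < _)%N]add0n ltn_add2r.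
rewrite (reindex_onto (fun a : 'I_W.+1 => Ordinal (h1 a)) (fun b => Ordinal (h2 b))) /=.
  apply: eq_bigl => a; rewrite muln_gt0 p0 /= dvdn_mulr// andbT.
  by rewrite -val_eqE /= mulKn// eqxx andbT.
by move=> b /andP[_ pb]; apply: val_inj; rewrite /= mulnC divnK.
Qed.

Lemma dirpoly_sieve p e W t : (0 < p)%N -> (forall b, (W < b)%N -> e b = 0) ->
  dirpoly (sieve p e) (p * W) t = (1 - pwt t p) * dirpoly e W t.
Proof.
move=> p0 he; rewrite mulrBl mul1r -{1}(@dirpoly_widen e W (p * W)) ?leq_pmull// !dirpolyE.
transitivity (\sum_(b < (p * W).+1 | (0 < b)%N) (e b)%:C * pwt t b -
   \sum_(b < (p * W).+1 | (0 < b)%N && (p %| b)%N) (e (b %/ p)%N)%:C * pwt t b).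
  rewrite [X in _ - X]big_mkcondr -sumrB; apply: eq_bigr => b _; rewrite /sieve.
  by case: ifP => _; rewrite ?subr0// (rmorphB (real_complex R)) mulrBl.
congr (_ - _).
rewrite (@sum_multiples _ p W (fun b => (e (b %/ p)%N)%:C * pwt t b)) // mulr_sumr.
by apply: eq_bigr => a a0; rewrite mulKn// pwtM// mulrCA.
Qed.

Lemma sieve_support p e W : (0 < p)%N -> (forall b, (W < b)%N -> e b = 0) ->
  forall b, (p * W < b)%N -> sieve p e b = 0.
Proof.
move=> p0 he b hb; rewrite /sieve he ?(leq_ltn_trans _ hb) ?leq_pmull//.
case: ifP => pb; rewrite ?subr0// he ?subrr//.
by rewrite ltn_divRL// mulnC.
Qed.

Lemma sieve_le p e B : (forall b, `|e b| <= B) -> forall b, `|sieve p e b| <= B * 2.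
Proof.
move=> he b; have B0 : 0 <= B := le_trans (normr_ge0 _) (he 0%N).
rewrite /sieve; case: ifP => _; last by rewrite subr0; apply: le_trans (he b) _; lra.
apply: le_trans (ler_normB _ _) _; have := he b; have := he (b %/ p)%N; lra.
Qed.

Lemma sieve_local p e e' X : (forall b, (b <= X)%N -> e b = e' b) ->
  forall b, (b <= X)%N -> sieve p e b = sieve p e' b.
Proof.
move=> he b hb; rewrite /sieve he// he//.
by apply: leq_trans hb; exact: leq_div.
Qed.

Lemma rough_cons_div p ps b : prime p -> p \notin ps -> all prime ps -> (p %| b)%N ->
  rough ps (b %/ p) = rough ps b.
Proof.
move=> pp pps hps pb; rewrite /rough; apply: eq_in_all => q qps; congr (~~ _).
have qp := allP hps q qps.
rewrite -{2}(divnK pb) Euclid_dvdM// (dvdn_prime2 qp pp).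
suff /negbTE -> : q != p by rewrite orbF.
by apply: contraNneq pps => <-.
Qed.

(** The sign [(-1)^(b-1)], written as the coefficient of [zeta (s) - 2 * 2^(-s) zeta (s)] so that
    the sieve acts on each part. *)
Definition alt (b : nat) : R := 1 - (if (2 %| b)%N then 2 else 0).

(** Removing the primes of [ps] from [zeta] leaves the indicator of rough numbers; the factor
    [1 - 2^(1-s)] subtracts twice its dilate by 2. *)
Lemma sieve_alt ps b : uniq ps -> all prime ps -> (0 < b)%N ->
  foldr sieve alt ps b = (rough ps b)%:R - (if (2 %| b)%N then 2 * (rough ps (b %/ 2))%:R else 0).
Proof.
elim: ps b => [|p ps IH] b /=; first by move=> _ _ _; rewrite /alt; case: ifP => _; rewrite ?mulr1.
move=> /andP[pps ups] /andP[pp hps] b0; have p0 := prime_gt0 pp.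
rewrite {1}/sieve IH//; case: (boolP (p %| b)%N) => pb /=; last first.
  rewrite subr0; case: ifP => // b2.
  suff -> : (p %| b %/ 2)%N = false by [].
  by apply: contraNF pb => h; rewrite -(divnK b2) dvdn_mulr.
have bp0 : (0 < b %/ p)%N by rewrite divn_gt0// dvdn_leq.
rewrite IH// (rough_cons_div pp pps hps pb).
have e2 : ((2 %| b %/ p) = (2 %| b) && (p %| b %/ 2))%N.
  rewrite dvdn_divRL//; apply/idP/andP => [h|[b2 h]]; last by rewrite mulnC -dvdn_divRL.
  have b2 : (2 %| b)%N by apply: dvdn_trans h; exact: dvdn_mulr.
  by rewrite b2 dvdn_divRL// mulnC.
rewrite e2; case: (boolP (2 %| b)%N) => b2 /=; last by rewrite !subr0 subrr.
case: (boolP (p %| b %/ 2)%N) => pb2 /=; last by rewrite subr0; ring.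
by rewrite divnAC (rough_cons_div pp pps hps pb2); ring.
Qed.

(** * The sieved coefficients of the averaged partial sums *)

Section SievedEta.
Variables (P0 X : nat).
Hypothesis P0_ge2 : (2 <= P0)%N.

Definition small_primes : seq nat := [seq p <- iota 0 P0.+1 | prime p].
Definition sieve_modulus : nat := \prod_(p <- small_primes) p.

(** The coefficients of [etaV t X]: the averaging tapers the last two to [3/4] and [1/4]. *)
Definition eta_coef (b : nat) : R :=
  if (b <= X)%N then alt b else if b == X.+1 then 3 / 4 * alt b else
  if b == X.+2 then 4^-1 * alt b else 0.

Definition sieved_coef : nat -> R := foldr sieve eta_coef small_primes.

Definition sieve_factor (t : R) : C := \prod_(p <- small_primes) (1 - pwt t p).

Lemma small_primes_prime : all prime small_primes.
Proof. by apply/allP => p; rewrite mem_filter => /andP[]. Qed.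

Lemma mem_small_primes p : (p \in small_primes) = prime p && (p <= P0)%N.
Proof. by rewrite mem_filter mem_iota /= add0n ltnS. Qed.

Lemma small_primes_uniq : uniq small_primes.
Proof. by rewrite filter_uniq// iota_uniq. Qed.

Lemma alt_signE k : (alt k.+1)%:C = (-1) ^+ k :> C.
Proof.
rewrite /alt dvdn2 /= negbK -signr_odd; case: (odd k); rewrite ?subr0//.
by rewrite (_ : 1 - 2 = - 1); [rewrite (rmorphN (real_complex R)) | lra].
Qed.

Lemma norm_alt b : `|alt b| = 1.
Proof. by rewrite /alt; case: ifP => _; rewrite ?subr0 ?normr1// (_ : 1 - 2 = - 1) ?normrN1//; lra. Qed.

Lemma etaP_pwt t n : etaP t n = \sum_(1 <= b < n.+1) (alt b)%:C * pwt t b.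
Proof.
rewrite /etaP big_add1 /= big_mkord; apply: eq_bigr => k _.
rewrite alt_signE /ut /pwt; congr (_ * (_ * _)).
by rewrite pwN sqrt_pw// ltr0n.
Qed.

Lemma etaP_recr t n : etaP t n.+1 = etaP t n + (alt n.+1)%:C * pwt t n.+1.
Proof. by rewrite !etaP_pwt big_nat_recr. Qed.

Lemma etaV_dirpoly t : etaV t X = dirpoly eta_coef X.+2 t.
Proof.
rewrite dirpolyE -(big_mkord (fun b => (0 < b)%N) (fun b => (eta_coef b)%:C * pwt t b)).
have -> : \sum_(0 <= b < X.+3 | (0 < b)%N) (eta_coef b)%:C * pwt t b = \sum_(1 <= b < X.+3) (eta_coef b)%:C * pwt t b.
  rewrite big_ltn_cond//= big_nat_cond [RHS]big_nat_cond; apply: eq_bigl => b.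
  by case: b.
rewrite big_nat_recr//= big_nat_recr//=.
have -> : \sum_(1 <= b < X.+1) (eta_coef b)%:C * pwt t b = etaP t X.
  rewrite etaP_pwt big_nat_cond [RHS]big_nat_cond; apply: eq_bigr => b.
  by move=> /andP[/andP[_ hb] _]; rewrite /eta_coef -ltnS hb.
rewrite /etaV !etaP_recr.
rewrite /eta_coef ltnn eqxx ltnNge leqnSn /= (gtn_eqF (ltnSn _)) eqxx.
rewrite !(rmorphM (real_complex R)) (rmorph_nat (real_complex R) 3).
have e4 : (4^-1)%:C * 4 = 1 :> C.
  by rewrite -(rmorph_nat (real_complex R) 4) -(rmorphM (real_complex R)) mulVf ?rmorph1// pnatr_eq0.
move: e4; set q4 := (4^-1)%:C; set E := etaP t X; set a1 := (alt X.+1)%:C * _; set a2 := _ * pwt t X.+2 => e4.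
have -> : q4 * (E + 2 * (E + a1) + (E + a1 + a2)) = (q4 * 4) * E + 3 * q4 * a1 + q4 * a2 by ring.
by rewrite e4 mul1r /a1 /a2 !mulrA.
Qed.

Lemma dirpoly_fold ps e W t : all prime ps -> (forall b, (W < b)%N -> e b = 0) ->
  dirpoly (foldr sieve e ps) (\prod_(p <- ps) p * W) t =
    (\prod_(p <- ps) (1 - pwt t p)) * dirpoly e W t /\
  (forall b, (\prod_(p <- ps) p * W < b)%N -> foldr sieve e ps b = 0).
Proof.
move=> hps he; elim: ps hps => [|p ps IH] /=; first by rewrite !big_nil mul1n mul1r.
move=> /andP[/prime_gt0 p0 /IH [IH1 IH2]]; rewrite !big_cons -mulnA; split.
  by rewrite dirpoly_sieve// IH1 mulrA.
exact: sieve_support.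
Qed.

Lemma sieved_dirpoly t :
  dirpoly sieved_coef (sieve_modulus * X.+2) t = sieve_factor t * etaV t X.
Proof.
rewrite etaV_dirpoly; apply: (dirpoly_fold _ small_primes_prime _).1 => b hb.
by rewrite /eta_coef leqNgt (ltn_trans _ hb) ?(gtn_eqF hb) ?(gtn_eqF (ltn_trans _ hb)).
Qed.

Lemma eta_coef_le1 b : `|eta_coef b| <= 1.
Proof.
rewrite /eta_coef; case: ifP => _; first by rewrite norm_alt.
case: ifP => _; first by rewrite normrM norm_alt ger0_norm; lra.
case: ifP => _; last by rewrite normr0.
by rewrite normrM norm_alt ger0_norm; lra.
Qed.

Lemma sieved_coef_bound b : `|sieved_coef b| <= 2 ^+ size small_primes.
Proof.
rewrite /sieved_coef; elim: small_primes b => [|p ps IH] b /=; first exact: eta_coef_le1.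
by rewrite exprSr; exact: sieve_le.
Qed.

Lemma sieve_factor_bound t : nrm (sieve_factor t) <= 2 ^+ size small_primes.
Proof.
rewrite /sieve_factor; have := small_primes_prime.
elim: small_primes => [|p ps IH] /=; first by rewrite big_nil nrm1.
move=> /andP[pp /IH {}IH]; rewrite big_cons nrmM exprS ler_pM ?nrm_ge0//.
apply: le_trans (nrmB _ _) _; rewrite nrm1 nrm_pwt.
have : pw p%:R (- 2^-1) <= 1 by apply: pw_le1; [rewrite ler1n prime_gt0 | lra].
lra.
Qed.

Lemma sieved_coefE b : (0 < b <= X)%N -> sieved_coef b =
  (rough small_primes b)%:R - (if (2 %| b)%N then 2 * (rough small_primes (b %/ 2))%:R else 0).
Proof.
move=> /andP[b0 bX]; rewrite -sieve_alt ?small_primes_uniq ?small_primes_prime//.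
rewrite /sieved_coef; elim: small_primes b bX {b0} => [|p ps IH] b hb /=.
  by rewrite /eta_coef hb.
by apply: sieve_local hb => b' hb'; exact: IH.
Qed.

Lemma not_rough A b : (2 <= A <= P0)%N -> rough small_primes (A * b) = false.
Proof.
move=> /andP[A2 AP]; apply/negbTE/allPn; exists (pdiv A).
  by rewrite mem_small_primes pdiv_prime//= (leq_trans _ AP)// pdiv_leq// ltnW.
by rewrite negbK dvdn_mulr// pdiv_dvd.
Qed.

Lemma sieved_coef_le2 b : (b <= X)%N -> `|sieved_coef b| <= 2.
Proof.
case: (posnP b) => [->|b0] hb; last first.
  rewrite sieved_coefE ?b0// ler_norml.
  have n01 (B : bool) : (0 : R) <= (B%:R : R) <= 1 by case: B; rewrite /= ?lexx ?ler01.
  have := n01 (rough small_primes b); have := n01 (rough small_primes (b %/ 2)).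
  by case: ifP => _; lra.
have h0 : sieved_coef 0 = foldr sieve alt small_primes 0.
  rewrite /sieved_coef; elim: small_primes => [|p ps IH] //=.
  by rewrite /sieve dvdn0 div0n IH.
have h2 : 2%N \in small_primes by rewrite mem_small_primes P0_ge2.
(* At [b = 0] a sieving step subtracts the value from itself. *)
suff -> : sieved_coef 0 = 0 by rewrite normr0.
rewrite h0; elim: small_primes h2 => // p ps IH _ /=.
by rewrite /sieve dvdn0 div0n subrr.
Qed.

Lemma sieved_coef_sum W :
  \sum_(b < W.+1 | (0 < b)%N) `|sieved_coef b| * pw b%:R (- 2^-1) <= 2 ^+ size small_primes * W.+1%:R.
Proof.
apply: le_trans (_ : \sum_(b < W.+1) 2 ^+ size small_primes <= _); last first.
  by rewrite sumr_const card_ord -[_ *+ _]mulr_natr.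
rewrite big_mkcond; apply: ler_sum => b _; case: ifP => b0; last by rewrite exprn_ge0.
rewrite -[X in _ <= X]mulr1 ler_pM ?normr_ge0 ?pw_ge0 ?sieved_coef_bound//.
by apply: pw_le1; [rewrite ler1n | lra].
Qed.

Section Rough.
Variables (I : finType) (pr : I -> nat).
Hypothesis pr_prime : forall i, prime (pr i).
Hypothesis pr_gtP0 : forall i, (P0 < pr i)%N.

Lemma rough_nS S : rough small_primes (nS pr S).
Proof.
apply/allP => p; rewrite mem_small_primes => /andP[pp pP].
rewrite /nS; elim/big_rec: _ => [|i z _ IH]; first by rewrite dvdn1 neq_ltn prime_gt1 ?orbT.
rewrite Euclid_dvdM// negb_or IH andbT dvdn_prime2//.
by apply/eqP => e; move: (pr_gtP0 i); rewrite -e ltnNge pP.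
Qed.

Lemma nS_odd_small S : (2 %| nS pr S)%N = false.
Proof.
apply/negbTE; apply: (allP (rough_nS S)); by rewrite mem_small_primes P0_ge2.
Qed.

Lemma sieved_coef_one S : (nS pr S <= X)%N -> sieved_coef (nS pr S) = 1.
Proof.
by move=> h; rewrite sieved_coefE ?nS_gt0// nS_odd_small rough_nS subr0.
Qed.

Lemma sieved_coef_two S : (2 * nS pr S <= X)%N -> sieved_coef (2 * nS pr S)%N = -2.
Proof.
move=> h; rewrite sieved_coefE ?muln_gt0 ?nS_gt0// dvdn_mulr// mulKn// rough_nS not_rough//.
by rewrite mulr1 sub0r.
Qed.

(** For even [A] the second term has the cofactor [A / 2 >= 2], again with a small prime; only
    [A = 2] escapes. *)
Lemma sieved_coef_zero A S : (3 <= A <= P0)%N -> (A * nS pr S <= X)%N -> sieved_coef (A * nS pr S)%N = 0.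
Proof.
move=> /andP[A3 AP] h; have A0 : (0 < A)%N by exact: leq_trans A3.
rewrite sieved_coefE ?muln_gt0 ?A0 ?nS_gt0// not_rough ?(ltnW A3)//.
case: ifP; rewrite ?subr0// Euclid_dvdM// nS_odd_small orbF => A2.
rewrite mulnC -muln_divA// mulnC.
rewrite not_rough ?mulr0 ?subr0//; apply/andP; split; last by apply: leq_trans AP; exact: leq_div.
rewrite leq_divRL//; case: A A3 A2 {A0 AP h} => [|[|[|[|A]]]] //.
Qed.

End Rough.
End SievedEta.

(** * The second moment with the sign-twisted resonator *)

(** Neighbouring terms are paired: each pair costs one difference, and at most one unpaired term
    costs its size. *)
Lemma alt_run (h : nat -> C) (B D : R) (a0 n : nat) : 0 <= B -> 0 <= D ->
  (forall a, (a0 <= a < a0 + n)%N -> nrm (h a) <= B) ->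
  (forall a, (a0 <= a)%N -> (a.+1 < a0 + n)%N -> nrm (h a.+1 - h a) <= D) ->
  nrm (\sum_(a0 <= a < a0 + n) (-1) ^+ a * h a) <= B + n.-1%:R * D.
Proof.
move=> B0 D0; have [m] := ubnP n; elim: m n a0 => // m IH [|[|n]] a0 hm hB hD.
- by rewrite addn0 big_geq// nrm0; pos.
- rewrite addn1 big_nat1 mul0r addr0 nrmM nrmX nrmN nrm1 expr1n mul1r.
  by apply: hB; rewrite leqnn addn1 ltnSn.
have e2 : (a0 + n.+2 = a0.+2 + n)%N by rewrite !addnS.
rewrite e2 in hB hD *.
have l1 : (a0 < a0.+2 + n)%N by rewrite !addSn ltnS leqW// leq_addr.
have l2 : (a0.+1 < a0.+2 + n)%N by rewrite !addSn !ltnS leq_addr.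
rewrite big_ltn// big_ltn//.
rewrite addrA -[X in nrm (X + _)](_ : (-1) ^+ a0 * (h a0 - h a0.+1) = _); last by rewrite exprS; ring.
apply: le_trans (nrmD _ _) _; rewrite nrmM nrmX nrmN nrm1 expr1n mul1r nrmBC.
have h1 : nrm (h a0.+1 - h a0) <= D by apply: hD.
have h2 := IH n a0.+2 _ _ _.
apply: le_trans (lerD h1 (h2 _ _ _)) _.
- by rewrite ltnS in hm; exact: ltnW.
- by move=> a /andP[h3 h4]; apply: hB; rewrite h4 andbT (ltnW (ltnW h3)).
- by move=> a h3 h4; apply: hD => //; exact: ltnW (ltnW h3).
have : n.-1%:R <= n%:R :> R by rewrite ler_nat leq_pred.
rewrite /= -natr1 => h5; have := ler_wpM2r D0 h5; lra.
Qed.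

Lemma alt_count a0 n : \sum_(a0 <= a < a0 + n) (-1) ^+ a = ((-1) ^+ a0 - (-1) ^+ (a0 + n)) / 2 :> R.
Proof.
elim: n => [|n IH]; first by rewrite addn0 big_geq// subrr mul0r.
by rewrite addnS big_nat_recr ?leq_addr//= IH exprS; lra.
Qed.

Definition gw (beta x : R) : C := (pw x (- 2^-1))%:C * cis (- (beta * ln x)).

Lemma nrm_gw beta x : nrm (gw beta x) = pw x (- 2^-1).
Proof. by rewrite /gw nrmM nrm_cis mulr1 nrm_real ger0_norm// pw_ge0. Qed.

Lemma gw_lip beta (k x x' : R) : 0 < k -> k <= x -> x <= x' ->
  nrm (gw beta x' - gw beta x) <= (2^-1 + `|beta|) * ((x' - x) / k) * pw k (- 2^-1).
Proof.
move=> k0 hx hx'; have x0 : 0 < x by lra. have x'0 : 0 < x' by lra.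
have hl : ln x' - ln x <= (x' - x) / k.
  have -> : ln x' - ln x = ln (x' / x) by rewrite lndiv.
  apply: le_trans (ln_leB1 _) _; first by rewrite divr_gt0.
  have -> : x' / x - 1 = (x' - x) / x by rewrite mulrBl divff// gt_eqF.
  by rewrite ler_wpM2l ?subr_ge0// lef_pV2 ?posrE.
have hl0 : 0 <= ln x' - ln x by rewrite subr_ge0 ler_ln.
have hpx : pw x (- 2^-1) <= pw k (- 2^-1) by apply: ler_pwN => //; lra.
have hpx' : pw x' (- 2^-1) <= pw x (- 2^-1) by apply: ler_pwN => //; lra.
have p0 := pw_ge0 x (- 2^-1); have p0' := pw_ge0 x' (- 2^-1).
have -> : gw beta x' - gw beta x = (pw x' (- 2^-1) - pw x (- 2^-1))%:C * cis (- (beta * ln x')) +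
   (pw x (- 2^-1))%:C * (cis (- (beta * ln x')) - cis (- (beta * ln x))).
  by rewrite /gw (rmorphB (real_complex R)); ring.
apply: le_trans (nrmD _ _) _; rewrite !nrmM nrm_cis mulr1 !nrm_real (ger0_norm p0).
have h1 : `|pw x' (- 2^-1) - pw x (- 2^-1)| <= pw x (- 2^-1) * (2^-1 * (ln x' - ln x)).
  rewrite distrC ger0_norm ?subr_ge0//.
  have e : pw x' (- 2^-1) = pw x (- 2^-1) * exp (- (2^-1 * (ln x' - ln x))).
    by rewrite /pw -expD; congr exp; ring.
  rewrite e -[X in X - _]mulr1 -mulrBr ler_wpM2l//.
  by have := exp_ge1D (- (2^-1 * (ln x' - ln x))); lra.
have h2 : nrm (cis (- (beta * ln x')) - cis (- (beta * ln x))) <= `|beta| * (ln x' - ln x).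
  apply: le_trans (nrm_cisB _ _) _.
  by rewrite -opprD normrN -mulrBr normrM [`|ln x' - _|]ger0_norm.
apply: le_trans (lerD h1 (ler_wpM2l p0 h2)) _.
have -> : pw x (- 2^-1) * (2^-1 * (ln x' - ln x)) + pw x (- 2^-1) * (`|beta| * (ln x' - ln x)) =
   (2^-1 + `|beta|) * (ln x' - ln x) * pw x (- 2^-1) by ring.
have b0 : 0 <= 2^-1 + `|beta| by rewrite addr_ge0 ?invr_ge0 ?ler0n.
by rewrite ler_pM ?mulr_ge0// ler_wpM2l.
Qed.

(** * Alternating sums over the multiples of [m] in an interval *)

Section Blocks.
Variables (beta : R) (X : nat).
Let cb : R := 2^-1 + `|beta|.
Let cb0 : 0 <= cb. Proof. by rewrite /cb addr_ge0 ?invr_ge0 ?ler0n. Qed.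

Definition Tm (m k k' : nat) : C :=
  \sum_(a < X | (k < a.+1 * m <= k')%N) (-1) ^+ a * gw beta (a.+1 * m)%:R.

Lemma TmE m k k' : (0 < m)%N -> (k <= k')%N ->
  Tm m k k' = \sum_(k %/ m <= a < minn (k' %/ m) X) (-1) ^+ a * gw beta (a.+1 * m)%:R.
Proof.
move=> m0 kk; rewrite /Tm.
rewrite -(big_mkord (fun a => (k < a.+1 * m <= k')%N) (fun a => (-1) ^+ a * gw beta (a.+1 * m)%:R)).
rewrite big_nat_cond [RHS]big_nat_cond.
have [h|h] := leqP X (k %/ m)%N.
  rewrite big_pred0; last first.
    move=> a; rewrite -ltn_divLR// ltnS; apply/negbTE/negP => /and3P[h1 h2 _].
    by have := leq_trans (leq_ltn_trans h2 h1) h; rewrite ltnn.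
  rewrite big_pred0// => a; rewrite andbT; apply/negbTE/negP => /andP[h1].
  rewrite leq_min => /andP[_ h2]; by have := leq_trans (leq_ltn_trans h1 h2) h; rewrite ltnn.
rewrite (@big_cat_nat _ _ _ (k %/ m)) //=; last exact: ltnW.
rewrite big1_seq ?add0r; last first.
  move=> a /andP[/andP[_ /andP[h1 _]]]; rewrite mem_index_iota => /andP[_ h2].
  by move: h1; rewrite -ltn_divLR// ltnS leqNgt h2.
rewrite -big_nat_cond; have hle : (minn (k' %/ m) X <= X)%N by rewrite geq_minr.
have [h'|h'] := leqP (minn (k' %/ m) X) (k %/ m).
  rewrite [RHS]big_geq// big_nat_cond big_pred0// => a; apply/negbTE/negP.
  move=> /andP[/andP[h1 h2] /and3P[_ _ h3]].
  move: h'; rewrite geq_min => /orP[h'|h']; last by have := leq_trans h h'; rewrite ltnn.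
  have : (a.+1 <= k' %/ m)%N by rewrite leq_divRL.
  by move=> h4; have := leq_trans (leq_ltn_trans h1 h4) h'; rewrite ltnn.
rewrite (@big_cat_nat _ _ _ (minn (k' %/ m) X)) //=; last exact: ltnW.
rewrite [X in _ + X]big1_seq ?addr0; last first.
  move=> a /andP[/and3P[_ _ h1]]; rewrite mem_index_iota => /andP[h2 h3].
  have h4 : (a.+1 <= k' %/ m)%N by rewrite leq_divRL.
  move: h2; rewrite geq_min leqNgt h4 /= => h2.
  by have := leq_ltn_trans h2 h3; rewrite ltnn.
rewrite big_nat_cond [RHS]big_nat_cond; apply: eq_bigl => a.
rewrite andbT; case: (boolP (k %/ m <= a < minn (k' %/ m) X)%N) => //= /andP[h1 h2].
move: h2; rewrite leq_min => /andP[h2 h3].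
by rewrite h3 -ltn_divLR// ltnS h1 -leq_divRL.
Qed.

Lemma run_span m k s a1 : (0 < m)%N -> (a1 <= (k + s) %/ m)%N ->
  ((a1 - k %/ m).-1 * m <= s)%N.
Proof.
move=> m0 h.
have h1 : (a1 * m <= k + s)%N by rewrite -leq_divRL.
have h2 : (k < (k %/ m).+1 * m)%N by rewrite -ltn_divLR.
rewrite -subnS mulnBl leq_subLR; apply: leq_trans h1 _.
by rewrite leq_add2r ltnW.
Qed.

Lemma Tm_dist m k s a : (0 < m)%N -> (0 < k)%N -> (k %/ m <= a)%N -> (a < (k + s) %/ m)%N ->
  k%:R <= (a.+1 * m)%:R :> R /\ (a.+1 * m)%:R - k%:R <= s%:R :> R.
Proof.
move=> m0 k0 h1 h2; split.
  by rewrite ler_nat ltnW// -ltn_divLR.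
by rewrite lerBlDl -natrD ler_nat -leq_divRL.
Qed.

Lemma run_step m k a : (0 < m)%N -> (0 < k)%N -> (k %/ m <= a)%N ->
  nrm (gw beta (a.+2 * m)%:R - gw beta (a.+1 * m)%:R) <= cb * (m%:R / k%:R) * pw k%:R (- 2^-1).
Proof.
move=> m0 k0 h1.
have -> : m%:R = (a.+2 * m)%:R - (a.+1 * m)%:R :> R by rewrite -natrB ?leq_mul2r ?leqnSn ?orbT// -mulnBl subSnn mul1n.
apply: gw_lip; rewrite ?ltr0n// ler_nat; last by rewrite leq_mul2r leqnSn orbT.
by rewrite ltnW// -ltn_divLR.
Qed.

(** Valid also for windows cut off by the end [X] of the polynomial, in contrast to [Tm_main]. *)
Lemma Tm_bound m k s : (0 < m)%N -> (0 < k)%N ->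
  nrm (Tm m k (k + s)) <= pw k%:R (- 2^-1) * (1 + cb * (s%:R / k%:R)).
Proof.
move=> m0 k0; have kp : 0 < k%:R :> R by rewrite ltr0n.
rewrite TmE ?leq_addr//; set a1 := minn _ _.
have R0 : 0 <= pw k%:R (- 2^-1) * (1 + cb * (s%:R / k%:R)) by pos.
case: (leqP a1 (k %/ m)) => h; first by rewrite big_geq// nrm0.
have ea : (k %/ m + (a1 - k %/ m) = a1)%N by rewrite subnKC// ltnW.
have ha1 : (a1 <= (k + s) %/ m)%N by rewrite geq_minl.
have := @alt_run (fun a => gw beta (a.+1 * m)%:R) (pw k%:R (- 2^-1)) (cb * (m%:R / k%:R) * pw k%:R (- 2^-1)) (k %/ m) (a1 - k %/ m).
rewrite ea => H; apply: le_trans (H _ _ _ _) _.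
- exact: pw_ge0.
- by pos.
- move=> a /andP[h1 h2]; rewrite nrm_gw; apply: ler_pwN; [lra | by [] |].
  by have [] := Tm_dist m0 k0 h1 (leq_trans h2 ha1).
- by move=> a h1 _; exact: run_step.
have hs := run_span m0 ha1; rewrite -(ler_nat R) natrM in hs.
have -> : pw k%:R (- 2^-1) + (a1 - k %/ m).-1%:R * (cb * (m%:R / k%:R) * pw k%:R (- 2^-1)) =
  pw k%:R (- 2^-1) * (1 + cb * ((a1 - k %/ m).-1%:R * m%:R / k%:R)) by ring.
by rewrite ler_wpM2l ?pw_ge0// lerD2l ler_wpM2l// ler_wpM2r// invr_ge0 ltW.
Qed.

(** In a window of relative length [s / k] the factor [gw] is nearly constant, so only the sum of
    the signs remains. *)
Lemma Tm_main m k s : (0 < m)%N -> (0 < k)%N -> (k + s < X)%N ->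
  nrm (Tm m k (k + s) - gw beta k%:R * (dB m s k)%:C) <= 2 * cb * (s%:R / k%:R) * pw k%:R (- 2^-1).
Proof.
move=> m0 k0 hX; have kp : 0 < k%:R :> R by rewrite ltr0n.
rewrite TmE ?leq_addr// (minn_idPl _); last by apply: leq_trans (ltnW hX); exact: leq_div.
set a1 := ((k + s) %/ m)%N.
have h : (k %/ m <= a1)%N by rewrite leq_div2r// leq_addr.
have ea : (k %/ m + (a1 - k %/ m) = a1)%N by rewrite subnKC.
have -> : (dB m s k)%:C = \sum_(k %/ m <= a < a1) (-1) ^+ a :> C.
  have := alt_count (k %/ m) (a1 - k %/ m); rewrite ea => e.
  rewrite /dB /chi -/a1 -[X in (X)%:C]e rmorph_sum; apply: eq_bigr => a _.
  by rewrite rmorphXn rmorphN rmorph1.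
rewrite mulr_sumr -sumrB.
have -> : \sum_(k %/ m <= a < a1) ((-1) ^+ a * gw beta (a.+1 * m)%:R - gw beta k%:R * (-1) ^+ a) =
   \sum_(k %/ m <= a < a1) (-1) ^+ a * (gw beta (a.+1 * m)%:R - gw beta k%:R).
  by apply: eq_bigr => a _; ring.
set E := cb * (s%:R / k%:R) * pw k%:R (- 2^-1).
have E0 : 0 <= E by rewrite /E; pos.
have := @alt_run (fun a => gw beta (a.+1 * m)%:R - gw beta k%:R) E (cb * (m%:R / k%:R) * pw k%:R (- 2^-1)) (k %/ m) (a1 - k %/ m).
rewrite ea => H; apply: le_trans (H _ _ _ _) _ => //.
- by pos.
- move=> a /andP[h1 h2]; have [h3 h4] := Tm_dist m0 k0 h1 h2.
  apply: le_trans (gw_lip beta kp (lexx _) h3) _.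
  by rewrite /E ler_wpM2r ?pw_ge0// ler_wpM2l// ler_wpM2r// invr_ge0 ltW.
- by move=> a h1 _; rewrite opprB addrA subrK; exact: run_step.
have hs := run_span m0 (leqnn a1); rewrite -(ler_nat R) natrM in hs.
have -> : (a1 - k %/ m).-1%:R * (cb * (m%:R / k%:R) * pw k%:R (- 2^-1)) =
  cb * ((a1 - k %/ m).-1%:R * m%:R / k%:R) * pw k%:R (- 2^-1) by ring.
have : cb * ((a1 - k %/ m).-1%:R * m%:R / k%:R) * pw k%:R (- 2^-1) <= E.
  by rewrite /E ler_wpM2r ?pw_ge0// ler_wpM2l// ler_wpM2r// invr_ge0 ltW.
have -> : 2 * cb * (s%:R / k%:R) * pw k%:R (- 2^-1) = E + E by rewrite /E; ring.
lra.
Qed.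

End Blocks.

(** * The partial sum of eta times the resonator as one Dirichlet polynomial *)

Section SecondMoment.
Variables (I : finType) (pr : I -> nat).
Hypothesis pr_prime : forall i, prime (pr i).
Hypothesis pr_inj : injective pr.
Hypothesis pr_odd : forall i, odd (pr i).
Variable N : nat.
Hypothesis N_gt0 : (0 < N)%N.
Variables f : I -> R.
Hypothesis f_ge0 : forall i, 0 <= f i.
Variables (beta : R) (X : nat).
Local Notation nS := (nS pr).
Local Notation fS := (fS f).
Local Notation FN := (FN pr N f).
Let cb : R := 2^-1 + `|beta|.
Let cb0 : 0 <= cb. Proof. by rewrite /cb addr_ge0 ?invr_ge0 ?ler0n. Qed.

Definition rS (S : {set I}) : R := \prod_(i in S) (- f i).

Lemma norm_rS S : `|rS S| = fS S.
Proof. by rewrite /rS normr_prod; apply: eq_bigr => i _; rewrite normrN ger0_norm. Qed.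

Lemma rSID S T : rS S = rS (S :&: T) * rS (S :\: T).
Proof. by rewrite /rS -big_setID. Qed.

Lemma ker_rr (u v : R) S T :
  rS S * rS T * (pw (nS (S :&: T))%:R u * pw (nS (S :\: T))%:R v * pw (nS (T :\: S))%:R v) =
  ker (fun i => f i ^+ 2 * pw (pr i)%:R u) (fun i => - f i * pw (pr i)%:R v)
      (fun i => - f i * pw (pr i)%:R v) S T.
Proof.
rewrite (rSID S T) (rSID T S) [T :&: S]setIC /ker !big_split /= -!pw_nS//.
have -> : \prod_(i in S :&: T) f i * \prod_(i in S :&: T) f i = rS (S :&: T) * rS (S :&: T).
  by rewrite /rS -!big_split; apply: eq_bigr => i _ /=; rewrite mulrNN.
by rewrite -!/(rS _); ring.
Qed.

(** Sets with [nS S > N] stay in the index type with coefficient 0; the value 1 preserves the bounds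
    that the large sieve asks of [n]. *)
Definition nn (i : 'I_X * {set I}) : nat := if (nS i.2 <= N)%N then (i.1.+1 * nS i.2)%N else 1%N.

Definition cc (i : 'I_X * {set I}) : C := if (nS i.2 <= N)%N then
  (rS i.2 * pw i.1.+1%:R (- 2^-1))%:C * ((-1) ^+ i.1 * cis (- (beta * ln (i.1.+1 * nS i.2)%:R))) else 0.

Lemma nn_gt0 i : (0 < nn i)%N.
Proof. by rewrite /nn; case: ifP => // _; rewrite muln_gt0 nS_gt0. Qed.

Lemma nn_leU i : (nn i <= X * N)%N.
Proof.
rewrite /nn; case: ifP => h; first by rewrite leq_mul.
by rewrite muln_gt0 N_gt0 andbT; case: i {h} => -[a ha] _; apply: leq_ltn_trans ha.
Qed.

Lemma etaP_resonator alpha l :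
  etaP (alpha * l%:R + beta) X * resonator pr N rS (alpha * l%:R + beta) =
  \sum_i cc i * cis (- (l%:R * (alpha * ln (nn i)%:R))).
Proof.
rewrite /etaP /resonator mulr_suml.
transitivity (\sum_(a < X) \sum_(S : {set I}) cc (a, S) * cis (- (l%:R * (alpha * ln (nn (a, S))%:R)))); last first.
  by rewrite pair_bigA; apply: eq_bigr => -[].
apply: eq_bigr => a _; rewrite mulr_sumr big_mkcond; apply: eq_bigr => S _.
rewrite /cc /nn /=; case: ifP => _; last by rewrite mul0r.
rewrite natrM lnM ?ltr0n ?nS_gt0// /ut sqrt_pw ?ltr0n// -pwN (rmorphM (real_complex R)).
transitivity ((rS S)%:C * (pw a.+1%:R (- 2^-1))%:C * (-1) ^+ a *
  (cis (- ((alpha * l%:R + beta) * ln a.+1%:R)) * cis (- ((alpha * l%:R + beta) * ln (nS S)%:R)))); first by ring.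
rewrite -cisD.
transitivity ((rS S)%:C * (pw a.+1%:R (- 2^-1))%:C * (-1) ^+ a *
  (cis (- (beta * (ln a.+1%:R + ln (nS S)%:R))) * cis (- (l%:R * (alpha * (ln a.+1%:R + ln (nS S)%:R)))))); last by ring.
by rewrite -cisD; congr (_ * cis _); ring.
Qed.

Lemma window_Tm k k' : (0 < k \/ k.+1 = k')%N -> (k <= k')%N ->
  window cc nn k k' = \sum_(S | (nS S <= N)%N) (rS S * pw (nS S)%:R 2^-1)%:C * Tm beta X (nS S) k k'.
Proof.
move=> hk kk; rewrite /window.
transitivity (\sum_(a < X) \sum_(S : {set I}) if (k < nn (a, S) <= k')%N then cc (a, S) else 0).
  by rewrite pair_bigA big_mkcond; apply: eq_bigr => -[].
rewrite exchange_big /= [RHS]big_mkcond; apply: eq_bigr => S _.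
rewrite /nn /cc /=; case: ifP => hS; last by rewrite big1 // => a _; case: ifP.
rewrite /Tm mulr_sumr [RHS]big_mkcond; apply: eq_bigr => a _; case: ifP => // _.
rewrite /gw natrM pwM ?ltr0n ?nS_gt0// !(rmorphM (real_complex R)).
have e : (pw (nS S)%:R 2^-1)%:C * (pw (nS S)%:R (- 2^-1))%:C = 1 :> C.
  by rewrite -(rmorphM (real_complex R)) -pwD subrr pw0.
transitivity ((pw (nS S)%:R 2^-1)%:C * (pw (nS S)%:R (- 2^-1))%:C * ((rS S)%:C * (pw a.+1%:R (- 2^-1))%:C * ((-1) ^+ a * cis (- (beta * ln (a.+1%:R * (nS S)%:R)))))); last by ring.
by rewrite e mul1r.
Qed.

End SecondMoment.

(** * Sums of inverse squares and partial sums of zeta *)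

Lemma sum_inv_sqr_tail (U Y : nat) : (0 < Y)%N -> \sum_(k < U | (Y < k)%N) (k%:R^-1) ^+ 2 <= Y%:R^-1 :> R.
Proof.
move=> Y0; rewrite -(big_mkord (fun k => (Y < k)%N) (fun k => (k%:R^-1 : R) ^+ 2)).
have Yp : 0 < Y%:R :> R by rewrite ltr0n.
suff : \sum_(0 <= k < U | (Y < k)%N) (k%:R^-1) ^+ 2 <= Y%:R^-1 - (if (Y < U)%N then U.-1%:R^-1 else Y%:R^-1) :> R.
  move=> h; apply: le_trans h _; case: ifP => _; last by rewrite subrr invr_ge0 ltW.
  by rewrite gerBl invr_ge0.
elim: U => [|U IH]; first by rewrite big_geq// ltn0 subrr.
rewrite big_mkcond big_nat_recr//= -big_mkcond ltnS.
case: (ltngtP Y U) IH => h IH; rewrite ?addr0; [|exact: IH|by move: IH; rewrite -h].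
apply: le_trans (lerD IH (lexx _)) _ => /=.
have p1 : 0 < U.-1%:R :> R by rewrite ltr0n -ltnS prednK ?(leq_trans _ h)// (leq_trans Y0)// -ltnS prednK// (leq_trans _ h).
have eU : U%:R = U.-1%:R + 1 :> R by rewrite natr1 prednK// (leq_trans _ h).
rewrite eU; set x := U.-1%:R in p1 *; clearbody x.
have e : x^-1 - (x + 1)^-1 - ((x + 1)^-1) ^+ 2 = x^-1 * ((x + 1)^-1) ^+ 2.
  by field; apply/andP; split; apply/eqP; lra.
have : 0 <= x^-1 * ((x + 1)^-1) ^+ 2 by rewrite mulr_ge0 ?sqr_ge0// invr_ge0 ltW.
lra.
Qed.

Lemma sum_inv_sqr (U : nat) : \sum_(k < U | (0 < k)%N) (k%:R^-1) ^+ 2 <= 2 :> R.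
Proof.
case: U => [|[|U]]; first by rewrite big_ord0.
  by rewrite big_mkcond big_ord1.
have h := @sum_inv_sqr_tail U.+2 1 isT; rewrite invr1 in h.
rewrite (bigD1 (inord 1)) /= ?inordK// invr1 expr1n.
rewrite (eq_bigl (fun k : 'I_U.+2 => (1 < k)%N)); first by lra.
move=> k; rewrite -val_eqE /= inordK//; by case: (k : nat) => [|[|n]].
Qed.

Lemma sum_shift_le (U a n : nat) (F : nat -> R) : (forall k, 0 <= F k) ->
  \sum_(k < U | (a <= k < a + n)%N) F k <= \sum_(j < n) F (a + j)%N.
Proof.
move=> F0; rewrite -(big_mkord (fun k => (a <= k < a + n)%N) F) -(big_mkord xpredT (fun j => F (a + j)%N)).
have -> : \sum_(0 <= j < n) F (a + j)%N = \sum_(a <= k < a + n) F k.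
  rewrite [RHS](_ : _ = \sum_(0 + a <= k < a + n) F k); last by rewrite add0n.
  rewrite big_addn addKn.
  by apply: eq_bigr => j _; rewrite addnC.
apply: le_trans (_ : \sum_(0 <= k < U + (a + n) | (a <= k < a + n)%N) F k <= _).
  rewrite [X in _ <= X](@big_cat_nat _ _ _ U) ?leq_addr//= lerDl.
  by apply: sumr_ge0.
rewrite (@big_cat_nat _ _ _ (a + n)) //=; last by rewrite leq_addl.
rewrite [X in _ + X]big1_seq ?addr0; last first.
  move=> k /andP[/andP[_ h1]]; rewrite mem_index_iota => /andP[h2 _].
  by move: h1; rewrite ltnNge h2.
rewrite (@big_cat_nat _ _ _ a) ?leq_addr//= big1_seq ?add0r; last first.
  move=> k /andP[/andP[h1 _]]; rewrite mem_index_iota => /andP[_ h2].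
  by move: h2; rewrite ltnNge h1.
rewrite big_nat_cond [X in _ <= X]big_nat_cond le_eqVlt; apply/orP; left; apply/eqP; apply: eq_bigl => k.
by rewrite andbT andbb.
Qed.

Lemma dB_period m s k q : (0 < m)%N -> dB m s (k + q * (2 * m)) = dB m s k.
Proof. by move=> m0; rewrite /dB addnAC !chi_period. Qed.

Lemma norm_dB m s k : `|dB m s k| <= 1.
Proof.
rewrite /dB normrM [`|2^-1|]ger0_norm ?invr_ge0// ler_pdivrMr// mul1r.
by apply: le_trans (ler_normB _ _) _; rewrite !chi_norm.
Qed.

Lemma Tm_succ beta X m k : odd m -> (k.+1 <= X)%N ->
  Tm beta X m k k.+1 = if (m %| k.+1)%N then (-1) ^+ k * gw beta k.+1%:R else 0.
Proof.
move=> om hk; have m0 : (0 < m)%N by case: m om.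
have hb (a : 'I_X) : (k < a.+1 * m <= k.+1)%N = (a.+1 * m == k.+1)%N by rewrite eqn_leq andbC.
rewrite /Tm (eq_bigl _ _ hb); case: ifP => [/dvdnP[q e]|hn]; last first.
  rewrite big_pred0// => a; apply/negbTE/negP => /eqP e.
  by move/negP: hn; apply; rewrite -e dvdn_mull.
have q0 : (0 < q)%N by case: q e.
have hq : (q.-1 < X)%N.
  rewrite prednK//; apply: leq_trans hk; rewrite e; exact: leq_pmulr.
rewrite (big_pred1 (Ordinal hq)) /=.
  rewrite prednK// -e; congr (_ * _); rewrite -signr_odd -[RHS]signr_odd; congr (_ ^+ _); congr (nat_of_bool _).
  have : odd q = odd k.+1 by rewrite e oddM om andbT.
  by rewrite -{1}(prednK q0) /= => /negb_inj.
move=> a; rewrite /= e eqn_pmul2r//; apply/eqP/eqP => [ea|->]; last by rewrite /= prednK.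
by apply: val_inj; rewrite /= -ea.
Qed.

Lemma sqr_le_split (w a b : R) : w ^+ 2 <= (a + b) ^+ 2 -> w ^+ 2 <= 2 * a ^+ 2 + 2 * b ^+ 2.
Proof. by move=> h; have := sqr_ge0 (a - b); nra. Qed.

Section Zeta.
Variable kap : R.
Hypothesis kap_gt0 : 0 < kap.

(** Partial sums of [zeta (1 + kap)]. *)
Definition hz (n : nat) : R := \sum_(j < n.+1 | (0 < j)%N) pw j%:R (- 1 - kap).

Lemma hzS n : hz n.+1 = hz n + pw n.+1%:R (- 1 - kap).
Proof. by rewrite /hz big_mkcond big_ord_recr /= -big_mkcond. Qed.

(** A discrete comparison of a term with the integral of [x^(-1-kap)], which telescopes in
    [hz_diff]. *)
Lemma hz_step n : (0 < n)%N -> pw n.+1%:R (- 1 - kap) <= kap^-1 * (pw n%:R (- kap) - pw n.+1%:R (- kap)).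
Proof.
move=> n0; have np : 0 < n%:R :> R by rewrite ltr0n.
have np1 : 0 < n.+1%:R :> R by rewrite ltr0n.
have k0 := kap_gt0.
rewrite -ler_pdivrMl ?invr_gt0// invrK (pwD _ (- 1)) (pwN _ 1) pw1//.
have e : pw n%:R (- kap) = pw n.+1%:R (- kap) * exp (kap * (ln n.+1%:R - ln n%:R)).
  by rewrite /pw -expD; congr exp; ring.
rewrite e -[X in _ <= _ - X]mulr1 -mulrBr mulrA mulrC ler_wpM2l ?pw_ge0//.
have h1 : n.+1%:R^-1 <= ln n.+1%:R - ln n%:R :> R.
  rewrite -[X in X <= _](_ : 1 - n%:R / n.+1%:R = _).
    have -> : ln n.+1%:R - ln n%:R = - ln (n%:R / n.+1%:R) :> R by rewrite lndiv//; ring.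
    have h0 : 0 < n%:R / n.+1%:R :> R by rewrite divr_gt0.
    by rewrite lerNr opprB; exact: ln_leB1.
  by rewrite -natr1; field; apply/eqP; lra.
apply: le_trans (ler_wpM2l (ltW k0) h1) _; rewrite lerBrDl; exact: exp_ge1D.
Qed.

Lemma hz_diff m n : (0 < m)%N -> (m <= n)%N -> 0 <= hz n - hz m <= kap^-1 * pw m%:R (- kap).
Proof.
move=> m0 hmn.
suff : 0 <= hz n - hz m <= kap^-1 * (pw m%:R (- kap) - pw n%:R (- kap)).
  move=> /andP[-> h] /=; apply: le_trans h _; rewrite ler_wpM2l ?invr_ge0 ?(ltW kap_gt0)//.
  by rewrite gerBl pw_ge0.
rewrite -(subnK hmn); elim: (n - m)%N => [|d IH]; first by rewrite add0n !subrr mulr0 lexx.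
rewrite addSn hzS; have := @hz_step (d + m)%N; rewrite addn_gt0 m0 orbT => /(_ isT).
have := pw_ge0 (d + m).+1%:R (- 1 - kap); move: IH; set x := kap^-1.
move=> /andP[h1 h2] h3 h4; apply/andP; split; lra.
Qed.

Lemma hz_le n : (0 < n)%N -> 0 <= hz n <= 1 + kap^-1.
Proof.
move=> n0; have h1 : hz 1 = 1 by rewrite /hz big_mkcond !big_ord_recl big_ord0 /= pw1x add0r addr0.
have := @hz_diff 1 n isT n0; rewrite h1 pw1x mulr1; lra.
Qed.

Lemma pw_tendsto0 (e : R) : 0 < e -> exists Z : nat, (0 < Z)%N /\ pw Z%:R (- kap) <= e.
Proof.
move=> e0; have k0 := kap_gt0.
exists (Num.truncn (exp (- ln e / kap))).+1; split=> //.
rewrite -[X in _ <= X](exp_ln0 e0) /pw ler_exp.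
have h : - ln e / kap <= ln (Num.truncn (exp (- ln e / kap))).+1%:R :> R.
  rewrite -[X in X <= _]ln_exp0 ler_ln ?exp_gt0 ?ltr0n//; exact/ltW/truncnS_gt.
rewrite ler_pdivrMr// in h; lra.
Qed.

End Zeta.

Lemma collect_constants (E kap P r : R) : 0 <= E -> 0 < kap -> kap <= 2^-1 -> 0 <= P -> 0 <= r ->
  E * ((1 + kap^-1) * (P + r)) + 13520 * (E / kap) * (2 * (P + r) + 2 * r) <=
  2 ^+ 16 * (E / kap * (P + r)).
Proof.
move=> E0 k0 kl P0 r0.
have c14 : 13520 + 1 <= 2 ^+ 14 :> R by rewrite natr1 -natrX ler_nat.
have c0 : 0 <= 13520 :> R by rewrite ler0n.
have -> : 2 ^+ 16 = 4 * 2 ^+ 14 :> R by rewrite !exprS; ring.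
have k2 : 1 <= kap^-1 by rewrite -[X in X <= _]invr1 lef_pV2 ?posrE//; lra.
have K0 : 0 <= E / kap by rewrite divr_ge0// ltW.
move: c14 c0; move: (13520 : R) (2 ^+ 14 : R) => c d cd c0.
have h3 : E * ((1 + kap^-1) * (P + r)) <= 2 * (E / kap * (P + r)).
  have -> : 2 * (E / kap * (P + r)) = E * ((kap^-1 + kap^-1) * (P + r)) by ring.
  by rewrite ler_wpM2l// ler_wpM2r ?addr_ge0//; lra.
have h4 : c * (E / kap) * (2 * (P + r) + 2 * r) <= c * (E / kap) * (4 * (P + r)).
  by rewrite ler_wpM2l ?mulr_ge0//; lra.
apply: le_trans (lerD h3 h4) _.
have Q0 : 0 <= E / kap * (P + r) by rewrite mulr_ge0 ?addr_ge0.
have := ler_wpM2r Q0 cd.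
have -> : c * (E / kap) * (4 * (P + r)) = 4 * (c * (E / kap * (P + r))) by ring.
rewrite -[X in _ -> _ <= X]mulrA mulrDl mul1r.
move: (E / kap * (P + r)) Q0 => Q Q0; lra.
Qed.

(** * The two sums of the large sieve *)

Section S12.
Variables (I : finType) (pr : I -> nat).
Hypothesis pr_prime : forall i, prime (pr i).
Hypothesis pr_inj : injective pr.
Hypothesis pr_odd : forall i, odd (pr i).
Variable N : nat.
Hypothesis N_gt0 : (0 < N)%N.
Variables f : I -> R.
Hypothesis f_ge0 : forall i, 0 <= f i.
Variables (beta : R) (X : nat).
Local Notation nS := (nS pr).
Local Notation fS := (fS f).
Local Notation rS := (rS f).
Local Notation FN := (FN pr N f).
Local Notation cc := (@cc I pr N f beta X).
Local Notation nn := (@nn I pr N X).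
Let cb : R := 2^-1 + `|beta|.
Let cb0 : 0 <= cb. Proof. by rewrite /cb addr_ge0 ?invr_ge0 ?ler0n. Qed.
Let sq S : R := pw (nS S)%:R 2^-1.
Let sq0 S : 0 <= sq S. Proof. exact: pw_ge0. Qed.
Let F0 S : 0 <= fS S. Proof. exact: fS_ge0. Qed.
Let nSp S : 0 < (nS S)%:R :> R. Proof. by rewrite ltr0n nS_gt0. Qed.
Let nS1 S : 1 <= (nS S)%:R :> R. Proof. by rewrite ler1n nS_gt0. Qed.
Let FN0 : 0 <= FN. Proof. exact: FN_ge0. Qed.

Definition RS : R := \sum_(S | (nS S <= N)%N) fS S * sq S.

Lemma RS_ge0 : 0 <= RS.
Proof. by apply: sumr_ge0 => S _; rewrite mulr_ge0. Qed.

Lemma double_sum_le (w : {set I} -> {set I} -> R) (B : R) : 0 <= B ->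
  (forall S T, (nS S <= N)%N -> (nS T <= N)%N -> `|w S T| <= B * (fS S * fS T)) ->
  `|\sum_(S | (nS S <= N)%N) \sum_(T | (nS T <= N)%N) w S T| <= B * (N%:R * FN).
Proof.
move=> B0 hw; apply: le_trans (_ : B * (\sum_(S | (nS S <= N)%N) fS S) ^+ 2 <= _); last first.
  by rewrite ler_wpM2l// sum_fS_sqr.
rewrite expr2 mulr_suml mulr_sumr; apply: le_trans (ler_norm_sum _ _ _) _.
apply: ler_sum => S hS; rewrite mulr_sumr mulr_sumr; apply: le_trans (ler_norm_sum _ _ _) _.
by apply: ler_sum => T hT; exact: hw.
Qed.

Lemma RS_sqr : RS ^+ 2 <= N%:R ^+ 2 * FN.
Proof.
rewrite expr2 [N%:R ^+ 2]expr2 -mulrA.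
have -> : RS * RS = \sum_(S | (nS S <= N)%N) \sum_(T | (nS T <= N)%N) fS S * sq S * (fS T * sq T).
  by rewrite /RS mulr_suml; apply: eq_bigr => S _; rewrite mulr_sumr.
apply: le_trans (ler_norm _) _; apply: double_sum_le => // S T hS hT.
rewrite ger0_norm ?mulr_ge0// mulrACA mulrC ler_wpM2r ?mulr_ge0//.
have h U : (nS U <= N)%N -> sq U <= pw N%:R 2^-1 by move=> hU; apply: ler_pw; rewrite ?ler_nat// invr_ge0.
apply: le_trans (_ : pw N%:R 2^-1 * pw N%:R 2^-1 <= _); first by rewrite ler_pM ?h.
by rewrite -pwD (_ : 2^-1 + 2^-1 = 1) ?pw1 ?ltr0n//; lra.
Qed.

(** The main part of the window [(k, k + s]], up to the factor [gw beta k]. *)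
Definition Qsk (s k : nat) : R := \sum_(S | (nS S <= N)%N) rS S * sq S * dB (nS S) s k.

Lemma Qsk0 k : Qsk 0 k = 0.
Proof. by rewrite /Qsk big1// => S _; rewrite /dB addn0 subrr mul0r mulr0. Qed.

Lemma pw_half_sqr (k : nat) : (0 < k)%N -> pw k%:R (- 2^-1) ^+ 2 = k%:R^-1 :> R.
Proof.
by move=> k0; rewrite pw_sqr (_ : - 2^-1 *+ 2 = - 1) ?pwN ?pw1 ?ltr0n//; lra.
Qed.

Lemma window_triv k s : (0 < k)%N -> (s <= k)%N ->
  nrm (window cc nn k (k + s)) ^+ 2 <= ((1 + cb) * RS) ^+ 2 * k%:R^-1.
Proof.
move=> k0 hs; rewrite window_Tm ?leq_addr//; last by left.
have hq0 : 0 <= (1 + cb) * RS * pw k%:R (- 2^-1) := mulr_ge0 (mulr_ge0 (addr_ge0 ler01 cb0) RS_ge0) (pw_ge0 _ _).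
rewrite -(pw_half_sqr k0) -exprMn ler_pXn2r ?nnegrE ?nrm_ge0//.
apply: le_trans (nrm_sum _ _ _) _; rewrite mulrC mulrCA mulrA mulrC /RS mulr_suml.
apply: ler_sum => S _; rewrite nrmM nrm_real normrM norm_rS// [`|pw _ _|]ger0_norm ?pw_ge0//.
apply: le_trans (ler_wpM2l (mulr_ge0 (F0 S) (sq0 S)) (Tm_bound beta X s (nS_gt0 pr_prime S) k0)) _.
apply: (ler_wpM2l (mulr_ge0 (F0 S) (sq0 S))).
rewrite mulrC ler_wpM2r ?pw_ge0// lerD2l -/cb -[X in _ <= X]mulr1 ler_wpM2l//.
by rewrite ler_pdivrMr ?ltr0n// mul1r ler_nat.
Qed.

Lemma window_main k s : (0 < k)%N -> (k + s < X)%N ->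
  nrm (window cc nn k (k + s)) ^+ 2 <=
  2 * (k%:R^-1 * Qsk s k ^+ 2) + 2 * ((2 * cb * (s%:R / k%:R) * RS) ^+ 2 * k%:R^-1).
Proof.
move=> k0 hX; rewrite window_Tm ?leq_addr//; last by left.
set W := \sum_(S | _) _.
have hE : nrm (W - gw beta k%:R * (Qsk s k)%:C) <= 2 * cb * (s%:R / k%:R) * RS * pw k%:R (- 2^-1).
  have -> : gw beta k%:R * (Qsk s k)%:C = \sum_(S | (nS S <= N)%N) (rS S * sq S)%:C * (gw beta k%:R * (dB (nS S) s k)%:C).
    rewrite /Qsk rmorph_sum mulr_sumr; apply: eq_bigr => S _.
    by rewrite (rmorphM (real_complex R)) mulrCA.
  rewrite /W -sumrB mulrAC /RS mulr_sumr; apply: le_trans (nrm_sum _ _ _) _.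
  apply: ler_sum => S _; rewrite -mulrBr nrmM nrm_real normrM norm_rS// [`|pw _ _|]ger0_norm ?pw_ge0//.
  apply: le_trans (ler_wpM2l (mulr_ge0 (F0 S) (sq0 S)) (@Tm_main beta X (nS S) k s (nS_gt0 pr_prime S) k0 hX)) _.
  by rewrite -/cb [X in _ <= X]mulrC.
have h2 : nrm W <= nrm (gw beta k%:R * (Qsk s k)%:C) + nrm (W - gw beta k%:R * (Qsk s k)%:C).
  by apply: le_trans (nrmD _ _); rewrite addrC subrK.
rewrite nrmM nrm_gw nrm_real in h2.
have e1 : k%:R^-1 * Qsk s k ^+ 2 = (pw k%:R (- 2^-1) * `|Qsk s k|) ^+ 2.
  by rewrite exprMn pw_half_sqr// real_normK ?num_real.
have e2 : (2 * cb * (s%:R / k%:R) * RS) ^+ 2 * k%:R^-1 = (2 * cb * (s%:R / k%:R) * RS * pw k%:R (- 2^-1)) ^+ 2.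
  by rewrite [in RHS]exprMn pw_half_sqr.
rewrite e1 e2; set a := pw _ _ * `|_| in h2 *; set b := 2 * cb * _ * _ * _ in hE *.
have a0 : 0 <= a by rewrite /a mulr_ge0 ?pw_ge0.
have hab : nrm W <= a + b by lra.
apply: sqr_le_split.
rewrite ler_pXn2r ?nnegrE ?nrm_ge0//; exact: le_trans (nrm_ge0 _) hab.
Qed.

Definition gk S T : R := sq S * sq T * ((gcdn (nS S) (nS T))%:R / ((nS S)%:R * (nS T)%:R)).

Lemma pw_nSID S T u : pw (nS S)%:R u = pw (nS (S :&: T))%:R u * pw (nS (S :\: T))%:R u.
Proof. by rewrite [in LHS](nSID pr S T) natrM pwM. Qed.

Lemma gkE S T : gk S T = pw (nS (S :&: T))%:R 0 * pw (nS (S :\: T))%:R (- 2^-1) * pw (nS (T :\: S))%:R (- 2^-1).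
Proof.
rewrite /gk gcd_nS// /sq invfM.
have inv1 U : (nS U)%:R^-1 = pw (nS U)%:R (- 1) :> R by rewrite (pwN _ 1) pw1.
rewrite -[X in _ * (X * _)](pw1 (nSp (S :&: T))) !inv1.
rewrite (pw_nSID S T 2^-1) (pw_nSID T S 2^-1) (pw_nSID S T (- 1)) (pw_nSID T S (- 1)) [T :&: S]setIC.
transitivity (pw (nS (S :&: T))%:R (2^-1 + 2^-1 + 1 - 1 - 1) * pw (nS (S :\: T))%:R (2^-1 - 1) *
   pw (nS (T :\: S))%:R (2^-1 - 1)); first by rewrite !pwD; ring.
by congr (pw _ _ * pw _ _ * pw _ _); lra.
Qed.

Lemma gk_ge0 S T : 0 <= gk S T.
Proof. by rewrite gkE !mulr_ge0 ?pw_ge0. Qed.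

Lemma gk_le1 S T : gk S T <= 1.
Proof.
rewrite gkE pw0 mul1r -[X in _ <= X]mulr1 ler_pM ?pw_ge0//; apply: pw_le1 => //; lra.
Qed.

(** The mean of [Qsk s k ^+ 2] over [k]: a product of two waves has period [2 m n], and [dB_corr]
    gives its sum over a period. *)
Definition Ms (s : nat) : R := \sum_(S | (nS S <= N)%N) \sum_(T | (nS T <= N)%N)
  rS S * rS T * (gk S T * wave (gcdn (nS S) (nS T)) s).

Lemma Qsk_mean s a n :
  `|\sum_(k < n) Qsk s (a + k) ^+ 2 - n%:R * Ms s| <= 4 * N%:R ^+ 3 * (N%:R * FN).
Proof.
pose F S T k := dB (nS S) s k * dB (nS T) s k.
have -> : \sum_(k < n) Qsk s (a + k) ^+ 2 - n%:R * Ms s =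
   \sum_(S | (nS S <= N)%N) \sum_(T | (nS T <= N)%N) rS S * rS T * (sq S * sq T *
     (\sum_(k < n) F S T (a + k)%N - n%:R / (2 * nS S * nS T)%:R * \sum_(k < 2 * nS S * nS T) F S T k)).
  have -> : \sum_(k < n) Qsk s (a + k) ^+ 2 = \sum_(S | (nS S <= N)%N) \sum_(T | (nS T <= N)%N)
     rS S * rS T * (sq S * sq T * \sum_(k < n) F S T (a + k)%N).
    transitivity (\sum_(k < n) \sum_(S | (nS S <= N)%N) \sum_(T | (nS T <= N)%N)
       rS S * rS T * (sq S * sq T * F S T (a + k)%N)).
      apply: eq_bigr => k _; rewrite expr2 /Qsk mulr_suml; apply: eq_bigr => S _.
      by rewrite mulr_sumr; apply: eq_bigr => T _; rewrite /F; ring.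
    rewrite exchange_big /=; apply: eq_bigr => S _; rewrite exchange_big /=; apply: eq_bigr => T _.
    by rewrite -mulr_sumr -mulr_sumr.
  rewrite /Ms mulr_sumr -sumrB; apply: eq_bigr => S _.
  rewrite mulr_sumr -sumrB; apply: eq_bigr => T _.
  rewrite /F dB_corr ?nS_odd// /gk !natrM.
  have h1 := nSp S; have h2 := nSp T; field; by rewrite !gt_eqF.
apply: double_sum_le; first by pos.
move=> S T hS hT; rewrite !normrM !norm_rS// mulrC.
rewrite ler_wpM2r ?mulr_ge0// [`|sq S|]ger0_norm// [`|sq T|]ger0_norm//.
have hper k : F S T (k + 2 * nS S * nS T)%N = F S T k.
  rewrite /F; congr (_ * _); last by rewrite (_ : 2 * nS S * nS T = nS S * (2 * nS T))%N ?dB_period ?nS_gt0//; nlia.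
  by rewrite (_ : 2 * nS S * nS T = nS T * (2 * nS S))%N ?dB_period ?nS_gt0//; nlia.
have L0 : (0 < 2 * nS S * nS T)%N by rewrite !muln_gt0 !nS_gt0.
have hF k : `|F S T k| <= 1 by rewrite /F normrM -[X in _ <= X]mulr1 ler_pM ?norm_dB.
apply: le_trans (ler_wpM2l _ (period_interval_mean a n hper L0 hF)) _; first by rewrite mulr_ge0.
have SN : (nS S)%:R <= N%:R :> R by rewrite ler_nat.
have TN : (nS T)%:R <= N%:R :> R by rewrite ler_nat.
have hsq U : (nS U <= N)%N -> sq U <= pw N%:R 2^-1 by move=> hU; apply: ler_pw; rewrite ?ler_nat// invr_ge0.
have e : pw N%:R 2^-1 * pw N%:R 2^-1 = N%:R :> R by rewrite -pwD (_ : 2^-1 + 2^-1 = 1) ?pw1 ?ltr0n//; lra.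
have h1 : sq S * sq T <= N%:R by rewrite -e ler_pM ?hsq.
have h2 : (nS S)%:R * (nS T)%:R <= N%:R * N%:R :> R by rewrite ler_pM.
rewrite !natrM.
have -> : sq S * sq T * (2 * (2 * (nS S)%:R * (nS T)%:R)) = 4 * ((sq S * sq T) * ((nS S)%:R * (nS T)%:R)) by ring.
have -> : 4 * N%:R ^+ 3 = 4 * (N%:R * (N%:R * N%:R)) :> R by ring.
by rewrite ler_wpM2l// ler_pM ?mulr_ge0.
Qed.

(** A limit of means of squares, since the error in [Qsk_mean] does not grow with [n]. *)
Lemma Ms_ge0 s : 0 <= Ms s.
Proof.
rewrite leNgt; apply/negP => h.
set B := 4 * N%:R ^+ 3 * (N%:R * FN).
have B0 : 0 <= B by rewrite /B; pos.
have [n hn] : exists n : nat, B / - Ms s < n%:R by exists (Num.truncn (B / - Ms s)).+1; exact: truncnS_gt.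
have := Qsk_mean s 0 n; rewrite -/B.
have s0 : 0 <= \sum_(k < n) Qsk s (0 + k) ^+ 2 by apply: sumr_ge0 => k _; exact: sqr_ge0.
rewrite ltr_pdivrMr ?oppr_gt0// in hn.
move=> hh; have := le_trans (ler_norm _) hh; lra.
Qed.

Definition Qf (u v : R) : R := \sum_(S | (nS S <= N)%N) \sum_(T | (nS T <= N)%N)
  rS S * rS T * (pw (nS (S :&: T))%:R u * pw (nS (S :\: T))%:R v * pw (nS (T :\: S))%:R v).

Variables (kap : R).
Hypothesis kap_gt0 : 0 < kap.
Hypothesis kap_le : kap <= 2^-1.

(** As [Ms >= 0], the range of [s] may be enlarged to a common multiple of all [2 g], where
    [sum_om_wave] is exact. The terms 2 and [g^(-kap)] yield [Qf 0] and [Qf (- kap)]; the values of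
    [tau], which depend on [g], agree up to [1 / Z]. *)
Lemma sum_om_Ms (Smax : nat) (B0 Bk : R) : Qf 0 (- 2^-1) <= B0 -> 0 <= Bk -> - Bk <= Qf (- kap) (- 2^-1) ->
  \sum_(1 <= s < Smax.+1) om kap s * Ms s <= 2 * B0 + 2 * Bk.
Proof.
move=> hB0 Bk0 hBk; apply/ler_addgt0Pr => e he.
have NF0 : 0 <= N%:R * FN by rewrite mulr_ge0.
pose Z := (Smax + Num.truncn (N%:R * FN / e)).+1.
have Z0 : (0 < Z)%N by [].
have hZ : N%:R * FN / e <= Z%:R.
  apply: le_trans (ltW (truncnS_gt _)) _; by rewrite ler_nat ltnS leq_addl.
pose P := nS setT; have P0 : (0 < P)%N by exact: nS_gt0.
pose Sx := (2 * (P * Z))%N.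
have hS : (Smax <= Sx)%N.
  rewrite /Sx; apply: leq_trans (_ : Z <= _)%N; first by rewrite /Z ltnW// ltnS leq_addr.
  by rewrite mulnA leq_pmull// muln_gt0.
apply: le_trans (_ : \sum_(1 <= s < Sx.+1) om kap s * Ms s <= _).
  rewrite [X in _ <= X](@big_cat_nat _ _ _ Smax.+1) //= lerDl big_nat_cond.
  apply: sumr_ge0 => s /andP[/andP[hs _] _]; rewrite mulr_ge0 ?Ms_ge0// om_ge0//.
  by apply: leq_trans hs.
have tau1 K : 0 <= tau kap K <= 1.
  rewrite tau_ge0//=; case: K => [|K]; first by rewrite /tau big_geq.
  have := @tau_diff kap kap_gt0 kap_le 1 K.+1 isT isT; rewrite invr1 /tau [X in _ - X]big_geq// subr0.
  exact: le_trans (ler_norm _).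
set t := tau kap (2 * Z).
have -> : \sum_(1 <= s < Sx.+1) om kap s * Ms s =
  (2 * Qf 0 (- 2^-1) - (1 + t) * Qf (- kap) (- 2^-1)) +
  \sum_(S | (nS S <= N)%N) \sum_(T | (nS T <= N)%N) rS S * rS T * (gk S T *
    ((t - tau kap (2 * (P %/ nS (S :&: T) * Z))) * pw (nS (S :&: T))%:R (- kap))).
  have eS S T : \sum_(1 <= s < Sx.+1) om kap s * wave (gcdn (nS S) (nS T)) s =
      2 - (1 + tau kap (2 * (P %/ nS (S :&: T) * Z))) * pw (nS (S :&: T))%:R (- kap).
    rewrite gcd_nS//; set g := nS (S :&: T).
    have g0 : (0 < g)%N by exact: nS_gt0.
    have gP : (g %| P)%N by rewrite /P [X in (_ %| X)%N](nSID pr setT (S :&: T)) setTI dvdn_mulr.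
    have K0 : (0 < P %/ g * Z)%N by rewrite muln_gt0 Z0 andbT divn_gt0// dvdn_leq.
    have -> : Sx = (2 * (P %/ g * Z).-1.+1 * g)%N.
      by rewrite prednK// /Sx -mulnA; congr (2 * _)%N; rewrite mulnAC divnK.
    by rewrite sum_om_wave// prednK.
  transitivity (\sum_(S | (nS S <= N)%N) \sum_(T | (nS T <= N)%N) rS S * rS T * (gk S T *
     \sum_(1 <= s < Sx.+1) om kap s * wave (gcdn (nS S) (nS T)) s)).
    rewrite /Ms; under eq_bigr do rewrite mulr_sumr.
    rewrite exchange_big /=; apply: eq_bigr => S _.
    under eq_bigr do rewrite mulr_sumr.
    rewrite exchange_big /=; apply: eq_bigr => T _.
    by rewrite !mulr_sumr; apply: eq_bigr => s _; ring.
  rewrite /Qf !mulr_sumr -sumrB -big_split; apply: eq_bigr => S _ /=.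
  rewrite !mulr_sumr -sumrB -big_split; apply: eq_bigr => T _ /=.
  rewrite eS gkE pw0; ring.
apply: lerD.
  have /andP[t0 t1] : 0 <= t <= 1 by exact: tau1.
  have : (1 + t) * - Bk <= (1 + t) * Qf (- kap) (- 2^-1) by rewrite ler_wpM2l//; lra.
  have : t * Bk <= 1 * Bk by rewrite ler_wpM2r.
  lra.
apply: le_trans (ler_norm _) _.
apply: le_trans (_ : Z%:R^-1 * (N%:R * FN) <= _); last first.
  rewrite ler_pdivrMr// in hZ; rewrite ler_pdivrMl ?ltr0n//; lra.
apply: double_sum_le; first by rewrite invr_ge0.
move=> S T _ _; rewrite normrM (normrM (rS S)) !norm_rS// mulrC ler_wpM2r ?mulr_ge0//.
rewrite (normrM (gk S T)) [`|gk S T|]ger0_norm ?gk_ge0// (normrM (t - _)) [`|pw _ _|]ger0_norm ?pw_ge0//.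
have h1 : pw (nS (S :&: T))%:R (- kap) <= 1 by apply: pw_le1 => //; have := kap_gt0; lra.
have h2 : `|t - tau kap (2 * (P %/ nS (S :&: T) * Z))| <= Z%:R^-1.
  rewrite distrC; apply: le_trans (tau_diff kap_gt0 kap_le _ _) _.
  - by rewrite muln_gt0.
  - rewrite leq_pmul2l// leq_pmull// divn_gt0 ?nS_gt0//; apply: dvdn_leq => //.
    by rewrite /P [X in (_ %| X)%N](nSID pr setT (S :&: T)) setTI dvdn_mulr.
  by rewrite lef_pV2 ?posrE ?ltr0n ?muln_gt0// ler_nat leq_pmull.
rewrite -[X in _ <= X]mul1r ler_pM ?gk_ge0 ?gk_le1 ?mulr_ge0 ?pw_ge0//.
by rewrite -[X in _ <= X]mulr1 ler_pM ?pw_ge0.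
Qed.

Variables (V Y1 : nat).
Hypothesis V_ge : (13 <= V)%N.
Hypothesis Y1_gt0 : (0 < Y1)%N.
Hypothesis Y1_X : (2 * Y1 < X)%N.
Let cond (k s : nat) : bool := (k < (s + 2) * V)%N && (s * V < k + 3 * V)%N.
Let V0 : (0 < V)%N. Proof. exact: leq_trans V_ge. Qed.
Let Vp : 0 < V%:R :> R. Proof. by rewrite ltr0n. Qed.
Let U := (X * N)%N.

Lemma cond_le k s : (V <= 4 * k)%N -> cond k s -> (s * V <= 13 * k)%N.
Proof. by move=> h /andP[_ h2]; move: h h2; clear; nlia. Qed.

Lemma cond_count k : \sum_(s < (4 * U).+1 | cond k s) (1 : R) <= 5.
Proof.
apply: le_trans (_ : \sum_(s < (4 * U).+1) ((k %/ V - 1 <= s < k %/ V + 4)%N%:R : R) <= _); last first.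
  apply: le_trans (sum_indicator_itv _ _ _) _; rewrite ler_nat; clear; nlia.
rewrite big_mkcond; apply: ler_sum => s _; case: ifP => [/andP[h1 h2]|_]; last by rewrite ler0n.
have h3 : (k %/ V < s + 2)%N by rewrite ltn_divLR.
have h4 : (s < k %/ V + 4)%N.
  rewrite ltnNge; apply/negP => h5.
  have : ((k %/ V).+1 + 3 <= s)%N by rewrite addSnnS.
  move=> h6; have h7 : (k < (k %/ V).+1 * V)%N by rewrite -ltn_divLR.
  have : (((k %/ V).+1 + 3) * V <= s * V)%N by rewrite leq_mul2r h6 orbT.
  rewrite mulnDl => h8;
  move: h2 h7 h8; clear; move: ((k %/ V).+1 * V)%N (s * V)%N => a b; nlia.
suff -> : (k %/ V - 1 <= s < k %/ V + 4)%N by [].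
by apply/andP; split; move: h3 h4; move: (k %/ V)%N (nat_of_ord s) => a b; clear; nlia.
Qed.

(** Up to [Y1] the windows are replaced by [Qsk]; beyond it the trivial bound leaves a convergent
    sum of [1 / k^2]. In the main part [k] is comparable to [s V]: for each [s] it runs through an
    interval of length [5 V], where [Qsk_mean] applies, and then [om s] replaces [1 / s^2]. *)
Lemma S2_bound (E B0 Bk : R) : 0 <= E -> pw (13 * Y1)%:R kap <= E ->
  Qf 0 (- 2^-1) <= B0 -> 0 <= Bk -> - Bk <= Qf (- kap) (- 2^-1) ->
  S2 cc nn U V <= 1690 / V%:R * (E / kap) * (2 * B0 + 2 * Bk) +
    (2704 * N%:R ^+ 4 / V%:R ^+ 2 + 13520 * cb ^+ 2 * N%:R ^+ 2 / V%:R ^+ 2 +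
     5 * (1 + cb) ^+ 2 * N%:R ^+ 2 / Y1%:R) * FN.
Proof.
move=> E0 hE hB0 Bk0 hBk; have RS0 := RS_ge0; have RS2 := RS_sqr.
have [G1 [eG1 G10]] : exists G1, G1 = 2 * (26 * cb / V%:R * RS) ^+ 2 /\ 0 <= G1.
  by eexists; split; [reflexivity | rewrite mulr_ge0// sqr_ge0].
have [G2 [eG2 G20]] : exists G2, G2 = ((1 + cb) * RS) ^+ 2 /\ 0 <= G2.
  by eexists; split; [reflexivity | exact: sqr_ge0].
pose mt (k s : nat) : R := if (k <= Y1)%N then 2 * (k%:R^-1 * Qsk s k ^+ 2) else 0.
have hterm k s : (V <= 4 * k)%N -> cond k s ->
   nrm (window cc nn k (k + s)) ^+ 2 <= mt k s + (G1 + (if (Y1 < k)%N then G2 else 0)) * k%:R^-1.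
  move=> hk hc; have hs := cond_le hk hc.
  have k0 : (0 < k)%N by move: hk V0; clear; nlia.
  have kp : 0 < k%:R :> R by rewrite ltr0n.
  have sk : (s <= k)%N.
    rewrite -(leq_pmul2r V0); apply: leq_trans hs _; rewrite mulnC leq_mul2l V_ge orbT //.
  rewrite /mt; case: (leqP k Y1) => hY.
    have hX : (k + s < X)%N.
      apply: leq_ltn_trans Y1_X; rewrite mul2n -addnn; exact: leq_add hY (leq_trans sk hY).
    have h : s%:R / k%:R <= 13 / V%:R :> R.
      by rewrite ler_pdivrMr// mulrAC ler_pdivlMr// -!natrM ler_nat.
    have n0 : 0 <= 2 * cb * (s%:R / k%:R) * RS by rewrite mulr_ge0// mulr_ge0 ?divr_ge0// mulr_ge0.
    have h26 : 2 * cb * (s%:R / k%:R) * RS <= 26 * cb / V%:R * RS.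
      have -> : 26 * cb / V%:R = 2 * cb * (13 / V%:R) by ring.
      by rewrite ler_wpM2r// ler_wpM2l ?mulr_ge0.
    apply: le_trans (window_main k0 hX) _; rewrite lerD2l addr0 eG1 -[X in _ <= X]mulrA ler_wpM2l//.
    rewrite ler_wpM2r ?invr_ge0 ?(ltW kp)// ler_pXn2r ?nnegrE//; exact: le_trans n0 h26.
  rewrite add0r; apply: le_trans (window_triv k0 sk) _.
  by rewrite eG2 ler_wpM2r ?invr_ge0 ?(ltW kp)// lerDr.
rewrite /S2.
apply: le_trans (_ : \sum_(k < U | (V <= 4 * k)%N) (k%:R^-1 * \sum_(s < (4 * U).+1 | cond k s) mt k s +
    5 * (G1 + (if (Y1 < k)%N then G2 else 0)) * (k%:R^-1) ^+ 2) <= _).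
  apply: ler_sum => k hk; have k0 : (0 < k)%N by move: hk V0; clear; nlia.
  have -> : 5 * (G1 + (if (Y1 < k)%N then G2 else 0)) * (k%:R^-1) ^+ 2 =
     k%:R^-1 * (5 * ((G1 + (if (Y1 < k)%N then G2 else 0)) * k%:R^-1)) by ring.
  rewrite -mulrDr ler_wpM2l ?invr_ge0 ?ler0n//.
  apply: le_trans (_ : \sum_(s < (4 * U).+1 | cond k s) (mt k s + (G1 + (if (Y1 < k)%N then G2 else 0)) * k%:R^-1) <= _).
    by apply: ler_sum => s hs; exact: hterm.
  rewrite big_split /= lerD2l.
  have -> : \sum_(s < (4 * U).+1 | cond k s) (G1 + (if (Y1 < k)%N then G2 else 0)) / k%:R =
     (G1 + (if (Y1 < k)%N then G2 else 0)) / k%:R * \sum_(s < (4 * U).+1 | cond k s) (1 : R).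
    by rewrite mulr_sumr; apply: eq_bigr => s _; rewrite mulr1.
  rewrite [X in _ <= X]mulrC ler_wpM2l ?cond_count// mulr_ge0 ?invr_ge0// addr_ge0//.
  by case: ifP.
rewrite big_split /=.
have hsec : \sum_(k < U | (V <= 4 * k)%N) 5 * (G1 + (if (Y1 < k)%N then G2 else 0)) * (k%:R^-1) ^+ 2 <=
   (13520 * cb ^+ 2 * N%:R ^+ 2 / V%:R ^+ 2 + 5 * (1 + cb) ^+ 2 * N%:R ^+ 2 / Y1%:R) * FN.
  apply: le_trans (_ : 5 * G1 * \sum_(k < U | (0 < k)%N) (k%:R^-1) ^+ 2 +
     5 * G2 * \sum_(k < U | (Y1 < k)%N) (k%:R^-1) ^+ 2 <= _).
    rewrite !mulr_sumr [X in _ <= X + _]big_mkcond [X in _ <= _ + X]big_mkcond -big_split big_mkcond /=.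
    apply: ler_sum => k _.
    have p0 : (0 : R) <= (k%:R^-1) ^+ 2 by exact: sqr_ge0.
    case: ifP => [hk|_]; last first.
      by apply: addr_ge0; case: ifP => // _; apply: mulr_ge0 => //; apply: mulr_ge0.
    have -> : (0 < k)%N by move: hk V0; clear; nlia.
    by case: ifP => _; rewrite le_eqVlt; apply/orP; left; apply/eqP; ring.
  have h1 := sum_inv_sqr U; have h2 := @sum_inv_sqr_tail U Y1 Y1_gt0.
  apply: le_trans (lerD (ler_wpM2l _ h1) (ler_wpM2l _ h2)) _; rewrite ?mulr_ge0//.
  rewrite [X in _ <= X]mulrDl; apply: lerD.
    have -> : 5 * G1 * 2 = 13520 * cb ^+ 2 / V%:R ^+ 2 * RS ^+ 2 :> R.
      by rewrite eG1 !exprMn exprVn; field; rewrite gt_eqF.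
    have c0 : 0 <= 13520 * cb ^+ 2 / V%:R ^+ 2 by rewrite divr_ge0 ?mulr_ge0 ?sqr_ge0.
    have h3 := ler_wpM2l c0 RS2.
    have -> : 13520 * cb ^+ 2 * N%:R ^+ 2 / V%:R ^+ 2 * FN = 13520 * cb ^+ 2 / V%:R ^+ 2 * (N%:R ^+ 2 * FN) by ring.
    exact: h3.
  have -> : 5 * G2 / Y1%:R = 5 * (1 + cb) ^+ 2 / Y1%:R * RS ^+ 2 by rewrite eG2 exprMn; ring.
  have c0 : 0 <= 5 * (1 + cb) ^+ 2 / Y1%:R.
    by apply: divr_ge0; [apply: mulr_ge0; [exact: ler0n | exact: sqr_ge0] | exact: ler0n].
  have -> : 5 * (1 + cb) ^+ 2 * N%:R ^+ 2 / Y1%:R * FN = 5 * (1 + cb) ^+ 2 / Y1%:R * (N%:R ^+ 2 * FN) by ring.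
  exact: ler_wpM2l.
suff hmain : \sum_(k < U | (V <= 4 * k)%N) k%:R^-1 * \sum_(s < (4 * U).+1 | cond k s) mt k s <=
   1690 / V%:R * (E / kap) * (2 * B0 + 2 * Bk) + 2704 * N%:R ^+ 4 / V%:R ^+ 2 * FN by lra.
pose L := (13 * Y1).+1.
(* For [s < 3] the truncated difference puts the interval at 0, where it still contains all
   admissible [k]. *)
pose as_ (s : nat) := ((s - 3) * V)%N.
(* [338 = 2 * 13^2], from [1 / k <= 13 / (s V)]; the length 5 and the error constant 4 turn it into
   1690 and 1352. *)
apply: le_trans (_ : \sum_(1 <= s < L) 338 / (s%:R * V%:R) ^+ 2 * \sum_(k < U | (as_ s <= k < as_ s + 5 * V)%N) Qsk s k ^+ 2 <= _).
  rewrite big_add1 /= big_mkord.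
  apply: le_trans (_ : \sum_(k < U) \sum_(s < (13 * Y1)%N | (as_ s.+1 <= k < as_ s.+1 + 5 * V)%N)
      338 / (s.+1%:R * V%:R) ^+ 2 * Qsk s.+1 k ^+ 2 <= _); last first.
    rewrite (exchange_big_dep xpredT) //= le_eqVlt; apply/orP; left; apply/eqP.
    by apply: eq_bigr => s _; rewrite mulr_sumr.
  rewrite big_mkcond; apply: ler_sum => k _.
  have q0 s : 0 <= 338 / (s.+1%:R * V%:R) ^+ 2 * Qsk s.+1 k ^+ 2 :> R by rewrite mulr_ge0 ?sqr_ge0// divr_ge0// sqr_ge0.
  case: ifP => hk; last by apply: sumr_ge0.
  have k0 : (0 < k)%N by move: hk V0; clear; nlia.
  have kp : 0 < k%:R :> R by rewrite ltr0n.
  have kV0 : 0 <= k%:R^-1 :> R by rewrite invr_ge0 ltW.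
  rewrite mulr_sumr /mt; case: (leqP k Y1) => hY; last first.
    by rewrite big1 ?sumr_ge0// => s _; rewrite mulr0.
  rewrite big_mkcond big_ord_recl /= Qsk0 expr0n /= !mulr0 (_ : (if cond k 0 then 0 else 0) = 0 :> R); last by case: ifP.
  rewrite add0r -big_mkcond.
  have hY13 : (0 < 13 * Y1)%N by rewrite muln_gt0 Y1_gt0.
  pose hh (s : 'I_(4 * U)) : 'I_(13 * Y1) := insubd (Ordinal hY13) (nat_of_ord s).
  have hhE (s : 'I_(4 * U)) : (s < 13 * Y1)%N -> hh s = s :> nat.
    by move=> h; rewrite /hh val_insubd h.
  have slt (s : 'I_(4 * U)) : cond k (bump 0 s) -> (s < 13 * Y1)%N.
    move=> hc; have := cond_le hk hc; rewrite /bump /= add1n => h.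
    have : (s.+1 * V <= 13 * Y1 * V)%N.
      apply: leq_trans h _; apply: leq_trans (_ : 13 * Y1 <= _)%N; first by rewrite leq_mul2l hY orbT.
      by rewrite leq_pmulr.
    by rewrite leq_pmul2r.
  apply: (@ler_sum_inj _ _ _ _ hh).
  - move=> s s'; rewrite !unfold_in => hs hs' /(congr1 (@nat_of_ord _)).
    by rewrite !hhE ?slt// => h; apply: val_inj.
  - move=> s hs; rewrite hhE ?slt//; move: hs; rewrite /cond /bump /= add1n /as_.
    move=> /andP[h1 h2]; clear -h1 h2.
    case: (leqP s 2) => hs.
      have -> : (s.+1 - 3 = 0)%N by move: hs; clear; nlia.
      rewrite mul0n add0n leq0n /=; apply: leq_trans h1 _; rewrite leq_mul2r; apply/orP; right.
      by move: hs; clear; nlia.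
    have e : (s.+1 = (s.+1 - 3) + 3)%N by rewrite subnK// leqW.
    move: h1 h2; rewrite {1 2}e; move: (s.+1 - 3)%N => d; clear; rewrite !mulnDl.
    by move: (d * V)%N => x; nlia.
  - move=> s hs; rewrite hhE ?slt// /bump /= add1n.
    have hb := cond_le hk hs; rewrite /bump /= add1n in hb.
    have sV : 0 < s.+1%:R * V%:R :> R by rewrite mulr_gt0 ?ltr0n.
    have h : k%:R^-1 <= 13 / (s.+1%:R * V%:R) :> R.
      rewrite -[X in X <= _]mul1r ler_pdivrMr// mulrAC ler_pdivlMr// mul1r -!natrM ler_nat //.
    have h2 : k%:R^-1 * k%:R^-1 <= 13 / (s.+1%:R * V%:R) * (13 / (s.+1%:R * V%:R)) :> R by rewrite ler_pM.
    have -> : k%:R^-1 * (2 * (k%:R^-1 * Qsk s.+1 k ^+ 2)) = 2 * (k%:R^-1 * k%:R^-1) * Qsk s.+1 k ^+ 2 by ring.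
    have -> : 338 / (s.+1%:R * V%:R) ^+ 2 = 2 * (13 / (s.+1%:R * V%:R) * (13 / (s.+1%:R * V%:R))) :> R by rewrite expr2 invfM; ring.
    by rewrite ler_wpM2r ?sqr_ge0// ler_wpM2l.
  - by move=> s _.
apply: le_trans (_ : \sum_(1 <= s < L) (1690 / V%:R * (E / kap) * (om kap s * Ms s) +
    1352 * N%:R ^+ 4 / V%:R ^+ 2 * FN * (s%:R^-1) ^+ 2) <= _); last first.
  rewrite big_split /= -!mulr_sumr; apply: lerD.
    rewrite ler_wpM2l ?sum_om_Ms// !mulr_ge0 ?invr_ge0// ltW//.
  have -> : \sum_(1 <= s < L) (s%:R^-1) ^+ 2 = \sum_(s < L | (0 < s)%N) (s%:R^-1) ^+ 2 :> R.
    rewrite -(big_mkord (fun s => (0 < s)%N) (fun s => (s%:R^-1 : R) ^+ 2)) [RHS]big_ltn_cond//=.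
    by rewrite big_nat_cond [RHS]big_nat_cond; apply: eq_bigl => -[|s] //; rewrite andbT.
  have h := sum_inv_sqr L.
  have c0 : 0 <= 1352 * N%:R ^+ 4 / V%:R ^+ 2 * FN by rewrite mulr_ge0// divr_ge0 ?mulr_ge0 ?exprn_ge0.
  have := ler_wpM2l c0 h; lra.
rewrite big_nat_cond [X in _ <= X]big_nat_cond; apply: ler_sum => s /andP[/andP[s1 sL] _].
have sp : 0 < s%:R :> R by rewrite ltr0n.
have hq := Qsk_mean s (as_ s) (5 * V).
have hm := le_trans (ler_norm _) hq.
have hsh : \sum_(k < U | (as_ s <= k < as_ s + 5 * V)%N) Qsk s k ^+ 2 <= (5 * V)%:R * Ms s + 4 * N%:R ^+ 4 * FN.
  apply: le_trans (@sum_shift_le U (as_ s) (5 * V) (fun k => Qsk s k ^+ 2) _) _; first by move=> k; exact: sqr_ge0.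
  have -> : 4 * N%:R ^+ 4 * FN = 4 * N%:R ^+ 3 * (N%:R * FN) by ring.
  lra.
have c0 : 0 <= 338 / (s%:R * V%:R) ^+ 2 :> R by rewrite divr_ge0// sqr_ge0.
apply: le_trans (ler_wpM2l c0 hsh) _.
have -> : 338 / (s%:R * V%:R) ^+ 2 * ((5 * V)%:R * Ms s + 4 * N%:R ^+ 4 * FN) =
   1690 / V%:R * ((s%:R^-1) ^+ 2 * Ms s) + 1352 * N%:R ^+ 4 / V%:R ^+ 2 * FN * (s%:R^-1) ^+ 2.
  by rewrite natrM; field; rewrite !gt_eqF.
rewrite lerD2r -[X in _ <= X]mulrA ler_wpM2l ?divr_ge0// mulrA ler_wpM2r ?Ms_ge0//.
have ho := om_ge kap_gt0 kap_le s1.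
have hpw : pw s%:R kap <= E.
  apply: le_trans hE; apply: ler_pw => //; [exact: ltW | by rewrite ler_nat -ltnS].
have ePW : pw s%:R kap * pw s%:R (- kap) = 1 by rewrite -pwD subrr pw0.
have -> : (s%:R^-1) ^+ 2 = (pw s%:R kap / kap) * (kap * pw s%:R (- kap) / s%:R ^+ 2) :> R.
  have -> : (pw s%:R kap / kap) * (kap * pw s%:R (- kap) / s%:R ^+ 2) =
     (pw s%:R kap * pw s%:R (- kap)) / s%:R ^+ 2 by field; rewrite !gt_eqF.
  by rewrite ePW mul1r exprVn.
apply: ler_pM => //; last by rewrite ler_wpM2r// invr_ge0 ltW.
- by rewrite divr_ge0 ?pw_ge0// ltW.
- by rewrite divr_ge0 ?sqr_ge0// mulr_ge0 ?pw_ge0// ltW.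
Qed.

Definition bn (n : nat) : R := \sum_(S | (nS S <= N)%N) if (nS S %| n)%N then rS S * sq S else 0.

(** As [nS S] is odd, every representation of [k + 1] as a multiple carries the same sign [(-1)^k],
    which factors out. *)
Lemma window_succ k : (k.+1 <= X)%N ->
  nrm (window cc nn k k.+1) ^+ 2 = k.+1%:R^-1 * bn k.+1 ^+ 2.
Proof.
move=> hk; rewrite window_Tm//; last by right.
have -> : \sum_(S | (nS S <= N)%N) (rS S * pw (nS S)%:R 2^-1)%:C * Tm beta X (nS S) k k.+1 =
   (bn k.+1)%:C * ((-1) ^+ k * gw beta k.+1%:R).
  rewrite /bn rmorph_sum mulr_suml; apply: eq_bigr => S _; rewrite Tm_succ ?nS_odd//.
  by case: ifP => _; rewrite ?mulr0 ?rmorph0 ?mul0r.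
rewrite nrmM nrm_real nrmM nrmX nrmN nrm1 expr1n mul1r nrm_gw exprMn pw_half_sqr// real_normK ?num_real//.
by rewrite mulrC.
Qed.

Lemma nSU_dvd S T n : ((nS S %| n) && (nS T %| n) = (nS (S :|: T) %| n))%N.
Proof.
apply/andP/idP => [[h1 h2]|h].
  apply: nS_dvd => // i; rewrite inE => /orP[iS|iT].
    by apply: dvdn_trans h1; rewrite pr_dvd_nS.
  by apply: dvdn_trans h2; rewrite pr_dvd_nS.
by split; apply: dvdn_trans h; apply: nS_dvd => // i iS; rewrite pr_dvd_nS// inE iS ?orbT.
Qed.

Lemma nSU S T : nS (S :|: T) = (nS (S :&: T) * nS (S :\: T) * nS (T :\: S))%N.
Proof. by rewrite (nSID pr (S :|: T) S) setUK setDUl setDv set0U (nSID pr S T). Qed.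

(** With [P] the product of all primes in use, every [nS (S :|: T)] divides [P Z] with quotient at
    least [Z]; so each inner sum is a value of [hz] beyond [Z], and all are nearly equal. *)
Lemma sum_bn (Z : nat) : (0 < Z)%N ->
  \sum_(n < (nS setT * Z).+1 | (0 < n)%N) pw n%:R (- 1 - kap) * bn n ^+ 2 <=
  hz kap Z * Qf (- kap) (- 2^-1 - kap) + kap^-1 * pw Z%:R (- kap) * (N%:R * FN).
Proof.
move=> Z0; set P := nS setT.
have lP S T : (nS (S :|: T) %| P)%N by apply: nS_dvd => // i _; rewrite pr_dvd_nS// inE.
have P0 : (0 < P)%N by exact: nS_gt0.
pose w S T : R := pw (nS (S :&: T))%:R (- kap) * pw (nS (S :\: T))%:R (- 2^-1 - kap) * pw (nS (T :\: S))%:R (- 2^-1 - kap).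
have k0 := kap_gt0.
have w01 S T : 0 <= w S T <= 1.
  have h A u : u <= 0 -> 0 <= pw (nS A)%:R u <= 1 by move=> hu; rewrite pw_ge0 pw_le1.
  have a1 : - kap <= 0 by lra.
  have a2 : - 2^-1 - kap <= 0 by lra.
  have /andP[h1 h2] := h (S :&: T) _ a1; have /andP[h3 h4] := h (S :\: T) _ a2; have /andP[h5 h6] := h (T :\: S) _ a2.
  rewrite /w !mulr_ge0//= -[X in _ <= X]mulr1 ler_pM ?mulr_ge0//.
  by rewrite -[X in _ <= X]mulr1 ler_pM.
pose q S T := (P %/ nS (S :|: T) * Z)%N.
have -> : \sum_(n < (P * Z).+1 | (0 < n)%N) pw n%:R (- 1 - kap) * bn n ^+ 2 =
  hz kap Z * Qf (- kap) (- 2^-1 - kap) +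
  \sum_(S | (nS S <= N)%N) \sum_(T | (nS T <= N)%N) rS S * rS T * (w S T * (hz kap (q S T) - hz kap Z)).
  have eST S T : sq S * sq T * \sum_(n < (P * Z).+1 | (0 < n)%N && (nS (S :|: T) %| n)%N) pw n%:R (- 1 - kap) =
      w S T * hz kap (q S T).
    have eP : (P * Z = nS (S :|: T) * q S T)%N by rewrite /q mulnA [(_ * (P %/ _))%N]mulnC divnK.
    rewrite eP (@sum_multiples _ (nS (S :|: T)) (q S T) (fun n => pw n%:R (- 1 - kap))) ?nS_gt0//.
    have -> : \sum_(a < (q S T).+1 | (0 < a)%N) pw (nS (S :|: T) * a)%:R (- 1 - kap) =
       pw (nS (S :|: T))%:R (- 1 - kap) * hz kap (q S T).
      by rewrite /hz mulr_sumr; apply: eq_bigr => a a0; rewrite natrM pwM ?ltr0n ?nS_gt0.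
    rewrite mulrA; congr (_ * _).
    rewrite /sq (pw_nSID S T 2^-1) (pw_nSID T S 2^-1) [T :&: S]setIC nSU !natrM !pwM ?mulr_gt0// /w.
    transitivity (pw (nS (S :&: T))%:R (2^-1 + 2^-1 + (- 1 - kap)) * pw (nS (S :\: T))%:R (2^-1 + (- 1 - kap)) *
       pw (nS (T :\: S))%:R (2^-1 + (- 1 - kap))); first by rewrite ![pw _ (2^-1 + _ + _)]pwD ![pw _ (2^-1 + _)]pwD; ring.
    by congr (pw _ _ * pw _ _ * pw _ _); lra.
  transitivity (\sum_(S | (nS S <= N)%N) \sum_(T | (nS T <= N)%N) rS S * rS T *
    (sq S * sq T * \sum_(n < (P * Z).+1 | (0 < n)%N && (nS (S :|: T) %| n)%N) pw n%:R (- 1 - kap))).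
    transitivity (\sum_(n < (P * Z).+1 | (0 < n)%N) \sum_(S | (nS S <= N)%N) \sum_(T | (nS T <= N)%N)
       rS S * rS T * (sq S * sq T * (if (nS (S :|: T) %| n)%N then pw n%:R (- 1 - kap) else 0))).
      apply: eq_bigr => n n0; rewrite expr2 /bn mulr_suml mulr_sumr; apply: eq_bigr => S _.
      rewrite mulr_sumr mulr_sumr; apply: eq_bigr => T _; rewrite -nSU_dvd.
      by case: (nS S %| n)%N; case: (nS T %| n)%N => /=; ring.
    rewrite exchange_big /=; apply: eq_bigr => S _; rewrite exchange_big /=; apply: eq_bigr => T _.
    by rewrite -mulr_sumr -mulr_sumr big_mkcondr.
  rewrite /Qf !mulr_sumr -big_split; apply: eq_bigr => S _ /=.
  rewrite !mulr_sumr -big_split; apply: eq_bigr => T _ /=.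
  by rewrite eST -/(w S T); ring.
rewrite lerD2l; apply: le_trans (ler_norm _) _.
apply: double_sum_le; first by rewrite mulr_ge0 ?pw_ge0// invr_ge0 ltW.
move=> S T _ _; rewrite normrM (normrM (rS S)) !norm_rS// mulrC ler_wpM2r ?mulr_ge0//.
have /andP[w0 w1] := w01 S T; rewrite normrM (ger0_norm w0).
have hq : (Z <= q S T)%N by rewrite /q leq_pmull// divn_gt0 ?nS_gt0// dvdn_leq.
have /andP[h1 h2] := hz_diff kap_gt0 Z0 hq.
by rewrite (ger0_norm h1) -[X in _ <= X]mul1r ler_pM.
Qed.

(** The bound [1 / n <= E n^(-1-kap)] for [n <= V] allows the sum to be extended to a range where it
    is nearly [zeta (1 + kap)] times a quadratic form. *)
Lemma S1_bound (E B' : R) : 0 <= E -> pw V%:R kap <= E -> (V <= X)%N ->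
  0 <= B' -> Qf (- kap) (- 2^-1 - kap) <= B' ->
  S1 cc nn U V <= E * ((1 + kap^-1) * B').
Proof.
move=> E0 hE VX B0 hB; apply/ler_addgt0Pr => e he.
have k0 := kap_gt0; have kv : 0 < kap^-1 by rewrite invr_gt0.
have NF0 : 0 <= N%:R * FN by rewrite mulr_ge0.
pose e' := e / (1 + E * (kap^-1 * (N%:R * FN))).
have den0 : 0 < 1 + E * (kap^-1 * (N%:R * FN)).
  have : 0 <= E * (kap^-1 * (N%:R * FN)) by apply: mulr_ge0 => //; apply: mulr_ge0 => //; exact: ltW.
  lra.
have e'0 : 0 < e' by rewrite divr_gt0.
have [Z1 [Z10 hZ1]] := pw_tendsto0 k0 e'0.
pose Z := (Z1 * V)%N.
have Z0 : (0 < Z)%N by rewrite muln_gt0 Z10.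
have hZ : pw Z%:R (- kap) <= e'.
  apply: le_trans hZ1; apply: ler_pwN; rewrite ?ltr0n// ?ler_nat ?leq_pmulr//; lra.
pose P := nS setT; have P0 : (0 < P)%N by exact: nS_gt0.
apply: le_trans (_ : \sum_(n < (P * Z).+1 | (0 < n)%N) E * (pw n%:R (- 1 - kap) * bn n ^+ 2) <= _); last first.
  rewrite -mulr_sumr; apply: le_trans (ler_wpM2l E0 (sum_bn Z0)) _.
  have /andP[h1 h2] := hz_le k0 Z0.
  have h3 : hz kap Z * Qf (- kap) (- 2^-1 - kap) <= (1 + kap^-1) * B'.
    by apply: le_trans (ler_wpM2l h1 hB) _; rewrite ler_wpM2r.
  rewrite mulrDr; apply: lerD; first by rewrite ler_wpM2l.
  have -> : E * (kap^-1 * pw Z%:R (- kap) * (N%:R * FN)) = (E * (kap^-1 * (N%:R * FN))) * pw Z%:R (- kap) by ring.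
  apply: le_trans (_ : (1 + E * (kap^-1 * (N%:R * FN))) * e' <= _); last by rewrite /e' mulrC mulfVK// gt_eqF.
  apply: ler_pM; rewrite ?pw_ge0//; last by rewrite lerDr.
  by apply: mulr_ge0 => //; apply: mulr_ge0 => //; exact: ltW.
have hin (k : 'I_U) : (4 * k < V)%N -> (k.+1 < (P * Z).+1)%N.
  move=> h; rewrite ltnS; apply: leq_trans (_ : V <= _)%N.
    by apply: leq_ltn_trans h; rewrite leq_pmull.
  by rewrite /Z mulnA leq_pmull// muln_gt0 P0.
pose hh (k : 'I_U) : 'I_(P * Z).+1 := inord k.+1.
apply: (@ler_sum_inj _ _ _ _ hh).
- move=> k k'; rewrite !unfold_in => h h' /(congr1 (@nat_of_ord _)); rewrite !inordK ?hin// => -[e1].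
  exact: val_inj.
- by move=> k h; rewrite inordK ?hin.
- move=> k h; rewrite inordK ?hin// window_succ; last first.
    by apply: leq_trans VX; apply: leq_ltn_trans h; rewrite leq_pmull.
  rewrite mulrA ler_wpM2r ?sqr_ge0//.
  have kp : 0 < k.+1%:R :> R by rewrite ltr0n.
  have -> : k.+1%:R^-1 = pw k.+1%:R kap * pw k.+1%:R (- 1 - kap) :> R.
    rewrite -pwD (_ : kap + (- 1 - kap) = - 1); last by lra.
    by rewrite (pwN _ 1) pw1.
  rewrite ler_wpM2r ?pw_ge0//; apply: le_trans hE; apply: ler_pw => //; first exact: ltW.
  by rewrite ler_nat; apply: leq_ltn_trans h; rewrite leq_pmull.
- by move=> n _; rewrite mulr_ge0// mulr_ge0 ?pw_ge0 ?sqr_ge0.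
Qed.

Variable rho : R.
Hypothesis rho_ge0 : 0 <= rho.
Hypothesis f_half : forall i, 2 * (f i * pw (pr i)%:R (- 2^-1)) <= 1.

(** It combines the largest positive term with the smallest negative term among the Euler products
    in use, so it bounds them all. *)
Definition PiA : R := \prod_i (1 + f i ^+ 2 - 2 * (f i * pw (pr i)%:R (- 2^-1 - kap))).
Definition rkA : R := rk_bound pr N rho (fun i => f i ^+ 2) (fun i => f i * pw (pr i)%:R (- 2^-1)) (fun i => f i * pw (pr i)%:R (- 2^-1)).

Lemma rkA_ge0 : 0 <= rkA.
Proof.
rewrite /rkA /rk_bound mulr_ge0 ?pw_ge0// addr_ge0//; apply: prodr_ge0 => i _;
by rewrite !addr_ge0 ?mulr_ge0 ?pw_ge0 ?sqr_ge0.
Qed.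

Lemma Qf_rankin u v : u <= 0 -> v <= - 2^-1 ->
  `|Qf u v - \prod_i (1 + f i ^+ 2 * pw (pr i)%:R u - 2 * (f i * pw (pr i)%:R v))| <= rkA.
Proof.
move=> hu hv.
have -> : Qf u v = trunc_ker pr N (fun i => f i ^+ 2 * pw (pr i)%:R u) (fun i => - f i * pw (pr i)%:R v)
      (fun i => - f i * pw (pr i)%:R v).
  by apply: eq_bigr => S _; apply: eq_bigr => T _; exact: ker_rr.
have -> : \prod_i (1 + f i ^+ 2 * pw (pr i)%:R u - 2 * (f i * pw (pr i)%:R v)) =
   \prod_i (1 + f i ^+ 2 * pw (pr i)%:R u + - f i * pw (pr i)%:R v + - f i * pw (pr i)%:R v).
  by apply: eq_bigr => i _; ring.
have p1 i : 1 <= (pr i)%:R :> R by rewrite ler1n prime_gt0.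
apply: rankin_ker => // i.
- rewrite ger0_norm ?mulr_ge0 ?sqr_ge0 ?pw_ge0// -[X in _ <= X]mulr1 ler_wpM2l ?sqr_ge0// pw_le1//.
- by rewrite mulNr normrN ger0_norm ?mulr_ge0 ?pw_ge0// ler_wpM2l// ler_pwe.
- by rewrite mulNr normrN ger0_norm ?mulr_ge0 ?pw_ge0// ler_wpM2l// ler_pwe.
Qed.

Lemma PiA_factors u v : - kap <= u -> u <= 0 -> - 2^-1 - kap <= v -> v <= - 2^-1 ->
  0 <= \prod_i (1 + f i ^+ 2 * pw (pr i)%:R u - 2 * (f i * pw (pr i)%:R v)) <= PiA.
Proof.
move=> u0 u1 v0 v1; have p1 i : 1 <= (pr i)%:R :> R by rewrite ler1n prime_gt0.
have h0 i : 0 <= 1 + f i ^+ 2 * pw (pr i)%:R u - 2 * (f i * pw (pr i)%:R v).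
  have h1 : f i * pw (pr i)%:R v <= f i * pw (pr i)%:R (- 2^-1) by rewrite ler_wpM2l// ler_pwe.
  have h2 : 0 <= f i ^+ 2 * pw (pr i)%:R u by rewrite mulr_ge0 ?sqr_ge0 ?pw_ge0.
  have := f_half i; lra.
apply/andP; split; first by apply: prodr_ge0.
apply: ler_prod => i _; rewrite h0 /=.
have h1 : f i * pw (pr i)%:R (- 2^-1 - kap) <= f i * pw (pr i)%:R v by rewrite ler_wpM2l// ler_pwe.
have h2 : f i ^+ 2 * pw (pr i)%:R u <= f i ^+ 2 by rewrite -[X in _ <= X]mulr1 ler_wpM2l ?sqr_ge0// pw_le1.
lra.
Qed.

Lemma PiA_ge0 : 0 <= PiA.
Proof.
have k0 := kap_gt0; have /andP[h1 h2] := @PiA_factors 0 (- 2^-1) ltac:(lra) ltac:(lra) ltac:(lra) ltac:(lra).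
exact: le_trans h1 h2.
Qed.

Lemma second_moment (alpha E : R) (L1 J : nat) : 0 < alpha -> (0 < L1)%N -> alpha * L1%:R <= V%:R ->
  alpha * ln U%:R / (2 * PI) + 2 <= J%:R -> (V <= X)%N -> (V <= 13 * Y1)%N ->
  pw (13 * Y1)%:R kap <= E ->
  \sum_(l < L1) nrm (etaP (alpha * l%:R + beta) X * resonator pr N rS (alpha * l%:R + beta)) ^+ 2 <=
  256 * J%:R * V%:R / alpha * (2 ^+ 16 * (E / kap * (PiA + rkA)) + 8 * V%:R *
   ((2704 * N%:R ^+ 4 / V%:R ^+ 2 + 13520 * cb ^+ 2 * N%:R ^+ 2 / V%:R ^+ 2 +
     5 * (1 + cb) ^+ 2 * N%:R ^+ 2 / Y1%:R) * FN)).
Proof.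
move=> al0 L10 hV hJ VX VY hE; have k0 := kap_gt0; have kl := kap_le.
have E0 : 0 <= E by apply: le_trans hE; exact: pw_ge0.
under eq_bigr do rewrite etaP_resonator//.
apply: le_trans (bessel_progression cc (nn_gt0 pr_prime N (X := X)) (nn_leU pr N_gt0 (X := X)) al0 L10 (leq_trans _ V_ge) hV hJ) _ => //.
have c0 : 0 <= 256 * J%:R * V%:R / alpha by rewrite divr_ge0 ?(ltW al0)// !mulr_ge0.
apply: ler_wpM2l => //.
have rk0 := rkA_ge0; have Pi0 := PiA_ge0.
have /andP[a1 a2] := @PiA_factors 0 (- 2^-1) ltac:(lra) ltac:(lra) ltac:(lra) ltac:(lra).
have /andP[b1 b2] := @PiA_factors (- kap) (- 2^-1) ltac:(lra) ltac:(lra) ltac:(lra) ltac:(lra).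
have /andP[d1 d2] := @PiA_factors (- kap) (- 2^-1 - kap) ltac:(lra) ltac:(lra) ltac:(lra) ltac:(lra).
have a3 : Qf 0 (- 2^-1) <= PiA + rkA.
  have := le_trans (ler_norm _) (@Qf_rankin 0 (- 2^-1) ltac:(lra) ltac:(lra)); lra.
have b3 : - rkA <= Qf (- kap) (- 2^-1).
  have := @Qf_rankin (- kap) (- 2^-1) ltac:(lra) ltac:(lra); rewrite ler_norml => /andP[h _]; lra.
have d3 : Qf (- kap) (- 2^-1 - kap) <= PiA + rkA.
  have := le_trans (ler_norm _) (@Qf_rankin (- kap) (- 2^-1 - kap) ltac:(lra) ltac:(lra)); lra.
have PR0 : 0 <= PiA + rkA by lra.
have hE1 : pw V%:R kap <= E.
  by apply: le_trans hE; apply: ler_pw; rewrite ?ler_nat//; exact: ltW.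
have h1 := S1_bound E0 hE1 VX PR0 d3.
have h2 := S2_bound E0 hE a3 rk0 b3.
have V8 : 0 <= 8 * V%:R :> R by rewrite mulr_ge0.
apply: le_trans (lerD h1 (ler_wpM2l V8 h2)) _.
rewrite [X in _ + X]mulrDr addrA lerD2r.
have -> : 8 * V%:R * (1690 / V%:R * (E / kap) * (2 * (PiA + rkA) + 2 * rkA)) =
   13520 * (E / kap) * (2 * (PiA + rkA) + 2 * rkA) by field; rewrite !gt_eqF.
have Ek0 : 0 <= E / kap by rewrite divr_ge0// ltW.
exact: collect_constants.
Qed.

End S12.

(** * The choice of the resonator *)

Lemma exp_le_quad (x : R) : 0 <= x -> x <= 2^-1 -> exp x <= 1 + x * (1 + 2 * x).
Proof.
move=> x0 x1; have h := exp_ge1D (- x); rewrite expN in h.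
have h2 : 0 < 1 - x by lra.
have h3 : exp x <= (1 - x)^-1.
  by rewrite -[exp x]invrK lef_pV2 ?posrE ?invr_gt0 ?exp_gt0.
apply: le_trans h3 _; rewrite -[X in X <= _]mul1r ler_pdivrMr//; nra.
Qed.

Lemma exp_le_lin (u e : R) : 0 <= u -> u <= e -> 0 < e -> e < 1 -> exp ((1 - e) * u) <= 1 + u.
Proof.
move=> u0 ue e0 e1; set s := (1 - e) * u.
have s0 : 0 <= s by rewrite /s mulr_ge0//; lra.
have s1 : s < 1 by rewrite /s; nra.
have h := exp_ge1D (- s); rewrite expN in h.
have h3 : exp s <= (1 - s)^-1.
  by rewrite -[exp s]invrK lef_pV2 ?posrE ?invr_gt0 ?exp_gt0//; lra.
apply: le_trans h3 _; rewrite -[X in X <= _]mul1r ler_pdivrMr; last lra.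
rewrite /s; nra.
Qed.

Lemma lin_sqr (a : R) : 1 - 2 * a <= (1 - a) * (1 - a). Proof. by have := sqr_ge0 a; lra. Qed.
Lemma lin_12 (a : R) : (1 + a) * (1 - 2 * a) <= 1 - a. Proof. by have := sqr_ge0 a; lra. Qed.
Lemma lin_52 (a : R) : (1 - 5 * a) * (1 + 2 * a) <= 1 - 3 * a. Proof. by have := sqr_ge0 a; lra. Qed.
Lemma lin_15 (a : R) : 1 - 6 * a <= (1 - a) * (1 - 5 * a). Proof. by have := sqr_ge0 a; lra. Qed.
Lemma lin_damp (g x a : R) : 0 <= x -> 0 <= g -> x <= a -> (1 - a) * g * (1 + x) <= g.
Proof.
move=> x0 g0 xa; have : 0 <= g * ((a - x) + a * x) by rewrite mulr_ge0// addr_ge0 ?mulr_ge0 ?subr_ge0//; lra.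
lra.
Qed.

Section PrimeRange.
Variables (v q : nat).

Definition range_pred : {pred 'I_(v ^ (q ^ 2)).+1} := [pred p : 'I_(v ^ (q ^ 2)).+1 | prime p && (v ^ q < p)%N].
Definition IP : finType := {p in range_pred}.
Definition pp (i : IP) : nat := val (val i).

Lemma pp_prime i : prime (pp i).
Proof. by have := valP i; rewrite inE => /andP[]. Qed.

Lemma pp_inj : injective pp.
Proof. by move=> i j /val_inj/val_inj. Qed.

Lemma pp_gt i : (v ^ q < pp i)%N.
Proof. by have := valP i; rewrite inE => /andP[]. Qed.

Lemma pp_le i : (pp i <= v ^ (q ^ 2))%N.
Proof. by have := ltn_ord (val i); rewrite ltnS. Qed.

Lemma sum_pp (F : nat -> R) : \sum_(i : IP) F (pp i) = \sum_((v ^ q).+1 <= p < (v ^ (q ^ 2)).+1 | prime p) F p.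
Proof.
have -> : \sum_(i : IP) F (pp i) = \sum_(p in range_pred) F (val p).
  by rewrite (big_sub range_pred (fun p : 'I_(v ^ (q ^ 2)).+1 => F (val p))).
rewrite -(big_mkord (fun p => prime p && (v ^ q < p)%N) F).
by rewrite [RHS](big_nat_widenl _ 0).
Qed.

Hypothesis v_gt1 : (1 < v)%N.
Hypothesis q_ge : (6 <= q)%N.
Definition lv : R := ln v%:R.
Hypothesis lv_ge : 9 * q%:R <= lv.

Let q0 : 0 < q%:R :> R. Proof. by rewrite ltr0n (leq_trans _ q_ge). Qed.
Let q6 : 6 <= q%:R :> R. Proof. by rewrite ler_nat. Qed.
Let lv0 : 0 < lv. Proof. by have := lv_ge; have := q6; lra. Qed.
Let vp : 0 < v%:R :> R. Proof. by rewrite ltr0n ltnW. Qed.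

Lemma ln_vX j : ln (v ^ j)%:R = j%:R * lv.
Proof. by rewrite natrX lnXn. Qed.

Lemma vX_gt0 j : (0 < v ^ j)%N.
Proof. by rewrite expn_gt0 ltnW. Qed.

Lemma pp_gt0 i : 0 < (pp i)%:R :> R.
Proof. by rewrite ltr0n prime_gt0// pp_prime. Qed.

Lemma ln_pp i : q%:R * lv <= ln (pp i)%:R <= q%:R ^+ 2 * lv.
Proof.
rewrite -natrX -!ln_vX !ler_ln ?pp_gt0 ?ltr0n ?vX_gt0//.
by rewrite !ler_nat pp_le ltnW// pp_gt.
Qed.

(** The constant 9 is 3 plus a bound for [2 ln 4]. *)
Lemma mert_diff m n : (0 < m)%N -> (m <= n)%N ->
  let s : R := \sum_(m.+1 <= p < n.+1 | prime p) ln p%:R / p%:R in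
  ln n%:R - ln m%:R - 9 <= s /\ s <= ln n%:R - ln m%:R + 9.
Proof.
move=> m0 hmn s; have n0 := leq_trans m0 hmn.
have e : mert n = mert m + s.
  rewrite /mert /s -!(big_mkord (fun p => prime p) (fun p => ln p%:R / p%:R : R)).
  by rewrite (@big_cat_nat _ _ _ m.+1).
have l4 : ln 4 <= 3 :> R by apply: le_trans (ln_leB1 _) _; lra.
have h1 := mert_le n0; have h2 := mert_ge n0; have h3 := mert_le m0; have h4 := mert_ge m0.
split; lra.
Qed.

Definition Psi : R := \sum_(i : IP) ((pp i)%:R * ln (pp i)%:R)^-1.

(** On [(v^j, v^(j+1)]] the sum of [ln p / p] is at least [lv - 9] and [ln p <= (j + 1) lv]; then
    [1 / (j + 1)^2] is bounded below by a telescoping difference. *)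
Lemma Psi_blocks j : (q <= j)%N ->
  (lv - 9) / lv ^+ 2 * (q.+1%:R^-1 - j.+1%:R^-1) <=
  \sum_((v ^ q).+1 <= p < (v ^ j).+1 | prime p) (p%:R * ln p%:R)^-1.
Proof.
have lv9 : 0 <= lv - 9 by have := lv_ge; have := q6; lra.
move=> hj; rewrite -(subnK hj); elim: (j - q)%N => [|d IH]; first by rewrite add0n subrr mulr0 big_geq.
rewrite addSn; set j' := (d + q)%N in IH *.
rewrite (@big_cat_nat _ _ _ (v ^ j').+1) //=; last 2 first.
- by rewrite ltnS leq_exp2l// leq_addl.
- by rewrite ltnS leq_exp2l.
have -> : (lv - 9) / lv ^+ 2 * (q.+1%:R^-1 - j'.+2%:R^-1) =
   (lv - 9) / lv ^+ 2 * (q.+1%:R^-1 - j'.+1%:R^-1) + (lv - 9) / lv ^+ 2 * (j'.+1%:R^-1 - j'.+2%:R^-1) by ring.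
apply: lerD => //.
have j1 : 0 < j'.+1%:R :> R by rewrite ltr0n.
have hle : (v ^ j' <= v ^ j'.+1)%N by rewrite leq_exp2l.
have [hm _] := mert_diff (vX_gt0 j') hle.
rewrite !ln_vX in hm.
have hm' : lv - 9 <= \sum_((v ^ j').+1 <= p < (v ^ j'.+1).+1 | prime p) ln p%:R / p%:R.
  by apply: le_trans hm; rewrite -natr1; lra.
set x := j'.+1%:R in j1 *.
have -> : j'.+2%:R = x + 1 :> R by rewrite natr1.
apply: le_trans (_ : (lv - 9) * (x * lv) ^- 2 <= _).
  have e : x^-1 - (x + 1)^-1 = (x * (x + 1))^-1 by field; apply/andP; split; apply/eqP; lra.
  rewrite e -mulrA ler_wpM2l// -invfM lef_pV2 ?posrE ?mulr_gt0 ?exprn_gt0 ?mulr_gt0//; last lra.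
  rewrite exprMn mulrC ler_wpM2l ?sqr_ge0//; nra.
have xl0 : 0 <= (x * lv) ^- 2 by rewrite invr_ge0 sqr_ge0.
apply: le_trans (ler_wpM2r xl0 hm') _; rewrite mulr_suml [X in X <= _]big_nat_cond [X in _ <= X]big_nat_cond.
apply: ler_sum => p /andP[/andP[p1 p2] pp].
have pp0 : 0 < p%:R :> R by rewrite ltr0n prime_gt0.
have lp0 : 0 < ln p%:R :> R by apply: ln_gt0; rewrite ltr1n prime_gt1.
have lp1 : ln p%:R <= x * lv by rewrite /x -ln_vX; rewrite ler_ln; [rewrite ler_nat -ltnS | exact: pp0 | rewrite ltr0n vX_gt0].
have -> : (p%:R * ln p%:R)^-1 = ln p%:R / p%:R * ln p%:R ^- 2 by field; rewrite !gt_eqF.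
rewrite ler_wpM2l ?divr_ge0 ?(ltW lp0)// lef_pV2 ?posrE ?exprn_gt0 ?mulr_gt0//.
by rewrite ler_pXn2r ?nnegrE ?mulr_ge0 ?(ltW j1) ?(ltW lv0) ?(ltW lp0).
Qed.

Lemma Psi_ge : (1 - 3 / q%:R) / (q%:R * lv) <= Psi.
Proof.
rewrite /Psi (sum_pp (fun p => (p%:R * ln p%:R)^-1)).
have hq2 : (q <= q ^ 2)%N by rewrite -{1}[q]expn1 leq_exp2l// (leq_trans _ q_ge).
apply: le_trans (Psi_blocks hq2).
have l9 : 9 / lv <= q%:R^-1.
  by rewrite ler_pdivrMr// mulrC ler_pdivlMr//; have := lv_ge; lra.
have e1 : (lv - 9) / lv ^+ 2 = (1 - 9 / lv) / lv by field; rewrite gt_eqF.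
have h1 : (1 - 2 / q%:R) / q%:R <= q.+1%:R^-1 - (q ^ 2).+1%:R^-1 :> R.
  have a1 : (1 - q%:R^-1) / q%:R <= q.+1%:R^-1 :> R.
    rewrite ler_pdivrMr// -[X in _ <= X](_ : q%:R / q.+1%:R = _); last by rewrite mulrC.
    rewrite ler_pdivlMr ?ltr0n// -natr1.
    have -> : (1 - q%:R^-1) * (q%:R + 1) = q%:R - q%:R^-1 :> R by field; rewrite gt_eqF.
    by rewrite gerBl invr_ge0 ltW.
  have a2 : (q ^ 2).+1%:R^-1 <= q%:R^-1 / q%:R :> R.
    rewrite -invfM lef_pV2 ?posrE ?ltr0n//; last by rewrite mulr_gt0.
    by rewrite -natr1 natrX expr2; lra.
  by move: a1 a2; move: (q.+1%:R^-1 : R) ((q ^ 2).+1%:R^-1 : R) (q%:R^-1 : R) => b c a; lra.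
rewrite e1.
have qi : 0 < q%:R^-1 :> R by rewrite invr_gt0.
have qi6 : q%:R^-1 <= 6^-1 :> R by rewrite lef_pV2 ?posrE.
apply: le_trans (_ : (1 - q%:R^-1) / lv * ((1 - 2 / q%:R) / q%:R) <= _); last first.
  apply: ler_pM => //.
  - by rewrite divr_ge0 ?(ltW lv0)//; lra.
  - by rewrite divr_ge0 ?(ltW q0)//; lra.
  - by rewrite ler_wpM2r ?invr_ge0 ?(ltW lv0)//; lra.
have -> : (1 - q%:R^-1) / lv * ((1 - 2 / q%:R) / q%:R) = (1 - q%:R^-1) * (1 - 2 / q%:R) / (q%:R * lv).
  by field; rewrite !gt_eqF.
rewrite ler_wpM2r ?invr_ge0 ?mulr_ge0 ?(ltW q0) ?(ltW lv0)//.
move: qi; move: (q%:R^-1) => a a0; nra.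
Qed.

Lemma Psi_gt0 : 0 < Psi.
Proof.
apply: lt_le_trans Psi_ge; rewrite divr_gt0 ?mulr_gt0// subr_gt0 ltr_pdivrMr// mul1r.
by have := q6; lra.
Qed.

Lemma Psi_le : Psi <= 16^-1.
Proof.
have hq2 : (v ^ q <= v ^ (q ^ 2))%N by rewrite leq_exp2l// -{1}[q]expn1 leq_exp2l// (leq_trans _ q_ge).
have [_ hm] := mert_diff (vX_gt0 q) hq2.
have ql0 : 0 < q%:R * lv by rewrite mulr_gt0.
apply: le_trans (_ : (q%:R * lv) ^- 2 * \sum_((v ^ q).+1 <= p < (v ^ (q ^ 2)).+1 | prime p) ln p%:R / p%:R <= _).
  rewrite -sum_pp mulr_sumr; apply: ler_sum => i _.
  have p0 := pp_gt0 i; have /andP[l1 l2] := ln_pp i.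
  have l0 : 0 < ln (pp i)%:R by apply: lt_le_trans l1.
  have -> : ((pp i)%:R * ln (pp i)%:R)^-1 = ln (pp i)%:R ^- 2 * (ln (pp i)%:R / (pp i)%:R) by field; rewrite !gt_eqF.
  rewrite ler_wpM2r ?divr_ge0 ?(ltW l0) ?(ltW p0)// lef_pV2 ?posrE ?exprn_gt0//.
  by rewrite ler_pXn2r ?nnegrE ?(ltW ql0) ?(ltW l0).
rewrite ler_pdivrMl ?exprn_gt0//; apply: le_trans hm _.
rewrite !ln_vX natrX.
have h1 := lv_ge; have h2 := q6.
have h3 : q%:R ^+ 2 * lv * 54 <= (q%:R * lv) ^+ 2.
  rewrite exprMn -mulrA ler_wpM2l ?sqr_ge0// expr2 ler_wpM2l ?(ltW lv0)//; lra.
have h4 : 9 <= q%:R ^+ 2 * lv.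
  have : 1 * 9 <= q%:R ^+ 2 * lv by apply: ler_pM => //; [nra | lra].
  lra.
have h5 : 0 <= q%:R * lv by exact: ltW.
lra.
Qed.

Variables (N : nat).
Hypothesis N_gt0 : (0 < N)%N.
Let w : R := ln N%:R.
Hypothesis w_gt0 : 0 < w.
Hypothesis w_le : w <= pw (v ^ q)%:R (q%:R / q.+1%:R).
Hypothesis w_lv : 40 * q%:R ^+ 4 * lv <= Num.sqrt w.

(** As [f(p)^2 <= w / p] and [w <= p^(q/(q+1))], the exponent left for [f(p)^2] is
    [1 / (q + 1) = 2 kap0]. *)
Definition kap0 : R := (2 * q.+1%:R)^-1.
(** Normalized so that the sum of [f(p)^2 ln p] is [(1 - 1/q) w], slightly below [w = ln N]; this
    makes the part of the resonator beyond [N] negligible. *)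
Definition LL : R := Num.sqrt ((1 - q%:R^-1) * w / Psi).
Definition ff (i : IP) : R := LL * pw (pp i)%:R (- 2^-1) / ln (pp i)%:R.
Definition gg (i : IP) : R := ff i * pw (pp i)%:R (- 2^-1).
Definition LP : R := LL * Psi.
(** Chosen so that [rho ln p <= 1 / (4 q)] on the whole range of primes. *)
Definition rho : R := (4 * q%:R ^+ 3 * lv)^-1.

Let qi0 : 0 < q%:R^-1 :> R. Proof. by rewrite invr_gt0. Qed.
Let qi6 : q%:R^-1 <= 6^-1 :> R. Proof. by rewrite lef_pV2 ?posrE. Qed.
Let lp0 i : 0 < ln (pp i)%:R.
Proof. by have /andP[h _] := ln_pp i; apply: lt_le_trans h; rewrite mulr_gt0. Qed.

Lemma LL_ge0 : 0 <= LL. Proof. exact: sqrtr_ge0. Qed.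

Lemma LL_sqr : LL ^+ 2 = (1 - q%:R^-1) * w / Psi.
Proof.
rewrite sqr_sqrtr// divr_ge0 ?(ltW Psi_gt0)// mulr_ge0 ?(ltW w_gt0)//; have := qi6; lra.
Qed.

Lemma ff_ge0 i : 0 <= ff i.
Proof. by rewrite /ff divr_ge0 ?(ltW (lp0 i))// mulr_ge0 ?LL_ge0 ?pw_ge0. Qed.

Lemma gg_ge0 i : 0 <= gg i.
Proof. by rewrite /gg mulr_ge0 ?ff_ge0 ?pw_ge0. Qed.

Lemma pw_half2 i : pw (pp i)%:R (- 2^-1) * pw (pp i)%:R (- 2^-1) = (pp i)%:R^-1 :> R.
Proof. by rewrite -pwD (_ : - 2^-1 + - 2^-1 = - 1); [rewrite (pwN _ 1) pw1// pp_gt0 | lra]. Qed.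

Lemma ggE i : gg i = LL * ((pp i)%:R * ln (pp i)%:R)^-1.
Proof. by rewrite /gg /ff invfM -pw_half2; ring. Qed.

Lemma sum_gg : \sum_i gg i = LP.
Proof. by rewrite /LP /Psi mulr_sumr; apply: eq_bigr => i _; rewrite ggE. Qed.

Lemma ff_sqr i : ff i ^+ 2 = LL ^+ 2 * ((pp i)%:R * ln (pp i)%:R)^-1 / ln (pp i)%:R.
Proof. by rewrite /ff !exprMn [pw _ _ ^+ 2]expr2 pw_half2 exprVn invfM; field; rewrite !gt_eqF ?pp_gt0. Qed.

Lemma sum_ff_ln : \sum_i ff i ^+ 2 * ln (pp i)%:R = (1 - q%:R^-1) * w.
Proof.
transitivity (LL ^+ 2 * Psi).
  rewrite /Psi mulr_sumr; apply: eq_bigr => i _; rewrite ff_sqr mulfVK// gt_eqF//; exact: lp0.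
by rewrite LL_sqr mulfVK// gt_eqF// Psi_gt0.
Qed.

Lemma LP_ge0 : 0 <= LP.
Proof. by rewrite mulr_ge0 ?LL_ge0 ?(ltW Psi_gt0). Qed.

Lemma LP_sqr : LP ^+ 2 = (1 - q%:R^-1) * w * Psi.
Proof.
rewrite /LP exprMn LL_sqr expr2; have := Psi_gt0; move: Psi => P P0.
by field; rewrite !gt_eqF.
Qed.

Lemma LP_le : LP <= Num.sqrt w / 4.
Proof.
have s0 := sqrtr_ge0 w; have h0 := LP_ge0.
rewrite -(ler_pXn2r (n := 2)) ?nnegrE ?divr_ge0// expr_div_n sqr_sqrtr ?(ltW w_gt0)// LP_sqr.
have a := Psi_le; have b := Psi_gt0; have c := qi0; have d := qi6; have e := w_gt0.
have -> : 4 ^+ 2 = 16 :> R by ring.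
apply: ler_pM => //; [by rewrite mulr_ge0 ?(ltW e)//; lra | exact: ltW |].
by rewrite -[X in _ <= X]mul1r ler_wpM2r ?(ltW e)//; lra.
Qed.

Lemma pp_ge1 i : 1 <= (pp i)%:R :> R.
Proof. by rewrite ler1n prime_gt0// pp_prime. Qed.

Lemma ff_le i : ff i <= pw (pp i)%:R (- kap0).
Proof.
have p0 := pp_gt0 i; have l0 := lp0 i; have /andP[l1 _] := ln_pp i.
have P0 := Psi_gt0; have hP := Psi_ge.
rewrite -(ler_pXn2r (n := 2)) ?nnegrE ?ff_ge0 ?pw_ge0// ff_sqr pw_sqr.
have ql0 : 0 < q%:R * lv by rewrite mulr_gt0.
have hL : LL ^+ 2 <= 2 * w * (q%:R * lv).
  rewrite LL_sqr ler_pdivrMr//.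
  have h1 : 1 <= 2 * (q%:R * lv) * Psi.
    rewrite -(ler_pM2l ql0) in hP; rewrite mulrC mulfVK ?gt_eqF// in hP.
    have : 3 / q%:R <= 2^-1 :> R by rewrite ler_pdivrMr//; have := q6; lra.
    lra.
  have -> : 2 * w * (q%:R * lv) * Psi = w * (2 * (q%:R * lv) * Psi) by ring.
  have h2 : w * 1 <= w * (2 * (q%:R * lv) * Psi) by rewrite ler_wpM2l ?(ltW w_gt0).
  have h3 : (1 - q%:R^-1) * w <= 1 * w by rewrite ler_wpM2r ?(ltW w_gt0)//; have := qi0; lra.
  lra.
have h4 : LL ^+ 2 <= w * ln (pp i)%:R ^+ 2.
  apply: le_trans hL _; rewrite mulrC mulrA mulrC ler_wpM2l ?(ltW w_gt0)//.
  have q2 : 2 <= q%:R * lv.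
    have := lv_ge; have := q6 => a b.
    have : 1 * 2 <= q%:R * lv by apply: ler_pM => //; lra.
    lra.
  rewrite expr2; apply: ler_pM; rewrite ?(ltW ql0)//; lra.
apply: le_trans (_ : w / (pp i)%:R <= _).
  have -> : LL ^+ 2 / ((pp i)%:R * ln (pp i)%:R) / ln (pp i)%:R = LL ^+ 2 / ln (pp i)%:R ^+ 2 / (pp i)%:R.
    by field; rewrite !gt_eqF.
  by rewrite ler_wpM2r ?invr_ge0 ?(ltW p0)// ler_pdivrMr ?exprn_gt0.
rewrite ler_pdivrMr//; apply: le_trans w_le _.
rewrite -[X in _ <= _ * X](pw1 p0) -pwD.
have -> : - kap0 *+ 2 + 1 = q%:R / q.+1%:R.
  rewrite /kap0 -natr1; field; apply/eqP; have := q0; lra.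
by apply: ler_pw; [rewrite divr_ge0 | rewrite ltr0n vX_gt0 | rewrite ler_nat ltnW// pp_gt].
Qed.

Hypothesis y_big : q%:R <= pw (v ^ q)%:R kap0.

Let k00 : 0 < kap0. Proof. by rewrite invr_gt0 mulr_gt0 ?ltr0n. Qed.
Let k0le : kap0 <= 2^-1.
Proof. by rewrite lef_pV2 ?posrE ?mulr_gt0 ?ltr0n// -[X in X <= _]mulr1 ler_wpM2l// ler1n. Qed.

Lemma pw_pp_kap0 i : pw (pp i)%:R (- kap0) <= q%:R^-1.
Proof.
rewrite pwN lef_pV2 ?posrE ?pw_gt0//; apply: le_trans y_big _.
by apply: ler_pw; [exact: ltW | rewrite ltr0n vX_gt0 | rewrite ler_nat ltnW// pp_gt].
Qed.

Lemma ff_leq i : ff i <= q%:R^-1.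
Proof. exact: le_trans (ff_le i) (pw_pp_kap0 i). Qed.

Lemma ff2_leq i : ff i ^+ 2 <= q%:R^-1.
Proof.
have h := ff_leq i; have h0 := ff_ge0 i; have := qi6; move: h0 h; rewrite expr2; move: (ff i) (q%:R^-1) => a b; nra.
Qed.

Lemma gg_leq i : gg i <= q%:R^-1.
Proof.
apply: le_trans (ff_leq i); rewrite -[X in _ <= X]mulr1 ler_wpM2l ?ff_ge0//.
apply: pw_le1; [exact: pp_ge1 | lra].
Qed.

Local Notation F0 := (F0 ff).
Local Notation tiny := (exp (- Num.sqrt w)).

Lemma F0_gt0 : 0 < F0.
Proof. by apply: prodr_gt0 => i _; have := sqr_ge0 (ff i); lra. Qed.

Lemma rho_gt0 : 0 < rho.
Proof. by rewrite invr_gt0 mulr_gt0// mulr_gt0// exprn_gt0. Qed.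

(* The saving: [rho * w] outweighs [sum f^2 (p^rho - 1)], which is at most
   [(1 - 1/q) (1 + 1/(2q)) rho w]. *)
Lemma rankin_tiny (hh : IP -> R) : (forall i, 0 <= hh i <= 2 * gg i) ->
  pw N%:R (- rho) * \prod_i (1 + ff i ^+ 2 * pw (pp i)%:R rho + hh i * pw (pp i)%:R rho) <= F0 * tiny.
Proof.
move=> hhb; have r0 := rho_gt0.
have rl i : 0 <= rho * ln (pp i)%:R <= (4 * q%:R)^-1.
  have /andP[_ l2] := ln_pp i; rewrite mulr_ge0 ?(ltW r0) ?(ltW (lp0 i))//=.
  apply: le_trans (ler_wpM2l (ltW r0) l2) _; rewrite /rho le_eqVlt; apply/orP; left; apply/eqP.
  by field; rewrite !gt_eqF.
have q4 : (4 * q%:R)^-1 = q%:R^-1 / 4 :> R by rewrite invfM mulrC.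
have hpr i : pw (pp i)%:R rho <= 1 + rho * ln (pp i)%:R * (1 + q%:R^-1 / 2).
  have /andP[h1 h2] := rl i; rewrite q4 in h2.
  apply: le_trans (exp_le_quad h1 _) _; first by have := qi6; lra.
  rewrite lerD2l ler_wpM2l//; lra.
have hp2 i : pw (pp i)%:R rho <= 2.
  have /andP[h1 h2] := rl i; rewrite q4 in h2; apply: le_trans (hpr i) _.
  have a := qi6; have b := qi0.
  have : rho * ln (pp i)%:R * (1 + q%:R^-1 / 2) <= 1 * 1 / 1.
    rewrite mulr1 divr1; apply: le_trans (_ : (q%:R^-1 / 4) * 2 <= _); last lra.
    by apply: ler_pM => //; lra.
  lra.
have hp1 i : 1 <= pw (pp i)%:R rho by apply: pw_ge1; [exact: pp_ge1 | exact: ltW].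
have -> : pw N%:R (- rho) = exp (- (rho * w)) by rewrite /pw mulNr.
apply: le_trans (_ : exp (- (rho * w)) * (F0 * exp (\sum_i (ff i ^+ 2 * (pw (pp i)%:R rho - 1) + hh i * pw (pp i)%:R rho))) <= _).
  rewrite ler_wpM2l ?exp_ge0// exp_sum /F0 -big_split /=.
  apply: ler_prod => i _; have /andP[b1 b2] := hhb i; have f2 := sqr_ge0 (ff i).
  have c0 : 0 <= ff i ^+ 2 * pw (pp i)%:R rho by rewrite mulr_ge0 ?pw_ge0.
  have c1 : 0 <= hh i * pw (pp i)%:R rho by rewrite mulr_ge0 ?pw_ge0.
  apply/andP; split; first by lra.
  set A := ff i ^+ 2 * (pw (pp i)%:R rho - 1) + hh i * pw (pp i)%:R rho.
  have A0 : 0 <= A by rewrite /A addr_ge0// mulr_ge0// subr_ge0.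
  apply: le_trans (_ : (1 + ff i ^+ 2) * (1 + A) <= _).
    have : 0 <= ff i ^+ 2 * A by rewrite mulr_ge0.
    rewrite /A; lra.
  by rewrite ler_wpM2l ?exp_ge1D//; lra.
rewrite mulrCA ler_wpM2l ?(ltW F0_gt0)// -expD ler_exp.
have hs : \sum_i (ff i ^+ 2 * (pw (pp i)%:R rho - 1) + hh i * pw (pp i)%:R rho) <=
   rho * (1 + q%:R^-1 / 2) * ((1 - q%:R^-1) * w) + 4 * LP.
  rewrite -sum_ff_ln -sum_gg !mulr_sumr -big_split /=; apply: ler_sum => i _; apply: lerD.
    have -> : rho * (1 + q%:R^-1 / 2) * (ff i ^+ 2 * ln (pp i)%:R) = ff i ^+ 2 * (rho * ln (pp i)%:R * (1 + q%:R^-1 / 2)) by ring.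
    by rewrite ler_wpM2l ?sqr_ge0//; have := hpr i; lra.
  have /andP[b1 b2] := hhb i; have g0 := gg_ge0 i.
  have -> : 4 * gg i = (2 * gg i) * 2 by ring.
  by apply: ler_pM; rewrite ?pw_ge0.
have hq : rho * (1 + q%:R^-1 / 2) * ((1 - q%:R^-1) * w) <= rho * w * (1 - q%:R^-1 / 2).
  have -> : rho * (1 + q%:R^-1 / 2) * ((1 - q%:R^-1) * w) = rho * w * ((1 + q%:R^-1 / 2) * (1 - q%:R^-1)) by ring.
  rewrite ler_wpM2l ?mulr_ge0 ?(ltW r0) ?(ltW w_gt0)//.
  by have := qi0; move: (q%:R^-1) => a a0; nra.
have hw : 5 * Num.sqrt w <= rho * w * (q%:R^-1 / 2).
  have s0 : 0 < Num.sqrt w by rewrite sqrtr_gt0.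
  have e : rho * w * (q%:R^-1 / 2) = Num.sqrt w * (Num.sqrt w / (8 * q%:R ^+ 4 * lv)).
    have -> : Num.sqrt w * (Num.sqrt w / (8 * q%:R ^+ 4 * lv)) = (Num.sqrt w ^+ 2) / (8 * q%:R ^+ 4 * lv) by ring.
    by rewrite sqr_sqrtr ?(ltW w_gt0)// /rho; field; rewrite !gt_eqF.
  rewrite e mulrC ler_wpM2l ?(ltW s0)// ler_pdivlMr ?mulr_gt0// ?exprn_gt0//.
  by have := w_lv; lra.
have := LP_le; have := sqrtr_ge0 w; lra.
Qed.

Lemma rho_ge0 : 0 <= rho. Proof. exact: ltW rho_gt0. Qed.

Lemma FN_lower : F0 * (1 - tiny) <= FN pp N ff.
Proof.
have := FN_ge (pr := pp) pp_prime N_gt0 rho_ge0 ff.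
have := @rankin_tiny (fun=> 0) _; under [in X in X -> _]eq_bigr do rewrite mul0r addr0.
move=> /(_ _) h1 h2; apply: le_trans h2; rewrite mulrBr mulr1 lerB//; apply: h1 => i.
by rewrite lexx mulr_ge0 ?gg_ge0.
Qed.

Lemma rk_tiny (B B' : IP -> R) : (forall i, 0 <= B i <= gg i) -> (forall i, 0 <= B' i <= gg i) ->
  rk_bound pp N rho (fun i => ff i ^+ 2) B B' <= 2 * (F0 * tiny).
Proof.
move=> hB hB'; rewrite /rk_bound mulrDr.
have hp1 i : 1 <= pw (pp i)%:R rho by apply: pw_ge1; [exact: pp_ge1 | exact: rho_ge0].
have mono (C1 C2 : IP -> R) : (forall i, 0 <= C1 i <= gg i) -> (forall i, 0 <= C2 i <= gg i) ->
    pw N%:R (- rho) * \prod_i (1 + ff i ^+ 2 * pw (pp i)%:R rho + C1 i * pw (pp i)%:R rho + C2 i) <= F0 * tiny.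
  move=> h1 h2; apply: le_trans (@rankin_tiny (fun i => C1 i + C2 i) _); last first.
    move=> i; have := h1 i; have := h2 i => /andP[a b] /andP[a' b']; apply/andP; split; lra.
  rewrite ler_wpM2l ?pw_ge0//; apply: ler_prod => i _.
  have /andP[a b] := h1 i; have /andP[a' b'] := h2 i; have c := sqr_ge0 (ff i).
  have d := pw_ge0 (pp i)%:R rho; have e := hp1 i.
  have c0 : 0 <= ff i ^+ 2 * pw (pp i)%:R rho by rewrite mulr_ge0.
  have c1 : 0 <= C1 i * pw (pp i)%:R rho by rewrite mulr_ge0.
  have c2 : C2 i * 1 <= C2 i * pw (pp i)%:R rho by rewrite ler_wpM2l.
  apply/andP; split; lra.
have h1 := mono _ _ hB hB'; have h2 := mono _ _ hB' hB.
have -> : \prod_i (1 + ff i ^+ 2 * pw (pp i)%:R rho + B i + B' i * pw (pp i)%:R rho) =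
  \prod_i (1 + ff i ^+ 2 * pw (pp i)%:R rho + B' i * pw (pp i)%:R rho + B i) by apply: eq_bigr => i _; ring.
lra.
Qed.

(** Taking [b = 0] discards all pairs except those with [S] contained in [T]. *)
Lemma diag1_trunc : diag1 pp N ff = trunc_ker pp N (fun i => ff i ^+ 2) (fun=> 0) gg.
Proof.
rewrite /diag1 /trunc_ker pair_big /= [LHS]big_mkcond [RHS]big_mkcond /=.
apply: eq_bigr => -[S T] _ /=.
case: (boolP (S \subset T)) => [sub|nsub] /=; last first.
  suff -> : ker (fun i => ff i ^+ 2) (fun=> 0) gg S T = 0 by case: ifP.
  rewrite /ker; have /subsetPn[i iS iT] := nsub.
  by rewrite [X in _ * X * _](bigD1 i) /= ?inE ?iS ?iT// mul0r mulr0 mul0r.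
have eS : S :\: T = set0 by apply/eqP; rewrite setD_eq0.
have -> : (nS pp S <= N)%N && (nS pp T <= N)%N = (nS pp T <= N)%N.
  case: (boolP (nS pp T <= N)%N) => hT; rewrite ?andbF// andbT; apply: leq_trans hT.
  apply: dvdn_leq; first exact: nS_gt0 pp_prime _.
  by rewrite [X in (_ %| X)%N](nSID pp T S) (setIidPr sub) dvdn_mulr.
case: ifP => // _; rewrite /ker eS big_set0 mulr1 (setIidPl sub).
rewrite (fSID ff T S) (setIidPr sub) (pw_nS pp_prime).
have -> : \prod_(i in T :\: S) gg i = fS ff (T :\: S) * \prod_(i in T :\: S) pw (pp i)%:R (- 2^-1).
  by rewrite -big_split.
have -> : \prod_(i in S) ff i ^+ 2 = fS ff S * fS ff S.
  by rewrite -big_split; apply: eq_bigr => i _; rewrite expr2.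
ring.
Qed.

(** Divided by [1 + f^2], each Euler factor is [1 + u] with [u >= (1 - 1/q) gg], and
    [1 + u >= exp ((1 - 1/q) u)]; the two losses combine to [2/q]. *)
Lemma diag1_ge : F0 * (exp ((1 - 2 / q%:R) * LP) - 2 * tiny) <= diag1 pp N ff.
Proof.
rewrite diag1_trunc.
have h0 i : `|ff i ^+ 2| <= ff i ^+ 2 by rewrite ger0_norm ?sqr_ge0.
have h1 (i : IP) : `|0 : R| <= 0 by rewrite normr0.
have h2 i : `|gg i| <= gg i by rewrite ger0_norm ?gg_ge0.
have := rankin_ker pp_prime N_gt0 rho_ge0 h0 h1 h2.
have : rk_bound pp N rho (fun i => ff i ^+ 2) (fun=> 0) gg <= 2 * (F0 * tiny).
  by apply: rk_tiny => i; rewrite gg_ge0 lexx.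
move=> a b; have := le_trans b a; rewrite ler_norml => /andP[c _]; clear a b h0 h1 h2.
suff d : F0 * exp ((1 - 2 / q%:R) * LP) <= \prod_i (1 + ff i ^+ 2 + 0 + gg i) by lra.
rewrite -sum_gg mulr_sumr exp_sum /F0 -big_split /=; apply: ler_prod => i _.
have f2 := sqr_ge0 (ff i); have g0 := gg_ge0 i; have fq := ff2_leq i; have gq := gg_leq i.
have c0 := qi0; have c6 := qi6.
apply/andP; split; first by rewrite mulr_ge0 ?exp_ge0//; lra.
have e1 : 1 + ff i ^+ 2 + 0 + gg i = (1 + ff i ^+ 2) * (1 + gg i / (1 + ff i ^+ 2)).
  by field; apply/eqP; lra.
rewrite e1 ler_wpM2l//; first lra.
set u := gg i / (1 + ff i ^+ 2).
have den : 0 < 1 + ff i ^+ 2 by lra.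
have u0 : 0 <= u by rewrite divr_ge0//; lra.
have ug : u <= gg i by rewrite ler_pdivrMr//; nra.
have ul : (1 - q%:R^-1) * gg i <= u.
  by rewrite ler_pdivlMr//; apply: lin_damp.
apply: le_trans (exp_le_lin u0 (le_trans ug gq) c0 _); last lra.
rewrite ler_exp; apply: le_trans (_ : (1 - q%:R^-1) * ((1 - q%:R^-1) * gg i) <= _).
  by rewrite mulrA ler_wpM2r//; exact: lin_sqr.
by rewrite ler_wpM2l//; lra.
Qed.

(** The condition on [kap] gives [p^(-kap) >= 1 - 1/q] on the whole range; dividing by [1 + f^2]
    costs the other [1/q]. *)
Lemma PiA_le (kap : R) : 0 < kap -> kap * (q%:R ^+ 3 * lv) <= 1 ->
  PiA pp ff kap <= F0 * exp (- (2 * ((1 - 2 / q%:R) * LP))).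
Proof.
move=> k0 hk; rewrite -sum_gg !mulr_sumr -sumrN exp_sum /PiA /F0 -big_split /=.
apply: ler_prod => i _.
have f2 := sqr_ge0 (ff i); have g0 := gg_ge0 i; have fq := ff2_leq i; have gq := gg_leq i.
have c0 := qi0; have c6 := qi6; have den : 0 < 1 + ff i ^+ 2 by lra.
have eg : ff i * pw (pp i)%:R (- 2^-1 - kap) = gg i * pw (pp i)%:R (- kap) by rewrite /gg pwD mulrA.
rewrite eg; set P := pw (pp i)%:R (- kap).
have P0 : 0 <= P by exact: pw_ge0.
have P1 : P <= 1 by apply: pw_le1; [exact: pp_ge1 | lra].
have Pq : 1 - q%:R^-1 <= P.
  apply: le_trans (exp_ge1D _); rewrite lerD2l mulNr lerN2.
  have /andP[_ l2] := ln_pp i; apply: le_trans (ler_wpM2l (ltW k0) l2) _.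
  rewrite -[X in _ <= X]mul1r ler_pdivlMr//; lra.
apply/andP; split.
  have : gg i * P <= gg i * 1 by rewrite ler_wpM2l.
  lra.
apply: le_trans (_ : (1 + ff i ^+ 2) * (1 - 2 * ((1 - 2 / q%:R) * gg i)) <= _); last first.
  by rewrite ler_wpM2l ?(ltW den)//; apply: exp_ge1D.
have h : (1 + ff i ^+ 2) * ((1 - 2 / q%:R) * gg i) <= gg i * P.
  rewrite [X in _ <= X]mulrC mulrA ler_wpM2r//.
  apply: le_trans (_ : (1 + q%:R^-1) * (1 - 2 / q%:R) <= _); first by rewrite ler_wpM2r//; lra.
  apply: le_trans Pq; exact: lin_12.
lra.
Qed.

Lemma LP_sqr_ge : q%:R * lv <= (1 + 2 / q%:R) * ln w -> 0 < ln w ->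
  (1 - 6 / q%:R) * (w / ln w) <= LP ^+ 2.
Proof.
move=> h lw0; rewrite LP_sqr.
have c0 := qi0; have c6 := qi6; have P0 := Psi_gt0.
have hP : (1 - 5 / q%:R) / ln w <= Psi.
  apply: le_trans Psi_ge; rewrite ler_pdivrMr// mulrAC ler_pdivlMr ?mulr_gt0//.
  apply: le_trans (_ : (1 - 5 / q%:R) * ((1 + 2 / q%:R) * ln w) <= _).
    by rewrite ler_wpM2l//; lra.
  by rewrite mulrA ler_wpM2r ?(ltW lw0)//; exact: lin_52.
apply: le_trans (_ : (1 - q%:R^-1) * w * ((1 - 5 / q%:R) / ln w) <= _); last first.
  by rewrite ler_wpM2l// mulr_ge0 ?(ltW w_gt0)//; lra.
have -> : (1 - q%:R^-1) * w * ((1 - 5 / q%:R) / ln w) = ((1 - q%:R^-1) * (1 - 5 / q%:R)) * (w / ln w) by ring.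
by rewrite ler_wpM2r ?divr_ge0 ?(ltW w_gt0) ?(ltW lw0)//; exact: lin_15.
Qed.

End PrimeRange.

(** * The choice of the scales *)

Lemma exp_beats (C c : R) (n : nat) : 0 < c -> exists B : R, forall x : R, B <= x -> C * (x + 1) ^+ n <= exp (c * x).
Proof.
move=> c0.
have [C' [C0 CC]] : exists C' : R, 0 <= C' /\ C <= C' by exists `|C|; rewrite normr_ge0 ler_norm.
have [m [em m0]] : exists m : R, m = n.+1%:R /\ 0 < m by exists n.+1%:R; rewrite ltr0n.
exists (1 + C' * 2 ^+ n * (m / c) ^+ n.+1) => x hx.
have K0 : 0 <= C' * 2 ^+ n * (m / c) ^+ n.+1 by rewrite !mulr_ge0 ?exprn_ge0 ?divr_ge0 ?(ltW m0) ?(ltW c0).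
have x1 : 1 <= x by lra.
apply: le_trans (_ : C' * 2 ^+ n * x ^+ n <= _).
  apply: le_trans (_ : C' * (x + 1) ^+ n <= _); first by rewrite ler_wpM2r// exprn_ge0//; lra.
  by rewrite -mulrA -exprMn ler_wpM2l//; apply: lerXn2r; rewrite ?nnegrE; lra.
have e : exp (c * x) = exp (c * x / m) ^+ n.+1.
  by rewrite -expMn -em; congr exp; field; rewrite gt_eqF.
have h1 : (c * x / m) ^+ n.+1 <= exp (c * x / m) ^+ n.+1.
  rewrite ler_pXn2r ?nnegrE ?exp_ge0 ?divr_ge0 ?mulr_ge0 ?(ltW c0) ?(ltW m0)//; last lra.
  by have := exp_ge1D (c * x / m); lra.
rewrite e; apply: le_trans h1.
have -> : (c * x / m) ^+ n.+1 = x ^+ n * (x / (m / c) ^+ n.+1).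
  have -> : c * x / m = x / (m / c) by field; rewrite !gt_eqF.
  by rewrite expr_div_n [x ^+ n.+1]exprSr mulrA.
rewrite mulrC ler_wpM2l ?exprn_ge0//; first lra.
rewrite ler_pdivlMr ?exprn_gt0 ?divr_gt0//; lra.
Qed.

Lemma exp_ge_id (x : R) : x <= exp x.
Proof. by have := exp_ge1D x; lra. Qed.

Section Scales.
Variable q : nat.
Hypothesis q_ge : (20 <= q)%N.
Let q0 : 0 < q%:R :> R. Proof. by rewrite ltr0n (leq_trans _ q_ge). Qed.
Let q20 : 20 <= q%:R :> R. Proof. by rewrite ler_nat. Qed.

Definition Nz (z : nat) : nat := (z ^ (2 * q - 1))%N.
Definition wz (z : nat) : R := ln (Nz z)%:R.
(** Just above [w^((q+1)/q^2)], which makes [v^q] at least [w^(1 + 1/q)]. *)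
Definition vz (z : nat) : nat := (Num.truncn (pw (wz z) (q.+1%:R / q%:R ^+ 2))).+1.

Definition good (z : nat) : Prop :=
  [/\ (1 < z)%N, (1 < vz z)%N, 9 * q%:R <= lv (vz z), 0 < wz z & wz z <= pw (vz z ^ q)%:R (q%:R / q.+1%:R)] /\
  [/\ 40 * q%:R ^+ 4 * lv (vz z) <= Num.sqrt (wz z), q%:R <= pw (vz z ^ q)%:R (kap0 q),
      q%:R * lv (vz z) <= (1 + 2 / q%:R) * ln (wz z), 0 < ln (wz z) & q%:R ^+ 3 * lv (vz z) <= ln z%:R] /\
  wz z <= (vz z ^ q)%:R.

Lemma wzE z : (0 < z)%N -> wz z = (2 * q%:R - 1) * ln z%:R.
Proof.
move=> z0; rewrite /wz /Nz natrX lnXn ?ltr0n// natrB ?natrM//.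
by rewrite muln_gt0 (leq_trans _ q_ge).
Qed.

Lemma good_eventually : exists B : R, forall z : nat, (1 < z)%N -> B <= ln (wz z) -> good z.
Proof.
have [B1 h1] := @exp_beats (40 * q%:R ^+ 4) 2^-1 1 ltac:(lra).
have [B2 h2] := @exp_beats (q%:R ^+ 3 * (2 * q%:R - 1)) 1 1 ltac:(lra).
exists (`|B1| + `|B2| + 9 * q%:R ^+ 2 + 4 * q%:R ^+ 2 + 1) => z z1 hu.
set u := ln (wz z) in hu.
have b1 := ler_norm B1; have b2 := ler_norm B2; have nb1 := normr_ge0 B1; have nb2 := normr_ge0 B2.
have qq : 400 <= q%:R ^+ 2 :> R by have := q20; nra.
have u0 : 0 < u by lra.
have lz0 : 0 < ln z%:R :> R by apply: ln_gt0; rewrite ltr1n.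
have wE := wzE (ltnW z1).
have w0 : 0 < wz z by rewrite wE mulr_gt0//; have := q20; lra.
have ewu : exp u = wz z by rewrite /u exp_ln0.
set ee : R := q.+1%:R / q%:R ^+ 2.
have eeE : ee = (1 + q%:R^-1) / q%:R.
  by rewrite /ee -natr1; field; rewrite gt_eqF.
have qi0 : 0 < q%:R^-1 :> R by rewrite invr_gt0.
have ee0 : 0 < ee by rewrite /ee divr_gt0 ?exprn_gt0// ltr0n.
have vlow : pw (wz z) ee < (vz z)%:R by exact: truncnS_gt.
have p1 : 1 <= pw (wz z) ee.
  by rewrite /pw exp_ge1 // mulr_ge0// ltW.
have vup : (vz z)%:R <= 2 * pw (wz z) ee.
  rewrite /vz -natr1.
  have : (Num.truncn (pw (wz z) ee))%:R <= pw (wz z) ee by rewrite truncn_le ?pw_ge0.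
  lra.
have vp : 0 < (vz z)%:R :> R by apply: lt_trans vlow; exact: pw_gt0.
have lvl : ee * u <= lv (vz z).
  by rewrite /lv -[X in X <= _]ln_exp0 ler_ln ?exp_gt0// ltW.
have l2 : ln 2 <= 1 :> R by apply: le_trans (ln_leB1 _) _; lra.
have lvu : lv (vz z) <= ee * u + 1.
  rewrite /lv; apply: le_trans (_ : ln (2 * pw (wz z) ee) <= _).
    by rewrite ler_ln ?mulr_gt0 ?pw_gt0.
  by rewrite lnM ?pw_gt0// ln_pw -/u; lra.
have eu1 : q%:R * (ee * u) = (1 + q%:R^-1) * u by rewrite eeE; field; rewrite gt_eqF.
have qi : q%:R^-1 <= 20^-1 :> R by rewrite lef_pV2 ?posrE.
have qu : q%:R ^+ 2 * q%:R^-1 = q%:R :> R by field; rewrite gt_eqF.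
have uq : 9 * q%:R <= u / q%:R.
  by rewrite ler_pdivlMr//; lra.
have h9 : 9 * q%:R <= lv (vz z).
  apply: le_trans uq _; apply: le_trans lvl; rewrite eeE mulrAC ler_wpM2r ?(ltW qi0)//; nra.
have qlv : q%:R * lv (vz z) <= (1 + 2 / q%:R) * u.
  have : q%:R * lv (vz z) <= q%:R * (ee * u + 1) by rewrite ler_wpM2l// ltW.
  rewrite mulrDr eu1 mulr1 => h; apply: le_trans h _.
  have : q%:R <= q%:R^-1 * u by rewrite mulrC; apply: le_trans uq; have := q20; lra.
  lra.
have lvu2 : lv (vz z) <= u.
  have : 2 * lv (vz z) <= q%:R * lv (vz z) by rewrite ler_wpM2r//; have := q20; lra.
  have : 2 / q%:R * u <= 1 * u by rewrite ler_wpM2r ?(ltW u0)//; lra.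
  lra.
have vw : wz z <= pw (vz z ^ q)%:R (q%:R / q.+1%:R).
  have -> : pw (vz z ^ q)%:R (q%:R / q.+1%:R) = exp (q%:R / q.+1%:R * (q%:R * lv (vz z))).
    by rewrite /pw natrX lnXn.
  rewrite -ewu ler_exp.
  have q1 : 0 < q.+1%:R :> R by rewrite ltr0n.
  apply: le_trans (_ : q%:R / q.+1%:R * (q%:R * (ee * u)) <= _).
    rewrite /ee -natr1 le_eqVlt; apply/orP; left; apply/eqP; field; apply/andP; split; apply/eqP; have := q0; lra.
  by rewrite ler_wpM2l ?divr_ge0 ?(ltW q0) ?(ltW q1)// ler_wpM2l ?(ltW q0).
have vw1 : wz z <= (vz z ^ q)%:R.
  have vq0 : 0 < (vz z ^ q)%:R :> R by rewrite natrX exprn_gt0.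
  rewrite -ewu -[X in _ <= X](exp_ln0 vq0) ler_exp natrX lnXn//.
  apply: le_trans (_ : q%:R * (ee * u) <= _); last by rewrite ler_wpM2l ?(ltW q0).
  by rewrite eu1; nra.
split; [split=> // | split; [split=> // | done]].
- by rewrite -(ltr_nat R); apply: le_lt_trans vlow.
- apply: le_trans (_ : 40 * q%:R ^+ 4 * u <= _); first by rewrite ler_wpM2l// mulr_ge0// exprn_ge0// ltW.
  rewrite sqrt_pw// /pw -/u; apply: le_trans (h1 u _); last lra.
  by rewrite expr1 ler_wpM2l// ?mulr_ge0 ?exprn_ge0 ?(ltW q0)//; lra.
- have vq0 : 0 < (vz z ^ q)%:R :> R by rewrite natrX exprn_gt0.
  have k0 : 0 < kap0 q by rewrite invr_gt0 mulr_gt0 ?ltr0n.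
  apply: le_trans (_ : pw (wz z) (kap0 q) <= _); last by apply: ler_pw => //; exact: ltW.
  rewrite /pw -/u; apply: le_trans (exp_ge_id _).
  rewrite /kap0 mulrC ler_pdivlMr ?mulr_gt0 ?ltr0n// -natr1.
  have := q20; nra.
- apply: le_trans (_ : q%:R ^+ 3 * u <= _); first by rewrite ler_wpM2l// exprn_ge0// ltW.
  have d0 : 0 < 2 * q%:R - 1 :> R by have := q20; lra.
  rewrite -(ler_pM2l d0) -wE -ewu; apply: le_trans (_ : q%:R ^+ 3 * (2 * q%:R - 1) * (u + 1) ^+ 1 <= _).
    rewrite expr1 mulrCA mulrA ler_wpM2l//; last lra.
    by rewrite mulr_ge0 ?exprn_ge0 ?(ltW q0)// ltW.
  by rewrite -[X in exp X]mul1r; apply: h2; lra.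
Qed.

End Scales.

(** * Large values *)

Section Core.
Variables (alpha beta : R) (q z : nat).
Hypothesis alpha_gt0 : 0 < alpha.
Hypothesis q_ge : (20 <= q)%N.
Hypothesis gz : good q z.
Definition xz : R := ln z%:R.
Local Notation x := xz.
Definition Mz : nat := (z ^ (12 * q))%N.
Definition Xz : nat := (z ^ (17 * q + 1))%N.
Local Notation N := (Nz q z).
Local Notation v := (vz q z).
Local Notation w := (wz q z).
Local Notation f := (@ff v q N).
Local Notation pr := (@pp v q).
Local Notation F0 := (F0 f).
Local Notation FN := (FN pr N f).

Lemma z_gt1 : (1 < z)%N. Proof. by case: gz => -[]. Qed.
Lemma v_gt1 : (1 < v)%N. Proof. by case: gz => -[]. Qed.
Lemma v_lv : 9 * q%:R <= lv v. Proof. by case: gz => -[]. Qed.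
Lemma w_gt0 : 0 < w. Proof. by case: gz => -[]. Qed.
Lemma w_pw : w <= pw (v ^ q)%:R (q%:R / q.+1%:R). Proof. by case: gz => -[]. Qed.
Lemma w_sqrt : 40 * q%:R ^+ 4 * lv v <= Num.sqrt w. Proof. by case: gz => _ [[]]. Qed.
Lemma v_kap : q%:R <= pw (v ^ q)%:R (kap0 q). Proof. by case: gz => _ [[]]. Qed.
Lemma q_lv : q%:R * lv v <= (1 + 2 / q%:R) * ln w. Proof. by case: gz => _ [[]]. Qed.
Lemma lnw_gt0 : 0 < ln w. Proof. by case: gz => _ [[]]. Qed.
Lemma x_lv : q%:R ^+ 3 * lv v <= x. Proof. by case: gz => _ [[]]. Qed.
Lemma w_vq : w <= (v ^ q)%:R. Proof. by case: gz => _ []. Qed.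

Lemma q_gt5 : (5 < q)%N. Proof. exact: leq_trans q_ge. Qed.
Lemma q_ge20 : 20 <= q%:R :> R. Proof. by rewrite ler_nat. Qed.
Lemma x_gt0 : 0 < x. Proof. by apply: ln_gt0; rewrite ltr1n z_gt1. Qed.

Lemma zXE n : (z ^ n)%:R = exp (n%:R * x) :> R.
Proof. by rewrite natrX expMn /xz exp_ln0// ltr0n (ltnW z_gt1). Qed.

Lemma zX_gt0 n : (0 < z ^ n)%N. Proof. by rewrite expn_gt0 (ltnW z_gt1). Qed.

Lemma NzE : N%:R = exp ((2 * q%:R - 1) * x).
Proof. by rewrite zXE natrB ?natrM// muln_gt0 (leq_trans _ q_ge). Qed.

Lemma MzE : Mz%:R = exp (12 * q%:R * x). Proof. by rewrite zXE natrM. Qed.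
Lemma XzE : Xz%:R = exp ((17 * q%:R + 1) * x). Proof. by rewrite zXE natrD natrM. Qed.

Lemma tiny_le : exp (- Num.sqrt w) <= 16^-1.
Proof.
have h : 16 <= Num.sqrt w.
  apply: le_trans w_sqrt; have h1 := v_lv; have h2 := q_ge20.
  have h3 : 1 <= q%:R ^+ 4 :> R by rewrite exprn_ege1//; lra.
  have : 1 * 1 <= q%:R ^+ 4 * lv v by apply: ler_pM => //; lra.
  rewrite -mulrA; lra.
rewrite expN lef_pV2 ?posrE ?exp_gt0//; apply: le_trans h (exp_ge_id _).
Qed.

Lemma F0_pos : 0 < F0. Proof. exact: F0_gt0. Qed.
Lemma f_pos i : 0 <= f i.
Proof. exact: (ff_ge0 v_gt1 q_gt5 v_lv N i). Qed.

Lemma FN_bounds : F0 / 2 <= FN /\ FN <= F0.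
Proof.
have Fp := F0_pos; split; last exact: FN_le.
have h := FN_lower v_gt1 q_gt5 v_lv (zX_gt0 _) w_gt0 w_sqrt.
apply: le_trans h; rewrite ler_wpM2l ?(ltW Fp)//; have := tiny_le; lra.
Qed.

Definition dz : R := exp (- (11 * q%:R * x)).
Hypothesis x_ge26 : 26 <= x.
Hypothesis big_al : 16 / alpha < exp x.
Hypothesis u_res : 16 * exp (kap0 q / (2 * alpha)) / ((1 - exp (- (kap0 q * PI / alpha))) * kap0 q) <= ln w.

Lemma exp_le_x (a b : R) : a + b * q%:R + 1 <= 0 -> exp ((a + b * q%:R) * x) <= exp (- x).
Proof. by move=> h; rewrite ler_exp; have := x_gt0; nra. Qed.

Lemma pow2_exp (n : nat) : 2 ^+ n <= exp n%:R :> R.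
Proof.
have h : 2 <= exp 1 by apply: le_trans (exp_ge1D 1); lra.
by rewrite -[n%:R]mulr1 expMn; apply: lerXn2r; rewrite ?nnegrE ?exp_ge0.
Qed.

Lemma big26 : 2 ^+ 26 <= exp x.
Proof. by apply: le_trans (pow2_exp _) _; rewrite ler_exp. Qed.

Lemma dz_gt0 : 0 < dz. Proof. exact: exp_gt0. Qed.

Lemma MdE : Mz%:R * dz = exp (q%:R * x).
Proof. by rewrite MzE /dz -expD; congr exp; ring. Qed.

Lemma farE : (2 / (Mz%:R * dz)) ^+ 24 = 2 ^+ 24 * exp (- (24 * q%:R * x)).
Proof. by rewrite MdE exprMn exprVn -expMn -expN; congr (_ * exp _); ring. Qed.

Lemma dz_exp : dz <= exp (- x).
Proof.
by rewrite /dz ler_exp lerN2; have := q_ge20; have := x_gt0; nra.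
Qed.

Lemma dz_le : dz <= 2^-1.
Proof.
apply: le_trans dz_exp _; rewrite expN lef_pV2 ?posrE ?exp_gt0//; apply: le_trans big26.
by rewrite exprS ler_peMr// exprn_ege1//; lra.
Qed.

Lemma dz_small : 4 * dz / alpha <= 2^-1.
Proof.
have h := dz_exp; have ha := big_al; rewrite ltr_pdivrMr// in ha.
rewrite ler_pdivrMr//; apply: le_trans (ler_wpM2l _ h) _ => //.
by rewrite expN ler_pdivrMr ?exp_gt0//; lra.
Qed.

Lemma dz_poly (a b : R) : a + b * q%:R <= 11 * q%:R - 1 -> 16 * dz / alpha * exp ((a + b * q%:R) * x) < 1.
Proof.
move=> h; have ha := big_al; rewrite ltr_pdivrMr// in ha.
have -> : 16 * dz / alpha * exp ((a + b * q%:R) * x) = 16 * (dz * exp ((a + b * q%:R) * x)) / alpha by ring.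
rewrite ltr_pdivrMr// mul1r.
have : dz * exp ((a + b * q%:R) * x) <= exp (- x).
  by rewrite /dz -expD ler_exp; have := x_gt0; nra.
rewrite expN => h2; have : 16 / exp x < alpha by rewrite ltr_pdivrMr ?exp_gt0// mulrC.
lra.
Qed.

(** The far part gains [z^(24q)] against [N]. In the near part all primes exceed [w], and
    [w^(kap0/2) >= (kap0/2) ln w] together with [u_res] makes it small. *)
Lemma resonator_half (r : {set (IP v q)} -> R) (c0 : nat) : (forall S, `|r S| = fS f S) ->
  let a := Av Mz 24 (fun l => nrm (resonator pr N r (alpha * l%:R + beta)) ^+ 2) c0 in
  FN / 2 <= a /\ a <= 3 / 2 * FN.
Proof.
move=> hr a.
have k0 : 0 < kap0 q by rewrite invr_gt0 mulr_gt0 ?ltr0n.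
have y1 : 1 <= (v ^ q)%:R :> R by rewrite ler1n expn_gt0 (ltnW v_gt1).
have yl i : (v ^ q)%:R <= (pr i)%:R :> R by rewrite ler_nat ltnW// pp_gt.
have [J hJ] : exists J : nat, alpha * ln N%:R + 1 <= 6 * J%:R.
  exists (Num.truncn (alpha * ln N%:R + 1)).+1; have := truncnS_gt (alpha * ln N%:R + 1).
  have : 0 <= (Num.truncn (alpha * ln N%:R + 1)).+1%:R :> R by rewrite ler0n.
  move: (_%:R) => t; lra.
have dN : 8 * dz / alpha * N%:R * N%:R ^+ 2 < 1.
  have := @dz_poly (-3) 6; have hq := q_ge20 => /(_ ltac:(lra)) h; apply: le_lt_trans h.
  have -> : 8 * dz / alpha * N%:R * N%:R ^+ 2 = 8 * dz / alpha * exp ((-3 + 6 * q%:R) * x).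
    by rewrite -mulrA -exprS NzE -expMn; congr (_ * exp _); ring.
  have d0 := dz_gt0.
  by rewrite ler_wpM2r ?exp_ge0// ler_wpM2r ?invr_ge0 ?(ltW alpha_gt0)// ler_wpM2r ?(ltW d0)//; lra.
have fl i := ff_le v_gt1 q_gt5 v_lv w_gt0 w_pw i.
have h := @resonator_mean _ pr (@pp_prime v q) (@pp_inj v q) N (zX_gt0 _) f f_pos alpha beta dz alpha_gt0 dz_gt0
  (v ^ q)%:R (kap0 q) y1 yl k0 fl Mz 24 J (zX_gt0 _) dz_le hJ dz_small dN r c0 hr.
have FN0 : 0 <= FN by have [] := FN_bounds; have := F0_pos; lra.
suff hs : (2 / (Mz%:R * dz)) ^+ 24 * N%:R + pw (v ^ q)%:R (- (kap0 q / 2)) * exp (kap0 q / (2 * alpha)) *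
        (2 / (1 - exp (- (kap0 q * PI / alpha)))) <= 2^-1.
  have := le_trans h (ler_wpM2r FN0 hs); rewrite -/a ler_norml => /andP[h1 h2]; split; lra.
have p1 : (2 / (Mz%:R * dz)) ^+ 24 * N%:R <= 4^-1.
  rewrite farE NzE -(mulrA (2 ^+ 24)) -expD.
  have -> : - (24 * q%:R * x) + (2 * q%:R - 1) * x = (-1 + -22 * q%:R) * x by ring.
  apply: le_trans (ler_wpM2l _ (exp_le_x _)) _; first by rewrite exprn_ge0.
    by have := q_ge20; lra.
  rewrite expN ler_pdivrMr ?exp_gt0// mulrC ler_pdivlMr//; apply: le_trans big26.
  by rewrite (exprD _ 24 2) (_ : 2 ^+ 2 = 4 :> R); [rewrite lexx | ring].
have q2 : 0 < 1 - exp (- (kap0 q * PI / alpha)).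
  by rewrite subr_gt0 -exp00 ltr_exp oppr_lt0 divr_gt0// mulr_gt0// PI_gt0.
have p2 : pw (v ^ q)%:R (- (kap0 q / 2)) * exp (kap0 q / (2 * alpha)) * (2 / (1 - exp (- (kap0 q * PI / alpha)))) <= 4^-1.
  have ur := u_res; set C1 := exp (kap0 q / (2 * alpha)) in ur *; set D := 1 - exp (- (kap0 q * PI / alpha)) in ur q2 *.
  have C10 : 0 < C1 by exact: exp_gt0.
  have k2 : 0 < kap0 q / 2 by lra.
  have lw0 := lnw_gt0.
  have hpw : pw (v ^ q)%:R (- (kap0 q / 2)) <= (kap0 q / 2 * ln w)^-1.
    rewrite pwN lef_pV2 ?posrE ?pw_gt0//; last exact: mulr_gt0.
    apply: le_trans (_ : pw w (kap0 q / 2) <= _); first exact: exp_ge_id.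
    by apply: ler_pw; [exact: ltW | exact: w_gt0 | exact: w_vq].
  have c0' : 0 <= C1 * (2 / D) by rewrite mulr_ge0 ?divr_ge0 ?(ltW C10) ?(ltW q2).
  rewrite -mulrA; apply: le_trans (ler_wpM2r c0' hpw) _.
  rewrite mulrC ler_pdivrMr; last exact: mulr_gt0.
  move: ur; rewrite ler_pdivrMr ?mulr_gt0// => h3.
  have -> : C1 * (2 / D) = C1 * 2 / D by ring.
  rewrite ler_pdivrMr//; lra.
lra.
Qed.

Variable c0 : nat.
Hypothesis c0_le : (c0 <= Mz)%N.

(** [25 M] covers [c0 + 24 M]. The square of [t] is at most a constant times [z^(24q)], while
    [X^(3/2)] exceeds [z^(25q)]. *)
Lemma eta_err (l X' : nat) : (l <= c0 + 24 * Mz)%N -> (Xz <= X')%N ->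
  nrm (eta (alpha * l%:R + beta) - etaV (alpha * l%:R + beta) X') <= (1 + 25 * alpha + `|beta|) ^+ 2 * exp (- x).
Proof.
move=> hl hX; have X0 : (0 < X')%N by apply: leq_trans hX; exact: zX_gt0.
apply: le_trans (eta_approx _ X0) _.
have a0 := alpha_gt0; have M0 : 1 <= Mz%:R :> R by rewrite ler1n zX_gt0.
have lM : l%:R <= 25 * Mz%:R :> R.
  rewrite -natrM ler_nat; apply: leq_trans hl _; rewrite -[25%N]/(1 + 24)%N mulnDl mul1n leq_add2r //.
have ht : 1 + `|alpha * l%:R + beta| <= (1 + 25 * alpha + `|beta|) * Mz%:R.
  apply: le_trans (_ : 1 + (alpha * l%:R + `|beta|) <= _).
    rewrite lerD2l; apply: le_trans (ler_normD _ _) _; rewrite lerD2r ger0_norm// mulr_ge0 ?ler0n// ltW//.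
  have : alpha * l%:R <= alpha * (25 * Mz%:R) by rewrite ler_wpM2l// ltW.
  have : `|beta| * 1 <= `|beta| * Mz%:R by rewrite ler_wpM2l.
  lra.
have ht2 : (1 + `|alpha * l%:R + beta|) ^+ 2 <= (1 + 25 * alpha + `|beta|) ^+ 2 * exp (24 * q%:R * x).
  have -> : exp (24 * q%:R * x) = Mz%:R ^+ 2 by rewrite MzE -expMn; congr exp; ring.
  have b0 : 0 <= `|alpha * l%:R + beta| by [].
  have b1 : 0 <= 1 + `|alpha * l%:R + beta| by lra.
  rewrite -exprMn ler_pXn2r ?nnegrE//; exact: le_trans b1 ht.
have hden : exp (25 * q%:R * x) <= Num.sqrt X'%:R * X'%:R.
  have XX : Xz%:R <= X'%:R :> R by rewrite ler_nat.
  have Xp : 0 < Xz%:R :> R by rewrite ltr0n zX_gt0.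
  apply: le_trans (_ : Num.sqrt Xz%:R * Xz%:R <= _).
    rewrite sqrt_pw// XzE /pw ln_exp0 -expD ler_exp.
    have := x_gt0; have := q_ge20; nra.
  by apply: ler_pM; rewrite ?sqrtr_ge0// ler_sqrt// (lt_le_trans Xp).
have dp : 0 < Num.sqrt X'%:R * X'%:R :> R by apply: lt_le_trans hden; exact: exp_gt0.
rewrite ler_pdivrMr//; apply: le_trans ht2 _; rewrite -[X in _ <= X]mulrA ler_wpM2l ?sqr_ge0//.
apply: le_trans (_ : exp (- x) * exp (25 * q%:R * x) <= _); last by rewrite ler_wpM2l ?exp_ge0.
by rewrite -expD ler_exp; have := x_gt0; have := q_ge20; nra.
Qed.

End Core.

(** [LP^2] is at least of order [w / ln w], so [LP] beats every multiple of [ln w]; hence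
    [exp (LP / q)] absorbs all constants and powers of [ln z]. *)
Lemma LP_ge_log q (C : R) : (20 <= q)%N -> 0 <= C -> exists B : R, forall z : nat, (1 < z)%N -> B <= ln (wz q z) ->
  C * (ln (wz q z) + 1) <= LP (vz q z) q (Nz q z).
Proof.
move=> q_ge C0; have [B1 h1] := good_eventually q_ge.
have [B2 h2] := @exp_beats (2 * C ^+ 2) 1 3 ltr01.
exists (`|B1| + `|B2|) => z z1 hu.
have b1 := ler_norm B1; have b2 := ler_norm B2; have nb1 := normr_ge0 B1; have nb2 := normr_ge0 B2.
have g : good q z by apply: h1 => //; lra.
have lw0 := lnw_gt0 g; have w0 := w_gt0 g.
have hL := LP_sqr_ge (v_gt1 g) (q_gt5 q_ge) (v_lv g) w0 (q_lv g) lw0.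
have L0 := LP_ge0 (v_gt1 g) (q_gt5 q_ge) (v_lv g) (Nz q z).
set u := ln (wz q z) in hu lw0 *.
have h3 : 2 * C ^+ 2 * (u + 1) ^+ 3 <= wz q z.
  have := h2 u; rewrite mul1r /u exp_ln0// => h; apply: h; rewrite -/u; lra.
have u1 : 0 < u + 1 by lra.
have uC : 0 <= C * (u + 1) by rewrite mulr_ge0// ltW.
rewrite -(ler_pXn2r (n := 2)) ?nnegrE//.
apply: le_trans hL; rewrite -/u exprMn.
have q6 : 6 / q%:R <= 2^-1 :> R.
  have q20 := q_ge20 q_ge; rewrite ler_pdivrMr; lra.
apply: le_trans (_ : 2^-1 * (wz q z / u) <= _); last first.
  by rewrite ler_wpM2r ?divr_ge0 ?(ltW w0) ?(ltW lw0)//; lra.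
rewrite [X in _ <= X]mulrA ler_pdivlMr//.
have c2 : 0 <= C ^+ 2 * (u + 1) ^+ 2 by rewrite mulr_ge0 ?sqr_ge0.
have : C ^+ 2 * (u + 1) ^+ 2 * u <= C ^+ 2 * (u + 1) ^+ 2 * (u + 1) by rewrite ler_wpM2l//; lra.
have -> : C ^+ 2 * (u + 1) ^+ 2 * (u + 1) = C ^+ 2 * (u + 1) ^+ 3 by ring.
lra.
Qed.

Lemma lnz_ge q (C : R) : (20 <= q)%N -> exists B : R, forall z : nat, (1 < z)%N -> B <= ln (wz q z) -> C <= xz z.
Proof.
move=> q_ge; exists (`|C| * (2 * q%:R)) => z z1 hu.
have q20 := q_ge20 q_ge; have wE := wzE q_ge (ltnW z1).
have x0 : 0 < xz z by apply: ln_gt0; rewrite ltr1n.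
have w0 : 0 < wz q z by rewrite wE mulr_gt0//; lra.
have h : ln (wz q z) <= wz q z by have := ln_leB1 w0; lra.
have h2 : `|C| * (2 * q%:R) <= xz z * (2 * q%:R).
  apply: le_trans hu _; apply: le_trans h _; rewrite wE mulrC ler_wpM2l ?(ltW x0)//; lra.
rewrite ler_pM2r in h2; last lra.
by apply: le_trans (ler_norm _) h2.
Qed.

Lemma moment_arith (F A D FN e BJ Er N : R) : 0 < F -> 1 <= A -> 0 <= FN -> FN <= F -> 0 <= D ->
  F * (A - 2 * e) <= D -> e <= 16^-1 -> BJ <= 5^-1 -> Er * N <= 20^-1 ->
  F * (A / 10) <= (2 / 5 - BJ) * D - Er * (N * FN).
Proof.
move=> F0 far_const FN0 FNF D0 hD he hB hE.
have e1 : 5^-1 * D <= (2 / 5 - BJ) * D by rewrite ler_wpM2r//; lra.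
have e2 : Er * (N * FN) <= 20^-1 * F.
  rewrite [X in X <= _]mulrA; apply: le_trans (ler_wpM2r FN0 hE) _; apply: ler_wpM2l => //; lra.
have e3 : F * (A - 8^-1) <= D by apply: le_trans hD; rewrite ler_wpM2l ?(ltW F0)//; lra.
have e4 : F * 1 <= F * A by rewrite ler_wpM2l// ltW.
lra.
Qed.

(** The mean of [dp - A / 30] with weights [rs] is positive, since [A / 30] contributes at most half
    of the lower bound [F A / 10]. *)
Lemma resonance_pick (M K c0 : nat) (F A : R) (dp rs : nat -> R) : (0 < M)%N -> 0 < F -> 0 < A ->
  (forall l, 0 <= rs l) -> Av M K rs c0 <= 3 / 2 * F -> F * (A / 10) <= Av M K (fun l => dp l * rs l) c0 ->
  exists l, (c0 <= l <= c0 + K * M)%N /\ A / 30 <= dp l.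
Proof.
move=> M0 F0 A0 rs0 hr hd.
have h : F * (A / 20) <= Av M K (fun l => dp l * rs l + - (A / 30) * rs l) c0.
  rewrite Av_add Av_scale.
  have : A / 30 * Av M K rs c0 <= A / 30 * (3 / 2 * F) by rewrite ler_wpM2l//; lra.
  lra.
have [l [hl hge]] := Av_exists_ge M0 h; exists l; split=> //.
have pos : 0 < dp l * rs l + - (A / 30) * rs l.
  by apply: lt_le_trans hge; rewrite mulr_gt0// divr_gt0.
rewrite leNgt; apply/negP => h2; have := ler_wpM2r (rs0 l) (ltW h2); lra.
Qed.

(** * The first moment at a given scale *)

Section LargeZ.
Variables (alpha beta : R) (q z P0 c0 : nat).
Hypothesis al0 : 0 < alpha.
Hypothesis q_ge : (20 <= q)%N.
Hypothesis g : good q z.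
Hypothesis P02 : (2 <= P0)%N.

Local Notation N := (Nz q z).
Local Notation M := (Mz q z).
Local Notation X := (Xz q z).
Local Notation v := (vz q z).
Local Notation f := (@ff v q N).
Local Notation pr := (@pp v q).
Local Notation x := (xz z).

Definition sieve_bound : R := 2 ^+ size (small_primes P0).
Definition modulus : R := (sieve_modulus P0)%:R.
Definition sieved_length : nat := (sieve_modulus P0 * X.+2)%N.
(** A bound for the [|j|] that can occur in a coincidence. *)
Definition winding_bound : nat := (Num.truncn (alpha * (ln sieved_length%:R + ln N%:R) + 1)).+1.
Definition far_const : R := exp 24%:R * sieve_bound * (4 * modulus).
Definition winding_const : R := alpha * (`|ln (4 * modulus)| + 19 * q%:R) + 3.
Definition tail_const : R := 8 / alpha * pw (4 * modulus) 2^-1 + pw 2 2^-1.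

Lemma sieve_bound_ge1 : 1 <= sieve_bound.
Proof. by rewrite exprn_ege1//; lra. Qed.

Lemma sieve_modulus_gt0 : (0 < sieve_modulus P0)%N.
Proof.
rewrite /sieve_modulus big_seq; apply: prodn_cond_gt0 => p.
by rewrite mem_small_primes => /andP[/prime_gt0].
Qed.

Lemma modulus_ge1 : 1 <= modulus.
Proof. by rewrite ler1n sieve_modulus_gt0. Qed.

Lemma z_ge (n : nat) (C : R) : C <= x -> C <= (z ^ n.+1)%:R.
Proof.
move=> hC; rewrite (zXE g); apply: le_trans hC _; apply: le_trans (exp_ge_id _) _.
by rewrite ler_exp -[X in X <= _]mul1r ler_wpM2r ?(ltW (x_gt0 g))// ler1n.
Qed.

Lemma sieved_length_gt0 : 0 < sieved_length%:R :> R.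
Proof. by rewrite ltr0n muln_gt0 sieve_modulus_gt0. Qed.

Lemma sieved_length_le : sieved_length.+1%:R <= 4 * modulus * exp ((17 * q%:R + 1) * x).
Proof.
rewrite -(XzE g) -natr1 /sieved_length natrM -/modulus.
have X1 : 1 <= X%:R :> R by rewrite ler1n (zX_gt0 g).
have -> : X.+2%:R = X%:R + 2 :> R by rewrite -addn2 natrD.
have P1 := modulus_ge1; have : modulus * 1 <= modulus * X%:R by rewrite ler_wpM2l//; lra.
lra.
Qed.

Lemma ln_sieved_length : ln sieved_length%:R <= `|ln (4 * modulus)| + (17 * q%:R + 1) * x.
Proof.
have W0 := sieved_length_gt0; have P1 := modulus_ge1.
have WB : sieved_length%:R <= 4 * modulus * exp ((17 * q%:R + 1) * x) by apply: le_trans sieved_length_le; rewrite ler_nat.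
apply: le_trans (_ : ln (4 * modulus * exp ((17 * q%:R + 1) * x)) <= _).
  by rewrite ler_ln// (lt_le_trans W0).
rewrite lnM ?ln_exp0; [by rewrite lerD2r ler_norm | by rewrite mulr_gt0//; lra | exact: exp_gt0].
Qed.

Lemma lnNz : ln N%:R = (2 * q%:R - 1) * x.
Proof. by rewrite (NzE q_ge g) ln_exp0. Qed.

Lemma winding_bound_big : alpha * (ln sieved_length%:R + ln N%:R) + 1 <= 6 * winding_bound%:R.
Proof.
have : alpha * (ln sieved_length%:R + ln N%:R) + 1 < winding_bound%:R by exact: truncnS_gt.
have : 0 <= winding_bound%:R :> R by rewrite ler0n.
move: (winding_bound%:R : R) => j; lra.
Qed.

Lemma winding_bound_le : winding_bound.+1%:R <= winding_const * (x + 1).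
Proof.
have x0 := x_gt0 g.
have J1 : 0 <= alpha * (ln sieved_length%:R + ln N%:R) + 1.
  have : 0 <= alpha * (ln sieved_length%:R + ln N%:R) by rewrite mulr_ge0 ?(ltW al0)// addr_ge0 ?lnn_ge0.
  lra.
have t1 : (Num.truncn (alpha * (ln sieved_length%:R + ln N%:R) + 1))%:R <= alpha * (ln sieved_length%:R + ln N%:R) + 1 by rewrite truncn_le.
have -> : winding_bound.+1%:R = (Num.truncn (alpha * (ln sieved_length%:R + ln N%:R) + 1))%:R + 2 :> R by rewrite /winding_bound -addn2 natrD.
have h : alpha * (ln sieved_length%:R + ln N%:R) <= alpha * (`|ln (4 * modulus)| + 19 * q%:R * x).
  by rewrite ler_wpM2l ?(ltW al0)// lnNz; have := ln_sieved_length; lra.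
have c1 : 0 <= (`|ln (4 * modulus)| * alpha) * x by rewrite !mulr_ge0 ?normr_ge0// ltW.
have c2 : 0 <= alpha * q%:R by rewrite mulr_ge0 ?ler0n// ltW.
rewrite /winding_const; lra.
Qed.

Lemma tail_le : (8 * dz q z / alpha * pw sieved_length%:R 2^-1 + pw (2 * N%:R / exp (7 * q%:R * x)) 2^-1) * N%:R <= tail_const * exp (- x).
Proof.
have x0 := x_gt0 g; have q20 := q_ge20 q_ge; have P1 := modulus_ge1; have W0 := sieved_length_gt0.
have qx : 20 * x <= q%:R * x by rewrite ler_wpM2r// ltW.
rewrite mulrDl /tail_const [X in _ <= X]mulrDl; apply: lerD.
  have hW : pw sieved_length%:R 2^-1 <= pw (4 * modulus) 2^-1 * exp (2^-1 * ((17 * q%:R + 1) * x)).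
    apply: le_trans (_ : pw (4 * modulus * exp ((17 * q%:R + 1) * x)) 2^-1 <= _).
      by apply: ler_pw => //; [lra | apply: le_trans sieved_length_le; rewrite ler_nat].
    rewrite pwM ?exp_gt0//; last by rewrite mulr_gt0//; lra.
    by rewrite {2}/pw ln_exp0.
  have c0' : 0 <= 8 * dz q z / alpha by rewrite divr_ge0 ?(ltW al0)// mulr_ge0// ltW// dz_gt0.
  apply: le_trans (ler_wpM2r (ler0n _ _) (ler_wpM2l c0' hW)) _.
  rewrite (NzE q_ge g) /dz.
  have -> : 8 * exp (- (11 * q%:R * x)) / alpha * (pw (4 * modulus) 2^-1 * exp (2^-1 * ((17 * q%:R + 1) * x))) *
     exp ((2 * q%:R - 1) * x) = 8 / alpha * pw (4 * modulus) 2^-1 *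
     (exp (- (11 * q%:R * x)) * exp (2^-1 * ((17 * q%:R + 1) * x)) * exp ((2 * q%:R - 1) * x)) by ring.
  apply: ler_wpM2l; first by rewrite mulr_ge0 ?pw_ge0 ?divr_ge0 ?(ltW al0).
  rewrite -!expD ler_exp; lra.
have -> : pw (2 * N%:R / exp (7 * q%:R * x)) 2^-1 = pw 2 2^-1 * exp (2^-1 * ((2 * q%:R - 1) * x - 7 * q%:R * x)).
  rewrite (NzE q_ge g) -expN -mulrA -expD pwM ?exp_gt0//.
  by rewrite {2}/pw ln_exp0.
rewrite (NzE q_ge g) -mulrA -expD ler_wpM2l ?pw_ge0// ler_exp; lra.
Qed.

Lemma far_le : 26 <= x -> (2 / (M%:R * dz q z)) ^+ 24 * (sieve_bound * sieved_length.+1%:R) * N%:R <= far_const * exp (- x).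
Proof.
move=> x26; have x0 := x_gt0 g; have q20 := q_ge20 q_ge; have P1 := modulus_ge1; have C1 := sieve_bound_ge1.
have qx : 20 * x <= q%:R * x by rewrite ler_wpM2r// ltW.
rewrite (farE g) (NzE q_ge g).
have h1 : 2 ^+ 24 * exp (- (24 * q%:R * x)) <= exp 24%:R * exp (- (24 * q%:R * x)).
  by rewrite ler_wpM2r ?exp_ge0// pow2_exp.
have h2 : sieve_bound * sieved_length.+1%:R <= sieve_bound * (4 * modulus * exp ((17 * q%:R + 1) * x)) by rewrite ler_wpM2l ?sieved_length_le//; lra.
apply: le_trans (_ : exp 24%:R * exp (- (24 * q%:R * x)) * (sieve_bound * (4 * modulus * exp ((17 * q%:R + 1) * x))) * exp ((2 * q%:R - 1) * x) <= _).
  rewrite ler_wpM2r ?exp_ge0//; apply: ler_pM => //.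
    by rewrite mulr_ge0 ?exp_ge0 ?exprn_ge0.
  by rewrite mulr_ge0 ?ler0n//; lra.
have -> : exp 24%:R * exp (- (24 * q%:R * x)) * (sieve_bound * (4 * modulus * exp ((17 * q%:R + 1) * x))) * exp ((2 * q%:R - 1) * x) =
  far_const * (exp (- (24 * q%:R * x)) * exp ((17 * q%:R + 1) * x) * exp ((2 * q%:R - 1) * x)) by rewrite /far_const; ring.
have A10 : 0 <= far_const by rewrite /far_const mulr_ge0 ?mulr_ge0 ?exp_ge0//; lra.
rewrite ler_wpM2l// -!expD ler_exp; lra.
Qed.

Lemma moment_error : 26 <= x -> 20 * ((far_const + 2 * winding_const * sieve_bound * tail_const) * (x + 1)) <= exp x ->
  ((2 / (M%:R * dz q z)) ^+ 24 * (sieve_bound * sieved_length.+1%:R) + 2 * winding_bound.+1%:R *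
   (sieve_bound * (8 * dz q z / alpha * pw sieved_length%:R 2^-1 + pw (2 * N%:R / exp (7 * q%:R * x)) 2^-1))) * N%:R <= 20^-1.
Proof.
move=> x26 herr; have x0 := x_gt0 g; have C1 := sieve_bound_ge1; have P1 := modulus_ge1.
have A10 : 0 <= far_const by rewrite /far_const mulr_ge0 ?mulr_ge0 ?exp_ge0//; lra.
have A30 : 0 <= tail_const by rewrite /tail_const addr_ge0 ?pw_ge0// mulr_ge0 ?pw_ge0// divr_ge0// ltW.
have h1 := far_le x26; have h2 := tail_le; have h3 := winding_bound_le.
rewrite mulrDl; set Bg := _ + pw _ 2^-1 in h2 *.
have h4 : 2 * winding_bound.+1%:R * (sieve_bound * Bg) * N%:R <= 2 * (winding_const * (x + 1)) * sieve_bound * (tail_const * exp (- x)).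
  have -> : 2 * winding_bound.+1%:R * (sieve_bound * Bg) * N%:R = 2 * winding_bound.+1%:R * sieve_bound * (Bg * N%:R) by ring.
  have d0 := dz_gt0 q z.
  have Bg0 : 0 <= Bg by rewrite /Bg addr_ge0 ?pw_ge0// mulr_ge0 ?pw_ge0// divr_ge0 ?(ltW al0)// mulr_ge0// ltW.
  apply: ler_pM => //; rewrite ?mulr_ge0//; try lra.
  by rewrite ler_wpM2r//; [lra | rewrite ler_wpM2l].
have h5 : far_const * exp (- x) <= far_const * (x + 1) * exp (- x).
  by rewrite ler_wpM2r ?exp_ge0// ler_peMr//; lra.
apply: le_trans (lerD (le_trans h1 h5) h4) _.
have -> : far_const * (x + 1) * exp (- x) + 2 * (winding_const * (x + 1)) * sieve_bound * (tail_const * exp (- x)) =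
  (far_const + 2 * winding_const * sieve_bound * tail_const) * (x + 1) / exp x by rewrite expN; ring.
rewrite ler_pdivrMr ?exp_gt0//; lra.
Qed.

Hypothesis x26 : 26 <= x.
Hypothesis big_al : 16 / alpha < exp x.
Hypothesis P0_x : P0%:R <= x.
Hypothesis P0_w : P0%:R <= wz q z.
Hypothesis kap_w : 4 / kap0 q <= ln (wz q z).
Hypothesis two : cis (alpha * ln 2) = 1 \/ nrm (Av M 24 (fun l => cis (- (l%:R * (alpha * ln 2)))) c0) <= 4^-1.

Lemma kap0_gt0 : 0 < kap0 q.
Proof. by rewrite invr_gt0 mulr_gt0 ?ltr0n. Qed.

Lemma kap0_le : kap0 q <= 2^-1.
Proof. by rewrite lef_pV2 ?posrE ?mulr_gt0 ?ltr0n// -[X in X <= _]mulr1 ler_wpM2l// ler1n. Qed.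

Lemma P0N_X : (P0 * N <= X)%N.
Proof.
have h : (P0 <= z ^ 1)%N by rewrite -(ler_nat R); apply: z_ge.
apply: leq_trans (leq_mul h (leqnn N)) _; rewrite /Xz /Nz -expnD leq_pexp2l ?(ltnW (z_gt1 g))//.
by move: q_ge; clear; nlia.
Qed.

Lemma twoN_X : (2 * N <= X)%N.
Proof. by apply: leq_trans P0N_X; rewrite leq_mul2r P02 orbT. Qed.

Lemma moment_lower :
  (2 / 5 - 4 * (pw P0%:R (- (kap0 q / 2 / 2)) * exp (kap0 q / 2 / (2 * alpha))) /
     (1 - exp (- (kap0 q / 2 * PI / alpha)))) * diag1 pr N f -
  ((2 / (M%:R * dz q z)) ^+ 24 * (sieve_bound * sieved_length.+1%:R) + 2 * winding_bound.+1%:R *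
   (sieve_bound * (8 * dz q z / alpha * pw sieved_length%:R 2^-1 + pw (2 * N%:R / exp (7 * q%:R * x)) 2^-1))) * (N%:R * FN pr N f) <=
  nrm (Av M 24 (fun l => dirpoly (sieved_coef P0 X) sieved_length (alpha * l%:R + beta) *
     (nrm (resonator pr N (fS f) (alpha * l%:R + beta)) ^+ 2)%:C) c0).
Proof.
have k0 := kap0_gt0; have x0 := x_gt0 g.
have fl i : f i <= pw (pr i)%:R (- kap0 q) := ff_le (v_gt1 g) (q_gt5 q_ge) (v_lv g) (w_gt0 g) (w_pw g) i.
have wv := w_vq g; have N2X := twoN_X; have NX := P0N_X.
have prP0 i : (P0 < pr i)%N.
  by apply: leq_ltn_trans (pp_gt i); rewrite -(ler_nat R); exact: le_trans wv.
have prk i : 2 <= pw (pr i)%:R (kap0 q / 2).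
  have kh : 0 < kap0 q / 2 by rewrite divr_gt0.
  apply: le_trans (_ : pw (wz q z) (kap0 q / 2) <= _); last first.
    apply: ler_pw; [exact: ltW | exact: (w_gt0 g) |].
    by apply: le_trans wv _; rewrite ler_nat ltnW// pp_gt.
  by apply: le_trans (exp_ge_id _); move: kap_w; rewrite ler_pdivrMr//; lra.
apply: (@first_moment_lower _ _ (@pp_prime v q) (@pp_inj v q) N (zX_gt0 g _) f (f_pos q_ge g) alpha beta (dz q z) al0 (dz_gt0 q z)
  P0 (kap0 q) P02 prP0 k0 kap0_le fl prk (sieved_coef P0 X) sieved_length sieve_bound (sieve_bound * sieved_length.+1%:R) X%:R) => //.
- apply: leq_trans N2X _; rewrite /sieved_length; apply: leq_trans (_ : X.+2 <= _)%N; last by rewrite leq_pmull// sieve_modulus_gt0.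
  by rewrite leqW// leqW.
- by move=> S h; apply: (sieved_coef_one P02 (@pp_prime v q) prP0); apply: leq_trans h (leq_trans _ N2X); rewrite leq_pmull.
- by move=> S h; apply: (sieved_coef_two P02 (@pp_prime v q) prP0); apply: leq_trans N2X; rewrite leq_mul2l h orbT.
- move=> A S hA h; apply: (sieved_coef_zero P02 (@pp_prime v q) prP0 hA); apply: leq_trans NX.
  by apply: leq_mul => //; case/andP: hA.
- by move=> b; rewrite ler_nat => h; exact: sieved_coef_le2.
- by move=> b; exact: sieved_coef_bound.
- by have := sieve_bound_ge1; lra.
- exact: sieved_coef_sum.
- exact: (zX_gt0 g).
- exact: dz_le.
- exact: winding_bound_big.
- exact: dz_small.
- by apply: exp_ge1; rewrite !mulr_ge0 ?ler0n// ltW.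
(* [G N^2 = z^(11q - 2)], just within the reach of the tolerance [dz]. *)
- have h := @dz_poly alpha q z al0 g big_al (-2) 11 ltac:(lra); apply: le_lt_trans h.
  rewrite (NzE q_ge g) -expMn.
  have -> : 8 * dz q z / alpha * (2 * exp (7 * q%:R * x)) * exp (2%:R * ((2 * q%:R - 1) * x)) =
    16 * dz q z / alpha * (exp (7 * q%:R * x) * exp (2%:R * ((2 * q%:R - 1) * x))) by ring.
  rewrite -expD le_eqVlt; apply/orP; left; apply/eqP; congr (_ * exp _); ring.
- rewrite (NzE q_ge g) (XzE g) -mulrA -expD.
  apply: le_trans (_ : exp x * exp (7 * q%:R * x + (2 * q%:R - 1) * x) <= _).
    by rewrite ler_wpM2r ?exp_ge0//; apply: le_trans (exp_ge_id x); apply: le_trans x26; lra.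
  have qx : 0 <= q%:R * x by rewrite mulr_ge0 ?ler0n// ltW.
  by rewrite -expD ler_exp; lra.
Qed.

Hypothesis u_res : 16 * exp (kap0 q / (2 * alpha)) / ((1 - exp (- (kap0 q * PI / alpha))) * kap0 q) <= ln (wz q z).
Hypothesis herr : 20 * ((far_const + 2 * winding_const * sieve_bound * tail_const) * (x + 1)) <= exp x.
Hypothesis hBj : 4 * (pw P0%:R (- (kap0 q / 2 / 2)) * exp (kap0 q / 2 / (2 * alpha))) /
     (1 - exp (- (kap0 q / 2 * PI / alpha))) <= 5^-1.
Hypothesis c0_le : (c0 <= M)%N.
Local Notation LPz := (LP v q N).

Lemma large_etaV : exists l, (c0 <= l <= c0 + 24 * M)%N /\
  exp ((1 - 2 / q%:R) * LPz) / (30 * sieve_bound) <= nrm (etaV (alpha * l%:R + beta) X).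
Proof.
pose rs l := nrm (resonator pr N (fS f) (alpha * l%:R + beta)) ^+ 2.
pose dp l := nrm (dirpoly (sieved_coef P0 X) sieved_length (alpha * l%:R + beta)).
have q20 := q_ge20 q_ge.
have far_const' : 1 <= exp ((1 - 2 / q%:R) * LPz).
  apply: exp_ge1; rewrite mulr_ge0 ?LP_ge0 ?(v_gt1 g) ?(q_gt5 q_ge) ?(v_lv g)//.
  rewrite subr_ge0 ler_pdivrMr; first lra.
  by apply: lt_le_trans q20; lra.
have rs0 l : 0 <= rs l by exact: sqr_ge0.
have hr S : `|fS f S| = fS f S by rewrite ger0_norm// fS_ge0//; exact: f_pos.
have [_ hR2] := resonator_half beta al0 q_ge g x26 big_al u_res c0 hr.
have [Fl Fu] := FN_bounds q_ge g; have Fp := F0_pos q z.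
have FN0 : 0 <= FN pr N f by apply: le_trans Fl; rewrite divr_ge0// ltW.
have D0 : 0 <= diag1 pr N f by apply: diag1_ge0; exact: f_pos.
have hd : F0 f * (exp ((1 - 2 / q%:R) * LPz) - 2 * exp (- Num.sqrt (wz q z))) <= diag1 pr N f :=
  diag1_ge (v_gt1 g) (q_gt5 q_ge) (v_lv g) (zX_gt0 g _) (w_gt0 g) (w_pw g) (w_sqrt g) (v_kap g).
have low := moment_arith Fp far_const' FN0 Fu D0 hd (tiny_le q_ge g) hBj (moment_error x26 herr).
have lowA : F0 f * (exp ((1 - 2 / q%:R) * LPz) / 10) <= Av M 24 (fun l => dp l * rs l) c0.
  apply: le_trans low _; apply: le_trans moment_lower _.
  apply: le_trans (nrm_Av _ _ _ _) _; apply: ler_Av => l _.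
  by rewrite nrmM nrm_real /dp /rs ger0_norm ?sqr_ge0.
have upA : Av M 24 rs c0 <= 3 / 2 * F0 f.
  by apply: le_trans hR2 _; apply: ler_wpM2l; rewrite ?divr_ge0.
have [l [hl hge]] := resonance_pick (zX_gt0 g _) Fp (lt_le_trans ltr01 far_const') rs0 upA lowA.
exists l; split=> //.
have CH0 : 0 < sieve_bound by apply: lt_le_trans sieve_bound_ge1.
have h2 : nrm (sieve_factor P0 (alpha * l%:R + beta)) * nrm (etaV (alpha * l%:R + beta) X) <= sieve_bound * nrm (etaV (alpha * l%:R + beta) X).
  by rewrite ler_wpM2r ?nrm_ge0// sieve_factor_bound.
rewrite ler_pdivrMr; last by rewrite mulr_gt0.
move: hge; rewrite /dp sieved_dirpoly nrmM => h.
move: (le_trans h h2); rewrite ler_pdivrMr//.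
by move=> h3; apply: le_trans h3 _; rewrite le_eqVlt; apply/orP; left; apply/eqP; ring.
Qed.

End LargeZ.

Lemma mean_cis_two (alpha D : R) (M c0 : nat) : (0 < M)%N -> 0 < D ->
  D <= nrm (1 - cis (alpha * ln 2)) -> 8 <= M%:R * D ->
  nrm (Av M 24 (fun l => cis (- (l%:R * (alpha * ln 2)))) c0) <= 4^-1.
Proof.
move=> M0 D0 h MD; apply: le_trans (nrm_Av_cis_far 24 c0 M0 D0 h) _.
have MD0 : 0 < M%:R * D by lra.
have r4 : 2 / (M%:R * D) <= 4^-1 by rewrite ler_pdivrMr//; lra.
have r0 : 0 <= 2 / (M%:R * D) by rewrite divr_ge0// ltW.
rewrite exprS; apply: le_trans (_ : 2 / (M%:R * D) * 1 <= _); last by rewrite mulr1.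
by apply: ler_wpM2l => //; apply: exprn_ile1 => //; apply: le_trans r4 _; lra.
Qed.

(** [P0] depends only on [q] and [alpha], so sieving costs a constant factor. *)
Lemma sieve_level (q : nat) (alpha : R) : (20 <= q)%N -> 0 < alpha -> exists2 P0 : nat, (2 <= P0)%N &
  4 * (pw P0%:R (- (kap0 q / 2 / 2)) * exp (kap0 q / 2 / (2 * alpha))) / (1 - exp (- (kap0 q / 2 * PI / alpha))) <= 5^-1.
Proof.
move=> q_ge al0; have k0 := kap0_gt0 q.
have [qa [eqa qa0]] : exists qa, qa = exp (- (kap0 q / 2 * PI / alpha)) /\ 0 < 1 - qa.
  eexists; split; first reflexivity.
  have PI0 := PI_gt0; rewrite subr_gt0 -[X in _ < X]exp00 ltr_exp oppr_lt0; apply: divr_gt0 => //.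
  by apply: mulr_gt0 => //; apply: divr_gt0.
rewrite -eqa.
have k4 : 0 < kap0 q / 2 / 2 by rewrite !divr_gt0.
have eb0 : 0 < (1 - qa) / (20 * exp (kap0 q / 2 / (2 * alpha))) by rewrite divr_gt0// mulr_gt0 ?exp_gt0.
have [P1 [P10 hP1]] := pw_tendsto0 k4 eb0.
exists P1.+1; first by [].
rewrite ler_pdivrMr//.
have hp : pw P1.+1%:R (- (kap0 q / 2 / 2)) <= (1 - qa) / (20 * exp (kap0 q / 2 / (2 * alpha))).
  by apply: le_trans hP1; apply: ler_pwN; [rewrite oppr_le0 ltW | rewrite ltr0n | rewrite ler_nat].
have := ler_wpM2r (exp_ge0 (kap0 q / 2 / (2 * alpha))) hp.
have ee := exp_gt0 (kap0 q / 2 / (2 * alpha)).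
have -> : (1 - qa) / (20 * exp (kap0 q / 2 / (2 * alpha))) * exp (kap0 q / 2 / (2 * alpha)) = (1 - qa) / 20.
  by field; rewrite gt_eqF.
lra.
Qed.

(** The gap does not depend on the scale, so averages over long blocks suppress a nontrivial phase
    of 2. *)
Lemma cis_two_gap (alpha : R) : exists D1 : R, 0 < D1 /\ (cis (alpha * ln 2) = 1 \/ D1 <= nrm (1 - cis (alpha * ln 2))).
Proof.
case: (eqVneq (cis (alpha * ln 2)) 1) => [e|ne]; first by exists 1; split=> //; left.
exists (nrm (1 - cis (alpha * ln 2))); split; last by right.
rewrite lt_def nrm_ge0 andbT; apply: contra ne => /eqP/Normc.eq0_normc/eqP.
by rewrite subr_eq0 eq_sym.
Qed.

Lemma le_of_norm_sum (a b c d e f u : R) : 0 <= e -> 0 <= f -> `|a| + `|b| + `|c| + `|d| + e + f <= u ->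
  [/\ a <= u, b <= u & c <= u] /\ [/\ d <= u, e <= u & f <= u].
Proof.
move=> e0 f0 h; have := ler_norm a; have := ler_norm b; have := ler_norm c; have := ler_norm d.
have := normr_ge0 a; have := normr_ge0 b; have := normr_ge0 c; have := normr_ge0 d.
by do !split; lra.
Qed.

Lemma le_of_sum (a b c d e f u : R) : 0 <= b -> 0 <= c -> 0 <= d -> 0 <= e -> 0 <= f -> `|a| + b + c + d + e + f <= u ->
  [/\ a <= u, b <= u & c <= u] /\ [/\ d <= u, e <= u & f <= u].
Proof. by move=> b0 c0 d0 e0 f0; have := ler_norm a; have := normr_ge0 a; do !split; lra. Qed.

(** Passing from [2/Q] to [3/Q] gains [exp (L / Q) >= 120 H], which is 4 times [30 H]: a factor 3
    between [eta] and [zeta], and 1 for the truncation error. *)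
Lemma large_arith (H Q L Z : R) (e V : C) : 1 <= H -> 20 <= Q -> 0 <= L -> Q * (120 * H) <= L ->
  exp ((1 - 2 / Q) * L) / (30 * H) <= nrm V -> nrm (e - V) <= 1 -> nrm e / 3 <= Z -> exp ((1 - 3 / Q) * L) <= Z.
Proof.
move=> H1 Q20 L0 hL hV heV; apply: le_trans.
have Q0 : 0 < Q by lra.
have [E [eE E1]] : exists E, E = exp ((1 - 3 / Q) * L) /\ 1 <= E.
  eexists; split; first reflexivity.
  by apply: exp_ge1; rewrite mulr_ge0// subr_ge0 ler_pdivrMr//; lra.
rewrite -eE.
have hE : exp ((1 - 2 / Q) * L) = E * exp (L / Q) by rewrite eE -expD; congr exp; field; rewrite gt_eqF.
have h3 : 120 * H <= exp (L / Q) by apply: le_trans (exp_ge_id _); rewrite ler_pdivlMr// mulrC.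
have h4 : 4 * E <= nrm V.
  apply: le_trans hV; rewrite hE ler_pdivlMr; last lra.
  have := ler_wpM2l (le_trans ler01 E1) h3; lra.
have := nrmD e (V - e); rewrite addrC subrK; rewrite -nrmN opprB in heV => h5.
lra.
Qed.

Lemma large_value (alpha beta : R) (q : nat) : 0 < alpha -> (20 <= q)%N ->
  exists B : R, forall z : nat, (1 < z)%N -> B <= ln (wz q z) ->
  forall c0 : nat, (c0 <= Mz q z)%N -> exists l : nat, (c0 <= l <= c0 + 24 * Mz q z)%N /\
    exp ((1 - 3 / q%:R) * LP (vz q z) q (Nz q z)) <= zeta_abs_crit (alpha * l%:R + beta).
Proof.
move=> al0 q_ge; have q20 := q_ge20 q_ge.
have [P0 P02 hBj] := sieve_level q_ge al0.
have [D1 [D10 hD1]] := cis_two_gap alpha.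
have CH1 := sieve_bound_ge1 P0; have CH0 : 0 < sieve_bound P0 := lt_le_trans ltr01 CH1.
have [A4 [eA4 A40]] : exists A4 : R, A4 = (1 + 25 * alpha + `|beta|) ^+ 2 /\ 0 <= A4.
  by eexists; split; [reflexivity | exact: sqr_ge0].
have [X1 hX1] := @exp_beats (20 * (far_const P0 + 2 * winding_const alpha q P0 * sieve_bound P0 * tail_const alpha P0)) 1 1 ltr01.
have [B1 h1] := good_eventually q_ge.
have [X2 eX2] : exists X2 : R, X2 = `|X1| + 26 + 17 / alpha + A4 + 8 / D1 + P0%:R by eexists.
have [B2 h2] := lnz_ge X2 q_ge.
have cpos : 0 <= q%:R * (120 * sieve_bound P0) by rewrite !mulr_ge0 ?ler0n// ltW.
have [B3 h3] := LP_ge_log q_ge cpos.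
have [Bu eBu] : exists Bu : R, Bu = 16 * exp (kap0 q / (2 * alpha)) / ((1 - exp (- (kap0 q * PI / alpha))) * kap0 q) by eexists.
have p00 : 0 <= P0%:R :> R by rewrite ler0n.
have k40 : 0 <= 4 / kap0 q by rewrite divr_ge0// ltW// kap0_gt0.
exists (`|B1| + `|B2| + `|B3| + `|Bu| + P0%:R + 4 / kap0 q) => z z1 hu c0 hc0.
have [[u1 u2 u3] [u4 u5 u6]] := le_of_norm_sum p00 k40 hu.
have g : good q z := h1 z z1 u1.
have hx := h2 z z1 u2; have hLP := h3 z z1 u3; rewrite {}eBu in u4; rewrite {}eX2 in hx.
have a17 : 0 <= 17 / alpha by rewrite divr_ge0// ltW.
have d80 : 0 <= 8 / D1 by rewrite divr_ge0// ltW.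
have [[x1 x2 x3] [x4 x5 x6]] := @le_of_sum X1 26 (17 / alpha) A4 (8 / D1) P0%:R (xz z) ltac:(lra) a17 A40 d80 p00 hx.
have big_al : 16 / alpha < exp (xz z).
  apply: lt_le_trans (exp_ge_id _); apply: lt_le_trans x3; rewrite ltr_pM2r ?invr_gt0//; lra.
have M0 : (0 < Mz q z)%N := zX_gt0 g _.
have two : cis (alpha * ln 2) = 1 \/ nrm (Av (Mz q z) 24 (fun l => cis (- (l%:R * (alpha * ln 2)))) c0) <= 4^-1.
  case: hD1 => h; [by left | right]; apply: (mean_cis_two c0 M0 D10 h).
  have : 8 / D1 <= (Mz q z)%:R.
    rewrite /Mz (_ : (12 * q)%N = (12 * q).-1.+1); first exact: (z_ge g).
    by rewrite prednK// muln_gt0 (leq_trans _ q_ge).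
  by rewrite ler_pdivrMr.
have herr : 20 * ((far_const P0 + 2 * winding_const alpha q P0 * sieve_bound P0 * tail_const alpha P0) * (xz z + 1)) <= exp (xz z).
  by have := hX1 _ x1; rewrite mul1r expr1 mulrA.
have P0w : P0%:R <= wz q z by apply: le_trans u5 _; have := ln_leB1 (w_gt0 g); lra.
have [l [hl hV]] := large_etaV beta al0 q_ge g P02 x2 big_al x6 P0w u6 two u4 herr hBj.
exists l; split=> //.
have lM : (l <= c0 + 24 * Mz q z)%N by case/andP: hl.
have he := eta_err beta al0 q_ge g hc0 lM (leqnn _); rewrite -eA4 in he.
have he1 : nrm (eta (alpha * l%:R + beta) - etaV (alpha * l%:R + beta) (Xz q z)) <= 1.
  apply: le_trans he _; rewrite expN ler_pdivrMr ?exp_gt0// mul1r.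
  by apply: le_trans (exp_ge_id _).
apply: (large_arith CH1 q20 (LP_ge0 (v_gt1 g) (q_gt5 q_ge) (v_lv g) (Nz q z)) _ hV he1 (zeta_eta _).1).
apply: le_trans hLP; rewrite -[X in X <= _]mulr1 ler_wpM2l// lerDr ltW// lnw_gt0//.
Qed.

(** * Small values *)

Lemma second_error_le (a b c V M N Y e al K : R) : 0 < al -> 0 < M -> al * M <= V -> V <= K * M -> 1 <= N ->
  0 <= a -> 0 <= b -> 0 <= c -> 0 < Y -> N ^+ 4 <= e * M -> M * N ^+ 2 <= e * Y ->
  8 * V * (a * N ^+ 4 / V ^+ 2 + b * N ^+ 2 / V ^+ 2 + c * N ^+ 2 / Y) <= (8 * (a + b) / al + 8 * c * K) * e.
Proof.
move=> al0 M0 hV VK N1 a0 b0 c0 Y0 h4 h2.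
have V0 : 0 < V by apply: lt_le_trans hV; rewrite mulr_gt0.
have e0 : 0 <= e.
  rewrite leNgt; apply/negP => e0; have : 0 <= N ^+ 4 by rewrite exprn_ge0//; lra.
  by apply/negP; rewrite -ltNge; apply: le_lt_trans h4 _; rewrite nmulr_rlt0.
have K0 : 0 <= K by rewrite -(pmulr_lge0 _ M0); apply: le_trans VK; exact: ltW.
have t1 : N ^+ 4 / V <= e / al.
  rewrite ler_pdivrMr// mulrAC ler_pdivlMr//; apply: le_trans (ler_wpM2r (ltW al0) h4) _.
  by rewrite -[X in X <= _]mulrA ler_wpM2l// mulrC.
have t2 : N ^+ 2 / V <= e / al.
  apply: le_trans t1; rewrite ler_wpM2r ?invr_ge0 ?(ltW V0)//.
  by rewrite ler_weXn2l.
have t3 : V * N ^+ 2 / Y <= K * e.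
  rewrite ler_pdivrMr//; apply: le_trans (ler_wpM2r (sqr_ge0 N) VK) _.
  by rewrite -[X in X <= _]mulrA -[X in _ <= X]mulrA ler_wpM2l.
have -> : 8 * V * (a * N ^+ 4 / V ^+ 2 + b * N ^+ 2 / V ^+ 2 + c * N ^+ 2 / Y) =
  8 * a * (N ^+ 4 / V) + 8 * b * (N ^+ 2 / V) + 8 * c * (V * N ^+ 2 / Y).
  by field; rewrite !gt_eqF.
have s1 : 8 * a * (N ^+ 4 / V) <= 8 * a * (e / al) by rewrite ler_wpM2l// mulr_ge0.
have s2 : 8 * b * (N ^+ 2 / V) <= 8 * b * (e / al) by rewrite ler_wpM2l// mulr_ge0.
have s3 : 8 * c * (V * N ^+ 2 / Y) <= 8 * c * (K * e) by rewrite ler_wpM2l// mulr_ge0.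
apply: le_trans (lerD (lerD s1 s2) s3) _.
by rewrite le_eqVlt; apply/orP; left; apply/eqP; ring.
Qed.

Lemma second_total_le (c2 cj K al E x J V M Pi rk a t F Er B1 e FN : R) : 0 <= c2 -> 0 <= E -> 0 < al -> 0 < M ->
  0 <= J -> J <= cj * (x + 1) -> 0 <= V -> V <= K * M -> 0 <= x -> 0 <= Pi + rk -> Pi <= F * a -> rk <= 2 * (F * t) -> t <= a ->
  0 <= Er -> 8 * V * Er <= B1 * e -> 0 <= B1 -> e <= a -> 0 <= FN -> FN <= F -> 0 <= a ->
  M^-1 * (256 * J * V / al * (c2 * (E / x^-1 * (Pi + rk)) + 8 * V * (Er * FN))) <=
  256 * cj * K / al * (3 * (c2 * E) + B1) * ((x + 1) ^+ 2 * (F * a)).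
Proof.
move=> c20 E0 al0 M0 J0 Jc V0 VK x0 PR0 hP hr ta Er0 hE B10 ea FN0 FNF a0.
have F0 : 0 <= F by exact: le_trans FNF.
have Fa : 0 <= F * a by rewrite mulr_ge0.
have i1 : Pi + rk <= 3 * (F * a) by have := ler_wpM2l F0 ta; lra.
have i2 : 8 * V * (Er * FN) <= B1 * (F * a).
  rewrite [X in X <= _]mulrA; apply: le_trans (ler_wpM2r FN0 hE) _.
  rewrite -[X in X <= _]mulrA ler_wpM2l//; apply: le_trans (ler_wpM2r FN0 ea) _.
  by rewrite mulrC ler_wpM2r.
have x1 : 0 <= x + 1 by lra.
have i3 : c2 * (E / x^-1 * (Pi + rk)) + 8 * V * (Er * FN) <= (3 * (c2 * E) + B1) * ((x + 1) * (F * a)).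
  have cE : 0 <= c2 * E by rewrite mulr_ge0.
  have j1 : c2 * (E / x^-1 * (Pi + rk)) <= 3 * (c2 * E) * ((x + 1) * (F * a)).
    rewrite invrK.
    have -> : c2 * (E * x * (Pi + rk)) = c2 * E * (x * (Pi + rk)) by ring.
    have -> : 3 * (c2 * E) * ((x + 1) * (F * a)) = c2 * E * ((x + 1) * (3 * (F * a))) by ring.
    by rewrite ler_wpM2l//; apply: ler_pM => //; lra.
  have j2 : B1 * (F * a) <= B1 * ((x + 1) * (F * a)) by rewrite ler_wpM2l// ler_peMl//; lra.
  lra.
have lhs0 : 0 <= c2 * (E / x^-1 * (Pi + rk)) + 8 * V * (Er * FN).
  by rewrite addr_ge0 ?mulr_ge0// invr_ge0 invr_ge0.
have i4 : M^-1 * (256 * J * V / al) <= 256 * (cj * (x + 1)) * K / al.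
  rewrite ler_pdivrMl//.
  have -> : M * (256 * (cj * (x + 1)) * K / al) = 256 / al * ((cj * (x + 1)) * (K * M)) by ring.
  have -> : 256 * J * V / al = 256 / al * (J * V) by ring.
  by rewrite ler_wpM2l ?divr_ge0 ?(ltW al0)//; apply: ler_pM.
have i5 : 0 <= M^-1 * (256 * J * V / al) by rewrite mulr_ge0 ?invr_ge0 ?(ltW M0)// divr_ge0 ?(ltW al0)// !mulr_ge0.
rewrite [X in X <= _]mulrA; apply: le_trans (ler_pM i5 lhs0 i4 i3) _.
by rewrite le_eqVlt; apply/orP; left; apply/eqP; ring.
Qed.

Lemma twoPI_ge1 : 1 <= 2 * PI.
Proof. by have := PI_ge3; lra. Qed.

(** The large sieve applies to the three sharp partial sums, whose signs are exactly alternating;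
    convexity of the square recombines them. *)
Lemma nrm_etaV_sqr (t : R) (n : nat) (r : C) : nrm (etaV t n * r) ^+ 2 <=
  4^-1 * (nrm (etaP t n * r) ^+ 2 + 2 * nrm (etaP t n.+1 * r) ^+ 2 + nrm (etaP t n.+2 * r) ^+ 2).
Proof.
set a := etaP t n; set b := etaP t n.+1; set c := etaP t n.+2.
have h : nrm (etaV t n * r) <= 4^-1 * (nrm (a * r) + 2 * nrm (b * r) + nrm (c * r)).
  have -> : etaV t n * r = (4^-1)%:C * (a * r + (b * r + b * r) + c * r) by rewrite /etaV -/a -/b -/c; ring.
  rewrite nrmM nrm_real ger0_norm; last by rewrite invr_ge0.
  rewrite ler_wpM2l ?invr_ge0//; apply: le_trans (nrmD _ _) _; rewrite lerD2r.
  apply: le_trans (nrmD _ _) _; rewrite lerD2l; apply: le_trans (nrmD _ _) _; lra.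
apply: le_trans (_ : (4^-1 * (nrm (a * r) + 2 * nrm (b * r) + nrm (c * r))) ^+ 2 <= _).
  by apply: lerXn2r => //; rewrite nnegrE ?nrm_ge0// mulr_ge0 ?invr_ge0// !addr_ge0 ?mulr_ge0 ?nrm_ge0.
move: (nrm (a * r)) (nrm (b * r)) (nrm (c * r)) => A B D.
have := sqr_ge0 (A - B); have := sqr_ge0 (B - D); have := sqr_ge0 (A - D); lra.
Qed.

(** The mean of [Q - et] with weights [rs] is positive. *)
Lemma small_pick (M K c0 : nat) (et rs : nat -> R) (F Q : R) : (0 < M)%N -> 0 < F -> 0 < Q -> (forall l, 0 <= rs l) ->
  F / 4 <= Av M K rs c0 -> Av M K (fun l => et l * rs l) c0 <= Q / 8 * F ->
  exists l, (c0 <= l <= c0 + K * M)%N /\ et l <= Q.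
Proof.
move=> M0 F0 Q0 rs0 hr he.
have h : Q * F / 8 <= Av M K (fun l => Q * rs l + -1 * (et l * rs l)) c0.
  rewrite Av_add !Av_scale; have := ler_wpM2l (ltW Q0) hr; lra.
have [l [hl hge]] := Av_exists_ge M0 h; exists l; split=> //.
have pos : 0 < Q * rs l + -1 * (et l * rs l) by apply: lt_le_trans hge; rewrite divr_gt0// mulr_gt0.
rewrite leNgt; apply/negP => h2; have := ler_wpM2r (rs0 l) (ltW h2); lra.
Qed.

Lemma nrm_approx_sqr (e V r : C) (d : R) : nrm (e - V) <= d -> nrm e ^+ 2 * nrm r ^+ 2 <= 2 * nrm (V * r) ^+ 2 + 2 * d ^+ 2 * nrm r ^+ 2.
Proof.
move=> h; rewrite nrmM exprMn [X in _ <= X + _]mulrA -mulrDl ler_wpM2r ?sqr_ge0//.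
have h2 : nrm e <= nrm V + d by have := nrmD V (e - V); rewrite addrC subrK; lra.
have e0 := nrm_ge0 e; have V0 := nrm_ge0 V; have d0 := le_trans (nrm_ge0 _) h.
apply: le_trans (_ : (nrm V + d) ^+ 2 <= _); first by apply: lerXn2r; rewrite ?nnegrE ?addr_ge0.
have := sqr_ge0 (nrm V - d); lra.
Qed.

Lemma double_quarter (y u : R) : y <= 4^-1 * u -> 2 * y <= 2^-1 * u.
Proof. lra. Qed.

Lemma second_error_ge0 (a b c V N Y : R) : 0 <= a -> 0 <= b -> 0 <= c -> 0 <= N -> 0 <= Y ->
  0 <= a * N ^+ 4 / V ^+ 2 + b * N ^+ 2 / V ^+ 2 + c * N ^+ 2 / Y.
Proof.
move=> a0 b0 c0 N0 Y0; have V0 := sqr_ge0 V; have N2 := sqr_ge0 N; have N4 : 0 <= N ^+ 4 by rewrite exprn_ge0.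
by move: (V ^+ 2) (N ^+ 2) (N ^+ 4) V0 N2 N4 => V2 n2 n4 V20 n20 n40; rewrite !addr_ge0// divr_ge0// mulr_ge0.
Qed.

(** * The second moment at a given scale *)

Section SmallZ.
Variables (alpha beta : R) (q z c0 : nat).
Hypothesis al0 : 0 < alpha.
Hypothesis q_ge : (20 <= q)%N.
Hypothesis g : good q z.
Hypothesis c0_le : (c0 <= Mz q z)%N.
Hypothesis x26 : 26 <= xz z.
Hypothesis big_al : 16 / alpha < exp (xz z).
Hypothesis al_x : 25 * alpha + 14 <= xz z.
Hypothesis u_res : 16 * exp (kap0 q / (2 * alpha)) / ((1 - exp (- (kap0 q * PI / alpha))) * kap0 q) <= ln (wz q z).

Local Notation N := (Nz q z).
Local Notation M := (Mz q z).
Local Notation X := (Xz q z).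
Local Notation v := (vz q z).
Local Notation f := (@ff v q N).
Local Notation pr := (@pp v q).
Local Notation x := (xz z).
Local Notation w := (wz q z).
Local Notation LPz := (LP v q N).

(** At least [alpha (c0 + 24 M)], as the large sieve demands, and more than 13. *)
Definition Vz : nat := (Num.truncn (25 * alpha * M%:R) + 14)%N.
(** A factor [z] below [X], so that windows starting below it are complete. *)
Definition Yz : nat := (z ^ (17 * q))%N.
Definition Jz : nat := (Num.truncn (alpha * ln (X.+2 * N)%:R + 2)).+1.
Definition B1z : R := 8 * (2704 + 13520 * (2^-1 + `|beta|) ^+ 2) / (25 * alpha) + 8 * (5 * (1 + (2^-1 + `|beta|)) ^+ 2) * (25 * alpha + 14).
Definition Ccz : R := 256 * (alpha * (2 + 19 * q%:R) + 3) * (25 * alpha + 14) / alpha * (3 * (2 ^+ 16 * exp (17 * q%:R + 1)) + B1z).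

Lemma M_gt0 : 0 < M%:R :> R.
Proof. by rewrite ltr0n (zX_gt0 g). Qed.

Lemma Vz_bounds : 25 * alpha * M%:R <= Vz%:R /\ Vz%:R <= (25 * alpha + 14) * M%:R.
Proof.
have M0 := M_gt0; have a0 : 0 <= 25 * alpha * M%:R by rewrite !mulr_ge0// ltW.
have h := truncnS_gt (25 * alpha * M%:R); have h2 : (Num.truncn (25 * alpha * M%:R))%:R <= 25 * alpha * M%:R by rewrite truncn_le.
have -> : Vz%:R = (Num.truncn (25 * alpha * M%:R))%:R + 14 :> R by rewrite /Vz natrD.
have M1 : 1 <= M%:R :> R by rewrite ler1n (zX_gt0 g).
rewrite -[(Num.truncn _).+1]addn1 natrD in h.
by move: h h2 M1; generalize ((Num.truncn (25 * alpha * M%:R))%:R : R) (M%:R : R) => t m h h2 M1; split; lra.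
Qed.

Lemma YzE : Yz%:R = exp (17 * q%:R * x) :> R.
Proof. by rewrite (zXE g) natrM. Qed.

Lemma qx_ge : 20 * x <= q%:R * x.
Proof. by rewrite ler_wpM2r ?(ltW (x_gt0 g))// (q_ge20 q_ge). Qed.

Lemma z_ge26 : (26 <= z)%N.
Proof. by rewrite -(ler_nat R); have := z_ge g 0 x26; rewrite expn1. Qed.

Lemma Y_X : (26 * Yz <= X)%N.
Proof. by rewrite /Yz /Xz expnD expn1 mulnC leq_mul2l z_ge26 orbT. Qed.

Lemma V_Y : (Vz <= Yz)%N.
Proof.
rewrite -(ler_nat R); have [_ h] := Vz_bounds; apply: le_trans h _.
apply: le_trans (_ : exp x * M%:R <= _).
  by rewrite ler_wpM2r ?ler0n//; apply: le_trans al_x (exp_ge_id _).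
by rewrite (MzE g) YzE -expD ler_exp; have := qx_ge; have := x_gt0 g; lra.
Qed.

Lemma sqrt_le_x : Num.sqrt w <= x.
Proof.
have q20 := q_ge20 q_ge; have h := w_sqrt g; have h2 := v_lv g; have w0 := w_gt0 g.
have s0 : 0 <= Num.sqrt w by exact: sqrtr_ge0.
have wE := wzE q_ge (ltnW (z_gt1 g)); have x0 := x_gt0 g.
have h3 : 2 * q%:R <= Num.sqrt w.
  apply: le_trans h; have q4 : 1 <= q%:R ^+ 4 :> R by rewrite exprn_ege1//; lra.
  have : 40 * (9 * q%:R) <= 40 * q%:R ^+ 4 * lv v.
    apply: ler_pM => //; first lra.
    by rewrite -[X in X <= _]mulr1 ler_wpM2l.
  lra.
have h4 : 2 * q%:R * Num.sqrt w <= w.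
  by rewrite -{2}(sqr_sqrtr (ltW w0)) expr2 ler_wpM2r.
have h5 : w <= 2 * q%:R * x by rewrite wE ler_wpM2r ?(ltW x0)//; lra.
have := le_trans h4 h5; rewrite ler_pM2l//; lra.
Qed.

Lemma LP4_le : 4 * LPz <= Num.sqrt w.
Proof.
have h : LPz <= Num.sqrt w / 4 := LP_le (v_gt1 g) (q_gt5 q_ge) (v_lv g) (w_gt0 g).
lra.
Qed.

Lemma LPz_ge0 : 0 <= LPz.
Proof. exact: LP_ge0 (v_gt1 g) (q_gt5 q_ge) (v_lv g) _. Qed.

Lemma exp_sqrt_le : exp (- Num.sqrt w) <= exp (- (2 * ((1 - 2 / q%:R) * LPz))).
Proof.
rewrite ler_exp lerN2; have h := LP4_le; have L0 := LPz_ge0.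
have : 0 <= 2 / q%:R * LPz by rewrite mulr_ge0// divr_ge0 ?ler0n.
lra.
Qed.

Lemma exp_x_le : exp (- x) <= exp (- (2 * ((1 - 2 / q%:R) * LPz))).
Proof. by apply: le_trans exp_sqrt_le; rewrite ler_exp lerN2 sqrt_le_x. Qed.

Lemma Jz_ge : alpha * ln (X.+2 * N)%:R + 2 <= Jz%:R.
Proof. exact/ltW/truncnS_gt. Qed.

Lemma lnXN : ln (X.+2 * N)%:R <= 2 + 19 * q%:R * x.
Proof.
have X1 : 1 <= X%:R :> R by rewrite ler1n (zX_gt0 g).
have e : (X.+2 * N)%:R <= 3 * exp (19 * q%:R * x) :> R.
  rewrite natrM.
  have -> : exp (19 * q%:R * x) = X%:R * N%:R by rewrite (XzE g) (NzE q_ge g) -expD; congr exp; ring.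
  rewrite [X in _ <= X]mulrA ler_wpM2r ?ler0n//.
  have -> : X.+2%:R = X%:R + 2 :> R by rewrite -addn2 natrD.
  lra.
have p0 : 0 < (X.+2 * N)%:R :> R by rewrite ltr0n muln_gt0 (zX_gt0 g).
apply: le_trans (_ : ln (3 * exp (19 * q%:R * x)) <= _); first by rewrite ler_ln// (lt_le_trans p0).
rewrite lnM ?ln_exp0; [| lra | exact: exp_gt0].
by rewrite lerD2r; have := @ln_leB1 3 ltac:(lra); lra.
Qed.

Lemma Jz_le : Jz%:R <= (alpha * (2 + 19 * q%:R) + 3) * (x + 1).
Proof.
have l0 : 0 <= ln (X.+2 * N)%:R by exact: lnn_ge0.
have a0 : 0 <= alpha * ln (X.+2 * N)%:R + 2.
  by have : 0 <= alpha * ln (X.+2 * N)%:R; [rewrite mulr_ge0// ltW | lra].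
have t1 : (Num.truncn (alpha * ln (X.+2 * N)%:R + 2))%:R <= alpha * ln (X.+2 * N)%:R + 2 by rewrite truncn_le.
rewrite /Jz -natr1.
have h := ler_wpM2l (ltW al0) lnXN; have x0 := x_gt0 g.
have c1 : 0 <= alpha * x by rewrite mulr_ge0// ltW.
have c2 : 0 <= alpha * q%:R by rewrite mulr_ge0// ltW.
lra.
Qed.

Lemma B1z_ge0 : 0 <= B1z.
Proof.
have c1 : 0 <= (2^-1 + `|beta|) ^+ 2 by exact: sqr_ge0.
have c2 : 0 <= (1 + (2^-1 + `|beta|)) ^+ 2 by exact: sqr_ge0.
rewrite /B1z addr_ge0//.
  by rewrite divr_ge0 ?mulr_ge0 ?(ltW al0)// addr_ge0// mulr_ge0.
apply: mulr_ge0; last by rewrite addr_ge0// mulr_ge0// ltW.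
by apply: mulr_ge0 => //; apply: mulr_ge0.
Qed.

Lemma Ccz_ge0 : 0 <= Ccz.
Proof.
rewrite /Ccz mulr_ge0//.
  rewrite divr_ge0 ?(ltW al0)// !mulr_ge0//.
    by rewrite addr_ge0// mulr_ge0 ?(ltW al0)// addr_ge0// mulr_ge0.
  by rewrite addr_ge0// mulr_ge0// ltW.
by rewrite addr_ge0 ?B1z_ge0// !mulr_ge0 ?exp_ge0 ?exprn_ge0.
Qed.

Lemma N4_le : N%:R ^+ 4 <= exp (- x) * M%:R.
Proof. rewrite (NzE q_ge g) (MzE g) -expMn -expD ler_exp; have := qx_ge; have := x_gt0 g; lra. Qed.

Lemma N2_le : M%:R * N%:R ^+ 2 <= exp (- x) * Yz%:R.
Proof. rewrite (NzE q_ge g) (MzE g) YzE -expMn -!expD ler_exp; have := qx_ge; have := x_gt0 g; lra. Qed.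

Lemma ln13_le : ln 13 <= x.
Proof.
have h : ln 13 <= 13 - 1 :> R by apply: ln_leB1; rewrite ltr0n.
apply: le_trans h _; apply: le_trans x26; lra.
Qed.

Lemma Er_le : 8 * Vz%:R * (2704 * N%:R ^+ 4 / Vz%:R ^+ 2 +
   13520 * (2^-1 + `|beta|) ^+ 2 * N%:R ^+ 2 / Vz%:R ^+ 2 + 5 * (1 + (2^-1 + `|beta|)) ^+ 2 * N%:R ^+ 2 / Yz%:R) <= B1z * exp (- x).
Proof.
have [Vl Vu] := Vz_bounds.
have c1 : 0 <= (2^-1 + `|beta|) ^+ 2 by exact: sqr_ge0.
have c2 : 0 <= (1 + (2^-1 + `|beta|)) ^+ 2 by exact: sqr_ge0.
apply: (second_error_le _ M_gt0 Vl Vu _ _ _ _ _ N4_le N2_le).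
- by rewrite mulr_gt0.
- by rewrite ler1n (zX_gt0 g).
- by [].
- by apply: mulr_ge0.
- by apply: mulr_ge0.
- by rewrite YzE exp_gt0.
Qed.

(** With [kap = 1 / ln z] the factor [(13 Y)^kap] is bounded in terms of [q], and [kap] is small
    enough for [PiA_le]; the price [1 / kap] is only [ln z]. *)
Lemma etaP_mean (X' : nat) : (X <= X' <= X.+2)%N ->
  Av M 24 (fun l => nrm (etaP (alpha * l%:R + beta) X' * resonator pr N (rS f) (alpha * l%:R + beta)) ^+ 2) c0 <=
  Ccz * ((x + 1) ^+ 2 * (F0 f * exp (- (2 * ((1 - 2 / q%:R) * LPz))))).
Proof.
case/andP=> X1 X2.
have M0n : (0 < M)%N := zX_gt0 g _.
apply: le_trans (Av_le_sum 23 c0 M0n (fun l => sqr_ge0 _)) _.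
have x0 := x_gt0 g; have q20 := q_ge20 q_ge; have [Vl Vu] := Vz_bounds.
have k0 : 0 < x^-1 by rewrite invr_gt0.
have kl : x^-1 <= 2^-1 by rewrite lef_pV2 ?posrE//; apply: le_trans x26; lra.
have odd_pr i : odd (pr i).
  case: (even_prime (pp_prime i)) => // e; exfalso; have := pp_gt i; rewrite e ltnNge => /negP; apply.
  by apply: leq_trans (v_gt1 g) _; rewrite -{1}(expn1 v) leq_pexp2l ?(ltnW (v_gt1 g))// (leq_trans _ q_ge).
have V12 : (12 < Vz)%N by rewrite /Vz ltn_addl.
have Y0 : (0 < Yz)%N := zX_gt0 g _.
have YX' : (2 * Yz < X')%N.
  by apply: leq_trans X1; apply: leq_trans Y_X; rewrite ltn_mul2r Y0.
have VY := V_Y.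
have fh i : 2 * (f i * pw (pr i)%:R (- 2^-1)) <= 1.
  have h : gg N i <= q%:R^-1 := gg_leq (v_gt1 g) (q_gt5 q_ge) (v_lv g) (w_gt0 g) (w_pw g) (v_kap g) i.
  have h2 : q%:R^-1 <= 2^-1 :> R by rewrite lef_pV2 ?posrE//; lra.
  have := le_trans h h2; rewrite /gg; lra.
have L0 : (0 < c0 + 24 * M)%N by rewrite addn_gt0 muln_gt0 M0n orbT.
have aL : alpha * (c0 + 24 * M)%:R <= Vz%:R.
  apply: le_trans Vl; rewrite -mulrA [X in _ <= X]mulrCA ler_wpM2l ?(ltW al0)// -natrM ler_nat.
  by move: c0_le; clear; nlia.
have hJ : alpha * ln (X' * N)%:R / (2 * PI) + 2 <= Jz%:R.
  apply: le_trans Jz_ge; rewrite lerD2r.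
  have lX : ln (X' * N)%:R <= ln (X.+2 * N)%:R.
    have X'0 : (0 < X')%N by apply: leq_trans YX'.
    by rewrite ler_ln ?ltr0n ?muln_gt0 ?(zX_gt0 g) ?andbT// ler_nat leq_mul2r X2 orbT.
  have p2 : 1 <= 2 * PI by exact: twoPI_ge1.
  have aln : 0 <= alpha * ln (X' * N)%:R by rewrite mulr_ge0 ?lnn_ge0// ltW.
  rewrite ler_pdivrMr; last lra.
  apply: le_trans (ler_wpM2l (ltW al0) lX) _.
  by rewrite ler_peMr// mulr_ge0 ?lnn_ge0// ltW.
have VX' : (Vz <= X')%N by apply: leq_trans X1; apply: leq_trans VY (leq_trans _ Y_X); rewrite leq_pmull.
have VY' : (Vz <= 13 * Yz)%N by apply: leq_trans VY _; rewrite leq_pmull.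
have hE : pw (13 * Yz)%:R x^-1 <= exp (17 * q%:R + 1).
  rewrite /pw ler_exp natrM lnM ?ltr0n// YzE ln_exp0 mulrDr.
  have -> : x^-1 * (17 * q%:R * x) = 17 * q%:R by field; rewrite gt_eqF.
  rewrite addrC lerD2l ler_pdivrMl// mulr1.
  exact: ln13_le.
have hS := second_moment (@pp_prime v q) (@pp_inj v q) odd_pr (zX_gt0 g _ : (0 < N)%N) (f_pos q_ge g) beta k0 kl V12 Y0 YX'
  (rho_ge0 (q_gt5 q_ge) (v_lv g)) fh al0 L0 aL hJ VX' VY' hE.
have Mi : 0 <= M%:R^-1 :> R by rewrite invr_ge0 ler0n.
apply: le_trans (ler_wpM2l Mi hS) _.
have hEr := Er_le.
have [Fl Fu] := FN_bounds q_ge g; have Fp := F0_pos q z.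
have kx : x^-1 * (q%:R ^+ 3 * lv v) <= 1 by rewrite ler_pdivrMl// mulr1 (x_lv g).
have hP : PiA pr f x^-1 <= F0 f * exp (- (2 * ((1 - 2 / q%:R) * LPz))) :=
  PiA_le (v_gt1 g) (q_gt5 q_ge) (v_lv g) (w_gt0 g) (w_pw g) (v_kap g) k0 kx.
have ggb (i : IP v q) : 0 <= gg N i <= gg N i by rewrite lexx andbT; apply: mulr_ge0; [exact: f_pos | exact: pw_ge0].
have hr : rkA pr N f (rho v q) <= 2 * (F0 f * exp (- Num.sqrt w)) :=
  rk_tiny (v_gt1 g) (q_gt5 q_ge) (v_lv g) (w_gt0 g) (w_sqrt g) ggb ggb.
apply: (second_total_le _ _ al0 M_gt0 _ Jz_le _ Vu (ltW x0) _ hP hr exp_sqrt_le _ hEr B1z_ge0 exp_x_le _ Fu _).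
- by rewrite exprn_ge0.
- exact: exp_ge0.
- exact: ler0n.
- exact: ler0n.
- apply: addr_ge0.
    by apply: PiA_ge0 => //; first [exact: pp_prime | exact: (f_pos q_ge g)].
  by apply: rkA_ge0 => //; exact: (f_pos q_ge g).
- by apply: second_error_ge0; rewrite ?ler0n//; apply: mulr_ge0 => //; exact: sqr_ge0.
- by apply: le_trans Fl; rewrite divr_ge0// ltW.
- exact: exp_ge0.
Qed.

Definition Aez : R := (1 + 25 * alpha + `|beta|) ^+ 2.
Definition Cdz : R := 2 * Ccz + 3 * Aez ^+ 2 + 1.

Lemma Cdz_ge1 : 1 <= Cdz.
Proof. by rewrite /Cdz; have := Ccz_ge0; have := sqr_ge0 Aez; lra. Qed.

Lemma small_eta : exists l, (c0 <= l <= c0 + 24 * M)%N /\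
  nrm (eta (alpha * l%:R + beta)) ^+ 2 <= 8 * Cdz * ((x + 1) ^+ 2 * exp (- (2 * ((1 - 2 / q%:R) * LPz)))).
Proof.
have x0 := x_gt0 g; have M0n : (0 < M)%N := zX_gt0 g _.
have [a [ea a0]] : exists a, a = exp (- (2 * ((1 - 2 / q%:R) * LPz))) /\ 0 < a.
  by eexists; split; [reflexivity | exact: exp_gt0].
have xa := exp_x_le; rewrite -ea in xa *.
have Fp := F0_pos q z; have [Fl Fu] := FN_bounds q_ge g.
have [hR1 hR2] := resonator_half beta al0 q_ge g x26 big_al u_res c0 (norm_rS (f_pos q_ge g)).
have C1 := Cdz_ge1; have x1 : 1 <= (x + 1) ^+ 2 by rewrite exprn_ege1//; lra.
have xa0 : 0 < (x + 1) ^+ 2 * a by rewrite mulr_gt0//; lra.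
apply: (@small_pick M 24 c0 (fun l => nrm (eta (alpha * l%:R + beta)) ^+ 2)
  (fun l => nrm (resonator pr N (rS f) (alpha * l%:R + beta)) ^+ 2) (F0 f)) => //.
- by rewrite mulr_gt0// mulr_gt0//; lra.
- by move=> l; exact: sqr_ge0.
- by apply: le_trans hR1; lra.
have X0 := @etaP_mean X ltac:(by rewrite leqnn/= leqW).
have X1 := @etaP_mean X.+1 ltac:(by rewrite leqnSn/=).
have X2 := @etaP_mean X.+2 ltac:(by rewrite leqnn andbT leqW).
rewrite -ea in X0 X1 X2.
set R0 := fun l : nat => nrm (resonator pr N (rS f) (alpha * l%:R + beta)) ^+ 2 in hR2 *.
set g0 := fun l : nat => nrm (etaP (alpha * l%:R + beta) X * _) ^+ 2 in X0.
set g1 := fun l : nat => nrm (etaP (alpha * l%:R + beta) X.+1 * _) ^+ 2 in X1.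
set g2 := fun l : nat => nrm (etaP (alpha * l%:R + beta) X.+2 * _) ^+ 2 in X2.
apply: le_trans (_ : Av M 24 (fun l => 2^-1 * (g0 l + 2 * g1 l + g2 l) + 2 * (Aez * exp (- x)) ^+ 2 * R0 l) c0 <= _).
  apply: ler_Av => l /andP[_ hl].
  apply: le_trans (nrm_approx_sqr _ (eta_err beta al0 q_ge g c0_le hl (leqnn _))) _.
  by rewrite lerD2r; apply: double_quarter; exact: nrm_etaV_sqr.
rewrite Av_add !Av_scale !Av_add !Av_scale.
have e1 : exp (- x) <= 1 by rewrite -[X in _ <= X]exp00 ler_exp oppr_le0 ltW.
have e2 : (Aez * exp (- x)) ^+ 2 <= Aez ^+ 2 * a.
  rewrite exprMn ler_wpM2l ?sqr_ge0// expr2; apply: le_trans xa.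
  by rewrite ler_piMr ?exp_ge0.
have R00 : 0 <= Av M 24 R0 c0 by apply: le_trans hR1; apply: divr_ge0 => //; apply: le_trans Fl; rewrite divr_ge0// ltW.
have R1 : Av M 24 R0 c0 <= 3 / 2 * F0 f by apply: le_trans hR2 _; rewrite ler_wpM2l// divr_ge0.
have e3 : 2 * (Aez * exp (- x)) ^+ 2 * Av M 24 R0 c0 <= 2 * (Aez ^+ 2 * a) * (3 / 2 * F0 f).
  by apply: ler_pM => //; [rewrite mulr_ge0 ?sqr_ge0 | rewrite ler_wpM2l].
have e4 : Aez ^+ 2 * (a * F0 f) <= Aez ^+ 2 * ((x + 1) ^+ 2 * a * F0 f).
  rewrite ler_wpM2l ?sqr_ge0// -[X in _ <= X]mulrA ler_peMl// mulr_ge0 ?(ltW a0) ?(ltW Fp)//.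
have -> : 8 * Cdz * ((x + 1) ^+ 2 * a) / 8 * F0 f = Cdz * ((x + 1) ^+ 2 * a * F0 f) by field.
have e5 : 0 <= (x + 1) ^+ 2 * a * F0 f by rewrite mulr_ge0 ?(ltW xa0) ?(ltW Fp).
have e6 : Ccz * ((x + 1) ^+ 2 * (F0 f * a)) = Ccz * ((x + 1) ^+ 2 * a * F0 f) by ring.
rewrite e6 in X0 X1 X2; rewrite /Cdz.
move: e3 e4 e5 X0 X1 X2; clear; move: (Av M 24 R0 c0) (Av M 24 g0 c0) (Av M 24 g1 c0) (Av M 24 g2 c0) => r0 u0 u1 u2.
move: ((x + 1) ^+ 2 * a * F0 f) => T; lra.
Qed.

End SmallZ.

(** After squaring, [exp (2 L / Q)] absorbs [72 D] and [(x + 1)^2], the latter being at most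
    [exp (2 ln w)]. *)
Lemma small_arith (D Q L w x Z e : R) : 1 <= D -> 20 <= Q -> 0 <= L -> Q * (36 * D + 1) * (ln w + 1) <= L -> 0 < w -> 0 <= ln w ->
  0 <= x -> x + 1 <= w -> 0 <= e -> 0 <= Z -> e ^+ 2 <= 8 * D * ((x + 1) ^+ 2 * exp (- (2 * ((1 - 2 / Q) * L)))) -> Z <= 3 * e ->
  Z <= exp (- ((1 - 3 / Q) * L)).
Proof.
move=> D1 Q20 L0 hL w0 lw x0 xw e0 Z0 he hZ.
have Q0 : 0 < Q by lra.
have h1 : 72 * D * (x + 1) ^+ 2 <= exp (2 * (L / Q)).
  have a1 : (36 * D + 1) * (ln w + 1) <= L / Q by rewrite ler_pdivlMr// mulrC mulrA.
  have a2 : 72 * D <= exp (72 * D) by exact: exp_ge_id.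
  have a3 : (x + 1) ^+ 2 <= exp (2 * ln w).
    have -> : exp (2 * ln w) = w ^+ 2 by rewrite -[in RHS](exp_ln0 w0) -expMn.
    apply: lerXn2r; rewrite ?nnegrE//; lra.
  apply: le_trans (_ : exp (72 * D) * exp (2 * ln w) <= _); first by apply: ler_pM => //; [lra | exact: sqr_ge0].
  rewrite -expD ler_exp.
  have : 0 <= 36 * D * ln w by rewrite mulr_ge0//; lra.
  lra.
have h2 : (3 * e) ^+ 2 <= exp (- ((1 - 3 / Q) * L)) ^+ 2.
  have -> : exp (- ((1 - 3 / Q) * L)) ^+ 2 = exp (2 * (L / Q)) * exp (- (2 * ((1 - 2 / Q) * L))).
    by rewrite -expMn -expD; congr exp; field; rewrite gt_eqF.
  apply: le_trans (ler_wpM2r (exp_ge0 _) h1); lra.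
apply: le_trans hZ _; rewrite -(ler_pXn2r (n := 2)) ?nnegrE ?exp_ge0//; lra.
Qed.

Lemma small_value (alpha beta : R) (q : nat) : 0 < alpha -> (20 <= q)%N ->
  exists B : R, forall z : nat, (1 < z)%N -> B <= ln (wz q z) ->
  forall c0 : nat, (c0 <= Mz q z)%N -> exists l : nat, (c0 <= l <= c0 + 24 * Mz q z)%N /\
    zeta_abs_crit (alpha * l%:R + beta) <= exp (- ((1 - 3 / q%:R) * LP (vz q z) q (Nz q z))).
Proof.
move=> al0 q_ge; have q20 := q_ge20 q_ge.
have D1 := Cdz_ge1 beta q al0.
have [B1 h1] := good_eventually q_ge.
have [X2 eX2] : exists X2 : R, X2 = `|0 : R| + 26 + 17 / alpha + (25 * alpha + 14) + 0 + 0 by eexists.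
have [B2 h2] := lnz_ge X2 q_ge.
have cpos : 0 <= q%:R * (36 * Cdz alpha beta q + 1).
  by rewrite mulr_ge0//; move: D1; move: (Cdz alpha beta q) => D; lra.
have [B3 h3] := LP_ge_log q_ge cpos.
have [Bu eBu] : exists Bu : R, Bu = 16 * exp (kap0 q / (2 * alpha)) / ((1 - exp (- (kap0 q * PI / alpha))) * kap0 q) by eexists.
exists (`|B1| + `|B2| + `|B3| + `|Bu| + 0 + 0) => z z1 hu c0 hc0.
have [[u1 u2 u3] [u4 _ _]] := le_of_norm_sum (lexx 0) (lexx 0) hu.
have g : good q z := h1 z z1 u1.
have hx := h2 z z1 u2; have hLP := h3 z z1 u3; rewrite {}eBu in u4; rewrite {}eX2 in hx.
have a17 : 0 <= 17 / alpha by rewrite divr_ge0// ltW.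
have [[_ x2 x3] [x4 _ _]] := @le_of_sum 0 26 (17 / alpha) (25 * alpha + 14) 0 0 (xz z) ltac:(lra) a17 ltac:(lra) (lexx 0) (lexx 0) hx.
have big_al : 16 / alpha < exp (xz z).
  apply: lt_le_trans (exp_ge_id _); apply: lt_le_trans x3; rewrite ltr_pM2r ?invr_gt0//; lra.
have [l [hl he]] := small_eta beta al0 q_ge g hc0 x2 big_al x4 u4.
exists l; split=> //.
apply: (small_arith D1 q20 (LPz_ge0 q_ge g) hLP (w_gt0 g) (ltW (lnw_gt0 g)) (ltW (x_gt0 g)) _ (nrm_ge0 _) _ he (zeta_eta _).2).
  rewrite (wzE q_ge (ltnW z1)); have : 39 * xz z <= (2 * q%:R - 1) * xz z by rewrite ler_wpM2r ?(ltW (x_gt0 g))//; lra.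
  by rewrite -/(xz z); apply: le_trans; move: x2; move: (xz z) => y; lra.
by apply: le_trans (zeta_eta _).1; rewrite divr_ge0 ?nrm_ge0.
Qed.

(** * Conclusion *)

Lemma rateE (l : nat) : rate l = Num.sqrt (ln l%:R / (6 * ln (ln l%:R))).
Proof.
have e6 : IZR 6 = 6 by rewrite IZRposE INRE.
by rewrite /rate RsqrtE e6 !RealsE.
Qed.

(** [u / ln u] increases once [ln u >= 1]; the inequality [ln (v / u) <= v / u - 1] takes the place
    of a derivative. *)
Lemma div_ln_mono (u v : R) : 1 <= ln u -> 0 < u -> u <= v -> u / ln u <= v / ln v.
Proof.
move=> lu u0 uv; have v0 : 0 < v := lt_le_trans u0 uv.
have luv : ln u <= ln v by rewrite ler_ln.
rewrite ler_pdivrMr; last lra.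
rewrite mulrAC ler_pdivlMr; last lra.
have h : ln (v / u) <= v / u - 1 by apply: ln_leB1; rewrite divr_gt0.
have e : ln (v / u) = ln v - ln u by rewrite lnM ?invr_gt0// lnV.
rewrite e in h.
have h2 : u * (ln v - ln u) <= v - u.
  have := ler_wpM2l (ltW u0) h; have -> : u * (v / u - 1) = v - u by field; rewrite gt_eqF.
  by [].
have h3 : (v - u) * 1 <= (v - u) * ln u by rewrite ler_wpM2l//; lra.
lra.
Qed.

(** To first order the squares compare as [1 - 18 e] with [1 - 12 e]; this margin covers the higher
    terms up to [e = 1/20]. *)
Lemma rate_arith (e a r L : R) : 0 <= e -> e <= 20^-1 -> 0 <= L -> 0 <= r -> 0 <= a ->
  r ^+ 2 <= (1 + 2 * e) * a -> (1 - 6 * e) * a <= L ^+ 2 -> (1 - 10 * e) * r <= (1 - 3 * e) * L.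
Proof.
move=> e0 e1 L0 r0 a0 hr hL.
rewrite -(ler_pXn2r (n := 2)) ?nnegrE//; try by rewrite mulr_ge0//; lra.
rewrite !exprMn.
have c1 : 0 <= (1 - 10 * e) ^+ 2 by exact: sqr_ge0.
have c2 : 0 <= (1 - 3 * e) ^+ 2 by exact: sqr_ge0.
apply: le_trans (ler_wpM2l c1 hr) _; apply: le_trans _ (ler_wpM2l c2 hL).
rewrite ![_ * (_ * a)]mulrA ler_wpM2r//.
have ee : 0 <= e * e by rewrite mulr_ge0.
have ee1 : e * e <= 20^-1 * e by rewrite ler_wpM2r.
have eee : e * e * e <= 20^-1 * (e * e) by rewrite -[X in X <= _]mulrA ler_wpM2r.
have eee0 : 0 <= e * e * e by rewrite !mulr_ge0.
lra.
Qed.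

(** [ln l <= 12 q ln z + 24] and [w = (2 q - 1) ln z] give [ln l <= 6 (1 + 2/q) w]; monotonicity of
    [u / ln u] carries this over to the rate. *)
Lemma rate_le_LP (q z l : nat) : (20 <= q)%N -> good q z -> 2 <= xz z -> 1 <= ln (ln l%:R) -> 0 < ln l%:R ->
  (0 < l)%N -> (l <= 25 * Mz q z)%N -> (1 - 10 / q%:R) * rate l <= (1 - 3 / q%:R) * LP (vz q z) q (Nz q z).
Proof.
move=> q_ge g x2 ll lp l0 lM; have q20 := q_ge20 q_ge; have x0 := x_gt0 g.
have w0 := w_gt0 g; have lw0 := lnw_gt0 g.
have L0 := LP_ge0 (v_gt1 g) (q_gt5 q_ge) (v_lv g) (Nz q z).
have hL : (1 - 6 / q%:R) * (wz q z / ln (wz q z)) <= LP (vz q z) q (Nz q z) ^+ 2 :=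
  LP_sqr_ge (v_gt1 g) (q_gt5 q_ge) (v_lv g) w0 (q_lv g) lw0.
have q0 : 0 < q%:R :> R by apply: lt_le_trans q20.
apply: (rate_arith (a := wz q z / ln (wz q z)) _ _ L0 _ _ _ hL).
- by rewrite invr_ge0 ltW.
- by rewrite lef_pV2 ?posrE.
- by rewrite rateE sqrtr_ge0.
- by apply: divr_ge0; exact: ltW.
rewrite rateE sqr_sqrtr; last by rewrite divr_ge0 ?(ltW lp)// mulr_ge0//; lra.
have hl : ln l%:R <= 12 * q%:R * xz z + 24.
  have h25 : ln 25 <= 25 - 1 :> R by apply: ln_leB1; rewrite ltr0n.
  apply: le_trans (_ : ln (25 * (Mz q z)%:R) <= _).
    by rewrite ler_ln ?ltr0n// -?natrM ?ler_nat// ltr0n (leq_trans l0).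
  rewrite lnM ?ltr0n ?(zX_gt0 g)// (MzE g) ln_exp0; lra.
have wE : wz q z = (2 * q%:R - 1) * xz z := wzE q_ge (ltnW (z_gt1 g)).
set La := 12 * q%:R * xz z + 24 in hl.
have wL : wz q z <= La.
  rewrite wE /La; have : 0 <= q%:R * xz z by rewrite mulr_ge0// ltW.
  lra.
have L6 : La <= 6 * ((1 + 2 / q%:R) * wz q z).
  have -> : 6 * ((1 + 2 / q%:R) * wz q z) = (12 * q%:R + 18 - 12 / q%:R) * xz z by rewrite wE; field; rewrite gt_eqF.
  have e1 : 12 / q%:R <= 1 :> R by rewrite ler_pdivrMr//; lra.
  have : (12 * q%:R + 17) * xz z <= (12 * q%:R + 18 - 12 / q%:R) * xz z by rewrite ler_wpM2r ?(ltW x0)//; lra.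
  rewrite /La; lra.
have m := div_ln_mono ll lp hl.
have La0 : 0 < La := lt_le_trans w0 wL.
have m2 : La / ln La <= La / ln (wz q z).
  by rewrite ler_wpM2l ?(ltW La0)// lef_pV2 ?posrE ?ler_ln// (lt_le_trans lw0)// ler_ln.
have -> : ln l%:R / (6 * ln (ln l%:R)) = 6^-1 * (ln l%:R / ln (ln l%:R)).
  by rewrite invfM; ring.
rewrite ler_pdivrMl//; apply: le_trans m (le_trans m2 _).
rewrite [X in _ <= X]mulrA [X in _ <= X]mulrA ler_wpM2r ?invr_ge0 ?(ltW lw0)//.
by rewrite -[X in _ <= X]mulrA.
Qed.

Lemma z_exists (q c0 : nat) (B : R) : (20 <= q)%N ->
  exists z : nat, [/\ (1 < z)%N, B <= ln (wz q z), 2 <= xz z & (c0 <= Mz q z)%N].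
Proof.
move=> q_ge; have q20 := q_ge20 q_ge.
pose E := exp (`|B| + 2); pose z := (Num.truncn (exp E) + c0 + 2)%N.
have nB := normr_ge0 B; have bB := ler_norm B.
have E2 : `|B| + 2 <= E by exact: exp_ge_id.
have zE : exp E <= z%:R.
  have h : exp E < (Num.truncn (exp E)).+1%:R by exact: truncnS_gt.
  by apply: le_trans (ltW h) _; rewrite ler_nat /z -addnA -addn1 leq_add2l addn2.
have z1 : (1 < z)%N by rewrite /z addn2.
have xE : E <= xz z by rewrite -[X in X <= _]ln_exp0 /xz ler_ln ?exp_gt0// (lt_le_trans (exp_gt0 E)).
have x2 : 2 <= xz z by apply: le_trans xE; lra.
exists z; split=> //.
  have wx : E <= wz q z.
    rewrite (wzE q_ge (ltnW z1)) -/(xz z); apply: le_trans xE _; rewrite ler_peMl//; lra.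
  have -> : B = ln (exp B) by rewrite ln_exp0.
  rewrite ler_ln ?exp_gt0//; last by apply: lt_le_trans wx; exact: exp_gt0.
  by apply: le_trans wx; rewrite /E ler_exp; lra.
apply: leq_trans (_ : z <= _)%N; first by rewrite /z -addnA addnC -addnA leq_addr.
rewrite /Mz -{1}(expn1 z) leq_pexp2l ?(ltnW z1)// muln_gt0 (leq_trans _ q_ge)//.
Qed.

Lemma frequently (q : nat) (Q : nat -> R -> Prop) : (20 <= q)%N ->
  (forall l r s, s <= r -> Q l r -> Q l s) ->
  (exists B : R, forall z : nat, (1 < z)%N -> B <= ln (wz q z) ->
    forall c0 : nat, (c0 <= Mz q z)%N -> exists l : nat, (c0 <= l <= c0 + 24 * Mz q z)%N /\
    Q l ((1 - 3 / q%:R) * LP (vz q z) q (Nz q z))) ->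
  forall N0 : nat, exists l : nat, (N0 < l)%N /\ Q l ((1 - 10 / q%:R) * rate l).
Proof.
move=> q_ge Qm [B hB] N0; have [B1 h1] := good_eventually q_ge.
(* Starting beyond [exp (exp 1)] ensures [ln (ln l) >= 1], as the comparison of rates requires. *)
pose c0 := (N0 + (Num.truncn (exp (exp 1))).+1)%N.
have [z [z1 hz x2 hM]] := z_exists c0 (`|B| + `|B1|) q_ge.
have b1 : B <= `|B| + `|B1| by apply: le_trans (ler_norm B) _; rewrite lerDl.
have b2 : B1 <= `|B| + `|B1| by apply: le_trans (ler_norm B1) _; rewrite lerDr.
have [l [/andP[l1 l2] hl]] := hB z z1 (le_trans b1 hz) c0 hM.
have g : good q z := h1 z z1 (le_trans b2 hz).
have lE : exp (exp 1) <= l%:R.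
  have h : exp (exp 1) < (Num.truncn (exp (exp 1))).+1%:R by exact: truncnS_gt.
  by apply: le_trans (ltW h) _; rewrite ler_nat (leq_trans _ l1)// leq_addl.
have N0l : (N0 < l)%N by apply: leq_trans l1; rewrite /c0 addnS ltnS leq_addr.
have l0 : (0 < l)%N by apply: leq_trans N0l.
have ln1 : exp 1 <= ln l%:R by rewrite -[X in X <= _]ln_exp0 ler_ln ?exp_gt0// ltr0n.
have lnp : 0 < ln l%:R := lt_le_trans (exp_gt0 1) ln1.
exists l; split=> //; apply: Qm hl; apply: rate_le_LP => //.
  by rewrite -[X in X <= _]ln_exp0 ler_ln ?exp_gt0.
by apply: leq_trans l2 _; move: hM; clear; nlia.
Qed.

(** A diagonal choice: [L n] is a witness for the loss [10 / (n + 20)] beyond [L (n - 1)]. As [L]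
    increases strictly, the loss at [l] can be read off from the least [n] with [l <= L n]; it is
    the right one at the points [L n] and tends to 0. *)
Lemma eps_of_frequently (P : nat -> R -> Prop) :
  (forall n N0, exists l, (N0 < l)%N /\ P l (- (10 / (n + 20)%:R))) ->
  exists eps : nat -> R, Un_cv eps 0 /\ forall N0, exists l, (N0 < l)%N /\ P l (eps l).
Proof.
move=> h; pose F n N0 := constructive_indefinite_description _ (h n N0).
pose L := fix L n := if n is m.+1 then sval (F n (L m)) else sval (F 0%N 0%N).
have LP n : P (L n) (- (10 / (n + 20)%:R)) by case: n => [|n] /=; case: (F _ _) => l [].
have LS n : (L n < L n.+1)%N by rewrite /=; case: (F _ _) => l [].
have Lm : {homo L : m n / (m < n)%N} by apply: homo_ltn => //; exact: ltn_trans.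
have Ln n : (n < L n)%N.
  elim: n => [|n ih]; first by rewrite /=; case: (F _ _) => l [].
  exact: leq_ltn_trans ih (LS n).
have ex l : exists n, (l <= L n)%N by exists l; exact/ltnW/Ln.
pose m l := ex_minn (ex l).
have mL n : m (L n) = n.
  rewrite /m; case: ex_minnP => k hk mk; apply/eqP; rewrite eqn_leq mk//= leqNgt.
  by apply/negP => /Lm; rewrite ltnNge hk.
exists (fun l => - (10 / (m l + 20)%:R)); split; last first.
  by move=> N0; exists (L N0); rewrite Ln mL; split.
move=> e /RltP e0.
pose k := (Num.truncn (10 / e)).+1; exists (L k) => l /ssrnat.leP hl.
have mk : (k <= m l)%N.
  rewrite /m; case: ex_minnP => j hj _; rewrite leqNgt; apply/negP => /Lm hjk.
  by move: (leq_trans hl hj); rewrite leqNgt hjk.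
apply/RltP; rewrite RdistE; set y := 10 / _.
have d0 : 0 < (m l + 20)%:R :> R by rewrite ltr0n addn_gt0 orbT.
have -> : `|- y - 0| = y by rewrite subr0 normrN ger0_norm// divr_ge0// ltW.
rewrite ltr_pdivrMr// mulrC -ltr_pdivrMr//.
by apply: lt_le_trans (truncnS_gt _) _; rewrite ler_nat -/k (leq_trans mk)// leq_addr.
Qed.

Lemma extreme_values (alpha beta : R) : 0 < alpha ->
  (exists eps : nat -> R, Un_cv eps 0 /\ forall N0 : nat, exists l : nat, (N0 < l)%N /\
     exp ((1 + eps l) * rate l) <= zeta_abs_crit (alpha * l%:R + beta)) /\
  (exists eps : nat -> R, Un_cv eps 0 /\ forall N0 : nat, exists l : nat, (N0 < l)%N /\
     zeta_abs_crit (alpha * l%:R + beta) <= exp (- ((1 + eps l) * rate l))).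
Proof.
move=> al0; have q_ge n : (20 <= n + 20)%N by rewrite leq_addl.
split.
  apply: (eps_of_frequently (P := fun l e => exp ((1 + e) * rate l) <= zeta_abs_crit (alpha * l%:R + beta))) => n.
  apply: (@frequently (n + 20) (fun l r => exp r <= zeta_abs_crit (alpha * l%:R + beta))) => //.
    by move=> l r s sr; apply: le_trans; rewrite ler_exp.
  exact: large_value.
apply: (eps_of_frequently (P := fun l e => zeta_abs_crit (alpha * l%:R + beta) <= exp (- ((1 + e) * rate l)))) => n.
apply: (@frequently (n + 20) (fun l r => zeta_abs_crit (alpha * l%:R + beta) <= exp (- r))) => //.
  by move=> l r s sr h; apply: le_trans h _; rewrite ler_exp lerN2.
exact: small_value.
Qed.

Bind Scope R_scope with R.
Arguments exp _%_R_scope.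
Local Open Scope R_scope.

Theorem theorem5 (alpha beta : R) (Halpha : 0 < alpha) :
  (exists eps : nat -> R, Un_cv eps 0 /\
     forall N : nat, exists l : nat, (N < l)%coq_nat /\ (0 < l)%coq_nat /\
       zeta_abs_crit (alpha * INR l + beta) >= exp ((1 + eps l) * rate l))
  /\
  (exists eps : nat -> R, Un_cv eps 0 /\
     forall N : nat, exists l : nat, (N < l)%coq_nat /\ (0 < l)%coq_nat /\
       zeta_abs_crit (alpha * INR l + beta) <= exp (- ((1 + eps l) * rate l))).
Proof.
have [[eps [epsc hl]] [eps' [epsc' hs]]] := extreme_values beta (introT RltP Halpha).
split; [exists eps | exists eps']; split=> // N.
  have [l [Nl h]] := hl N; exists l; split; first exact/ssrnat.ltP.
  split; first by apply/ssrnat.ltP; apply: leq_trans Nl.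
  by apply/Rle_ge/RleP; rewrite !RealsE.
have [l [Nl h]] := hs N; exists l; split; first exact/ssrnat.ltP.
split; first by apply/ssrnat.ltP; apply: leq_trans Nl.
by apply/RleP; rewrite !RealsE.
Qed.
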